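(* Let $\Sigma=\mathbb{D}/\Gamma$ be a compact smooth Riemann surface of genus $g\ge2$, $T$ a compact metric space, $\rho\colon\Gamma\to\mathrm{Homeo}(T)$ a representation, and $\mathscr{F}$ the suspension of $\rho$. If $h(\mathscr{F})=2$, then $\mathscr{F}$ admits an invariant measure.
   Context: Suspensions: $\mathbb{D}$ is the unit disk and $\Gamma=\pi_1(\Sigma)\subset\mathrm{Aut}(\mathbb{D})$ acts freely by deck transformations. $\Gamma$ acts on $\mathbb{D}\times T$ by $\gamma\cdot(z,t)=(\gamma\cdot z,\rho(\gamma)(t))$. Put $X=(\mathbb{D}\times T)/\Gamma$ (compact). The suspension of $\rho$ is the lamination $\mathscr{F}$ of $X$ by the hyperbolic Riemann surfaces (leaves) $[\mathbb{D}\times\{t\}]$, $t\in T$, where $[\cdot]$ denotes images in $X$. Standing assumption: $X$ is embedded in a real manifold $M$ carrying a smooth Riemannian metric $g_M$ which restricts to a Hermitian metric on the leaves, and $d$ is the distance on $X$ induced by $g_M$. Hyperbolic entropy: for $x\in X$, let $L_x$ be the leaf through $x$ and $\phi_x\colon\mathbb{D}\to L_x$ a holomorphic universal covering with $\phi_x(0)=x$. For $R>0$ let $\overline{\mathbb{D}}_R$ be the closed disk centered at $0$ of radius $R$ for the Poincaré distance $d_P$, $d_P(0,\xi)=\log\frac{1+|\xi|}{1-|\xi|}$. Put $d_R(x,y)=\inf_{\theta\in\mathbb{R}}\sup_{\xi\in\overline{\mathbb{D}}_R}d(\phi_x(\xi),\phi_y(e^{i\theta}\xi))$, let $N(X,R,\varepsilon)$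 be the minimal number of $d_R$-balls of radius $\varepsilon$ covering $X$, and $h(\mathscr{F})=\sup_{\varepsilon>0}\limsup_{R\to+\infty}\frac1R\log N(X,R,\varepsilon)$. Invariant measures: a Borel probability measure $\mu$ on $X$ is harmonic for $\mathscr{F}$ if for every flow box $U\simeq\mathbb{D}\times\mathbb{T}$ (a foliated chart, plaques being $\mathbb{D}\times\{t\}$) there are a Radon measure $\nu$ on $\mathbb{T}$ and harmonic functions $h_t\colon\mathbb{D}\to\mathbb{R}_+$, $t\in\mathbb{T}$, such that $\int f\,d\mu=\int_{\mathbb{T}}\int_{\mathbb{D}}h_t(z)f(t,z)\,g_P(z)\,d\nu(t)$ for every integrable $f\colon U\to\mathbb{R}$, where $g_P$ is the area form of the leafwise Poincaré metric. It is invariant if moreover all the $h_t$ are constant. *)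

(* Defs.v *)
From HB Require Import structures.
From mathcomp Require Import all_boot all_order all_algebra.
From mathcomp Require Import complex.
From mathcomp Require Import all_classical all_reals all_analysis.

Set Implicit Arguments.
Unset Strict Implicit.
Unset Printing Implicit Defensive.

Import Order.TTheory GRing.Theory Num.Theory.
Import numFieldNormedType.Exports.

Local Open Scope classical_set_scope.
Local Open Scope ring_scope.
Local Open Scope complex_scope.

(* [R[i]] carries the topology of its modulus and is a normed space over
   itself, so that [derivable f z 1] and ['D_1 f z] are complex
   differentiability and the complex derivative. *)
HB.instance Definition _ (R : realType) :=
  NormedModule.copy R[i] (R[i] : numFieldType)^o.

(* Measurable types are pointed in the library, hence a metric space that is to
   carry Borel measures has to be pointed as well. *)
#[short(type="pmetricType")]
HB.structure Definition PointedMetric (K : numDomainType) :=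
  {M of Metric K M & isPointed M}.

Notation borel X := (g_sigma_algebraType (@open X)).

Local Notation normc := Normc.normc.

Section Disk.
Variable R : realType.
Local Notation C := R[i].

Definition unit_disk : set C := [set z | `|z| < 1].

Definition holomorphic_on (A : set C) (f : C -> C) : Prop :=
  forall z, A z -> derivable f z 1.

Definition cexp_i (theta : R) : C := cos theta +i* sin theta.

(* The closed disk of center 0 and radius r for the Poincare distance. *)
Definition poincare_disk (r : R) : set C :=
  [set z | unit_disk z /\ ln ((1 + normc z) / (1 - normc z)) <= r].

(* The unit disk in real coordinates. *)
Definition unit_disk2 : set (R * R) := [set u | unit_disk (u.1 +i* u.2)].

Definition harmonic_on_disk (h : C -> R) : Prop :=
  let f := fun u : R * R => h (u.1 +i* u.2) in
  let axes := [set (1, 0); (0, 1)] : set (R * R) in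
  [/\ forall u v, unit_disk2 u -> axes v -> derivable f u v,
      forall u v w, unit_disk2 u -> axes v -> axes w ->
        derivable ('D_v f) u w /\ {for u, continuous ('D_w ('D_v f))} &
      forall u, unit_disk2 u ->
        'D_(1, 0) ('D_(1, 0) f) u + 'D_(0, 1) ('D_(0, 1) f) u = 0].

End Disk.

Section Surface.
Variables (R : realType) (Gamma : groupType).
Local Notation C := R[i].

(* [q], restricted to the open set [A], exhibits [Z] as the topological
   quotient of [A] by the action [a] of [Gamma]. *)
Definition quotient_by (Y Z : topologicalType) (A : set Y)
    (a : Gamma -> Y -> Y) (q : Y -> Z) : Prop :=
  [/\ q @` A = [set: Z],
      forall x y, A x -> A y -> (q x = q y <-> exists c, y = a c x) &
      forall V : set Z, open V <-> open (A `&` q @^-1` V)].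

Definition real_character (chi : Gamma -> R) : Prop :=
  forall a b, chi (a * b)%g = chi a + chi b.

(* A closed orientable surface with fundamental group [Gamma] has genus [g] when
   its first cohomology group H^1(-; R) = Hom(Gamma, R) has dimension 2g. *)
Definition has_genus (g : nat) : Prop :=
  exists f : 'I_(2 * g) -> Gamma -> R,
    (forall i, real_character (f i)) /\
    forall chi, real_character chi ->
      exists! c : 'rV[R]_(2 * g), forall a, chi a = \sum_i c 0 i * f i a.

(* [Gamma], acting by [act], is the deck group of a universal covering
   [q : D -> Sigma] of a compact Riemann surface of genus [g]. The values of
   [act c] and [q] outside of the disk are irrelevant. *)
Record surface_group (act : Gamma -> C -> C) (Sigma : topologicalType)
    (q : C -> Sigma) (g : nat) : Prop := {
  act_disk : forall c z, unit_disk z -> unit_disk (act c z) ;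
  act_holo : forall c, holomorphic_on (@unit_disk R) (act c) ;
  act1 : forall z, unit_disk z -> act 1%g z = z ;
  actM : forall a b z, unit_disk z -> act (a * b)%g z = act a (act b z) ;
  act_free : forall c z, unit_disk z -> act c z = z -> c = 1%g ;
  act_cover : forall z, unit_disk z -> exists V : set C,
    [/\ open V, V z, V `<=` @unit_disk R &
        forall c, c <> 1%g -> (act c @` V) `&` V = set0] ;
  surface_quotient : quotient_by (@unit_disk R) act q ;
  surface_hausdorff : hausdorff_space Sigma ;
  surface_compact : compact [set: Sigma] ;
  surface_genus : has_genus g }.

End Surface.

Section Suspension.
Variables (R : realType) (Gamma : groupType) (T : metricType R).
Variables (X : pmetricType R) (p : R[i] * T -> X).
Local Notation C := R[i].

(* Each [rho c] is then a homeomorphism, with inverse [rho c^-1]. *)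
Definition homeo_representation (rho : Gamma -> T -> T) : Prop :=
  [/\ forall c, continuous (rho c), forall t, rho 1%g t = t &
      forall a b t, rho (a * b)%g t = rho a (rho b t)].

Definition disk_times : set (C * T) := [set u | unit_disk u.1].

(* [X] is the quotient of D x T by the diagonal action, and [p] the projection;
   the distance of [X] is any one inducing the quotient topology. *)
Definition is_suspension (act : Gamma -> C -> C) (rho : Gamma -> T -> T) :
    Prop :=
  quotient_by disk_times (fun c u => (act c u.1, rho c u.2)) p.

Definition leaf (t : T) : set X := [set p (z, t) | z in @unit_disk R].

(* [phi] is a holomorphic covering of the leaf of [t] by the unit disk, i.e. a
   holomorphic universal covering. The Riemann surface structure of the leaf is
   the one whose charts are the inverses of the injective restrictions of
   [p (-, t)] to open sets; each point of the leaf lies in such a chart domain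
   [p (B x {t})] whose preimage is a disjoint union of open sets [W i], all
   mapped biholomorphically onto it by [phi], which reads [f i] in the chart. *)
Definition holomorphic_covering (t : T) (phi : C -> X) : Prop :=
  phi @` @unit_disk R = leaf t /\
  forall w, unit_disk w -> exists B : set C,
    [/\ open B, B w, B `<=` @unit_disk R, {in B &, injective (fun z => p (z, t))} &
      exists (I : Type) (W : I -> set C) (f : I -> C -> C),
        [/\ trivIset [set: I] W,
            \bigcup_i W i =
              @unit_disk R `&` phi @^-1` [set p (z, t) | z in B] &
            forall i, [/\ open (W i), holomorphic_on (W i) (f i),
              set_bij (W i) B (f i) &
              forall z, W i z -> phi z = p (f i z, t)]]].

Definition leaf_covering_at (x : X) (phi : C -> X) : Prop :=
  phi 0 = x /\ exists t, holomorphic_covering t phi.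

(* [s] is the inverse of the restriction of [p] to [W], i.e. a chart with values
   in D x T; these charts form the foliated atlas of the suspension. *)
Definition suspension_chart (W : set (C * T)) (s : X -> C * T) : Prop :=
  [/\ open W, W `<=` disk_times & forall u, W u -> s (p u) = u].

(* Maps which locally have the form (z, t) |-> (a(z, t), b(t)), with [a]
   holomorphic in [z]. *)
Definition foliated_map (S1 S2 : topologicalType) (A : set (C * S1))
    (F : C * S1 -> C * S2) : Prop :=
  forall u, A u ->
    [/\ {for u, continuous F},
        \forall v \near u, (F v).2 = (F (u.1, v.2)).2 &
        derivable (fun z => (F (z, u.2)).1) u.1 1].

Record flow_box (S : ptopologicalType) (U : set X) (Phi : X -> C * S)
    (Psi : C * S -> X) : Prop := {
  flow_box_open : open U ;
  flow_box_to : forall x, U x -> unit_disk (Phi x).1 ;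
  flow_box_from : forall u, unit_disk u.1 -> U (Psi u) ;
  flow_boxK : forall x, U x -> Psi (Phi x) = x ;
  flow_boxVK : forall u, unit_disk u.1 -> Phi (Psi u) = u ;
  flow_box_cont : forall x, U x -> {for x, continuous Phi} ;
  flow_box_contV : forall u, unit_disk u.1 -> {for u, continuous Psi} ;
  flow_box_compat : forall W s, suspension_chart W s ->
    foliated_map (W `&` p @^-1` U) (Phi \o p) /\
    foliated_map [set u | unit_disk u.1 /\ (p @` W) (Psi u)] (s \o Psi) }.

(* The density at [u], with respect to dx dy, of the area form g_P of the
   leafwise Poincare metric in the flow box with inverse [Psi]: pullback of
   4 dx dy / (1 - |z|^2)^2 by a local lift [F] of the plaque of [u] to the
   universal covering D x {t} of its leaf. It does not depend on the lift. *)
Definition poincare_area (S : ptopologicalType) (Psi : C * S -> X)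
    (u : C * S) : R :=
  get [set r : R | exists W s, [/\ suspension_chart W s, (p @` W) (Psi u) &
    let F := fun z => (s (Psi (z, u.2))).1 in
    r = 4 * normc ('D_1 F u.1) ^+ 2 / (1 - normc (F u.1) ^+ 2) ^+ 2]].

Definition radon (S : ptopologicalType)
    (nu : {measure set (borel S) -> \bar R}) : Prop :=
  (forall K : set S, compact K -> (nu K < +oo)%E) /\
  (forall A : set (borel S), measurable A ->
     nu A = ereal_sup [set nu K | K in [set K : set S | compact K /\ K `<=` A]]).

(* The measurability of [h] in the transverse variable is what gives a meaning
   to the outer integral. *)
Record disintegration (mu : probability (borel X) R) (S : ptopologicalType)
    (U : set X) (Psi : C * S -> X)
    (nu : {measure set (borel S) -> \bar R}) (h : S -> C -> R) : Prop := {
  disint_radon : radon nu ;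
  disint_harmonic : forall t, harmonic_on_disk (h t) ;
  disint_ge0 : forall t z, unit_disk z -> 0 <= h t z ;
  disint_meas : forall z, unit_disk z ->
    measurable_fun [set: borel S] (fun t : borel S => h t z) ;
  disint_eq : forall f : borel X -> R, mu.-integrable U (EFin \o f) ->
    (\int[mu]_(x in U) (f x)%:E =
     \int[nu]_t \int[(@lebesgue_measure R \x @lebesgue_measure R)%E]_(u in
         @unit_disk2 R)
       (h t (u.1 +i* u.2)%C * f (Psi ((u.1 +i* u.2)%C, t)) *
        poincare_area Psi ((u.1 +i* u.2)%C, t))%:E)%E }.

Definition harmonic_measure (mu : probability (borel X) R) : Prop :=
  forall (S : ptopologicalType) (U : set X) (Phi : X -> C * S)
    (Psi : C * S -> X), flow_box U Phi Psi ->
  exists (nu : {measure set (borel S) -> \bar R}) (h : S -> C -> R),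
    disintegration mu U Psi nu h.

Definition invariant_measure (mu : probability (borel X) R) : Prop :=
  harmonic_measure mu /\
  forall (S : ptopologicalType) (U : set X) (Phi : X -> C * S)
    (Psi : C * S -> X), flow_box U Phi Psi ->
  exists (nu : {measure set (borel S) -> \bar R}) (h : S -> C -> R),
    disintegration mu U Psi nu h /\
    forall t z w, unit_disk z -> unit_disk w -> h t z = h t w.

End Suspension.

Section Entropy.
Variables (R : realType) (X : pmetricType R).
(* [phi x] is a universal covering of the leaf through [x]. *)
Variable phi : X -> R[i] -> X.
Local Open Scope ereal_scope.

Definition leafwise_dist (r : R) (x y : X) : \bar R :=
  ereal_inf [set ereal_sup [set (mdist (phi x z) (phi y (cexp_i theta * z)%R))%:E
                           | z in poincare_disk r]
            | theta in [set: R]].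

Definition covering_number (r e : R) : \bar R :=
  ereal_inf [set ((size s)%:R : R)%:E | s in
    [set s : seq X | forall y, exists2 x, x \in s & leafwise_dist r x y < e%:E]].

Definition hyperbolic_entropy : \bar R :=
  ereal_sup [set limf_esup (fun r : R => r^-1%:E * lne (covering_number r e))
                           (pinfty_nbhs R)
            | e in [set e : R | (0 < e)%R]].

End Entropy.

(* Main.v *)
(* Points of a leaf at distance about e^(-R) become d_R-separated, so the leaf directions alone
   contribute e^(2 R) to N(X, R, e), on top of which come the points of T that are separated by
   the deck transformations moving the origin by at most R. Entropy 2 therefore says that these
   separated sets of T grow subexponentially in R. Let E be a separated set in T whose size cannot
   be increased by more than a factor 1 + d when R is replaced by R + k. For g moving the origin
   by at most k, exchanging the points of E near a set A for those of g^-1 E lying in A yields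
   another separated set, so that the normalized counting measures of such sets E are almost
   invariant; an ultralimit of them is a content on compact sets, which induces an invariant
   probability nu on T. The product of the hyperbolic area with nu, restricted to a fundamental
   domain of the action on D x T, descends to X. In a flow box it reads locally as a measure on
   the transversal times the leafwise area, and the measures on the transversal obtained at two
   points of a plaque agree because overlapping boxes determine the same one. Hence the leafwise
   densities are constant. *)
Require Import Defs.
From HB Require Import structures.
From mathcomp Require Import all_boot all_order all_algebra.
From mathcomp Require Import complex.
From mathcomp Require Import all_classical all_reals all_analysis.
From mathcomp Require Import measurable_realfun.
From mathcomp Require Import ring lra.

Set Implicit Arguments.
Unset Strict Implicit.
Unset Printing Implicit Defensive.

Import Order.TTheory GRing.Theory Num.Theory.
Import numFieldNormedType.Exports.

Local Open Scope classical_set_scope.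
Local Open Scope ring_scope.
Local Open Scope complex_scope.
Local Notation normc := Normc.normc.
Local Notation Re := complex.Re.
Local Notation Im := complex.Im.

(** * Cauchy's theorem and the maximum principle *)

(** The leaves account for the whole rate 2 for the following reason. Two leaf maps that stay close
    in [X] over a disk of radius R have lifts that stay close, and an automorphism that hardly moves
    a circle of radius R moves its centre by [O(exp (- R))] only; hence a planar grid with mesh of
    that order is separated.

    Complex analysis is needed to identify coverings of leaves with [p (-, t)] up to isometries, to
    see that the leafwise area is continuous across plaques although charts are only continuous
    transversally, and to compare areas in different charts. All of it rests on one fact: an
    additive function of rectangles that is o(area) at every point vanishes.

    The disintegration is required in every flow box, over a transversal that is an arbitrary
    topological space without a given measure. A set of plaques is given the mass that [mu] assigns
    to its disks of radius 1/2; the leafwise density is then the inverse of the area of that disk,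
    which depends on the plaque alone. *)

Lemma half_step (R : realFieldType) (s l a x : R) : 0 < s * l -> x = a \/ x = a + s / 2 * l ->
  a <= x /\ x + s / 2 * l <= a + s * l.
Proof. by move=> sl [->|->]; split; lra. Qed.

Section Quadrisection.
Variables (R : realType) (d : R -> R -> R -> R) (l1 l2 : R).
Hypotheses (l1_gt0 : 0 < l1) (l2_gt0 : 0 < l2).
Variables A B S : R.
Hypothesis S_gt0 : 0 < S.

Let inside a b s := [/\ 0 < s, A <= a, a + s * l1 <= A + S * l1,
  B <= b & b + s * l2 <= B + S * l2].

Hypothesis d_split : forall a b s, inside a b s ->
  d a b s = d a b (s / 2) + d (a + s / 2 * l1) b (s / 2) +
    (d a (b + s / 2 * l2) (s / 2) + d (a + s / 2 * l1) (b + s / 2 * l2) (s / 2)).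

Hypothesis d_local : forall x y, A <= x <= A + S * l1 -> B <= y <= B + S * l2 ->
  forall e, 0 < e -> exists2 k : R, 0 < k & forall a b s, inside a b s -> s < k ->
    a <= x <= a + s * l1 -> b <= y <= b + s * l2 -> `|d a b s| <= e * s ^+ 2.

(** The common core of Cauchy's theorem and of the change of variables. If [d A B S] were not 0,
    some quarter of each rectangle would keep at least a quarter of the value, so
    [e * s ^+ 2 <= |d a b s|] would persist along rectangles shrinking to a point, against [d_local]
    at that point with [e / 2]. *)
Lemma quadrisection : d A B S = 0.
Proof.
apply/eqP; apply: contrapT => /negP d0.
pose e := `|d A B S| / S ^+ 2.
have e_gt0 : 0 < e by rewrite divr_gt0 ?normr_gt0// exprn_gt0.
pose bad (n : nat) (u : R * R) := inside u.1 u.2 (S / 2 ^+ n) /\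
  e * (S / 2 ^+ n) ^+ 2 <= `|d u.1 u.2 (S / 2 ^+ n)|.
pose below n (u v : R * R) := [/\ u.1 <= v.1, u.2 <= v.2,
  v.1 + S / 2 ^+ n.+1 * l1 <= u.1 + S / 2 ^+ n * l1 &
  v.2 + S / 2 ^+ n.+1 * l2 <= u.2 + S / 2 ^+ n * l2].
have step n u : bad n u -> exists v, bad n.+1 v /\ below n u v.
  case: u => a b [/=]; set s := S / 2 ^+ n => ins bd.
  have sE : S / 2 ^+ n.+1 = s / 2 by rewrite exprSr invfM mulrA.
  rewrite /bad /below sE /= -/s.
  have [s0 h1 h2 h3 h4] := ins.
  have sl1 : 0 < s * l1 by rewrite mulr_gt0.
  have sl2 : 0 < s * l2 by rewrite mulr_gt0.
  have [|h] := pselect (exists v : R * R, [/\ inside v.1 v.2 (s / 2),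
     e * (s / 2) ^+ 2 <= `|d v.1 v.2 (s / 2)|,
     (v.1 = a \/ v.1 = a + s / 2 * l1) & (v.2 = b \/ v.2 = b + s / 2 * l2)]).
    move=> [[x y] /= [i1 i2 i3 i4]]; exists (x, y) => /=; split => //.
    by have [? ?] := half_step sl1 i3; have [? ?] := half_step sl2 i4; split.
  exfalso.
  have small x y : (x = a \/ x = a + s / 2 * l1) ->
      (y = b \/ y = b + s / 2 * l2) -> `|d x y (s / 2)| < e * (s / 2) ^+ 2.
    move=> xE yE; rewrite ltNge; apply/negP => bdxy; apply: h.
    have [x1 x2] := half_step sl1 xE; have [y1 y2] := half_step sl2 yE.
    by exists (x, y); split => //; split; [exact: divr_gt0|exact: le_trans h1 x1|
      exact: le_trans x2 h2|exact: le_trans h3 y1|exact: le_trans y2 h4].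
  have := small a b (or_introl erefl) (or_introl erefl).
  have := small (a + s / 2 * l1) b (or_intror erefl) (or_introl erefl).
  have := small a (b + s / 2 * l2) (or_introl erefl) (or_intror erefl).
  have := small (a + s / 2 * l1) (b + s / 2 * l2) (or_intror erefl) (or_intror erefl).
  move: bd; rewrite (d_split ins).
  set d1 := d a b _; set d2 := d _ b _; set d3 := d a _ _; set d4 := d _ _ _.
  have := ler_normD (d1 + d2) (d3 + d4); have := ler_normD d1 d2.
  have := ler_normD d3 d4; rewrite (_ : (s / 2) ^+ 2 = s ^+ 2 / 4); last by field.
  rewrite (mulrA e (s ^+ 2)) ; lra.
have bad0 : bad 0 (A, B).
  rewrite /bad expr0 divr1 /=; split; first by split => //; rewrite ltW.
  by rewrite /e divfK// expf_neq0// gt_eqF.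
have [f fP] : {f : nat -> R * R | forall n, bad n (f n) /\ below n (f n) (f n.+1)}.
  pose next n u := if pselect (exists v, bad n.+1 v /\ below n u v) is left h
     then projT1 (cid h) else u.
  have nextP n u : bad n u -> bad n.+1 (next n u) /\ below n u (next n u).
    move=> bdu; rewrite /next; case: pselect => [h|]; last by case/(_ (step _ _ bdu)).
    by case: cid.
  pose f := fix f n := if n is k.+1 then next k (f k) else (A, B).
  have bf n : bad n (f n) by elim: n => // n IH; have [] := nextP _ _ IH.
  by exists f => n; split => //; have [] := nextP _ _ (bf n).
pose s n := S / 2 ^+ n.
have s0 n : 0 < s n by rewrite divr_gt0// exprn_gt0.
have le1 m n : (m <= n)%N -> (f m).1 <= (f n).1 /\ (f n).1 + s n * l1 <= (f m).1 + s m * l1 /\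
   (f m).2 <= (f n).2 /\ (f n).2 + s n * l2 <= (f m).2 + s m * l2.
  elim: n => [|n IH]; first by rewrite leqn0 => /eqP ->.
  rewrite leq_eqVlt => /orP[/eqP -> //|]; rewrite ltnS => /IH [] a1 [a2 [a3 a4]].
  have [_ [b1 b2 b3 b4]] := fP n.
  rewrite /s in a2 a4 *; lra.
(* The common point of the nested rectangles is obtained as the supremum of their lower left
   corners. *)
pose x := sup (range (fun n => (f n).1)); pose y := sup (range (fun n => (f n).2)).
have ub1 m n : (f n).1 <= (f m).1 + s m * l1.
  have sl n' : 0 < s n' * l1 by rewrite mulr_gt0.
  have [mn|/ltnW nm] := leqP m n.
    have [_ [h _]] := le1 _ _ mn; have := sl n; lra.
  have [h _] := le1 _ _ nm; have := sl m; lra.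
have ub2 m n : (f n).2 <= (f m).2 + s m * l2.
  have sl n' : 0 < s n' * l2 by rewrite mulr_gt0.
  have [mn|/ltnW nm] := leqP m n.
    have [_ [_ [_ h]]] := le1 _ _ mn; have := sl n; lra.
  have [_ [_ [h _]]] := le1 _ _ nm; have := sl m; lra.
have xP n : (f n).1 <= x <= (f n).1 + s n * l1.
  apply/andP; split.
    apply: ub_le_sup; last by exists n.
    by exists ((f 0).1 + s 0 * l1) => _ [m _ <-]; exact: ub1.
  apply: ge_sup; first by exists (f 0%N).1, 0%N.
  by move=> _ [m _ <-]; exact: ub1.
have yP n : (f n).2 <= y <= (f n).2 + s n * l2.
  apply/andP; split.
    apply: ub_le_sup; last by exists n.
    by exists ((f 0).2 + s 0 * l2) => _ [m _ <-]; exact: ub2.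
  apply: ge_sup; first by exists (f 0%N).2, 0%N.
  by move=> _ [m _ <-]; exact: ub2.
have f0in n : inside (f n).1 (f n).2 (s n) by have [[]] := fP n.
have xin : A <= x <= A + S * l1.
  have [_ h1 h2 _ _] := f0in 0%N; have /andP[h3 h4] := xP 0%N; apply/andP; split; lra.
have yin : B <= y <= B + S * l2.
  have [_ _ _ h1 h2] := f0in 0%N; have /andP[h3 h4] := yP 0%N; apply/andP; split; lra.
have e20 : 0 < e / 2 by rewrite divr_gt0.
have [k k0 kP] := d_local xin yin e20.
have [n sk] : exists n, s n < k.
  have [n _ /(_ n (leqnn n)) /= h] : \forall n \near \oo, 2^-1 ^+ n < k / S :> R.
    have /cvgrPdist_lt /(_ (k / S)) := @cvg_expr R 2^-1 (ltac:(by rewrite ger0_norm ?invr_ge0// invf_lt1// ltr1n)).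
    move=> /(_ (divr_gt0 k0 S_gt0)) [n _ h]; exists n => // m nm.
    have /= := h m nm; rewrite sub0r normrN ger0_norm//; by rewrite exprn_ge0// invr_ge0.
  by exists n; move: h; rewrite /s exprVn ltr_pdivlMr// mulrC.
have := kP _ _ _ (f0in n) sk (xP n) (yP n).
have [[_ bd] _] := fP n.
apply/negP; rewrite -ltNge; apply: lt_le_trans bd.
by rewrite ltr_pM2r ?exprn_gt0 ?s0//; lra.
Qed.

End Quadrisection.

(** * Integrals over segments, handled through primitives *)

Section Primitive.
Variables (R : realType) (L : R).
Implicit Types f g : R -> R.

(* [segint f a b] is the integral of [f] from [a] to [b], for [L < a, b]. *)
Definition prim f (x : R) : R :=
  (\int[@lebesgue_measure R]_(t in `[L, x]) f t)%R.
Definition segint f a b := prim f b - prim f a.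

Lemma continuous_integrable f a b : continuous f ->
  (@lebesgue_measure R).-integrable `[a, b] (EFin \o f).
Proof.
move=> cf; apply: continuous_compact_integrable; first exact: segment_compact.
exact: continuous_subspaceT.
Qed.

Lemma prim_derive f x : continuous f -> L < x -> is_derive x 1 (prim f) (f x).
Proof.
move=> cf Lx.
have x1 : x < x + 1 by rewrite ltrDl.
have [h1 h2] := @continuous_FTC1_closed R f L x (x + 1) x1
  (continuous_integrable _ _ cf) Lx (cf x).
by apply: DeriveDef; [exact: h1|rewrite -derive1E; exact: h2].
Qed.

Lemma intD f a b c : segint f a b + segint f b c = segint f a c.
Proof. by rewrite /segint addrC addrA subrK. Qed.

Lemma intxx f a : segint f a a = 0.
Proof. by rewrite /segint subrr. Qed.

(** All estimates of [segint] below come from this mean value theorem, applied to a primitive or to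
    a difference of primitives. *)
Lemma prim_mvt (F f : R -> R) a b : a < b -> L < a ->
  (forall x, L < x -> is_derive x 1 F (f x)) ->
  exists2 c, a < c < b & F b - F a = f c * (b - a).
Proof.
move=> ab La dF.
have [||c] := @MVT R F f a b ab.
- by move=> x; rewrite in_itv /= => /andP[ax _]; apply: dF; exact: lt_trans ax.
- apply: derivable_within_continuous => x; rewrite in_itv /= => /andP[ax _].
  by have [] := dF x (lt_le_trans La ax).
- by rewrite in_itv /= => cab E; exists c.
Qed.

Lemma intB f g a b : continuous f -> continuous g -> L < a -> a <= b ->
  segint (fun x => f x - g x) a b = segint f a b - segint g a b.
Proof.
move=> cf cg La; rewrite le_eqVlt => /predU1P[<-|ab]; first by rewrite !intxx subrr.
have cfg : continuous (fun x => f x - g x) by move=> x; exact: cvgB (cf x) (cg x).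
have [|c _] := @prim_mvt (prim (fun x => f x - g x) - (prim f - prim g))
   (fun x => (f x - g x) - (f x - g x)) a b ab La.
  move=> x Lx; apply: is_deriveB; first exact: (prim_derive cfg).
  by apply: is_deriveB; exact: prim_derive.
rewrite subrr mul0r !fctE /segint; lra.
Qed.

Lemma int_near_cst f k e a b : continuous f -> L < a -> a <= b ->
  (forall x, a <= x <= b -> `|f x - k| <= e) -> `|segint f a b - k * (b - a)| <= e * (b - a).
Proof.
move=> cf La; rewrite le_eqVlt => /predU1P[<-|ab] fk.
  by rewrite intxx !subrr !mulr0 subrr normr0.
have [c cab E] := prim_mvt ab La (fun x Lx => prim_derive cf Lx).
rewrite /segint E -mulrBl normrM [X in _ * X]gtr0_norm ?subr_gt0//.
rewrite ler_pM2r ?subr_gt0//; apply: fk.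
by case/andP: cab => h1 h2; rewrite !ltW.
Qed.

Lemma int_near_cst_len f k e a l : continuous f -> L < a -> 0 <= l ->
  (forall x, a <= x <= a + l -> `|f x - k| <= e) -> `|segint f a (a + l) - k * l| <= e * l.
Proof.
move=> cf La l0 h; have := @int_near_cst f k e a (a + l) cf La.
by rewrite lerDl (addrC a l) addrK addrC; apply.
Qed.

Lemma le_int_near f g e a b : continuous f -> continuous g -> L < a -> a <= b ->
  (forall x, a <= x <= b -> `|f x - g x| <= e) -> `|segint f a b - segint g a b| <= e * (b - a).
Proof.
move=> cf cg La ab h; rewrite -intB//.
have cfg : continuous (fun x => f x - g x) by move=> x; exact: cvgB (cf x) (cg x).
have := @int_near_cst _ 0 e a b cfg La ab; rewrite mul0r subr0; apply => x xab.
by rewrite subr0 h.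
Qed.

End Primitive.

Lemma dist_in_segment (R : realFieldType) (a x y l : R) : a <= x <= a + l -> a <= y <= a + l -> `|x - y| <= l.
Proof. by move=> /andP[? ?] /andP[? ?]; rewrite ler_norml; apply/andP; split; lra. Qed.

Lemma le_norm_sub (R : realFieldType) (x y z K : R) : z = x - y -> `|x| <= K -> `|y| <= K -> `|z| <= K * 2.
Proof. by move=> -> hx hy; apply: le_trans (ler_normB _ _) _; rewrite mulr2n mulrDr mulr1 lerD. Qed.

(** * Cauchy's theorem on a rectangle *)

Section Goursat.
Variables (R : realType) (u v : R -> R -> R) (A B l1 l2 : R).
Hypotheses (l1_gt0 : 0 < l1) (l2_gt0 : 0 < l2).
Hypotheses (cu : forall x, continuous (u x)) (cv : forall y, continuous (v^~ y)).

Let L := Num.min A B - 1.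
Let LA : L < A. Proof. by rewrite /L ltrBlDr ltr_pwDr// ge_min lexx. Qed.
Let LB : L < B. Proof. by rewrite /L ltrBlDr ltr_pwDr// ge_min lexx orbT. Qed.

(* [u + i v] has complex derivative [a + i b] at [(x0, y0)]. *)
Hypothesis duv : forall x0 y0, A <= x0 <= A + l1 -> B <= y0 <= B + l2 ->
  exists a b, forall e, 0 < e -> exists2 k : R, 0 < k & forall x y,
    `|x - x0| < k -> `|y - y0| < k ->
    `|u x y - u x0 y0 - (a * (x - x0) - b * (y - y0))| <= e * (`|x - x0| + `|y - y0|) /\
    `|v x y - v x0 y0 - (b * (x - x0) + a * (y - y0))| <= e * (`|x - x0| + `|y - y0|).

Let d (a b s : R) : R :=
  segint L (v^~ b) a (a + s * l1) - segint L (v^~ (b + s * l2)) a (a + s * l1) +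
  (segint L (u (a + s * l1)) b (b + s * l2) - segint L (u a) b (b + s * l2)).

(** The left side is the imaginary part [v dx + u dy] of the integral of [(u + i v) dz] along the
    boundary. On a small rectangle [u] and [v] are replaced by their affine approximations, whose
    contributions [- al * (s * l2) * (s * l1)] and [al * (s * l1) * (s * l2)] cancel; the rest is
    o(s^2), as [quadrisection] requires. *)
Lemma goursat : segint L (v^~ B) A (A + l1) - segint L (v^~ (B + l2)) A (A + l1) +
  (segint L (u (A + l1)) B (B + l2) - segint L (u A) B (B + l2)) = 0.
Proof.
suff : d A B 1 = 0 by rewrite /d !mul1r.
apply: (@quadrisection _ d l1 l2) => //.
- move=> a b s [s0 _ _ _ _]; rewrite /d.
  have E1 c l : c + s / 2 * l + s / 2 * l = c + s * l by field.
  rewrite !E1.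
  rewrite -(intD L (v^~ b) a (a + s / 2 * l1) (a + s * l1)).
  rewrite -(intD L (v^~ (b + s * l2)) a (a + s / 2 * l1) (a + s * l1)).
  rewrite -(intD L (u a) b (b + s / 2 * l2) (b + s * l2)).
  rewrite -(intD L (u (a + s * l1)) b (b + s / 2 * l2) (b + s * l2)).
  ring.
- rewrite !mul1r => x0 y0 x0P y0P e e0.
  have [al [be abP]] := duv x0P y0P.
  have l12 : 0 < l1 + l2 by rewrite addr_gt0.
  pose e' := e / (4 * (l1 + l2) ^+ 2).
  have e'0 : 0 < e' by rewrite divr_gt0// mulr_gt0// exprn_gt0.
  have [k k0 kP] := abP _ e'0.
  exists (k / (l1 + l2)); first by rewrite divr_gt0.
  move=> a b s [s0 Aa aA Bb bB] sk /andP[ax xa] /andP[b_y yb].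
  have sl1 : 0 < s * l1 by rewrite mulr_gt0.
  have sl2 : 0 < s * l2 by rewrite mulr_gt0.
  have skl : s * l1 + s * l2 < k by rewrite -mulrDr -ltr_pdivlMr.
  have near x y : a <= x <= a + s * l1 -> b <= y <= b + s * l2 ->
    `|u x y - u x0 y0 - (al * (x - x0) - be * (y - y0))| <= e' * (s * (l1 + l2)) /\
    `|v x y - v x0 y0 - (be * (x - x0) + al * (y - y0))| <= e' * (s * (l1 + l2)).
    move=> xin yin.
    have h1 : `|x - x0| <= s * l1 by apply: dist_in_segment xin _; rewrite ax.
    have h2 : `|y - y0| <= s * l2 by apply: dist_in_segment yin _; rewrite b_y.
    have [||g1 g2] := kP x y.
    - by apply: le_lt_trans h1 _; apply: le_lt_trans skl; rewrite lerDl ltW.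
    - by apply: le_lt_trans h2 _; apply: le_lt_trans skl; rewrite lerDr ltW.
    have E : e' * (`|x - x0| + `|y - y0|) <= e' * (s * (l1 + l2)).
      by rewrite ler_pM2l// mulrDr lerD.
    by split; [exact: le_trans g1 E|exact: le_trans g2 E].
  pose E := e' * (s * (l1 + l2)) * 2.
  have ca f g : continuous f -> continuous g -> continuous (fun x : R => f x - g x : R).
    by move=> cf cg x; exact: cvgB (cf x) (cg x).
  have La : L < a by exact: lt_le_trans LA Aa.
  have Lb : L < b by exact: lt_le_trans LB Bb.
  have aa : a <= a + s * l1 by rewrite lerDl ltW.
  have bb : b <= b + s * l2 by rewrite lerDl ltW.
  have I1 : `|segint L (v^~ b) a (a + s * l1) - segint L (v^~ (b + s * l2)) a (a + s * l1) -
      (- al * (s * l2)) * (s * l1)| <= E * (s * l1).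
    rewrite -intB//; apply: int_near_cst_len => // [||x xP]; [exact: ca|exact: ltW|].
    have [||_ h1] := near x b; [by []|by rewrite lexx|].
    have [||_ h2] := near x (b + s * l2); [by []|by rewrite lexx andbT|].
    by apply: le_norm_sub h1 h2; ring.
  have I2 : `|segint L (u (a + s * l1)) b (b + s * l2) - segint L (u a) b (b + s * l2) -
      (al * (s * l1)) * (s * l2)| <= E * (s * l2).
    rewrite -intB//; apply: int_near_cst_len => // [||y yP]; [exact: ca|exact: ltW|].
    have [||h1 _] := near a y; [by rewrite lexx|by []|].
    have [||h2 _] := near (a + s * l1) y; [by rewrite lexx andbT|by []|].
    by apply: le_norm_sub h2 h1; ring.
  have -> : d a b s = (segint L (v^~ b) a (a + s * l1) - segint L (v^~ (b + s * l2)) a (a + s * l1) -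
      (- al * (s * l2)) * (s * l1)) + (segint L (u (a + s * l1)) b (b + s * l2) - segint L (u a) b (b + s * l2) -
      (al * (s * l1)) * (s * l2)) by rewrite /d; ring.
  apply: le_trans (ler_normD _ _) _; apply: le_trans (lerD I1 I2) _.
  rewrite -mulrDr -mulrDr /E /e' le_eqVlt; apply/orP.
  have -> : e / (4 * (l1 + l2) ^+ 2) * (s * (l1 + l2)) * 2 * (s * (l1 + l2)) = e * s ^+ 2 / 2.
    by field; rewrite gt_eqF.
  by right; rewrite ltr_pdivrMr// ltr_pMr ?ltr1n// mulr_gt0// exprn_gt0.
Qed.

End Goursat.

(** * Complex differentiability in epsilon form *)

Section ComplexBasics.
Variable R : realType.
Local Notation C := R[i].
Implicit Types (z w : C) (e : R).

Lemma normCE z : `|z| = (normc z)%:C.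
Proof. by case: z. Qed.

Lemma normc_ge0 z : 0 <= normc z.
Proof. by rewrite -ler0c -normCE. Qed.

Lemma normc_eq0 z : (normc z == 0) = (z == 0).
Proof. by apply/eqP/eqP => [/Normc.eq0_normc//|->]; rewrite Normc.normc0. Qed.

Lemma normc_gt0 z : (0 < normc z) = (z != 0).
Proof. by rewrite lt_def normc_ge0 andbT normc_eq0. Qed.

Lemma normcBC z w : normc (z - w) = normc (w - z).
Proof. by rewrite -opprB normcN. Qed.

Lemma normc_triangle z w t : normc (z - t) <= normc (z - w) + normc (w - t).
Proof. by rewrite -[z - t](subrKA w); exact: le_normcD. Qed.

Lemma normc_rev z w : normc z - normc w <= normc (z - w).
Proof. by rewrite lerBlDr; have := le_normcD (z - w) w; rewrite subrK. Qed.

Lemma normc_real (x : R) : normc x%:C = `|x|.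
Proof. by rewrite /= expr0n addr0 sqrtr_sqr. Qed.

Lemma normc_Re z : `|Re z| <= normc z.
Proof. by rewrite -lecR -normCE normc_ge_Re. Qed.

Lemma normc_Im z : `|Im z| <= normc z.
Proof.
case: z => a b /=; rewrite -sqrtr_sqr ler_sqrt ?lerDr ?sqr_ge0//.
by rewrite addr_ge0 ?sqr_ge0.
Qed.

Lemma normc_le_ReIm z : normc z <= `|Re z| + `|Im z|.
Proof.
case: z => a b /=.
rewrite (_ : `|a| + `|b| = Num.sqrt ((`|a| + `|b|) ^+ 2)); last first.
  by rewrite sqrtr_sqr [RHS]ger0_norm ?addr_ge0.
rewrite ler_sqrt ?sqr_ge0// -(real_normK (num_real a)) -(real_normK (num_real b)).
rewrite sqrrD -addrA (addrC (_ *+ 2)) addrA lerDl.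
by rewrite mulrn_wge0// mulr_ge0.
Qed.

Lemma normc_sqr z : normc z ^+ 2 = Re z ^+ 2 + Im z ^+ 2.
Proof. by case: z => a b /=; rewrite sqr_sqrtr// addr_ge0 ?sqr_ge0. Qed.

Lemma sqr_normc_lt1 z : (normc z ^+ 2 < 1) = (normc z < 1) :> bool.
Proof. by rewrite -[X in _ < X](expr1n _ 2) ltr_pXn2r// nnegrE ?normc_ge0// ler01. Qed.

Lemma unit_diskE z : unit_disk z <-> normc z < 1.
Proof. by rewrite /unit_disk /= normCE (_ : 1 = (1 : R)%:C)// ltcR. Qed.

Lemma nbhsCP z (A : set C) :
  nbhs z A <-> exists2 e : R, 0 < e & forall w, normc (w - z) < e -> A w.
Proof.
split.
  move=> /(@nbhs_ballP _ C)[e /= e0 eA].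
  have /andP[/eqP ime ree] : (Im e == 0) && (0 < Re e) by move: e0; rewrite ltcE /= eq_sym.
  exists (Re e) => // w wz; apply: eA.
  rewrite /ball /= normCE normcBC (_ : e = (Re e)%:C) ?ltcR//.
  by case: e ime {e0 ree wz} => a b /= ->.
move=> [e e0 eA]; apply/(@nbhs_ballP _ C); exists e%:C; first by rewrite /= ltcR.
by move=> w; rewrite /ball /= normCE normcBC ltcR; exact: eA.
Qed.

Lemma openCP (A : set C) :
  open A <-> forall z, A z -> exists2 e : R, 0 < e & forall w, normc (w - z) < e -> A w.
Proof.
rewrite openE; split => [h z /h/nbhsCP//|h z /h]; by move/nbhsCP.
Qed.

Lemma open_unit_disk : open (@unit_disk R).
Proof.
apply/openCP => z /unit_diskE z1; exists (1 - normc z); first by rewrite subr_gt0.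
by move=> w wz; apply/unit_diskE; have := normc_rev w z; lra.
Qed.

Lemma cvgCP {T} (F : set_system T) {FF : Filter F} (f : T -> C) z :
  f @ F --> z <-> forall e, 0 < e -> \forall t \near F, normc (f t - z) < e.
Proof.
split => [h e e0|h A /nbhsCP[e e0 eA]].
  by apply: (h [set w | normc (w - z) < e]); apply/nbhsCP; exists e.
by apply: filterS (h e e0) => t; exact: eA.
Qed.

Lemma cvgC_at (f : C -> C) z y : f @ z --> y <-> forall e, 0 < e ->
  exists2 k : R, 0 < k & forall w, normc (w - z) < k -> normc (f w - y) < e.
Proof.
have key := @cvgCP C (nbhs z) (nbhs_filter z) f y.
split => [/(proj1 key) h e /h /(proj1 (nbhsCP _ _))//|h].
by apply: (proj2 key) => e /h h'; apply/nbhsCP.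
Qed.

Lemma cvg_Complex {T} (F : set_system T) {FF : Filter F} (f g : T -> R) a b :
  f @ F --> a -> g @ F --> b -> (fun t => f t +i* g t) @ F --> a +i* b.
Proof.
move=> /cvgrPdist_lt fa /cvgrPdist_lt gb; apply/cvgCP => e e0.
have e2 : 0 < e / 2 by rewrite divr_gt0.
near=> t; apply: le_lt_trans (normc_le_ReIm _) _ => /=.
rewrite [e]splitr ltrD// distrC; near: t; [exact: fa|exact: gb].
Unshelve. all: by end_near. Qed.

Lemma cvg_Re {T} (F : set_system T) {FF : Filter F} (f : T -> C) z :
  f @ F --> z -> (fun t => Re (f t)) @ F --> Re z.
Proof.
move=> /cvgCP fz; apply/cvgrPdist_lt => e /fz; apply: filterS => t.
by apply: le_lt_trans; rewrite distrC; have := normc_Re (f t - z); rewrite raddfB.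
Qed.

Lemma cvg_Im {T} (F : set_system T) {FF : Filter F} (f : T -> C) z :
  f @ F --> z -> (fun t => Im (f t)) @ F --> Im z.
Proof.
move=> /cvgCP fz; apply/cvgrPdist_lt => e /fz; apply: filterS => t.
by apply: le_lt_trans; rewrite distrC; have := normc_Im (f t - z); rewrite raddfB.
Qed.

Lemma cvg_normc {T} (F : set_system T) {FF : Filter F} (f : T -> C) z :
  f @ F --> z -> (fun t => normc (f t)) @ F --> normc z.
Proof.
move=> /cvgCP fz; apply/cvgrPdist_lt => e /fz; apply: filterS => t.
apply: le_lt_trans; rewrite ler_norml; have := normc_rev z (f t); have := normc_rev (f t) z.
by rewrite (normcBC z); move=> h1 h2; apply/andP; split; lra.
Qed.

Lemma exists_le2 (a b : R) : 0 < a -> 0 < b ->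
  exists c : R, [/\ 0 < c, c <= a & c <= b].
Proof. by move=> a0 b0; exists (Num.min a b); rewrite lt_min a0 b0 !ge_min !lexx orbT. Qed.

(** The derivative as best affine approximation, which does not exclude [w = z]; [cdiffP] relates it
    to the derivative of the library. *)
Definition cdiff (f : C -> C) z A := forall e, 0 < e -> exists2 k : R, 0 < k &
  forall w, normc (w - z) < k -> normc (f w - f z - A * (w - z)) <= e * normc (w - z).

Lemma cdiffP (f : C -> C) z A :
  cdiff f z A <-> derivable f z 1 /\ 'D_1 f z = A.
Proof.
have FF : ProperFilter (0^' : set_system C) by exact: Proper_dnbhs_numFieldType.
have key : cdiff f z A <->
   (fun h : C => h^-1 *: (f (h *: 1 + z) - f z)) @ 0^' --> A.
  split => [h|/cvgCP h e e0].
    apply/cvgCP => e e0; have [k k0 kP] := h _ (divr_gt0 e0 (ltr0Sn R 1)).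
    apply/nbhsCP; exists k => // w; rewrite subr0 => wk w0.
    have wn0 : normc w != 0 by rewrite normc_eq0.
    have := kP (w + z); rewrite addrK => /(_ wk).
    rewrite -ler_pdivrMr ?normc_gt0//; move=> h1; apply: (@le_lt_trans _ _ (e / 2)); last by rewrite ltr_pdivrMr// ltr_pMr// ltr1n.
    apply: le_trans h1.
    rewrite -Normc.normcV -Normc.normcM le_eqVlt; apply/orP; left; apply/eqP; congr normc.
    rewrite /GRing.scale /= mulr1; field.
    exact: w0.
  have /nbhsCP[k k0 kP] := h _ e0.
  exists k => // w wk; have [->|wz] := eqVneq w z.
    by rewrite !subrr mulr0 subrr Normc.normc0 mulr0.
  have wz0 : w - z != 0 by rewrite subr_eq0.
  have := kP (w - z); rewrite subr0 => /(_ wk wz0).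
  rewrite /GRing.scale /= mulr1 subrK => /ltW.
  rewrite -(ler_pM2r (x := normc (w - z))) ?normc_gt0//; apply: le_trans.
  rewrite -Normc.normcM le_eqVlt; apply/orP; left; apply/eqP; congr normc; field.
  exact: wz0.
split => [/(proj1 key) h|[df dA]]; last by apply: (proj2 key); rewrite -dA; exact: df.
split; first by apply: cvgP h.
exact/cvg_lim.
Qed.

Lemma derivable_cdiff (f : C -> C) z : derivable f z 1 <-> exists A, cdiff f z A.
Proof.
split => [df|[A /cdiffP[]//]].
by exists ('D_1 f z); apply/cdiffP.
Qed.

Lemma cdiff_cont (f : C -> C) z A : cdiff f z A -> f @ z --> f z.
Proof.
move=> /(_ _ ltr01)[k k0 kP]; apply/cvgC_at => e e0.
have M0 : 0 < normc A + 1 by rewrite ltr_wpDl ?normc_ge0.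
exists (Num.min k (e / (normc A + 1))) => [|w]; first by rewrite lt_min k0 divr_gt0.
rewrite lt_min => /andP[wk]; rewrite ltr_pdivlMr// => we.
have h1 := kP w wk; have := normc_triangle (f w) (f z + A * (w - z)) (f z).
rewrite opprD addrA [f z + _]addrC addrK Normc.normcM; nra.
Qed.

Lemma cdiff_ext (f g : C -> C) z A :
  (exists2 e : R, 0 < e & forall w, normc (w - z) < e -> f w = g w) ->
  cdiff f z A -> cdiff g z A.
Proof.
move=> [e e0 fg] h e1 e10; have [k k0 kP] := h _ e10.
exists (Num.min k e) => [|w]; first by rewrite lt_min k0.
rewrite lt_min => /andP[wk we]; rewrite -!fg ?subrr ?Normc.normc0//; exact: kP.
Qed.

Lemma cdiff_id z : cdiff id z 1.
Proof. by move=> e e0; exists 1 => // w _; rewrite mul1r subrr Normc.normc0 mulr_ge0 ?normc_ge0 ?ltW. Qed.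

Lemma cdiff_cst a z : cdiff (fun=> a) z 0.
Proof. by move=> e e0; exists 1 => // w _; rewrite mul0r !subrr Normc.normc0 mulr_ge0 ?normc_ge0 ?ltW. Qed.

Lemma cdiffD (f g : C -> C) z A B : cdiff f z A -> cdiff g z B -> cdiff (fun w => f w + g w) z (A + B).
Proof.
move=> hf hg e e0; have e2 : 0 < e / 2 by rewrite divr_gt0.
have [k k0 kP] := hf _ e2; have [l l0 lP] := hg _ e2.
exists (Num.min k l) => [|w]; first by rewrite lt_min k0.
rewrite lt_min => /andP[/kP h1 /lP h2].
rewrite (_ : _ - _ = (f w - f z - A * (w - z)) + (g w - g z - B * (w - z))); last by ring.
by apply: le_trans (le_normcD _ _) _; lra.
Qed.

Lemma cdiff_comp (f g : C -> C) z A B : cdiff f z A -> cdiff g (f z) B ->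
  cdiff (g \o f) z (B * A).
Proof.
move=> hf hg e e0.
have M0 : 0 < normc A + 1 by rewrite ltr_wpDl ?normc_ge0.
have N0 : 0 < normc B + 1 by rewrite ltr_wpDl ?normc_ge0.
pose e1 := Num.min 1 (e / 2 / (normc B + 1)).
have e10 : 0 < e1 by rewrite lt_min ltr01 !divr_gt0.
pose e2 := e / 2 / (normc A + 1); have e20 : 0 < e2 by rewrite !divr_gt0.
have [k k0 kP] := hf _ e10; have [l l0 lP] := hg _ e20.
exists (Num.min k (l / (normc A + 1))) => [|w]; first by rewrite lt_min k0 divr_gt0.
rewrite lt_min => /andP[/kP h1]; rewrite ltr_pdivlMr// => wl.
have nw := normc_ge0 (w - z).
have e11 : e1 <= 1 by rewrite ge_min lexx.
have h2 : normc (f w - f z) <= (normc A + 1) * normc (w - z).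
  have := normc_triangle (f w) (f z + A * (w - z)) (f z).
  rewrite opprD addrA [f z + _]addrC addrK Normc.normcM; nra.
have {}wl : normc (f w - f z) < l by apply: le_lt_trans h2 _; rewrite mulrC.
have h3 := lP _ wl.
rewrite /= (_ : _ - _ = (g (f w) - g (f z) - B * (f w - f z)) + B * (f w - f z - A * (w - z))); last by ring.
apply: le_trans (le_normcD _ _) _; rewrite Normc.normcM.
rewrite [e]splitr mulrDl lerD//.
  apply: le_trans h3 _; rewrite /e2 -mulrA ler_pM2l ?divr_gt0//.
  by rewrite mulrC ler_pdivrMr// mulrC.
have : normc B * e1 <= e / 2.
  have : e1 <= e / 2 / (normc B + 1) by rewrite ge_min lexx orbT.
  rewrite ler_pdivlMr//; lra.
move=> h4; apply: le_trans (ler_wpM2l (normc_ge0 B) h1) _.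
by rewrite mulrA ler_wpM2r.
Qed.

Lemma cdiffM (f g : C -> C) z A B : cdiff f z A -> cdiff g z B ->
  cdiff (fun w => f w * g w) z (A * g z + f z * B).
Proof.
move=> /cdiffP[df <-] /cdiffP[dg <-]; apply/cdiffP; split.
  exact: (@derivableM _ _ f g z 1 df dg).
have -> : 'D_1 (fun w => f w * g w) z = f z *: 'D_1 g z + g z *: 'D_1 f z.
  exact: (@deriveM _ _ f g z 1 df dg).
rewrite /GRing.scale /=; move: ('D_1 f z) ('D_1 g z) => a b; ring.
Qed.

Lemma cdiff_inv z : z != 0 -> cdiff (fun w => w^-1) z (- z^-2).
Proof.
move=> z0 e e0.
have nz : 0 < normc z by rewrite normc_gt0.
exists (Num.min (normc z / 2) (e * normc z ^+ 3 / 2)) => [|w].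
  by rewrite lt_min !divr_gt0// mulr_gt0// exprn_gt0.
rewrite lt_min => /andP[h1 h2].
have nw : normc z / 2 < normc w by have := normc_rev z w; rewrite normcBC; lra.
have w0 : w != 0 by rewrite -normc_gt0; apply: lt_trans nw; rewrite divr_gt0.
have -> : w^-1 - z^-1 - - z^-2 * (w - z) = (w - z) * (w - z) * (z ^+ 2 * w)^-1.
  by field; rewrite z0 w0.
rewrite !(Normc.normcM, Normc.normcV) mulrAC ler_wpM2r ?normc_ge0//.
rewrite ler_pdivrMr; last by rewrite !mulr_gt0// normc_gt0.
apply: le_trans (ltW h2) _; rewrite -mulrA ler_pM2l//.
rewrite (_ : normc z ^+ 3 / 2 = normc z * normc z * (normc z / 2)); last by field.
by rewrite ler_pM2l ?mulr_gt0// ltW.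
Qed.

End ComplexBasics.

(** * The mean value property *)

Section MeanValue.
Variable R : realType.
Local Notation C := R[i].

Lemma int_base (L L' : R) (f : R -> R) a b : continuous f -> L < a -> L' < a -> a <= b ->
  segint L f a b = segint L' f a b.
Proof.
move=> cf La La'; rewrite le_eqVlt => /predU1P[<-|ab]; first by rewrite !intxx.
have ML : Num.max L L' < a by rewrite gt_max La.
have [|c _] := @prim_mvt _ (Num.max L L') (prim L f - prim L' f) (fun x => f x - f x) a b ab ML.
  move=> x; rewrite gt_max => /andP[Lx Lx'].
  by apply: is_deriveB; exact: prim_derive.
by rewrite subrr mul0r !fctE /segint; lra.
Qed.

Lemma is_derive_eps (f : R -> R) (x df : R) : is_derive x 1 f df -> forall e, 0 < e ->
  exists2 k : R, 0 < k & forall s, `|s| < k -> `|f (x + s) - f x - df * s| <= e * `|s|.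
Proof.
move=> [dv dE] e e0.
have : (fun h => h^-1 *: (f (h *: 1 + x) - f x)) @ 0^' --> df by rewrite -dE; exact: dv.
move=> /cvgrPdist_lt /(_ _ e0) [k /= k0 kP].
exists k => // s sk; have [->|s0] := eqVneq s 0.
  by rewrite addr0 subrr mulr0 subrr normr0 mulr0.
have := kP s; rewrite /ball /= sub0r normrN => /(_ sk s0).
rewrite /GRing.scale /= mulr1 (addrC s) => /ltW.
rewrite -(ler_pM2r (x := `|s|)) ?normr_gt0//; apply: le_trans.
rewrite -normrM distrC mulrBl mulrAC mulVf// mul1r; exact: lexx.
Qed.

(** The complex exponential of [x +i* y]. *)
Definition expcis (x y : R) : C := (expR x)%:C * cexp_i y.

Lemma expcisE x y : expcis x y = (expR x * cos y) +i* (expR x * sin y).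
Proof. by rewrite /expcis /cexp_i; simpc. Qed.

Lemma expcisD x y s t : expcis (x + s) (y + t) = expcis x y * expcis s t.
Proof. by rewrite !expcisE expRD cosD sinD; simpc; congr (_ +i* _); ring. Qed.

Lemma normc_cis y : normc (cexp_i y : C) = 1.
Proof. by rewrite /= cos2Dsin2 sqrtr1. Qed.

Lemma normc_expcis x y : normc (expcis x y) = expR x.
Proof. by rewrite Normc.normcM normc_cis mulr1 normc_real ger0_norm ?expR_ge0. Qed.

Lemma expcis_near0 e : 0 < e -> exists2 k : R, 0 < k & forall s t, `|s| < k -> `|t| < k ->
  normc (expcis s t - 1 - (s +i* t)) <= e * (`|s| + `|t|).
Proof.
move=> e0; have [|e1 [e10 e11 e18]] := @exists_le2 _ 1 (e / 8) ltr01; first by rewrite divr_gt0.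
have [k k0 kP] := is_derive_eps (is_derive_expR (0 : R)) e10.
have [l l0 lP] := is_derive_eps (is_derive_cos (0 : R)) e10.
have [m m0 mP] := is_derive_eps (is_derive_sin (0 : R)) e10.
exists (Num.min e1 (Num.min k (Num.min l m))) => [|s t]; first by rewrite !lt_min e10 k0 l0 m0.
rewrite !lt_min => /and4P[se sk _ _] /and4P[te _ tl tm].
have := kP s sk; have := lP t tl; have := mP t tm.
rewrite !add0r cos0 sin0 oppr0 mul0r !addr0 ?subr0 !mul1r expR0 mul1r => h1 h2 h3.
apply: le_trans (normc_le_ReIm _) _; rewrite expcisE /= subr0.
set E := expR s in h3 *.
have t0 := normr_ge0 t; have s0 := normr_ge0 s.
have E1 : `|E - 1| <= 2 * `|s|.
  have := ler_normD (E - 1 - s) s; rewrite subrK => h4.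
  have : e1 * `|s| <= `|s| by rewrite ler_piMl.
  lra.
have E3 : `|E| <= 3 by have := ler_normD (E - 1) 1; rewrite subrK normr1; lra.
have h4 : `|E * cos t - 1 - s| <= e1 * `|s| + 3 * (e1 * `|t|).
  rewrite (_ : _ - s = (E - 1 - s) + E * (cos t - 1)); last by ring.
  apply: le_trans (ler_normD _ _) _; rewrite normrM lerD//.
  by apply: ler_pM.
have h5 : `|E * sin t - 0 - t| <= 3 * (e1 * `|t|) + 2 * (e1 * `|t|).
  rewrite (_ : _ - t = E * (sin t - t) + (E - 1) * t); last by ring.
  apply: le_trans (ler_normD _ _) _; rewrite !normrM lerD//.
    by apply: ler_pM.
  rewrite mulrA ler_wpM2r//; apply: le_trans E1 _; lra.
move: h5; rewrite subr0 => h5.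
have h6 : e1 * `|s| <= e / 8 * `|s| by rewrite ler_wpM2r.
have h7 : e1 * `|t| <= e / 8 * `|t| by rewrite ler_wpM2r.
have h8 : 0 <= e * `|s| by rewrite mulr_ge0// ltW.
lra.
Qed.

(** The chain rule for [h (c + exp (x + i y))], in the form that the hypothesis of [goursat] takes
    after separating real and imaginary parts. *)
Lemma cdiff_expcis (h : C -> C) c x0 y0 A : cdiff h (c + expcis x0 y0) A -> forall e, 0 < e ->
  exists2 k : R, 0 < k & forall x y, `|x - x0| < k -> `|y - y0| < k ->
   normc (h (c + expcis x y) - h (c + expcis x0 y0) -
      A * expcis x0 y0 * ((x - x0) +i* (y - y0))) <= e * (`|x - x0| + `|y - y0|).
Proof.
move=> hd e e0; set w0 := expcis x0 y0 in hd *.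
pose W := normc w0; have W0 : 0 < W by rewrite /W normc_expcis expR_gt0.
pose N := normc A; have N0 : 0 <= N by exact: normc_ge0.
pose e1 := e / (2 * (2 * W)); have e10 : 0 < e1 by rewrite !divr_gt0// !mulr_gt0.
have [|e2 [e20 e21 e22]] := @exists_le2 _ 1 (e / (2 * W * (N + 1))) ltr01.
  by rewrite divr_gt0// !mulr_gt0//; lra.
have [k k0 kP] := hd _ e10; have [l l0 lP] := expcis_near0 e20.
exists (Num.min l (k / (4 * W))) => [|x y]; first by rewrite lt_min l0 divr_gt0// mulr_gt0.
rewrite !lt_min => /andP[xl xk] /andP[yl yk].
have := lP _ _ xl yl.
set s := x - x0 in xl xk *; set t := y - y0 in yl yk *.
set D := `|s| + `|t| => h1.
have D0 : 0 <= D by rewrite addr_ge0.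
have st : normc (s +i* t) <= D by exact: normc_le_ReIm.
have -> : expcis x y = w0 * expcis s t by rewrite -expcisD /s /t; congr expcis; ring.
have h2 : normc (expcis s t - 1) <= 2 * D.
  have := le_normcD (expcis s t - 1 - (s +i* t)) (s +i* t); rewrite subrK.
  have : e2 * D <= D by rewrite ler_piMl.
  lra.
have E1 : c + w0 * expcis s t - (c + w0) = w0 * (expcis s t - 1) by ring.
have h3 : normc (c + w0 * expcis s t - (c + w0)) <= W * (2 * D).
  by rewrite E1 Normc.normcM ler_pM2l.
have h3k : normc (c + w0 * expcis s t - (c + w0)) < k.
  apply: le_lt_trans h3 _; move: xk yk; rewrite !ltr_pdivlMr ?mulr_gt0//.
  rewrite (_ : W * (2 * D) = (`|s| * (4 * W) + `|t| * (4 * W)) / 2); last by rewrite /D; field.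
  lra.
have h4 := kP _ h3k.
rewrite (_ : _ - _ = (h (c + w0 * expcis s t) - h (c + w0) - A * (c + w0 * expcis s t - (c + w0))) +
   A * w0 * (expcis s t - 1 - (s +i* t))); last by ring.
apply: le_trans (le_normcD _ _) _; rewrite (Normc.normcM (A * w0)) (Normc.normcM A) -/W -/N.
have h5 : e1 * normc (c + w0 * expcis s t - (c + w0)) <= e / 2 * D.
  apply: le_trans (ler_wpM2l (ltW e10) h3) _; rewrite /e1 le_eqVlt; apply/orP; left; apply/eqP.
  by field; rewrite gt_eqF.
have h6 : N * W * normc (expcis s t - 1 - (s +i* t)) <= e / 2 * D.
  apply: le_trans (ler_wpM2l (mulr_ge0 N0 (ltW W0)) h1) _; rewrite mulrA ler_wpM2r//.
  move: e22.
  rewrite ler_pdivlMr; last by rewrite !mulr_gt0//; lra.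
  have : 0 <= e2 * W by rewrite mulr_ge0 ?ltW.
  rewrite (_ : e2 * (2 * W * (N + 1)) = 2 * (N * W * e2) + 2 * (e2 * W)); last by ring.
  lra.
apply: le_trans (lerD (le_trans h4 h5) h6) _; lra.
Qed.

Lemma cvg_circle (c : C) (rho y : R) :
  (fun t => c + rho%:C * cexp_i t) @ y --> c + rho%:C * cexp_i y.
Proof.
case: c => a b.
have E t : (a +i* b) + rho%:C * cexp_i t = (a + rho * cos t) +i* (b + rho * sin t).
  by rewrite /cexp_i; simpc.
rewrite E (_ : (fun t => _) = (fun t => (a + rho * cos t) +i* (b + rho * sin t))); last exact/funext.
apply: cvg_Complex; apply: cvgD; try exact: cvg_cst; apply: cvgMr; try exact: cvg_cst.
  exact: continuous_cos.
exact: continuous_sin.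
Qed.

Lemma cvg_ray (c : C) (b x y : R) :
  (fun t => c + expcis (Num.min t b) y) @ x --> c + expcis (Num.min x b) y.
Proof.
case: c => a1 b1.
have E1 t : (a1 +i* b1) + expcis (Num.min t b) y =
    (a1 + expR (Num.min t b) * cos y) +i* (b1 + expR (Num.min t b) * sin y).
  by rewrite expcisE; simpc.
rewrite E1 (_ : (fun t => _) = (fun t => (a1 + expR (Num.min t b) * cos y) +i* (b1 + expR (Num.min t b) * sin y))); last exact/funext.
have cm : (fun t => expR (Num.min t b)) @ x --> expR (Num.min x b).
  apply: (@cvg_comp _ _ _ (fun t => Num.min t b) (@expR R) _ (nbhs (Num.min x b))); last exact: continuous_expR.
  apply: (@continuous_min R R id (cst b) x); [exact: cvg_id|exact: cvg_cst].
by apply: cvg_Complex; apply: cvgD; try exact: cvg_cst; apply: cvgMl; try exact: cvg_cst.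
Qed.

Section disk.
Variables (h : C -> C) (c : C) (r : R).
Hypothesis ch : forall w, normc (w - c) < r -> h @ w --> h w.
Hypothesis dh : forall w, normc (w - c) < r -> w != c -> exists A, cdiff h w A.

Lemma continuous_circle (rho : R) : 0 <= rho < r ->
  continuous (fun y : R => Re (h (c + rho%:C * cexp_i y))) /\
  continuous (fun y : R => Im (h (c + rho%:C * cexp_i y))).
Proof.
move=> /andP[rho0 rhor].
have H y : (fun y => h (c + rho%:C * cexp_i y)) @ y --> h (c + rho%:C * cexp_i y).
  have in_disk : normc (c + rho%:C * cexp_i y - c) < r.
    by rewrite addrAC subrr add0r Normc.normcM normc_cis mulr1 normc_real ger0_norm.
  apply: (@cvg_comp _ _ _ (fun y => c + rho%:C * cexp_i y) h _ (nbhs (c + rho%:C * cexp_i y))).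
    exact: cvg_circle.
  exact: ch.
by split => y; [exact: cvg_Re (H y)|exact: cvg_Im (H y)].
Qed.

(** In the coordinate [c + exp (x + i y)] the annulus between the radii [rho1] and [rho] is a
    rectangle of height [2 pi]. By periodicity its horizontal sides cancel in [goursat], so the mean
    over a circle is the same for both radii, and for small [rho1] it is close to the value at [c].
    At the centre itself only continuity enters, which makes the lemma applicable to difference
    quotients. *)
Lemma mean_value_Re (rho : R) : 0 < rho < r ->
  segint (-1) (fun y => Re (h (c + rho%:C * cexp_i y))) 0 (pi *+ 2) = pi *+ 2 * Re (h c).
Proof.
move=> /andP[rho0 rhor].
have pi2 : 0 < pi *+ 2 :> R by rewrite mulrn_wgt0 ?pi_gt0.
have r0 : 0 < r by exact: lt_trans rhor.
have hc : h @ c --> h c by apply: ch; rewrite subrr Normc.normc0.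
apply/eqP; rewrite -subr_eq0 -normr_le0; apply/ler_addgt0Pr => e e0; rewrite add0r.
have e20 : 0 < e / (pi *+ 2) by rewrite divr_gt0.
move/cvgC_at : (hc) => /(_ _ e20)[k k0 kP].
have [m [m0 mrho mk]] := exists_le2 rho0 k0.
pose rho1 := m / 2.
have rho10 : 0 < rho1 by rewrite divr_gt0.
have rho1r : rho1 < rho by rewrite /rho1; lra.
have rho1k : rho1 < k by rewrite /rho1; lra.
(* Truncating the coordinate [x] at [ln rho2], beyond [ln rho], keeps all points inside the disk, so
   that the integrands are continuous on the whole line. *)
pose rho2 := (rho + r) / 2.
have rho20 : 0 < rho2 by rewrite divr_gt0// addr_gt0.
pose b := ln rho2.
pose E x y := c + expcis (Num.min x b) y.
have EE (p : R) y : 0 < p -> p <= rho2 -> E (ln p) y = c + p%:C * cexp_i y.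
  by move=> p0 pr; rewrite /E min_l ?ler_ln// /expcis lnK.
have Ein x y : normc (E x y - c) < r.
  rewrite /E addrAC subrr add0r normc_expcis.
  apply: (@le_lt_trans _ _ rho2); last by rewrite /rho2; lra.
  by rewrite -[X in _ <= X]lnK// ler_expR ge_min lexx orbT.
pose u x y := Re (h (E x y)); pose v x y := Im (h (E x y)).
have cu x : continuous (u x).
  have [] := @continuous_circle (expR (Num.min x b)); last by [].
  rewrite expR_ge0 /=; have := Ein x 0; rewrite /E addrAC subrr add0r normc_expcis.
  by [].
have cv y : continuous (v^~ y).
  move=> x; apply: cvg_Im.
  apply: (@cvg_comp _ _ _ (E^~ y) h _ (nbhs (E x y))); last exact: ch.
  exact: cvg_ray.
have l1_gt0 : 0 < ln rho - ln rho1 by rewrite subr_gt0 ltr_ln.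
have := @goursat R u v (ln rho1) 0 (ln rho - ln rho1) (pi *+ 2) l1_gt0 pi2 cu cv.
have rho2rho : rho < rho2 by rewrite /rho2; lra.
(* The first goal is the differentiability that [goursat] asks for; the second one continues with
   its conclusion. *)
rewrite (addrC (ln rho1)) subrK add0r => G; refine ((fun H K => K (G H)) _ _); clear G.
  move=> x0 y0 /andP[_ x0P] _.
  have x0b : x0 < b by apply: le_lt_trans x0P _; rewrite ltr_ln.
  have [A hA] : exists A, cdiff h (c + expcis x0 y0) A.
    apply: dh; first by have := Ein x0 y0; rewrite /E min_l// ltW.
    by rewrite -subr_eq0 addrAC subrr add0r -normc_gt0 normc_expcis expR_gt0.
  exists (Re (A * expcis x0 y0)), (Im (A * expcis x0 y0)) => e1 e10.
  have [l l0 lP] := cdiff_expcis hA e10.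
  exists (Num.min l (b - x0)) => [|x y]; first by rewrite lt_min l0 subr_gt0.
  rewrite !lt_min => /andP[xl xb] /andP[yl _].
  have xb' : x < b by move: xb; rewrite ltr_norml => /andP[_]; lra.
  have := lP x y xl yl; rewrite /u /v /E (min_l (ltW xb')) (min_l (ltW x0b)).
  move: (h _) (h _) (A * _) => [a1 b1] [a2 b2] [a3 b3] H.
  split; apply: le_trans H; [apply: le_trans (normc_Re _)|apply: le_trans (normc_Im _)];
    simpc; rewrite /= le_eqVlt; apply/orP; left; apply/eqP; congr `|_|; ring.
rewrite (_ : v^~ 0 = v^~ (pi *+ 2)); last first.
  apply/funext => x; rewrite /v /E !expcisE -[pi *+ 2]add0r sinD2pi cosD2pi.
  by [].
set L := Num.min _ _ - 1.
rewrite subrr add0r => /eqP; rewrite subr_eq0 => /eqP.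
have L0 : L < 0 by rewrite /L ltrBlDr add0r gt_min ltr01 orbT.
have base w : segint L (u w) 0 (pi *+ 2) = segint (-1) (u w) 0 (pi *+ 2).
  exact: (int_base (cu w) L0 (ltrN10 _) (ltW pi2)).
rewrite !base.
have -> : u (ln rho) = (fun y => Re (h (c + rho%:C * cexp_i y))).
  by apply/funext => y; rewrite /u EE// ltW.
move=> ->.
have := @int_near_cst_len R (-1) (u (ln rho1)) (Re (h c)) (e / (pi *+ 2)) 0 (pi *+ 2) (cu _) (ltrN10 _) (ltW pi2).
rewrite add0r (mulrC (Re _)) -mulrA mulVf ?gt_eqF// mulr1; apply => y _.
rewrite /u EE//; last by rewrite ltW// (lt_trans rho1r).
have : normc (c + rho1%:C * cexp_i y - c) < k.
  by rewrite addrAC subrr add0r Normc.normcM normc_cis mulr1 normc_real gtr0_norm.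
by move=> /kP /ltW; apply: le_trans; have := normc_Re (h (c + rho1%:C * cexp_i y) - h c); rewrite raddfB.
Qed.

End disk.
End MeanValue.

(** * The maximum principle *)

Section MaximumPrinciple.
Variable R : realType.
Local Notation C := R[i].

Definition closed_disk (r : R) : set C := [set z | normc z <= r].

Lemma continuous_normc : continuous (fun z : C => normc z).
Proof. by move=> z; apply: (@cvg_normc R C (nbhs z) _ id z); exact: cvg_id. Qed.

Lemma closed_closed_disk r : closed (closed_disk r).
Proof. by apply: (preimage_closed _ (@closed_le _ _)) => z _; exact: continuous_normc. Qed.

Lemma compact_closed_disk r : compact (closed_disk r).
Proof.
have cc : compact ((fun u : R * R => u.1 +i* u.2) @` (`[- r, r] `*` `[- r, r])).
  apply: continuous_compact; last by apply: compact_setX; exact: segment_compact.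
  apply: continuous_subspaceT => -[a b].
  by apply: cvg_Complex; [exact: cvg_fst|exact: cvg_snd].
apply: subclosed_compact cc _; first exact: closed_closed_disk.
move=> [a b] zr; exists (a, b) => //=; rewrite !in_itv /= -!ler_norml.
by split; [have := normc_Re (a +i* b)|have := normc_Im (a +i* b)] => /le_trans; apply.
Qed.

Lemma closed_disk_EVT (F : C -> R) (K : set C) r : closed K -> K `<=` closed_disk r -> K !=set0 ->
  (forall z, K z -> F @ z --> F z) -> exists2 z0, K z0 & forall z, K z -> F z <= F z0.
Proof.
move=> cK Kr K0 cF.
have compK := subclosed_compact cK (@compact_closed_disk r) Kr.
have [|z /set_mem Kz zP] := compact_EVT_max K0 compK (f := F).
  by apply: continuous_in_subspaceT => z /set_mem; exact: cF.
by exists z => // w Kw; apply: zP; exact/mem_set.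
Qed.

Lemma segint_le (L : R) (f : R -> R) (M a b : R) : continuous f -> L < a -> a < b ->
  (forall x, a < x < b -> f x <= M) -> segint L f a b <= M * (b - a).
Proof.
move=> cf La ab fM.
have [c cab E] := prim_mvt ab La (fun x Lx => prim_derive cf Lx).
by rewrite /segint E ler_wpM2r ?fM// subr_ge0 ltW.
Qed.

Lemma mean_value_le (h : C -> C) c r rho M :
  (forall w, normc (w - c) < r -> h @ w --> h w) ->
  (forall w, normc (w - c) < r -> w != c -> exists A, cdiff h w A) ->
  0 < rho < r -> (forall y, Re (h (c + rho%:C * cexp_i y)) <= M) -> Re (h c) <= M.
Proof.
move=> ch dh rhor hM.
have pi2 : 0 < pi *+ 2 :> R by rewrite mulrn_wgt0 ?pi_gt0.
have /andP[rho0 rr] := rhor.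
have rho_r : 0 <= rho < r by rewrite ltW.
have [cR _] := continuous_circle ch rho_r.
have := @segint_le (-1) _ M 0 (pi *+ 2) cR (ltrN10 _) pi2 (fun y _ => hM y).
by rewrite (mean_value_Re ch dh rhor) subr0 mulrC ler_pM2r.
Qed.

(** If [|h w0| > M], then [F w = |h w| + e |w|^2], for the small [e] chosen, has its maximum at an
    interior point [w1]. Let [a] turn [h w1] into its modulus. Expanding [|w|^2] about [w1], the
    maximality of [F w1] says that [g w = a h w + 2 e conj(w1) (w - w1)] has real part at most
    [|h w1| - e s^2] on the circle of radius [s] about [w1], while its value at the centre is
    [|h w1|]. The perturbation makes the inequality strict and avoids an argument by
    connectedness. *)
Lemma max_disk (h : C -> C) r rho M : 0 < rho < r ->
  (forall w, normc w < r -> h @ w --> h w) ->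
  (forall w, normc w < r -> w != 0 -> exists A, cdiff h w A) ->
  (forall w, normc w = rho -> normc (h w) <= M) ->
  forall w, normc w <= rho -> normc (h w) <= M.
Proof.
move=> /andP[rho0 rhor] ch dh hM w0 w0r.
rewrite leNgt; apply/negP => Mh.
pose e := (normc (h w0) - M) / (2 * rho ^+ 2).
have rho2 : 0 < rho ^+ 2 by rewrite exprn_gt0.
have e0 : 0 < e by rewrite divr_gt0 ?subr_gt0// mulr_gt0.
have eE : e * rho ^+ 2 = (normc (h w0) - M) / 2 by rewrite /e; field; rewrite gt_eqF.
pose F w := normc (h w) + e * normc w ^+ 2.
have [||w1 w1r w1P] := @closed_disk_EVT F (closed_disk rho) rho (@closed_closed_disk rho) (fun _ H => H).
- by exists w0.
- move=> z zr.
  have h1 : (fun w => normc (h w)) @ z --> normc (h z).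
    by apply: (@cvg_normc R C (nbhs z) _ h (h z)); apply: ch; exact: le_lt_trans rhor.
  have h2 : (fun w => e * normc w ^+ 2) @ z --> e * normc z ^+ 2.
    apply: (@cvgM _ _ (nbhs z) _ (fun=> e)); first exact: cvg_cst.
    apply: (@cvgM _ _ (nbhs z) _ (fun w : C => normc w) (fun w : C => normc w)); exact: continuous_normc.
  exact: (@cvgD _ _ _ (nbhs z) _ _ _ _ _ h1 h2).
have Fw0 : normc (h w0) <= F w0 by rewrite lerDl mulr_ge0 ?(ltW e0)// exprn_ge0// normc_ge0.
have w1rho : normc w1 < rho.
  rewrite lt_neqAle w1r andbT; apply/eqP => E; have := le_trans Fw0 (w1P w0 w0r).
  by rewrite /F E eE; have := hM _ E; lra.
(* The point 0, where [h] is only known to be continuous, is either the centre [w1] or outside the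
   disk of radius [m] about it. *)
have [m [m0 mrho mw1]] : exists m, [/\ 0 < m, m + normc w1 <= rho & w1 != 0 -> m <= normc w1].
  have [w10|w10] := eqVneq w1 0.
    by exists rho; split => //; rewrite w10 Normc.normc0 addr0.
  have [||k [k0 k1 k2]] := @exists_le2 _ (rho - normc w1) (normc w1); rewrite ?subr_gt0 ?normc_gt0//.
  by exists k; split => //; lra.
pose s := m / 2; have s0 : 0 < s by rewrite divr_gt0.
have sm : s < m by rewrite /s; lra.
have [a [a1 aE]] : exists a, normc a <= 1 /\ a * h w1 = (normc (h w1))%:C.
  have [hw|hw] := eqVneq (h w1) 0.
    by exists 0; rewrite hw mul0r Normc.normc0.
  exists ((normc (h w1))%:C / h w1); rewrite divfK//; split => //.
  by rewrite Normc.normcM Normc.normcV normc_real ger0_norm ?normc_ge0// divff// normc_eq0.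
pose g w := a * h w + 2%:R * e%:C * conjc w1 * (w - w1).
have inr w : normc (w - w1) < m -> normc w < r.
  by move=> wm; have := normc_rev w w1; lra.
have := @mean_value_le g w1 m s (normc (h w1) - e * s ^+ 2).
have -> : Re (g w1) = normc (h w1) by rewrite /g subrr mulr0 addr0 aE.
have lin w : cdiff (fun w => 2%:R * e%:C * conjc w1 * (w - w1)) w (2%:R * e%:C * conjc w1).
  move=> e1 e10; exists 1 => // w' _; rewrite (_ : _ - _ = 0); last by ring.
  by rewrite Normc.normc0 mulr_ge0 ?normc_ge0// ltW.
move=> H; suff : normc (h w1) <= normc (h w1) - e * s ^+ 2.
  have es : 0 < e * s ^+ 2 by rewrite mulr_gt0// exprn_gt0.
  by rewrite leNgt ltrBlDr ltrDl es.
apply: H.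
- move=> w wm.
  have h1 : (fun w => a * h w) @ w --> a * h w.
    apply: (@cvgM _ _ (nbhs w) _ (fun=> a)); [exact: cvg_cst|exact: ch (inr _ wm)].
  exact: (@cvgD _ _ _ (nbhs w) _ _ _ _ _ h1 (cdiff_cont (lin w))).
- move=> w wm ww1.
  have w0' : w != 0.
    apply/eqP => E; move: wm ww1; rewrite E sub0r normcN eq_sym => h1 /mw1; lra.
  have [A hA] := dh w (inr _ wm) w0'.
  exists (0 * h w + a * A + 2%:R * e%:C * conjc w1); apply: cdiffD; last exact: lin.
  by apply: cdiffM => //; exact: cdiff_cst.
- by rewrite s0.
- move=> y; set w := w1 + _.
  have ww1 : normc (w - w1) = s.
    by rewrite /w addrAC subrr add0r Normc.normcM normc_cis mulr1 normc_real gtr0_norm.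
  have wrho : normc w <= rho by have := normc_rev w w1; lra.
  have := w1P w wrho; rewrite /F.
  have h1 : Re (a * h w) <= normc (h w).
    have := normc_Re (a * h w); rewrite Normc.normcM ler_norml => /andP[_ /le_trans]; apply.
    by rewrite ler_piMl ?normc_ge0.
  have h2 : normc w ^+ 2 = normc w1 ^+ 2 + 2 * s * (Re w1 * cos y + Im w1 * sin y) + s ^+ 2.
    rewrite !normc_sqr /w /cexp_i; case: (w1) => p q; simpc => /=.
    transitivity (p ^+ 2 + q ^+ 2 + 2 * s * (p * cos y + q * sin y) + s ^+ 2 * (cos y ^+ 2 + sin y ^+ 2)); first by ring.
    by rewrite cos2Dsin2 mulr1.
  have h3 : Re (g w) = Re (a * h w) + e * (2 * s * (Re w1 * cos y + Im w1 * sin y)).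
    rewrite /g raddfD /=; congr (_ + _); rewrite /w addrAC subrr add0r /cexp_i.
    rewrite (_ : (2%:R : C) = 2%:R%:C); last by rewrite -natr1 rmorphD.
    by case: (w1) => p q; simpc => /=; ring.
  rewrite h2 h3; lra.
Qed.

End MaximumPrinciple.

(** * Cauchy's estimate for derivatives *)

Section Derivative.
Variable R : realType.
Local Notation C := R[i].

Lemma segint_close (L : R) (f g : R -> R) (e a b : R) : continuous f -> continuous g -> L < a -> a <= b ->
  (forall x, `|f x - g x| <= e) -> `|segint L f a b - segint L g a b| <= e * (b - a).
Proof. by move=> cf cg La ab h; apply: le_int_near => // x _. Qed.

Let quot (f : C -> C) z A w : C := if w == z then A else (f w - f z) / (w - z).

Let quot_cont f z A : cdiff f z A -> quot f z A @ z --> quot f z A z.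
Proof.
move=> df; apply/cvgC_at => e e0; have [k k0 kP] := df _ (divr_gt0 e0 (ltr0Sn R 1)).
exists k => // w wk; rewrite /quot eqxx; case: eqVneq => [_|wz]; first by rewrite subrr Normc.normc0.
have wz0 : w - z != 0 by rewrite subr_eq0.
rewrite (_ : _ - A = (f w - f z - A * (w - z)) / (w - z)); last by field.
rewrite Normc.normcM Normc.normcV ltr_pdivrMr ?normc_gt0//.
apply: le_lt_trans (kP _ wk) _; rewrite ltr_pM2r ?normc_gt0//; lra.
Qed.

Let quot_diff f z A w B : w != z -> cdiff f w B -> exists A', cdiff (quot f z A) w A'.
Proof.
move=> wz df.
have wz0 : w - z != 0 by rewrite subr_eq0.
have d1 : cdiff (fun w => f w + - f z) w (B + 0) by apply: cdiffD => //; exact: cdiff_cst.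
have d2 : cdiff (fun w => w + - z) w (1 + 0) by apply: cdiffD; [exact: cdiff_id|exact: cdiff_cst].
have d3 := cdiffM d1 (cdiff_comp d2 (cdiff_inv wz0)).
eexists; apply: cdiff_ext d3; exists (normc (w - z)); first by rewrite normc_gt0.
move=> u uw; rewrite /quot /=; case: eqVneq => // E.
by move: uw; rewrite E normcBC ltxx.
Qed.

(** The difference quotient, completed by the derivative at the base point, is continuous there and
    holomorphic elsewhere, so the derivative is its mean over a circle. On that circle the two
    quotients differ by at most [e / rho]. *)
Lemma deriv_close_Re (f g : C -> C) z z' A A' r rho e : 0 < rho < r ->
  (forall w, normc (w - z) < r -> exists B, cdiff f w B) -> cdiff f z A ->
  (forall w, normc (w - z') < r -> exists B, cdiff g w B) -> cdiff g z' A' ->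
  (forall u, normc u = rho -> normc (f (z + u) - f z - (g (z' + u) - g z')) <= e) ->
  `|Re A - Re A'| <= e / rho.
Proof.
move=> rhor df dfz dg dgz fg.
have pi2 : 0 < pi *+ 2 :> R by rewrite mulrn_wgt0 ?pi_gt0.
have /andP[rho0 rr] := rhor.
have rho_r : 0 <= rho < r by rewrite ltW.
have cq h y B : (forall w, normc (w - y) < r -> exists B, cdiff h w B) -> cdiff h y B ->
   (forall w, normc (w - y) < r -> quot h y B @ w --> quot h y B w) /\
   (forall w, normc (w - y) < r -> w != y -> exists A, cdiff (quot h y B) w A).
  move=> dh dhy; have H w : normc (w - y) < r -> w != y -> exists A, cdiff (quot h y B) w A.
    by move=> /dh[B' hB'] wy; exact: quot_diff hB'.
  split => // w wr; have [->|wy] := eqVneq w y; first exact: quot_cont.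
  by have [A1] := H w wr wy; exact: cdiff_cont.
have [c1 d1] := cq f z A df dfz; have [c2 d2] := cq g z' A' dg dgz.
have := mean_value_Re c1 d1 rhor; have := mean_value_Re c2 d2 rhor.
have qz h y B : quot h y B y = B by rewrite /quot eqxx.
rewrite !qz => E2 E1.
have [r1 _] := continuous_circle c1 rho_r; have [r2 _] := continuous_circle c2 rho_r.
have := @segint_close (-1) _ _ (e / rho) 0 (pi *+ 2) r1 r2 (ltrN10 _) (ltW pi2).
rewrite E1 E2 -mulrBr subr0 normrM (gtr0_norm pi2) (mulrC (pi *+ 2)) ler_pM2r//; apply => y.
set u := rho%:C * _.
have nu : normc u = rho by rewrite Normc.normcM normc_cis mulr1 normc_real gtr0_norm.
have u0 : u != 0 by rewrite -normc_gt0 nu.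
have zu t : (t + u == t) = false by rewrite -subr_eq0 addrAC subrr add0r (negbTE u0).
rewrite /quot !zu -raddfB; apply: le_trans (normc_Re _) _.
have -> : (f (z + u) - f z) / (z + u - z) - (g (z' + u) - g z') / (z' + u - z') =
   (f (z + u) - f z - (g (z' + u) - g z')) / u.
  have E t : t + u - t = u by rewrite addrAC subrr add0r.
  by rewrite !E -mulrBl.
by rewrite Normc.normcM Normc.normcV nu ler_pM2r ?invr_gt0// fg.
Qed.

(** The factor 2 comes from bounding the real and the imaginary part separately, the latter by
    applying the real estimate to ['i * f] and ['i * g]. *)
Lemma deriv_close (f g : C -> C) z z' A A' r rho e : 0 < rho < r ->
  (forall w, normc (w - z) < r -> exists B, cdiff f w B) -> cdiff f z A ->
  (forall w, normc (w - z') < r -> exists B, cdiff g w B) -> cdiff g z' A' ->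
  (forall u, normc u = rho -> normc (f (z + u) - f z - (g (z' + u) - g z')) <= e) ->
  normc (A - A') <= 2 * (e / rho).
Proof.
move=> rhor df dfz dg dgz fg.
have mi (h : C -> C) w B : cdiff h w B -> cdiff (fun w => 'i * h w) w ('i * B).
  move=> hB; rewrite -[_ * B]add0r -[X in X + _](mul0r (h w)).
  by apply: cdiffM => //; exact: cdiff_cst.
have h1 := deriv_close_Re rhor df dfz dg dgz fg.
have h2 : `|Re ('i * A) - Re ('i * A')| <= e / rho.
  apply: (@deriv_close_Re (fun w => 'i * f w) (fun w => 'i * g w) z z' _ _ r) => //.
  - by move=> w /df[B /mi]; eexists; eassumption.
  - exact: mi.
  - by move=> w /dg[B /mi]; eexists; eassumption.
  - exact: mi.
  move=> u /fg; rewrite -!mulrBr Normc.normcM.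
  by rewrite (_ : normc 'i = 1) ?mul1r//= expr0n expr1n add0r sqrtr1.
apply: le_trans (normc_le_ReIm _) _; rewrite mulr2n mulrDl mul1r lerD//.
  by rewrite raddfB.
by move: h2; rewrite !(mulrC 'i) !ReiNIm opprK [- Im A + _]addrC distrC raddfB.
Qed.

End Derivative.

(** * Automorphisms of the disk *)

Section OpenMapping.
Variable R : realType.
Local Notation C := R[i].
Implicit Types z w y : C.

Lemma cdiffZD (f : C -> C) z w A (a b : C) : cdiff f (b + w) A -> z = w ->
  cdiff (fun u => f (b + u)) z A.
Proof.
move=> h -> e /h[k k0 kP]; exists k => // u uk; have := kP (b + u).
by rewrite opprD addrACA subrr add0r; apply.
Qed.

Lemma cdiff_inv_sub (f : C -> C) z y A : f z != y -> cdiff f z A ->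
  exists B, cdiff (fun w => (f w - y)^-1) z B.
Proof.
move=> fz df; have fy : f z - y != 0 by rewrite subr_eq0.
have d1 : cdiff (fun w => f w + - y) z (A + 0) by apply: cdiffD => //; exact: cdiff_cst.
by have := cdiff_comp d1 (cdiff_inv fy); eexists; eassumption.
Qed.

(** By injectivity [f] stays at distance at least [2 m > 0] from [f c] on the circle of radius [s].
    If a value [y] within [m] of [f c] were omitted, [(f - y)^-1] would be holomorphic, at most
    [m^-1] on the circle and larger than [m^-1] at [c], against the maximum principle. *)
Lemma injective_holomorphic_open (f : C -> C) c r rho : 0 < rho < r ->
  (forall w, normc (w - c) < r -> exists A, cdiff f w A) ->
  (forall w w', normc (w - c) < r -> normc (w' - c) < r -> f w = f w' -> w = w') ->
  exists2 e : R, 0 < e & forall y, normc (y - f c) < e -> exists2 w, normc (w - c) < rho & f w = y.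
Proof.
move=> /andP[rho0 rhor] df fi.
pose s := rho / 2; have s0 : 0 < s by rewrite divr_gt0.
have srho : s < rho by rewrite /s; lra.
have inr w : normc w <= s -> normc (c + w - c) < r.
  by move=> h; rewrite addrAC subrr add0r; lra.
pose F w : R := - normc (f (c + w) - f c).
pose K := [set w : C | normc w = s].
have [||||w1 w1s w1P] := @closed_disk_EVT _ F K s.
- rewrite (_ : K = (fun w => normc w) @^-1` [set s])//.
  by apply: preimage_closed => [z _|]; [exact: continuous_normc|exact: closed_eq].
- by move=> w; rewrite /K /closed_disk /= => ->.
- by exists s%:C; change (normc s%:C = s); rewrite normc_real gtr0_norm.
- move=> w ws; have ws' : normc w <= s by rewrite (ws : normc w = s).
  have [A hA] := df (c + w) (inr w ws').
  have h1 : (fun u => f (c + u) - f c) @ w --> f (c + w) - f c.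
    by apply: cdiff_cont; apply: cdiffD (cdiff_cst _ _); apply: cdiffZD hA _.
  exact: (@cvgN _ _ _ (nbhs w) _ _ _ (@cvg_normc R C (nbhs w) _ _ _ h1)).
pose m := normc (f (c + w1) - f c) / 2.
have m0 : 0 < m.
  rewrite divr_gt0// normc_gt0 subr_eq0; apply/eqP => /fi h.
  have : c + w1 = c by apply: h; [by apply: inr; rewrite (w1s : normc w1 = s)|rewrite subrr Normc.normc0; lra].
  move=> /eqP; rewrite -subr_eq0 addrAC subrr add0r => /eqP E.
  by move: w1s; rewrite /K /= E Normc.normc0; lra.
exists m => // y ym; apply: contrapT => noy.
have ney w : normc (w - c) < rho -> f w != y.
  by move=> wr; apply/eqP => fw; apply: noy; exists w.
pose h w := (f (c + w) - y)^-1.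
have dh w : normc w < rho -> exists B, cdiff h w B.
  move=> wr; have wr' : normc (c + w - c) < rho by rewrite addrAC subrr add0r.
  have [A hA] := df _ (lt_trans wr' rhor).
  by apply: (@cdiff_inv_sub (fun u => f (c + u)) w y A (ney _ wr')); apply: cdiffZD hA _.
suff : normc (h 0) <= m^-1.
  have nz : 0 < normc (f c - y) by rewrite normc_gt0 subr_eq0 ney// subrr Normc.normc0.
  rewrite /h addr0 Normc.normcV lef_pV2 ?posrE// normcBC => h1.
  by move: ym; rewrite ltNge h1.
apply: (@max_disk R h rho s m^-1).
- by rewrite s0 srho.
- by move=> w /dh[B]; exact: cdiff_cont.
- by move=> w /dh.
- move=> w ws; have wr : normc w < rho by rewrite ws.
  have wr' : normc (c + w - c) < rho by rewrite addrAC subrr add0r.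
  have nz : 0 < normc (f (c + w) - y) by rewrite normc_gt0 subr_eq0 ney.
  rewrite /h Normc.normcV lef_pV2 ?posrE//.
  have := w1P w ws; rewrite /F lerN2 => h1.
  have := normc_triangle (f (c + w)) y (f c); rewrite /m in ym *; lra.
- by rewrite Normc.normc0 ltW.
Qed.

End OpenMapping.

(** * Blaschke factors *)

Section Blaschke.
Variable R : realType.
Local Notation C := R[i].
Implicit Types z w a : C.

Definition blaschke a z : C := (z - a) / (1 - conjc a * z).

(* The pseudo-hyperbolic distance. *)
Definition pdist z w : R := normc (blaschke w z).

Lemma normc_conj z : normc (conjc z) = normc z.
Proof. by case: z => a b /=; rewrite sqrrN. Qed.

Lemma normc_sqrC z : (normc z)%:C ^+ 2 = z * conjc z.
Proof. rewrite -rmorphXn /=; by rewrite normc_sqr; case: z => a b; simpc => /=; congr (_ +i* _); ring. Qed.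

Lemma conjcM z w : conjc (z * w) = conjc z * conjc w.
Proof. by rewrite rmorphM. Qed.

Lemma conjcB z w : conjc (z - w) = conjc z - conjc w.
Proof. by rewrite rmorphB. Qed.

Lemma blaschke_den a z : normc a < 1 -> normc z < 1 -> 1 - conjc a * z != 0.
Proof.
move=> a1 z1; rewrite -normc_gt0; apply: lt_le_trans (normc_rev 1 (conjc a * z)).
rewrite Normc.normc1 Normc.normcM normc_conj subr_gt0.
apply: le_lt_trans z1; rewrite ler_piMl ?normc_ge0//; exact: ltW.
Qed.

Lemma blaschke_ident a z : normc a < 1 -> normc z < 1 ->
  1 - normc (blaschke a z) ^+ 2 =
  (1 - normc a ^+ 2) * (1 - normc z ^+ 2) / normc (1 - conjc a * z) ^+ 2.
Proof.
move=> a1 z1; have dn := blaschke_den a1 z1.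
have dn0 : normc (1 - conjc a * z) ^+ 2 != 0 by rewrite expf_neq0// normc_eq0.
apply: (mulIf dn0); rewrite divfK// mulrBl mul1r /blaschke Normc.normcM Normc.normcV exprMn exprVn divfK//.
apply: (@complexI R); rewrite !(rmorphXn, rmorphB, rmorphM, rmorph1) /= !normc_sqrC !conjcB !conjcM conjcK.
rewrite (_ : conjc (1 : C) = 1); last by rewrite rmorph1.
ring.
Qed.

Lemma blaschke_lt1 a z : normc a < 1 -> normc z < 1 -> normc (blaschke a z) < 1.
Proof.
move=> a1 z1; rewrite -sqr_normc_lt1 -subr_gt0 blaschke_ident//.
have sq (x : C) : normc x < 1 -> 0 < 1 - normc x ^+ 2 by rewrite -sqr_normc_lt1 subr_gt0.
by apply: divr_gt0; [rewrite mulr_gt0 ?sq|rewrite exprn_gt0// normc_gt0 blaschke_den].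
Qed.

Lemma blaschkeK a z : normc a < 1 -> normc z < 1 -> blaschke (- a) (blaschke a z) = z.
Proof.
move=> a1 z1; have d1 := blaschke_den a1 z1.
have d2 := blaschke_den a1 a1.
have d3 : 1 - conjc (- a) * blaschke a z != 0.
  by apply: blaschke_den; [rewrite normcN|exact: blaschke_lt1].
rewrite {1}/blaschke; apply: (mulIf d3); rewrite divfK// /blaschke rmorphN; field.
exact: d1.
Qed.

Lemma blaschkeNK a z : normc a < 1 -> normc z < 1 -> blaschke a (blaschke (- a) z) = z.
Proof. by move=> a1 z1; rewrite -{1}(opprK a) blaschkeK// normcN. Qed.

Lemma blaschke_self a : blaschke a a = 0.
Proof. by rewrite /blaschke subrr mul0r. Qed.

Lemma blaschke0 a : blaschke a 0 = - a.
Proof. by rewrite /blaschke mulr0 subr0 divr1 sub0r. Qed.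

Lemma blaschke_0 z : blaschke 0 z = z.
Proof. by rewrite /blaschke conjc0 mul0r !subr0 divr1. Qed.

Lemma cdiff_blaschke a z : normc a < 1 -> normc z < 1 ->
  cdiff (blaschke a) z ((1 - normc a ^+ 2)%:C / (1 - conjc a * z) ^+ 2).
Proof.
move=> a1 z1; have d1 := blaschke_den a1 z1.
have h1 : cdiff (fun w => w + - a) z (1 + 0) by apply: cdiffD; [exact: cdiff_id|exact: cdiff_cst].
have h2 : cdiff (fun w => 1 + - conjc a * w) z (0 + (0 * z + - conjc a * 1)).
  apply: cdiffD; first exact: cdiff_cst.
  by apply: (@cdiffM _ (fun=> - conjc a) id); [exact: cdiff_cst|exact: cdiff_id].
have nz : 1 + - conjc a * z != 0 by rewrite mulNr.
have := cdiffM h1 (cdiff_comp h2 (cdiff_inv nz)).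
rewrite (_ : _ + _ = (1 - normc a ^+ 2)%:C / (1 - conjc a * z) ^+ 2).
  by apply: cdiff_ext; exists 1 => // w _; rewrite /blaschke /= mulNr.
rewrite /= rmorphB rmorphXn rmorph1 /= normc_sqrC !mulNr; field.
exact: d1.
Qed.

Lemma pdistC z w : pdist z w = pdist w z.
Proof.
rewrite /pdist /blaschke !Normc.normcM !Normc.normcV (normcBC z); congr (_ / _).
by rewrite -normc_conj conjcB conjcM conjcK rmorph1 mulrC.
Qed.

End Blaschke.

(** * The Schwarz lemma *)

Section Schwarz.
Variable R : realType.
Local Notation C := R[i].
Implicit Types z w a : C.

Let divz (f : C -> C) A w : C := if w == 0 then A else f w / w.

Lemma max_limit (h : C -> C) z :
  normc z < 1 ->
  (forall w, normc w < 1 -> h @ w --> h w) ->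
  (forall w, normc w < 1 -> w != 0 -> exists A, cdiff h w A) ->
  (forall e : R, 0 < e -> exists2 s : R, s < 1 & forall w, s < normc w < 1 -> normc (h w) <= 1 + e) ->
  normc (h z) <= 1.
Proof.
move=> z1 ch dh hb; apply/ler_addgt0Pr => e e0.
have [s s1 sP] := hb _ e0.
pose rho := Num.max ((normc z + 1) / 2) (Num.max (1 / 2) ((s + 1) / 2)).
have r1 : rho < 1 by rewrite !gt_max; apply/and3P; split; lra.
have [r2 [r3 r4]] : normc z <= rho /\ s < rho /\ 0 < rho.
  split; first by rewrite !le_max; apply/orP; left; lra.
  by split; rewrite !lt_max; [apply/or3P/Or33|apply/or3P/Or32]; lra.
apply: (@max_disk _ h 1 rho) => //; first by rewrite r4 r1.
by move=> w wr; apply: sP; rewrite wr r3 r1.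
Qed.

Lemma cont_off0 (h : C -> C) (r : R) : 
  (forall w, normc w < r -> w != 0 -> exists A, cdiff h w A) -> h @ (0 : C) --> h 0 ->
  forall w, normc w < r -> h @ w --> h w.
Proof.
move=> dh h0 w wr; have [->//|w0] := eqVneq w 0.
by have [A] := dh w wr w0; exact: cdiff_cont.
Qed.

Let divz_cont (f : C -> C) A : f 0 = 0 -> cdiff f 0 A -> divz f A @ (0 : C) --> divz f A 0.
Proof.
move=> f0 hA; apply/cvgC_at => e e0; have [k k0 kP] := hA _ (divr_gt0 e0 (ltr0Sn R 1)).
exists k => // w wk; rewrite /divz eqxx; case: eqVneq => [_|w0].
  by rewrite subrr Normc.normc0.
have := kP w wk; rewrite f0 !subr0 => h1.
rewrite (_ : _ - A = (f w - A * w) / w); last by field.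
rewrite Normc.normcM Normc.normcV ltr_pdivrMr ?normc_gt0//.
apply: le_lt_trans h1 _; rewrite ltr_pM2r ?normc_gt0//; lra.
Qed.

Lemma schwarz (f : C -> C) z :
  (forall w, normc w < 1 -> exists A, cdiff f w A) ->
  (forall w, normc w < 1 -> normc (f w) < 1) -> f 0 = 0 -> normc z < 1 ->
  normc (f z) <= normc z.
Proof.
move=> df f1 f0 z1; have [A hA] := df 0 (ltac:(by rewrite Normc.normc0)).
have [->|z0] := eqVneq z 0; first by rewrite f0.
pose h := divz f A.
have dh w : normc w < 1 -> w != 0 -> exists B, cdiff h w B.
  move=> w1 w0; have [B hB] := df w w1.
  have := cdiffM hB (cdiff_inv w0); eexists; apply: cdiff_ext H.
  exists (normc w); first by rewrite normc_gt0.
  move=> u uw; rewrite /h /divz; case: eqVneq => // E.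
  by move: uw; rewrite E sub0r normcN ltxx.
have h0 : h @ (0 : C) --> h 0 by exact: divz_cont.
have := @max_limit h z z1 (cont_off0 dh h0) dh.
rewrite {2}/h /divz (negbTE z0) Normc.normcM Normc.normcV ler_pdivrMr ?normc_gt0// mul1r; apply.
move=> e e0; exists (1 + e)^-1; first by rewrite invf_lt1; lra.
move=> w /andP[sw w1]; have w0 : 0 < normc w by apply: lt_trans sw; rewrite invr_gt0; lra.
rewrite /h /divz -normc_eq0 gt_eqF// Normc.normcM Normc.normcV ler_pdivrMr//.
apply: le_trans (ltW (f1 _ w1)) _; move: sw; rewrite -[X in X < _]mulr1 ltr_pdivrMl; last by lra.
exact: ltW.
Qed.

(* Applying the maximum principle to [w / f w]. *)
Lemma schwarz_rev (f g : C -> C) z A : cdiff f 0 A -> A != 0 ->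
  (forall w, normc w < 1 -> exists A, cdiff f w A) ->
  (forall w, normc w < 1 -> normc (f w) < 1) -> f 0 = 0 ->
  (forall w, normc w < 1 -> g @ w --> g w) ->
  (forall w, normc w < 1 -> normc (g w) < 1) ->
  (forall w, normc w < 1 -> g (f w) = w) -> normc z < 1 ->
  normc z <= normc (f z).
Proof.
move=> hA A0 df f1 f0 cg g1 gf z1; have [->|z0] := eqVneq z 0.
  by rewrite Normc.normc0 normc_ge0.
have g0 : g 0 = 0 by rewrite -{1}f0 gf// Normc.normc0.
have fn0 w : normc w < 1 -> w != 0 -> f w != 0.
  by move=> w1; apply: contra_neq => fw; rewrite -(gf w)// fw.
pose h w := if w == 0 then A^-1 else w / f w.
have dh w : normc w < 1 -> w != 0 -> exists B, cdiff h w B.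
  move=> w1 w0; have [B hB] := df w w1.
  have := cdiffM (cdiff_id w) (cdiff_comp hB (cdiff_inv (fn0 _ w1 w0))); eexists; apply: cdiff_ext H.
  exists (normc w); first by rewrite normc_gt0.
  move=> u uw; rewrite /h; case: eqVneq => // E.
  by move: uw; rewrite E sub0r normcN ltxx.
have h0 : h @ (0 : C) --> h 0.
  pose q w := divz f A w.
  have -> : h = (fun w => (q w)^-1).
    by apply/funext => w; rewrite /h /q /divz; case: eqP => // _; rewrite invf_div.
  apply: (@cvg_comp _ _ _ q (fun u : C => u^-1) _ (nbhs (q 0))); first exact: divz_cont.
  by apply: cdiff_cont (cdiff_inv _); rewrite /q /divz eqxx.
have := @max_limit h z z1 (cont_off0 dh h0) dh.
have fz : 0 < normc (f z) by rewrite normc_gt0 fn0.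
rewrite {2}/h (negbTE z0) Normc.normcM Normc.normcV ler_pdivrMr// mul1r; apply.
move=> e e0; pose r := (1 + e)^-1.
have r1 : r < 1 by rewrite invf_lt1; lra.
have r0 : 0 < r by rewrite invr_gt0; lra.
(* Properness of [f]: the image under [g] of the closed disk of radius [r] lies in a disk of radius
   [|g w1| < 1], outside of which therefore [|f w| > r]. This bounds [|w / f w|] by [r^-1 = 1 + e]
   near the unit circle. *)
have [||||w1 w1r w1P] := @closed_disk_EVT _ (fun w => normc (g w)) (closed_disk r) r.
- exact: closed_closed_disk.
- by [].
- by exists 0; change (normc (0 : C) <= r); rewrite Normc.normc0 ltW.
- move=> w wr; apply: (@cvg_normc R C (nbhs w) _ g (g w)); apply: cg; exact: le_lt_trans r1.
exists (normc (g w1)); first by apply: g1; exact: le_lt_trans r1.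
move=> w /andP[sw wn1]; have w0 : w != 0.
  by rewrite -normc_gt0; apply: le_lt_trans sw; exact: normc_ge0.
have rf : r < normc (f w).
  rewrite ltNge; apply/negP => fr; have := w1P _ fr; rewrite gf//.
  by rewrite leNgt sw.
rewrite /h (negbTE w0) Normc.normcM Normc.normcV ler_pdivrMr; last exact: lt_trans rf.
apply: le_trans (ltW wn1) _; move: rf; rewrite /r -[X in X < _]mulr1 ltr_pdivrMl; last by lra.
exact: ltW.
Qed.

End Schwarz.

(** * Holomorphic automorphisms are isometries *)

Section Automorphism.
Variable R : realType.
Local Notation C := R[i].
Implicit Types z w a u : C.

(** The inverse is only asked to be continuous, which is what lifting through a covering provides;
    it is shown to be holomorphic in [inv_aut]. *)
Record disk_automorphism (f g : C -> C) : Prop := {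
  aut_holo : forall w, normc w < 1 -> exists A, cdiff f w A ;
  aut_lt1 : forall w, normc w < 1 -> normc (f w) < 1 ;
  aut_inv_cont : forall w, normc w < 1 -> g @ w --> g w ;
  aut_inv_lt1 : forall w, normc w < 1 -> normc (g w) < 1 ;
  autK : forall w, normc w < 1 -> g (f w) = w ;
  autKV : forall w, normc w < 1 -> f (g w) = w }.

Lemma cdiff0_segment (f : C -> C) z u :
  (forall t : R, 0 <= t <= 1 -> cdiff f (z + t%:C * u) 0) -> f (z + u) = f z.
Proof.
move=> df.
have H (F : C -> R) : (forall x y, F (x - y) = F x - F y) -> (forall x, `|F x| <= normc x) ->
    F (f (z + u)) = F (f z).
  move=> FB Fn; pose p (t : R) := F (f (z + t%:C * u)).
  have dp (t : R) : 0 <= t <= 1 -> is_derive t 1 p 0.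
    move=> t01.
    suff H : (fun h => h^-1 *: (p (h *: 1 + t) - p t)) @ 0^' --> (0 : R).
      by apply: DeriveDef; [exact: cvgP H|exact: cvg_lim H].
    apply/cvgrPdist_lt => e e0.
    have M0 : 0 < normc u + 1 by rewrite ltr_wpDl ?normc_ge0.
    have e'0 : 0 < e / (normc u + 1) / 2 by rewrite !divr_gt0.
    have [k k0 kP] := df t t01 _ e'0.
    exists (k / (normc u + 1)); first by rewrite /= divr_gt0.
    move=> h; rewrite /ball /= sub0r normrN => hk h0.
    rewrite sub0r normrN /GRing.scale /= mulr1 normrM normfV ltr_pdivrMl ?normr_gt0//.
    rewrite /p -FB; apply: le_lt_trans (Fn _) _.
    have E : z + (h + t)%:C * u - (z + t%:C * u) = h%:C * u by rewrite rmorphD /=; ring.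
    have nE : normc (h%:C * u) = `|h| * normc u by rewrite Normc.normcM normc_real.
    have hu : normc (z + (h + t)%:C * u - (z + t%:C * u)) < k.
      rewrite E nE; move: hk; rewrite ltr_pdivlMr// => /le_lt_trans; apply.
      by rewrite ler_wpM2l// lerDl.
    have := kP _ hu; rewrite mul0r subr0 E nE => /le_lt_trans; apply.
    have hh : 0 < `|h| by rewrite normr_gt0.
    rewrite (_ : _ / 2 * _ = `|h| * (e * (normc u / (normc u + 1) / 2))); last first.
      by field; rewrite gt_eqF.
    rewrite ltr_pM2l// gtr_pMr// !ltr_pdivrMr//; have := normc_ge0 u; lra.
  have [||c _] := @MVT R p (fun=> 0) 0 1 ltr01.
  - by move=> t; rewrite in_itv /= => /andP[h1 h2]; apply: dp; rewrite !ltW.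
  - apply: derivable_within_continuous => t; rewrite in_itv /= => t01.
    by have [] := dp t t01.
  by rewrite mul0r /p mul0r mul1r addr0 => /eqP; rewrite subr_eq0 => /eqP.
have h1 : Re (f (z + u)) = Re (f z) by apply: H (@normc_Re R) => x y; rewrite raddfB.
have h2 : Im (f (z + u)) = Im (f z) by apply: H (@normc_Im R) => x y; rewrite raddfB.
by apply/eqP; rewrite eq_complex h1 h2 !eqxx.
Qed.

Section aut.
Variables f g : C -> C.
Hypothesis fg : disk_automorphism f g.

(** If the derivative vanished near [w], then [f] would be constant on a segment, against
    injectivity. Nonvanishing on a dense set suffices for [aut_pdist], whose two sides are
    continuous. *)
Lemma aut_deriv_dense w (e : R) : normc w < 1 -> 0 < e ->
  exists w', [/\ normc w' < 1, normc (w' - w) < e & exists2 A, A != 0 & cdiff f w' A].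
Proof.
move=> w1 e0; apply: contrapT => H.
have [|d [d0 de dw]] := @exists_le2 _ (e / 2) ((1 - normc w) / 2) (ltac:(by rewrite divr_gt0)).
  by rewrite divr_gt0// subr_gt0.
have in1 (t : R) : 0 <= t <= 1 -> normc (t%:C * d%:C) <= d.
  move=> /andP[t0 t1]; rewrite -rmorphM normc_real ger0_norm ?mulr_ge0// ?(ltW d0)//.
  by rewrite ler_piMl// ltW.
have : f (w + d%:C) = f w.
  apply: cdiff0_segment => t t01.
  have h1 := in1 t t01.
  have h2 : normc (w + t%:C * d%:C) < 1 by have := le_normcD w (t%:C * d%:C); lra.
  have [A hA] := aut_holo fg h2.
  have [<-//|A0] := eqVneq A 0; exfalso; apply: H.
  exists (w + t%:C * d%:C); split => //; last by exists A.
  by rewrite addrAC subrr add0r; lra.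
move=> /(congr1 g); rewrite !(autK fg)//; last first.
  by have := le_normcD w d%:C; rewrite normc_real gtr0_norm//; lra.
move=> /eqP; rewrite -subr_eq0 addrAC subrr add0r -normc_eq0 normc_real gtr0_norm// gt_eqF//.
Qed.

Let F w u := blaschke (f w) (f (blaschke (- w) u)).
Let G w u := blaschke w (g (blaschke (- f w) u)).

Let normN w : normc w < 1 -> normc (- w) < 1. Proof. by rewrite normcN. Qed.

Let FG0 w : normc w < 1 -> F w 0 = 0.
Proof. by move=> w1; rewrite /F blaschke0 opprK blaschke_self. Qed.

Let dF w u : normc w < 1 -> normc u < 1 -> exists A, cdiff (F w) u A.
Proof.
move=> w1 u1; have n1 := blaschke_lt1 (normN w1) u1.
have [A hA] := aut_holo fg n1.
eexists; apply: cdiff_comp (cdiff_comp (cdiff_blaschke (normN w1) u1) hA) _.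
exact: cdiff_blaschke (aut_lt1 fg w1) (aut_lt1 fg n1).
Qed.

Let F1 w u : normc w < 1 -> normc u < 1 -> normc (F w u) < 1.
Proof.
move=> w1 u1; apply: blaschke_lt1; first exact: (aut_lt1 fg).
by apply: (aut_lt1 fg); apply: blaschke_lt1; rewrite ?normcN.
Qed.

Let G1 w u : normc w < 1 -> normc u < 1 -> normc (G w u) < 1.
Proof.
move=> w1 u1; apply: blaschke_lt1 => //.
apply: (aut_inv_lt1 fg); apply: blaschke_lt1; rewrite ?normcN//; exact: (aut_lt1 fg).
Qed.

Let GF w u : normc w < 1 -> normc u < 1 -> G w (F w u) = u.
Proof.
move=> w1 u1; have n1 := blaschke_lt1 (normN w1) u1.
rewrite /G /F blaschkeK ?(autK fg)//; [|exact: (aut_lt1 fg) |exact: (aut_lt1 fg)].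
by rewrite blaschkeNK.
Qed.

Let cG w u : normc w < 1 -> normc u < 1 -> G w @ u --> G w u.
Proof.
move=> w1 u1; have n1 := blaschke_lt1 (normN (aut_lt1 fg w1)) u1.
apply: (@cvg_comp _ _ _ (g \o blaschke (- f w)) (blaschke w) _ (nbhs (g (blaschke (- f w) u)))).
  apply: (@cvg_comp _ _ _ (blaschke (- f w)) g _ (nbhs (blaschke (- f w) u))).
    by apply: cdiff_cont (cdiff_blaschke _ _); rewrite ?normcN// (aut_lt1 fg).
  exact: (aut_inv_cont fg).
by apply: cdiff_cont (cdiff_blaschke _ _) => //; exact: (aut_inv_lt1 fg).
Qed.

(** Moving [w] and [f w] to 0 by Blaschke factors turns the derivative of [f] into its hyperbolic
    normalisation. *)
Lemma blaschke_conj_deriv w A : normc w < 1 -> cdiff f w A ->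
  cdiff (F w) 0 ((1 - normc (f w) ^+ 2)^-1%:C * A * (1 - normc w ^+ 2)%:C).
Proof.
move=> w1 hA; have z1 : normc (0 : C) < 1 by rewrite Normc.normc0.
have h1 := cdiff_blaschke (normN w1) z1.
rewrite mulr0 subr0 expr1n divr1 normcN in h1.
have E : blaschke (- w) 0 = w by rewrite blaschke0 opprK.
have hA' : cdiff f (blaschke (- w) 0) A by rewrite E.
have h2 := cdiff_comp h1 hA'.
have fw1 := aut_lt1 fg w1.
have fE : (f \o blaschke (- w)) 0 = f w by rewrite /= E.
have h3 : cdiff (blaschke (f w)) ((f \o blaschke (- w)) 0) ((1 - normc (f w) ^+ 2)^-1%:C).
  rewrite fE; have := cdiff_blaschke fw1 fw1; congr cdiff.
  rewrite (mulrC _ (f w)) -normc_sqrC -rmorphXn -(rmorph1 (real_complex R)) -rmorphB.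
  rewrite -rmorphXn -fmorphV -rmorphM; congr (_%:C).
  field; by rewrite subr_eq0 eq_sym lt_eqF// sqr_normc_lt1.
by have := cdiff_comp h2 h3; rewrite mulrA.
Qed.

(** Conjugated by Blaschke factors so as to fix 0, [f] satisfies both inequalities of the Schwarz
    lemma. The reverse one divides by the derivative at the fixed point, so [w] is first taken where
    the derivative is not 0 and then arbitrary by continuity. *)
Lemma aut_pdist z w : normc z < 1 -> normc w < 1 -> pdist (f z) (f w) = pdist z w.
Proof.
move=> z1.
have key w' A : normc w' < 1 -> cdiff f w' A -> A != 0 -> pdist (f z) (f w') = pdist z w'.
  move=> w1 hA A0; have dA := blaschke_conj_deriv w1 hA.
  have nz (x : C) : normc x < 1 -> 1 - normc x ^+ 2 != 0.
    by move=> x1; rewrite subr_eq0 eq_sym lt_eqF// sqr_normc_lt1.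
  have B0 : (1 - normc (f w') ^+ 2)^-1%:C * A * (1 - normc w' ^+ 2)%:C != 0.
    rewrite !mulf_neq0//.
      by rewrite -(rmorph0 (real_complex R)) (inj_eq (@complexI R)) invr_eq0 nz// (aut_lt1 fg).
    by rewrite -(rmorph0 (real_complex R)) (inj_eq (@complexI R)) nz.
  have u1 := blaschke_lt1 w1 z1; set u := blaschke w' z in u1.
  have FE : F w' u = blaschke (f w') (f z) by rewrite /F /u blaschkeK.
  apply/eqP; rewrite /pdist -FE eq_le; apply/andP; split.
    apply: schwarz => //; [by move=> x; exact: dF|by move=> x; exact: F1|exact: FG0].
  apply: (@schwarz_rev _ (F w') (G w') u _ dA B0) => //.
  - by move=> x; exact: dF.
  - by move=> x; exact: F1.
  - exact: FG0.
  - by move=> x; exact: cG.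
  - by move=> x; exact: G1.
  - by move=> x; exact: GF.
move=> w1; apply/eqP; rewrite -subr_eq0 -normr_le0; apply/ler_addgt0Pr => e e0; rewrite add0r.
have e2 : 0 < e / 2 by rewrite divr_gt0.
have [B hB] := aut_holo fg w1.
have c1 : (fun x => blaschke (f z) (f x)) @ w --> blaschke (f z) (f w).
  by apply: cdiff_cont (cdiff_comp hB (cdiff_blaschke _ _)); exact: (aut_lt1 fg).
have c2 : blaschke z @ w --> blaschke z w by exact: cdiff_cont (cdiff_blaschke z1 w1).
move/cvgC_at : c1 => /(_ _ e2)[k k0 kP]; move/cvgC_at : c2 => /(_ _ e2)[l l0 lP].
have [m [m0 mk ml]] := exists_le2 k0 l0.
have [w' [w'1 w'm [A A0 hA]]] := aut_deriv_dense w1 m0.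
have := key w' A w'1 hA A0.
have := kP w' (lt_le_trans w'm mk); have := lP w' (lt_le_trans w'm ml).
rewrite !(pdistC _ w) !(pdistC _ (f w)) !(pdistC _ w') !(pdistC _ (f w')) /pdist.
set a := blaschke z w; set a' := blaschke z w'; set b := blaschke _ (f w); set b' := blaschke _ (f w').
move=> h1 h2 h3.
have := normc_rev a' a; have := normc_rev a a'; have := normc_rev b' b; have := normc_rev b b'.
rewrite (normcBC a a') (normcBC b b') => *.
by rewrite ler_norml; apply/andP; split; lra.
Qed.

(** The conjugate of [f] that fixes 0 preserves the modulus by [aut_pdist], so its derivative at 0
    has modulus 1; this is the invariance of the Poincare metric. *)
Lemma aut_deriv z A : normc z < 1 -> cdiff f z A ->
  normc A * (1 - normc z ^+ 2) = 1 - normc (f z) ^+ 2.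
Proof.
move=> z1 hA; have := blaschke_conj_deriv z1 hA.
set B := _ * _ * _ => hB.
have nF u : normc u < 1 -> normc (F z u) = normc u.
  move=> u1; have n1 := blaschke_lt1 (normN z1) u1.
  by have := aut_pdist n1 z1; rewrite /pdist blaschkeNK.
have B1 : normc B = 1.
  apply/eqP; rewrite -subr_eq0 -normr_le0; apply/ler_addgt0Pr => e e0; rewrite add0r.
  have [k k0 kP] := hB _ e0.
  have [d [d0 d1 d2]] := @exists_le2 _ (1 / 2) (k / 2) (ltac:(by lra)) (ltac:(by lra)).
  have nd : normc (d%:C : C) = d by rewrite normc_real gtr0_norm.
  have := kP d%:C; rewrite subr0 nd FG0// subr0 => /(_ (ltac:(by lra))) h1.
  have h2 : normc (F z d%:C) = d by rewrite nF nd//; lra.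
  rewrite -(ler_pM2r d0) -(gtr0_norm d0) -{1}(gtr0_norm d0) -normrM (gtr0_norm d0) mulrBl mul1r.
  have := normc_rev (F z d%:C) (B * d%:C); have := normc_rev (B * d%:C) (F z d%:C).
  rewrite (normcBC (B * _)) h2 Normc.normcM nd => h3 h4.
  by rewrite ler_norml; apply/andP; split; lra.
move: B1; rewrite /B !Normc.normcM !normc_real.
have p (x : C) : normc x < 1 -> 0 < 1 - normc x ^+ 2 by move=> x1; rewrite subr_gt0 sqr_normc_lt1.
have fz := p _ (aut_lt1 fg z1).
rewrite (gtr0_norm (p _ z1)) gtr0_norm ?invr_gt0// => h.
apply: (mulfI (x := (1 - normc (f z) ^+ 2)^-1)); first by rewrite invr_eq0 gt_eqF.
by rewrite mulVf ?gt_eqF// mulrA.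
Qed.

(** Since [f] preserves moduli and [pdist], it preserves the real inner product [Re (conjc w * z)].
    Differentiating in [z] at 0 in every direction gives [conjc (f w) * A = conjc w], and [|A| = 1],
    so [f] is multiplication by its derivative [A]. *)
Lemma aut_fix0 : f 0 = 0 -> exists2 l, normc l = 1 & forall z, normc z < 1 -> f z = l * z.
Proof.
move=> f0; have n0 : normc (0 : C) < 1 by rewrite Normc.normc0.
have nf z : normc z < 1 -> normc (f z) = normc z.
  by move=> z1; have := aut_pdist z1 n0; rewrite f0 /pdist !blaschke_0.
have ReE z w : normc z < 1 -> normc w < 1 -> Re (conjc (f w) * f z) = Re (conjc w * z).
  move=> z1 w1; have := congr1 (fun x => x ^+ 2) (aut_pdist z1 w1).
  have num a b : normc (a - b) ^+ 2 = normc a ^+ 2 + normc b ^+ 2 - 2 * Re (conjc b * a) :> R.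
    by rewrite !normc_sqr; case: a => a1 a2; case: b => b1 b2; simpc => /=; ring.
  have den a b : normc (1 - conjc b * a) ^+ 2 = 1 + normc a ^+ 2 * normc b ^+ 2 - 2 * Re (conjc b * a) :> R.
    by rewrite !normc_sqr; case: a => a1 a2; case: b => b1 b2; simpc => /=; ring.
  have dnz a b : normc a < 1 -> normc b < 1 -> 1 + normc a ^+ 2 * normc b ^+ 2 - 2 * Re (conjc b * a) != 0.
    by move=> a1 b1; rewrite -den expf_neq0// normc_eq0 blaschke_den.
  rewrite /pdist /blaschke !Normc.normcM !Normc.normcV !exprMn !exprVn !den !num !nf//.
  have := dnz _ _ z1 w1; have := dnz _ _ (aut_lt1 fg z1) (aut_lt1 fg w1); rewrite !nf//.
  set X := Re (_ * f z); set Y := Re (_ * z); set a := normc z ^+ 2; set b := normc w ^+ 2.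
  move=> d1 d2 /eqP; rewrite eqr_div// => /eqP E.
  have : (X - Y) * ((1 - a) * (1 - b)) = 0 by lra.
  move=> /eqP; rewrite !mulf_eq0 subr_eq0 => /orP[/eqP//|].
  have p (x : C) : normc x < 1 -> (1 - normc x ^+ 2 == 0) = false.
    by move=> x1; rewrite subr_eq0 eq_sym lt_eqF// sqr_normc_lt1.
  by rewrite !p.
have [A hA] := aut_holo fg n0.
have AE w : normc w < 1 -> conjc (f w) * A = conjc w.
  move=> w1.
  have key d : normc d = 1 -> Re ((conjc (f w) * A - conjc w) * d) = 0.
    move=> d1; apply/eqP; rewrite -normr_le0; apply/ler_addgt0Pr => e e0; rewrite add0r.
    have [k k0 kP] := hA _ e0.
    have [t [t0 t1 t2]] := @exists_le2 _ (1 / 2) (k / 2) (ltac:(by lra)) (ltac:(by lra)).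
    have nt : normc (t%:C * d) = t by rewrite Normc.normcM d1 mulr1 normc_real gtr0_norm.
    have := kP (t%:C * d); rewrite subr0 nt f0 subr0 => /(_ (ltac:(by lra))) h1.
    have := ReE (t%:C * d) w (ltac:(by rewrite nt; lra)) w1.
    move=> h2; rewrite -(ler_pM2r t0) -{1}(gtr0_norm t0) -normrM.
    have -> : Re ((conjc (f w) * A - conjc w) * d) * t = - Re (conjc (f w) * (f (t%:C * d) - A * (t%:C * d))).
      rewrite mulrBr raddfB /= h2.
      case: (conjc (f w)) (A) (conjc w) d {d1 nt h1 h2} => [a1 a2] [b1 b2] [c1 c2] [d1 d2]; simpc => /=; ring.
    rewrite normrN; apply: le_trans (normc_Re _) _; rewrite Normc.normcM normc_conj.
    apply: le_trans h1; rewrite ler_piMl ?normc_ge0// ltW//; exact: (aut_lt1 fg).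
  apply/eqP; rewrite -subr_eq0 eq_complex; apply/andP; split; apply/eqP.
    by have := key 1 (Normc.normc1 R); rewrite mulr1 => ->.
  have i1 : normc ('i : C) = 1 by rewrite /= expr0n expr1n add0r sqrtr1.
  by have /eqP := key 'i i1; rewrite ReiNIm oppr_eq0 => /eqP ->.
have A1 : normc A = 1.
  have hn : normc ((1 / 2 : R)%:C : C) = 1 / 2 by rewrite normc_real gtr0_norm//; lra.
  have h : normc ((1 / 2 : R)%:C : C) < 1 by rewrite hn; lra.
  have := congr1 (@normc R) (AE _ h); rewrite Normc.normcM !normc_conj nf// hn; lra.
exists A => // z z1; have := congr1 (@conjc R) (AE z z1).
rewrite conjcM !conjcK => E.
by rewrite -{2}E mulrCA -normc_sqrC A1 expr1n mulr1.
Qed.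

End aut.
End Automorphism.

(** * Invariant measures from separated sets *)

Definition image_measure d d' (T1 : measurableType d) (T2 : measurableType d')
  (R : realType) (m : {measure set T1 -> \bar R}) (f : T1 -> T2)
  (mf : measurable_fun [set: T1] f) : {measure set T2 -> \bar R}.
Proof. by unshelve refine (pushforward m f : {measure set T2 -> \bar R}). Defined.

Lemma image_measureE d d' (T1 : measurableType d) (T2 : measurableType d')
  (R : realType) (m : {measure set T1 -> \bar R}) (f : T1 -> T2)
  (mf : measurable_fun [set: T1] f) A : image_measure m mf A = m (f @^-1` A).
Proof. by []. Qed.

(** * From a finitely additive content to a Borel measure *)

Section OuterMeasure.
Variables (R : realType) (T : pmetricType R) (c : set T -> R).
Hypotheses (c_ge0 : forall A, 0 <= c A)
  (c_add : forall A B, A `&` B = set0 -> c (A `|` B) = c A + c B)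
  (c_T : c setT = 1).
Local Open Scope ereal_scope.

Let c0 : c set0 = 0%R.
Proof.
have := c_add (setI0 (set0 : set T)); rewrite setU0 => /eqP.
by rewrite -subr_eq0 opprD addrA subrr add0r oppr_eq0 => /eqP.
Qed.

Let c_le A B : A `<=` B -> (c A <= c B)%R.
Proof.
move=> AB; rewrite -(setDUK AB) c_add ?lerDl//.
by apply/seteqP; split => x // -[? []].
Qed.

Let c_le2 A B : (c (A `|` B) <= c A + c B)%R.
Proof.
rewrite (_ : A `|` B = A `|` (B `\` A)); last first.
  by apply/seteqP; split => x /=; have := pselect (A x); tauto.
rewrite c_add; last by apply/seteqP; split => x // -[? []].
by rewrite lerD2l c_le// => x [].
Qed.

Let c_le_sum (F : nat -> set T) n (A : set T) : A `<=` \bigcup_(i < n) F i ->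
  (c A <= \sum_(i < n) c (F i))%R.
Proof.
elim: n A => [|n IH] A AF.
  by rewrite big_ord0 -c0 c_le// => x /AF[].
rewrite big_ord_recr /= (_ : A = (A `\` F n) `|` (A `&` F n)); last first.
  by apply/seteqP; split => x /=; have := pselect (F n x); tauto.
apply: le_trans (c_le2 _ _) _; rewrite lerD//; last by apply: c_le => x [].
by apply: IH => x [/AF[i /= +] Fi Fn]; rewrite ltnS leq_eqVlt => /orP[/eqP E|]; [rewrite E in Fi|exists i].
Qed.

Definition shrink (d : R) (U : set T) : set T := [set x | ball x d `<=` U].
Definition thicken (d : R) (A : set T) : set T := [set x | exists2 y, A y & ball y d x].

(* [c] need not be inner regular on open sets. *)
Definition inner_content (U : set T) : \bar R :=
  ereal_sup [set (c (shrink d U))%:E | d in [set d : R | (0 < d)%R]].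

Definition open_content (A : set T) : \bar R :=
  ereal_inf [set inner_content U | U in [set U | open U /\ A `<=` U]].

Definition outer_content (A : set T) : \bar R :=
  @mu_ext _ (g_sigma_algebraType [set: set T]) R open_content A.

Let inner_ge0 U : 0 <= inner_content U.
Proof.
apply: (@le_trans _ _ (c (shrink 1 U))%:E); first by rewrite lee_fin.
by apply: ereal_sup_ubound; exists 1%R => /=.
Qed.

Let inner_le U : inner_content U <= (c U)%:E.
Proof.
apply: ge_ereal_sup => _ [d /= d0 <-]; rewrite lee_fin c_le// => x; apply.
exact: ballxx.
Qed.

Let inner_T : inner_content setT = 1.
Proof.
apply/eqP; rewrite eq_le; apply/andP; split; first by rewrite -c_T inner_le.
by apply: ereal_sup_ubound; exists 1%R => //=; rewrite (_ : shrink _ _ = setT) ?c_T//; apply/seteqP.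
Qed.

Let oc_ge0 A : 0 <= open_content A.
Proof. by apply: le_ereal_inf_tmp => _ [U _ <-]. Qed.

Let oc0 : open_content set0 = 0.
Proof.
apply/eqP; rewrite eq_le oc_ge0 andbT.
apply: (@le_trans _ _ (inner_content set0)); last by have := inner_le set0; rewrite c0.
by apply: ereal_inf_lbound; exists set0 => //; split => //; exact: open0.
Qed.

Let oc_open U : open U -> open_content U <= inner_content U.
Proof. by move=> oU; apply: ereal_inf_lbound; exists U => //; split. Qed.

Let mu := outer_content.

Let mu_le A : mu A <= open_content A.
Proof.
apply: ereal_inf_lbound; exists (fun i => if i is 0%N then A else set0).
  by split => [i|x Ax]; [exact: sub_sigma_algebra|exists 0%N].
rewrite (@nneseries_split _ _ 0 1)//= add0n big_nat1 eseries0 ?adde0// => -[|n]// _ _; exact: oc0.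
Qed.

Let mu_sub : sigma_subadditive mu.
Proof. exact: (@mu_ext_sigma_subadditive _ (g_sigma_algebraType [set: set T]) R open_content oc_ge0). Qed.

Definition outer_content_measure : {outer_measure set T -> \bar R} :=
  HB.pack_for {outer_measure set T -> \bar R} (outer_content : set T -> \bar R)
    (isOuterMeasure.Build R T outer_content 
      (@mu_ext0 _ (g_sigma_algebraType [set: set T]) R open_content oc0 oc_ge0)
      (@mu_ext_ge0 _ (g_sigma_algebraType [set: set T]) R open_content oc_ge0)
      (@le_mu_ext _ (g_sigma_algebraType [set: set T]) R open_content) mu_sub).

(** Cover [K] by open sets [U i] whose inner contents add up to at most [mu K + e]. By compactness
    some [d] is a Lebesgue number for finitely many of them: every ball of radius [d] about a point
    of [thicken d K] lies in one [U i]. So [thicken d K] is covered by the sets [shrink d (U i)]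
    with [i < n], and finite subadditivity of [c] is enough. *)
Lemma outer_content_thicken (K : set T) (e : R) : compact K -> (0 < e)%R ->
  exists2 d : R, (0 < d)%R & (c (thicken d K))%:E <= mu K + e%:E.
Proof.
move=> cK e0.
have muK : mu K \is a fin_num.
  rewrite ge0_fin_numE; last exact: mu_ext_ge0.
  apply: le_lt_trans (mu_le K) _; apply: (@le_lt_trans _ _ 1); last exact: ltry.
  by rewrite -inner_T; apply: ereal_inf_lbound; exists setT => //; split => //; exact: openT.
have e2 : (0 < e / 2)%R by rewrite divr_gt0.
have [_ [A [mA KA] <-] AK] := lb_ereal_inf_adherent e2 muK.
have [U UP] : {U : nat -> set T & forall i, [/\ open (U i), A i `<=` U i &
    inner_content (U i) <= open_content (A i) + (e / 2 / (2 ^ i.+1)%:R)%:E]}.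
  apply: (@choice _ _ (fun i V => [/\ open V, A i `<=` V &
    inner_content V <= open_content (A i) + (e / 2 / (2 ^ i.+1)%:R)%:E])) => i.
  have ofin : open_content (A i) \is a fin_num.
    rewrite ge0_fin_numE// (@le_lt_trans _ _ 1)// ?ltry// -inner_T.
    by apply: ereal_inf_lbound; exists setT => //; split => //; exact: openT.
  have ei : (0 < e / 2 / (2 ^ i.+1)%:R)%R by rewrite divr_gt0// ltr0n expn_gt0.
  have [_ [V [oV AV] <-] VA] := lb_ereal_inf_adherent ei ofin.
  by exists V; split => //; exact: ltW.
have KU x : K x -> exists i, U i x.
  by move=> /KA[i _ Ax]; exists i; have [_ + _] := UP i; apply.
(* The radius and the number of sets are chosen together, along the product of the filters at 0 and
   at infinity. *)
pose P (p : R * nat) k := forall y, ball k p.1 y -> exists2 i, (i < p.2)%N & ball y p.1 `<=` U i.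
have : \forall p \near filter_prod (0%R^'+) \oo, K `<=` P p.
  apply: (proj1 (compact_near_coveringP K) cK) => x Kx.
  have [i Ux] := KU x Kx; have [oU _ _] := UP i.
  have /nbhs_ballP[r /= r0 rU] : nbhs x (U i) by exact: open_nbhs_nbhs.
  have r3 : (0 < r / 3)%R by rewrite divr_gt0.
  exists (ball x (r / 3), [set p : R * nat | (p.1 < r / 3)%R /\ (i < p.2)%N]) => /=.
    split; first exact: nbhsx_ballx.
    exists ([set d : R | (d < r / 3)%R], [set n | (i < n)%N]) => /=.
      by split; [exact: nbhs_right_lt|exists i.+1].
    by move=> [d n] /=.
  move=> [x' [d n]] /= [xx' [dr ni]] y x'y; exists i => // z yz; apply: rU.
  rewrite (_ : r = (r / 3 + r / 3) + r / 3)%R; last by field.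
  have lift (u v : T) : ball u d v -> ball u (r / 3) v by apply: le_ball; exact: ltW.
  by apply: ball_triangle (lift _ _ yz); apply: ball_triangle xx' (lift _ _ x'y).
move=> nP; have : \forall p \near filter_prod (0%R^'+) \oo, (0 < p.1)%R /\ K `<=` P p.
  near=> p; split; last by near: p.
  near: p; exists ([set d : R | (0 < d)%R], setT); last by move=> [d n] [].
  by split; [exact: nbhs_right_gt|exact: filterT].
move=> /filter_ex[[d n] /= [d0 dP]]; exists d => //.
apply: (@le_trans _ _ (\sum_(i < n) (c (shrink d (U i))))%:E).
  rewrite lee_fin; apply: (@c_le_sum (fun i => shrink d (U i))) => x [y Ky yx].
  by have [i ni xU] := dP y Ky x yx; exists i.
rewrite -sumEFin.
apply: (@le_trans _ _ (\sum_(i < n) (open_content (A i) + (e / 2 / (2 ^ i.+1)%:R)%:E))).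
  apply: lee_sum => i _; have [_ _ +] := UP i; apply: le_trans.
  by apply: ereal_sup_ubound; exists d.
apply: (@le_trans _ _ (\sum_(0 <= i < n) (open_content (A i) + (e / 2 / (2 ^ i.+1)%:R)%:E))).
  by rewrite big_mkord.
apply: le_trans (nneseries_lim_ge _ _) _.
  by move=> i _ _; rewrite adde_ge0// lee_fin divr_ge0// ?ltW//.
have oc_ge0' k : 0 <= open_content (A k) by [].
apply: le_trans (epsilon_trick _ oc_ge0' (ltW e2)) _.
by rewrite [in leRHS](splitr e) EFinD addeA leeD2r// ltW.
Unshelve. all: by end_near. Qed.

Lemma outer_content_T : compact [set: T] -> mu setT = 1.
Proof.
move=> cT; apply/eqP; rewrite eq_le; apply/andP; split.
  apply: le_trans (mu_le _) _; rewrite -inner_T; exact: oc_open openT.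
apply/lee_addgt0Pr => e e0; have [d d0] := outer_content_thicken cT e0.
apply: le_trans; rewrite lee_fin -c_T c_le// => x _; exists x => //; exact: ballxx.
Qed.

Let mu_fin A : mu A \is a fin_num.
Proof.
rewrite ge0_fin_numE; last by rewrite /mu; exact: (outer_measure_ge0 outer_content_measure).
apply: le_lt_trans (mu_le A) _; apply: (@le_lt_trans _ _ 1); last exact: ltry.
by rewrite -inner_T; apply: ereal_inf_lbound; exists setT => //; split => //; exact: openT.
Qed.

Let mu_mono A B : A `<=` B -> mu A <= mu B.
Proof. exact: (le_outer_measure outer_content_measure). Qed.

Let mu_inner A U : open U -> A `<=` U -> mu A <= inner_content U.
Proof.
move=> oU AU; apply: le_trans (mu_mono AU) _; apply: le_trans (mu_le _) _; exact: oc_open.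
Qed.

(** Approximate [U & G] from inside by [V = shrink d (U & G)]. Points of [U] outside [G] lie in the
    open set [W], the part of [U] off the closure of the [d / 2]-thickening of [V]. Shrunken copies
    of [W] are disjoint from [V] and together with it lie in a shrunken copy of [U], so additivity
    of [c] applies. This is the Caratheodory criterion for open sets [G]. *)
Let mu_sep (U G : set T) : open U -> open G ->
  mu (U `&` G) + mu (U `&` ~` G) <= inner_content U.
Proof.
move=> oU oG; rewrite -leeBrDr//.
apply: le_trans (mu_inner (openI oU oG) (fun _ H => H)) _.
apply: ge_ereal_sup => _ [d d0 <-]; rewrite leeBrDr// addeC -leeBrDr//.
set V := shrink d (U `&` G).
pose W := U `&` ~` closure (thicken (d / 2) V).
have d2 : (0 < d / 2)%R by rewrite divr_gt0.
have d4 : (0 < d / 4)%R by rewrite divr_gt0.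
apply: (@le_trans _ _ (inner_content W)).
  apply: mu_inner; first by apply: openI => //; apply: closed_openC; exact: closed_closure.
  move=> x [Ux nGx]; split => // /(_ (ball x (d / 4)) (nbhsx_ballx _ _ d4))[y [[v Vv vy] xy]].
  apply: nGx; have [] // := Vv x.
  rewrite (_ : d = (d / 2 + d / 4) + d / 4)%R; last by field.
  apply: (@le_ball _ _ v (d / 2 + d / 4)); first by rewrite lerDl ltW.
  by apply: ball_triangle vy _; exact: ball_sym.
apply: ge_ereal_sup => _ [n n0 <-]; rewrite leeBrDr// -EFinD -c_add; last first.
  apply/seteqP; split => // x [/(_ x (ballxx _ n0))[_ nx] Vx]; apply: nx.
  apply: subset_closure; exists x => //; exact: ballxx.
have [k [k0 kd kn]] := exists_le2 d0 n0.
apply: (@le_trans _ _ (c (shrink k U))%:E).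
  rewrite lee_fin c_le// => x [h y xy|h y xy].
    by have [] := h y (le_ball kn xy).
  by have [] := h y (le_ball kd xy).
by apply: ereal_sup_ubound; exists k.
Qed.

Let open_caratheodory G : open G -> caratheodory_measurable outer_content_measure G.
Proof.
move=> oG; apply: le_caratheodory_measurable => X.
apply: le_ereal_inf_tmp => _ [A [mA XA] <-].
have mu0 B : 0 <= mu B by exact: (outer_measure_ge0 outer_content_measure).
apply: (@le_trans _ _ (\sum_(k <oo) (mu (A k `&` G) + mu (A k `&` ~` G)))).
  rewrite nneseriesD//; apply: leeD.
    apply: le_trans (mu_sub _); apply: mu_mono => x [/XA[i _ Ai] Gx]; exists i => //.
  apply: le_trans (mu_sub _); apply: mu_mono => x [/XA[i _ Ai] Gx]; exists i => //.
apply: lee_nneseries => [*|i *]; first by apply: adde_ge0; exact: mu0.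
apply: le_ereal_inf_tmp => _ [U [oU AU] <-]; apply: le_trans (mu_sep oU oG).
by apply: leeD; apply: mu_mono; exact: setSI.
Qed.

Let measurable_caratheodory (A : set (borel T)) : measurable A ->
  measurable (A : set (caratheodory_type outer_content_measure)).
Proof.
move=> mA; apply: (@smallest_sub _ (sigma_algebra setT) (@open T)) A mA.
  split; [exact: measurable0|move=> B mB; rewrite setTD; exact: measurableC|move=> F mF; exact: bigcupT_measurable].
exact: open_caratheodory.
Qed.

Let borel_sigma_additive : semi_sigma_additive (outer_content : set (borel T) -> \bar R).
Proof.
move=> F mF tF mUF.
by apply: (@measure_semi_sigma_additive _ (caratheodory_type outer_content_measure) R outer_content_measure F) => //;
  [move=> i|]; exact: measurable_caratheodory.
Qed.

(** These two one-sided comparisons are all that later relates [nu] to [c]; the two need not agree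
    on open or on compact sets. *)
Lemma content_measure : compact [set: T] ->
  exists nu : probability (borel T) R,
    (forall U : set T, open U -> nu U <= (c U)%:E) /\
    (forall (K : set T) (e : R), compact K -> (0 < e)%R ->
      exists2 d : R, (0 < d)%R & (c (thicken d K))%:E <= nu K + e%:E).
Proof.
move=> cT.
pose m := isMeasure.Build _ (borel T) R (outer_content : set (borel T) -> \bar R)
  (outer_measure0 outer_content_measure) (outer_measure_ge0 outer_content_measure)
  borel_sigma_additive.
pose nu : {measure set (borel T) -> \bar R} := HB.pack (outer_content : set (borel T) -> \bar R) m.
pose pr := Measure_isProbability.Build _ (borel T) R nu (outer_content_T cT).
pose P : probability (borel T) R := HB.pack (outer_content : set (borel T) -> \bar R) m pr.
exists P; split => [U oU|K e cK e0]; last exact: outer_content_thicken.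
by apply: le_trans (mu_inner oU (fun _ H => H)) _; exact: inner_le.
Qed.

End OuterMeasure.

(** * Invariance of the measure induced by an almost invariant content *)

Section InvariantMeasure.
Variables (R : realType) (T : pmetricType R) (c : set T -> R) (nu : probability (borel T) R).
Local Open Scope ereal_scope.
Hypotheses (cT : compact [set: T])
  (c_le : forall A B, A `<=` B -> (c A <= c B)%R)
  (nu_open : forall U : set T, open U -> nu U <= (c U)%:E)
  (nu_thicken : forall (K : set T) (e : R), compact K -> (0 < e)%R ->
      exists2 d : R, (0 < d)%R & (c (thicken d K))%:E <= nu K + e%:E).

Lemma open_mball (x : T) (r : R) : open (ball x r).
Proof.
rewrite openE => y; rewrite ballEmdist /= => xy; apply/nbhs_ballP.
exists (r - mdist x y)%R; first by rewrite /= subr_gt0.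
by move=> z; rewrite !ballEmdist /= ltrBrDl; apply: le_lt_trans; exact: metric_triangle.
Qed.

Lemma open_thicken (d : R) (A : set T) : open (thicken d A).
Proof.
rewrite (_ : thicken d A = \bigcup_(y in A) ball y d).
  apply: bigcup_open => y _; exact: open_mball.
by apply/seteqP; split => [x [y Ay yx]|x [y Ay yx]]; exists y.
Qed.

Lemma borel_open (U : set T) : open U -> measurable (U : set (borel T)).
Proof. exact: sub_sigma_algebra. Qed.

Lemma borel_closed (U : set T) : closed U -> measurable (U : set (borel T)).
Proof. by move=> cU; rewrite -(setCK U); apply: measurableC; apply: borel_open; exact: closed_openC. Qed.

(** With [K_d] for [thicken d K]: [nu (g K) <= nu (g K_(d/2)) <= c (g K_(d/2)) <= c K_d <= nu K +
    e]. The third inequality is the almost invariance of [c], which costs another [d / 2]. *)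
Lemma nu_le_image (g g' : T -> T) (K : set T) : continuous g' -> cancel g g' -> cancel g' g ->
  (forall (A : set T) (d : R), (0 < d)%R -> (c (g @` A) <= c (thicken d A))%R) ->
  closed K -> nu (g @` K) <= nu K.
Proof.
move=> cg' gK g'K gc clK; apply/lee_addgt0Pr => e e0.
have cK : compact K by exact: subclosed_compact clK cT _.
have [d d0 dP] := nu_thicken cK e0.
have d2 : (0 < d / 2)%R by rewrite divr_gt0.
have gE A : g @` A = g' @^-1` A.
  by apply/seteqP; split => [_ [x Ax <-] /=|x Ax]; [rewrite gK|exists (g' x)].
apply: le_trans dP; apply: (@le_trans _ _ (c (g @` (thicken (d / 2) K)))%:E).
  apply: le_trans (nu_open _).
    apply: le_measure; rewrite ?inE.
    - apply: borel_closed; rewrite gE; apply: preimage_closed => // x _; exact: cg'.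
    - apply: borel_open; rewrite gE; apply: open_comp; [move=> x _; exact: cg'|exact: open_thicken].
    - by apply: image_subset => x Kx; exists x => //; exact: ballxx.
  rewrite gE; apply: open_comp; [move=> x _; exact: cg'|exact: open_thicken].
rewrite lee_fin; apply: le_trans (gc _ _ d2) _; apply: c_le.
move=> x [y [k Kk ky] yx]; exists k => //; rewrite (splitr d); exact: ball_triangle ky yx.
Qed.

Lemma nu_invariant (g g' : T -> T) : continuous g -> continuous g' -> cancel g g' -> cancel g' g ->
  (forall (A : set T) (d : R), (0 < d)%R -> (c (g @` A) <= c (thicken d A))%R) ->
  (forall (A : set T) (d : R), (0 < d)%R -> (c (g' @` A) <= c (thicken d A))%R) ->
  forall A : set (borel T), measurable A -> nu (g @^-1` A) = nu A.
Proof.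
move=> cg cg' gK g'K gc g'c.
have mg : measurable_fun [set: borel T] (g : borel T -> borel T).
  apply: (@measurability _ _ (borel T) (borel T) setT g (@open T) erefl).
  move=> _ [U oU <-]; rewrite setTI; apply: borel_open.
  by apply: open_comp => // x _; exact: cg.
have key (K : set T) : closed K -> nu (g @^-1` K) = nu K.
  move=> clK; apply/eqP; rewrite eq_le; apply/andP; split.
    have -> : g @^-1` K = g' @` K.
      by apply/seteqP; split => [x Ax|_ [x Ax <-] /=]; [exists (g x)|rewrite g'K].
    exact: nu_le_image cg g'K gK g'c clK.
  have clgK : closed (g @^-1` K) by apply: preimage_closed => // x _; exact: cg.
  have := nu_le_image cg' gK g'K gc clgK; rewrite (_ : g @` (g @^-1` K) = K)//.
  by apply/seteqP; split => [_ [x Ax <-]//|x Kx]; exists (g' x) => /=; rewrite g'K.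
move=> A mA.
have := @measure_unique _ R (borel T) (@closed T) (fun=> setT) _ _ _ _
  (image_measure nu mg) nu _ _ A mA.
apply => //.
- rewrite eqEsubset; split; apply: smallest_sub; try exact: smallest_sigma_algebra.
    move=> U oU; rewrite -(setCK U) -setTD; apply: (@sigma_algebraCD _ setT _ _ _).
    by apply: sub_sigma_algebra; exact: open_closedC.
  by move=> U cU; exact: borel_closed.
- by move=> B C cB cC; exact: closedI.
- by apply/seteqP; split => // x _; exists 0%N.
- by move=> _; rewrite image_measureE preimage_setT; exact: le_lt_trans (probability_le1 nu measurableT) (ltry 1).
Qed.

End InvariantMeasure.

Section UltraLimit.
Variable R : realType.

(** The limit along an ultrafilter finer than the neighbourhoods of infinity, which exists on
    [[0, 1]] by compactness. The comparison allows an error that is eventually below any [d], since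
    the counting measures are only asymptotically invariant. *)
Lemma ultra_limit : exists L : (nat -> R) -> R,
  [/\ forall f g, (forall n, 0 <= f n <= 1) -> (forall n, 0 <= g n <= 1) ->
        (forall n, 0 <= f n + g n <= 1) -> L (fun n => f n + g n) = L f + L g,
      forall f g, (forall n, 0 <= f n <= 1) -> (forall n, 0 <= g n <= 1) ->
        (forall d : R, 0 < d -> \forall n \near \oo, f n <= g n + d) -> L f <= L g,
      forall f, (forall n, 0 <= f n <= 1) -> 0 <= L f &
      L (fun=> 1) = 1].
Proof.
have [U [UU Uoo]] := @ultraFilterLemma nat \oo _.
have cvgU (f : nat -> R) : (forall n, 0 <= f n <= 1) -> cvg (f @ U).
  move=> f01.
  have [|l [_ fl]] := @segment_compact R 0 1 (f @ U) _.
    by apply: (@filterS _ U _ setT) filterT => n _; rewrite /= in_itv /=; exact: f01.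
  apply/cvg_ex; exists l => V lV.
  have [//|UV] := in_ultra_setVsetC (f @^-1` V) UU.
  have [x [nVx Vx]] := fl (~` V) V UV lV.
  by case: nVx.
exists (fun f => lim (f @ U)); split.
- by move=> f g /cvgU cf /cvgU cg _; apply/cvg_lim => //; exact: cvgD.
- move=> f g /cvgU cf /cvgU cg fg; apply/ler_addgt0Pr => d d0.
  have cgd : (fun n => g n + d) @ U --> lim (g @ U) + d by apply: cvgD => //; exact: cvg_cst.
  rewrite -(cvg_lim (@Rhausdorff R) cgd); apply: ler_lim => //; first by apply/cvg_ex; eexists; exact: cgd.
  by apply: Uoo; exact: fg.
- move=> f f01; apply: limr_ge; first exact: cvgU.
  by apply: filterS filterT => n _; have /andP[] := f01 n.
- by apply/cvg_lim => //; exact: cvg_cst.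
Qed.

End UltraLimit.

(** * Counting measures of separated sets *)

Section Separated.
Variables (R : realType) (Gamma : groupType) (T : pmetricType R) (rho : Gamma -> T -> T).
Hypotheses (cT : compact [set: T]) (hrho : homeo_representation rho).
Variable B : nat -> set Gamma.
Hypotheses (B1 : forall n, B n 1%g)
  (BV : forall g, exists k, forall n h, B n h -> B (n + k) (h * g)%g)
  (B_mono : forall m n, (m <= n)%N -> B m `<=` B n).

(** The group version of an (n, e)-separated set: the points are [e] apart in the metric that
    maximises [mdist (rho h x) (rho h y)] over [h] in [B n]. *)
Definition separated n (e : R) (E : seq T) := uniq E /\
  forall x y, x \in E -> y \in E -> x != y -> exists2 h, B n h & e <= mdist (rho h x) (rho h y).

(* Both [E] and [rho g^-1 E] being separated and [E] of almost maximal size, replacing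
   the points of [E] near [A] by those of [rho g^-1 E] in [A] cannot gain much. *)
Lemma separated_exchange n k (e d : R) E (g : Gamma) (A : set T) :
  (forall h, B n h -> B (n + k) (h * g)%g) -> 0 < e ->
  separated n e E -> (forall E', separated (n + k) e E' -> (size E')%:R <= (1 + d) * (size E)%:R) ->
  (count (mem (rho g @` A)) E)%:R <= (count (mem (thicken e A)) E)%:R + d * (size E)%:R.
Proof.
move=> Bg e0 [uE sE] maxE.
have [crho rho1 rhoM] := hrho.
have gK x : rho g^-1%g (rho g x) = x by rewrite -rhoM mulVg.
have gVK x : rho g (rho g^-1%g x) = x by rewrite -rhoM mulgV.
have far x y : x \in A -> y \notin thicken e A -> e <= mdist x y.
  move=> /set_mem Ax; apply: contraR; rewrite -ltNge => xy; apply/mem_set; exists x => //.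
  by rewrite ballEmdist.
pose E1 := [seq x <- map (rho g^-1%g) E | x \in A].
pose E2 := [seq x <- E | x \notin thicken e A].
(* Two points of [E1] are images under [rho g^-1] of points separated by some [h] in [B n], hence
   are separated by [h * g]. Mixed pairs are already [e] apart, by the choice of [thicken e A], so
   the identity separates them. *)
have sep : separated (n + k) e (E1 ++ E2).
  split.
    rewrite cat_uniq !filter_uniq ?map_inj_uniq//; last exact: can_inj gVK.
    rewrite andbT; apply/hasPn => y; rewrite mem_filter => /andP[ny _].
    apply/negP; rewrite mem_filter => /andP[Ay _].
    by have := far y y Ay ny; rewrite mdistxx leNgt e0.
  have s1 x y : x \in E1 -> y \in E1 -> x != y -> exists2 h, B (n + k) h & e <= mdist (rho h x) (rho h y).
    rewrite !mem_filter => /andP[_ /mapP[x' Ex ->]] /andP[_ /mapP[y' Ey ->]] xy.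
    have [|h Bh he] := sE _ _ Ex Ey; first by apply: contra_neq xy => ->.
    by exists (h * g)%g; [exact: Bg|rewrite !rhoM !gVK].
  have s2 x y : x \in E1 -> y \in E2 -> e <= mdist x y.
    by rewrite !mem_filter => /andP[Ax _] /andP[Ay _]; exact: far.
  move=> x y; rewrite !mem_cat => /orP[x1|x2] /orP[y1|y2] xy.
  - exact: s1.
  - by exists 1%g => //; rewrite !rho1 s2.
  - by exists 1%g => //; rewrite !rho1 metric_sym s2.
  - move: x2 y2; rewrite !mem_filter => /andP[_ Ex] /andP[_ Ey].
    by have [h Bh he] := sE x y Ex Ey xy; exists h => //; apply: B_mono Bh; exact: leq_addr.
have := maxE _ sep; rewrite size_cat !size_filter count_map natrD => h.
have -> : count (mem (rho g @` A)) E = count (preim (rho g^-1%g) (mem A)) E.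
  apply: eq_count => x /=; apply/idP/idP => /set_mem.
    by move=> [y Ay <-]; rewrite gK; exact/mem_set.
  by move=> Ax; apply/mem_set; exists (rho g^-1%g x).
have := count_predC (mem (thicken e A)) E.
move=> /(congr1 (fun n => n%:R : R)); rewrite natrD => h2.
move: h; rewrite mulrDl mul1r.
rewrite (_ : count (fun x => x \notin thicken e A) E = count (predC (mem (thicken e A))) E)//.
rewrite (_ : count (preim (rho g^-1%g) (fun x => x \in A)) E = count (preim (rho g^-1%g) (mem A)) E)//.
lra.
Qed.

(** A diagonal choice: [E j] is separated at scale [1 / (j + 1)] and almost maximal, up to the
    factor [1 + 1 / (j + 1)], even when the level is raised by [j]. For a given [g] the shift [k] of
    [BV] is below [j] eventually, so [separated_exchange] applies with errors tending to 0. *)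
Lemma invariant_measure_exists :
  (forall (e d : R) k, 0 < e -> 0 < d -> exists n E, [/\ separated n e E, E != [::] &
    forall E', separated (n + k) e E' -> (size E')%:R <= (1 + d) * (size E)%:R]) ->
  exists nu : probability (borel T) R, forall g (A : set (borel T)), measurable A ->
    nu (rho g @^-1` A) = nu A.
Proof.
move=> H; have [crho rho1 rhoM] := hrho.
have [E EP] : {E : nat -> seq T & forall j, exists n, [/\ separated n j.+1%:R^-1 (E j), E j != [::] &
    forall E', separated (n + j) j.+1%:R^-1 E' -> (size E')%:R <= (1 + j.+1%:R^-1) * (size (E j))%:R :> R]}.
  apply: (@choice _ _ (fun j E => exists n, [/\ separated n j.+1%:R^-1 E, E != [::] &
    forall E', separated (n + j) j.+1%:R^-1 E' -> (size E')%:R <= (1 + j.+1%:R^-1) * (size E)%:R :> R])) => j.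
  have j0 : 0 < j.+1%:R^-1 :> R by rewrite invr_gt0.
  by have [n [E0 HE]] := H _ _ j j0 j0; exists E0, n.
have Epos j : 0 < (size (E j))%:R :> R.
  by have [n [_ + _]] := EP j; case: (E j) => //= *; rewrite ltr0n.
pose f (A : set T) j : R := (count (mem A) (E j))%:R / (size (E j))%:R.
have f01 A j : 0 <= f A j <= 1.
  by rewrite /f divr_ge0//= ler_pdivrMr// mul1r ler_nat count_size.
have [L [LD Lle L0 L1]] := ultra_limit R.
pose c A := L (f A).
have f_le A A' : A `<=` A' -> forall j, f A j <= f A' j.
  move=> AA' j; rewrite /f ler_pM2r ?invr_gt0// ler_nat; apply: sub_count => x /= /set_mem Ax.
  exact/mem_set/AA'.
have c_le A A' : A `<=` A' -> c A <= c A'.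
  move=> AA'; apply: (Lle _ _) => // d d0; near=> j; apply: le_trans (f_le _ _ AA' j) _.
  by rewrite lerDl ltW.
have c_add A A' : A `&` A' = set0 -> c (A `|` A') = c A + c A'.
  move=> AA'; have fE : f (A `|` A') = (fun j => f A j + f A' j).
    apply/funext => j; rewrite /f -mulrDl -natrD; congr (_%:R / _).
    rewrite -count_predUI (@eq_count _ (predI _ _) pred0) ?count_pred0 ?addn0.
      apply: eq_count => x /=; apply/idP/orP => [/set_mem[]|[]/set_mem] Ax; by [left; exact/mem_set|right; exact/mem_set|apply/mem_set; left|apply/mem_set; right].
    move=> x /=; apply/negbTE/negP => /andP[/set_mem Ax /set_mem A'x].
    by have : set0 x by rewrite -AA'.
  by rewrite /c fE LD// => j; rewrite -[f A j + _]/((fun j => f A j + f A' j) j) -fE.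
have cT1 : c setT = 1.
  rewrite /c -L1; congr L; apply/funext => j; rewrite /f (@eq_count _ _ predT) ?count_predT ?divff ?gt_eqF//.
  by move=> x /=; rewrite in_setT.
have [nu [nu1 nu2]] := content_measure (fun A => L0 _ (f01 A)) c_add cT1 cT.
have cg g (A : set T) (d : R) : 0 < d -> c (rho g @` A) <= c (thicken d A).
  move=> d0; apply: (Lle _ _) => // d' d'0.
  have [k kP] := BV g.
  near=> j.
  have [n [sE _ mE]] := EP j.
  have j0 : 0 < j.+1%:R^-1 :> R by rewrite invr_gt0.
  have kj : (k <= j)%N by near: j; exact: nbhs_infty_ge.
  have Bj h : B n h -> B (n + j) (h * g)%g.
    by move=> /kP; apply: B_mono; rewrite leq_add2l.
  have := separated_exchange A Bj j0 sE mE.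
  have jd : j.+1%:R^-1 <= d by apply: ltW; near: j; exact: near_infty_natSinv_lt (PosNum d0).
  have jd' : j.+1%:R^-1 <= d' by apply: ltW; near: j; exact: near_infty_natSinv_lt (PosNum d'0).
  rewrite -(ler_pM2r (x := (size (E j))%:R^-1)) ?invr_gt0// mulrDl -mulrA divff ?gt_eqF// mulr1.
  move=> /le_trans; apply; rewrite lerD//; apply: f_le => x [y Ay yx]; exists y => //.
  exact: le_ball yx.
exists nu => g A mA.
apply: (@nu_invariant _ _ c nu cT c_le nu1 nu2 _ (rho g^-1%g)) => //.
- by move=> x; rewrite -rhoM mulVg.
- by move=> x; rewrite -rhoM mulgV.
- exact: cg.
- exact: cg.
Unshelve. all: by end_near. Qed.

End Separated.

(** * Surface groups and suspensions *)

Section PseudoHyperbolic.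
Variable R : realType.
Local Notation C := R[i].
Implicit Types z w u : C.

Lemma blaschke_aut u : normc u < 1 -> disk_automorphism (blaschke u) (blaschke (- u)).
Proof.
move=> u1; have nu1 : normc (- u) < 1 by rewrite normcN.
split => w w1.
- by eexists; exact: cdiff_blaschke.
- exact: blaschke_lt1.
- exact: cdiff_cont (cdiff_blaschke nu1 w1).
- exact: blaschke_lt1.
- exact: blaschkeK.
- exact: blaschkeNK.
Qed.

Lemma rotation_aut l : normc l = 1 -> disk_automorphism (fun z : C => l * z) (fun z => l^-1 * z).
Proof.
move=> l1; have l0 : l != 0 by rewrite -normc_eq0 l1 oner_eq0.
have d (a : C) w : cdiff (fun z => a * z) w (0 * w + a * 1).
  by apply: (@cdiffM _ (fun=> a) id); [exact: cdiff_cst|exact: cdiff_id].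
split => w w1.
- by eexists; exact: d.
- by rewrite Normc.normcM l1 mul1r.
- exact: cdiff_cont (d _ _).
- by rewrite Normc.normcM Normc.normcV l1 invr1 mul1r.
- by rewrite mulKf.
- by rewrite mulVKf.
Qed.

Lemma comp_aut f f' g g' : disk_automorphism f f' -> disk_automorphism g g' ->
  disk_automorphism (f \o g : C -> C) (g' \o f').
Proof.
move=> hf hg; split => w w1 /=.
- have [A hA] := aut_holo hg w1; have [B hB] := aut_holo hf (aut_lt1 hg w1).
  by exists (B * A); exact: cdiff_comp.
- by apply: (aut_lt1 hf); exact: (aut_lt1 hg).
- apply: (@cvg_comp _ _ _ f' g' _ (nbhs (f' w))); first exact: (aut_inv_cont hf).
  by apply: (aut_inv_cont hg); exact: (aut_inv_lt1 hf).
- by apply: (aut_inv_lt1 hg); exact: (aut_inv_lt1 hf).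
- by rewrite (autK hf) ?(autK hg)//; exact: (aut_lt1 hg).
- by rewrite (autKV hg) ?(autKV hf)//; exact: (aut_inv_lt1 hf).
Qed.

Lemma pdist_ge0 z w : 0 <= pdist z w.
Proof. exact: normc_ge0. Qed.

Lemma pdistz0 z : pdist z 0 = normc z.
Proof. by rewrite /pdist blaschke_0. Qed.

Lemma pdist0z z : pdist 0 z = normc z.
Proof. by rewrite pdistC pdistz0. Qed.

Lemma sub_sqr_gt0 z : normc z < 1 -> 0 < 1 - normc z ^+ 2.
Proof. by move=> z1; rewrite subr_gt0 sqr_normc_lt1. Qed.

(** The case of the triangle inequality through 0. From [blaschke_ident] and
    [|1 - conj(w) z| <= 1 + a b] one gets the sharper bound [(a + b) / (1 + a b)]. *)
Lemma pdist_le_normD z w : normc z < 1 -> normc w < 1 -> pdist z w <= normc z + normc w.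
Proof.
move=> z1 w1; have := blaschke_ident w1 z1; rewrite -/(pdist z w).
set a := normc z in z1 *; set b := normc w in w1 *; set d := pdist z w; set D := normc _ => E.
have a0 : 0 <= a by exact: normc_ge0.
have b0 : 0 <= b by exact: normc_ge0.
have d0 : 0 <= d by exact: normc_ge0.
have D1 : D <= 1 + a * b.
  have := le_normcD 1 (- (conjc w * z)).
  by rewrite normcN Normc.normc1 Normc.normcM normc_conj -/a -/b (mulrC b).
have D0 : 0 < D by rewrite normc_gt0 blaschke_den.
have ab : 0 < 1 + a * b by rewrite ltr_wpDr// mulr_ge0.
rewrite -(@ler_pXn2r _ 2)// ?nnegrE ?addr_ge0//.
have S0 : 0 <= (a + b) / (1 + a * b) by apply: divr_ge0; [exact: addr_ge0|exact: ltW].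
have Sab : (a + b) / (1 + a * b) <= a + b.
  by rewrite ler_pdivrMr// mulrDr mulr1 lerDl mulr_ge0 ?addr_ge0 ?mulr_ge0.
apply: (@le_trans _ _ (((a + b) / (1 + a * b)) ^+ 2)); last first.
  by rewrite ler_pXn2r ?nnegrE ?addr_ge0.
have -> : ((a + b) / (1 + a * b)) ^+ 2 = 1 - (1 - b ^+ 2) * (1 - a ^+ 2) / (1 + a * b) ^+ 2.
  by field; rewrite gt_eqF.
have -> : d ^+ 2 = 1 - (1 - b ^+ 2) * (1 - a ^+ 2) / D ^+ 2 by rewrite -E; ring.
rewrite lerB// ler_pM2l; last by rewrite mulr_gt0 // subr_gt0 expr_lt1.
by rewrite lef_pV2 ?posrE ?exprn_gt0// ler_pXn2r// nnegrE ltW.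
Qed.

Lemma pdist_triangle u z w : normc u < 1 -> normc z < 1 -> normc w < 1 ->
  pdist z w <= pdist z u + pdist u w.
Proof.
move=> u1 z1 w1; have hb := blaschke_aut u1.
rewrite -(aut_pdist hb z1 w1) (pdistC u w).
by apply: pdist_le_normD; exact: blaschke_lt1.
Qed.

Lemma pdist_le_dist (r : R) z w : r < 1 -> normc z <= r -> normc w < 1 ->
  pdist z w <= normc (z - w) / (1 - r).
Proof.
move=> r1 zr w1; have z1 : normc z < 1 by exact: le_lt_trans r1.
rewrite /pdist /blaschke Normc.normcM Normc.normcV ler_wpM2l ?normc_ge0//.
rewrite lef_pV2 ?posrE ?subr_gt0// ?normc_gt0 ?blaschke_den//.
have := normc_rev 1 (conjc w * z); rewrite Normc.normc1 Normc.normcM normc_conj.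
apply: le_trans; rewrite lerB//; apply: le_trans zr; rewrite ler_piMl ?normc_ge0// ltW//.
Qed.

Lemma dist_le_pdist z w : normc z < 1 -> normc w < 1 -> normc (z - w) <= 2 * pdist z w.
Proof.
move=> z1 w1; have d0 : 0 < normc (1 - conjc w * z) by rewrite normc_gt0 blaschke_den.
have d2 : normc (1 - conjc w * z) <= 2.
  have := le_normcD 1 (- (conjc w * z)); rewrite normcN Normc.normc1 Normc.normcM normc_conj.
  move=> /le_trans; apply; rewrite [leRHS](_ : 2 = 1 + 1)//.
  by rewrite lerD2l mulr_ile1 ?normc_ge0// ltW.
have -> : normc (z - w) = normc (1 - conjc w * z) * pdist z w.
  by rewrite /pdist /blaschke Normc.normcM Normc.normcV mulrC divfK// gt_eqF.
by rewrite ler_wpM2r ?pdist_ge0.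
Qed.

(** The defect [1 - |z|^2] is comparable to [exp (- d_P(0, z))], and this is the triangle inequality
    for [d_P] in multiplicative form: the point [blaschke (- w) z] is as far from [w] as [z] is from
    0. The factor 4 absorbs the comparison constants. *)
Lemma aut_defect f g z w : disk_automorphism f g -> normc z < 1 -> normc w < 1 ->
  (1 - normc z ^+ 2) * (1 - normc (f w) ^+ 2) / 4 <= 1 - normc (f (blaschke (- w) z)) ^+ 2.
Proof.
move=> hf z1 w1; set v := blaschke (- w) z.
have v1 : normc v < 1 by apply: blaschke_lt1; rewrite ?normcN.
have fv1 := aut_lt1 hf v1; have fw1 := aut_lt1 hf w1.
have := blaschke_ident fw1 fv1; rewrite -/(pdist (f v) (f w)) (aut_pdist hf v1 w1).
rewrite /pdist /v blaschkeNK// -/v.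
set a := normc (f w); set b := normc (f v); set D := normc (1 - _) => E.
have D0 : 0 < D by rewrite normc_gt0 blaschke_den.
have a0 : 0 <= a by exact: normc_ge0.
have Da : 1 - a <= D.
  have := normc_rev 1 (conjc (f w) * f v); rewrite Normc.normc1 Normc.normcM normc_conj.
  apply: le_trans; rewrite lerB// ler_piMr// ltW//.
have a1 : 0 < 1 - a ^+ 2 by exact: sub_sqr_gt0.
have Eb : (1 - normc z ^+ 2) * D ^+ 2 = (1 - a ^+ 2) * (1 - b ^+ 2).
  by rewrite E divfK// expf_neq0// gt_eqF.
have zp := sub_sqr_gt0 z1.
have D2 : (1 - a) ^+ 2 <= D ^+ 2.
  by rewrite ler_pXn2r// nnegrE ?(ltW D0)// subr_ge0 ltW.
rewrite -(ler_pM2l a1) -Eb.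
apply: le_trans (ler_wpM2l (ltW zp) D2).
rewrite (_ : _ * (_ / 4) = (1 - normc z ^+ 2) * ((1 - a ^+ 2) ^+ 2 / 4)); last by field.
rewrite ler_pM2l//.
rewrite (_ : 1 - a ^+ 2 = (1 - a) * (1 + a)); last by ring.
rewrite exprMn -mulrA ler_piMr ?sqr_ge0// ler_pdivrMr// mul1r.
have : a < 1 by []. nra.
Qed.

End PseudoHyperbolic.

(** * The group of deck transformations *)

Section Deck.
Variables (R : realType) (Gamma : groupType) (act : Gamma -> R[i] -> R[i])
  (Sigma : topologicalType) (q : R[i] -> Sigma) (g : nat).
Hypothesis SG : surface_group act q g.
Local Notation C := R[i].
Implicit Types z w u : C.

Lemma act_lt1 c z : normc z < 1 -> normc (act c z) < 1.
Proof. by move=> z1; apply/unit_diskE; apply: (act_disk SG); exact/unit_diskE. Qed.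

Lemma act1E z : normc z < 1 -> act 1%g z = z.
Proof. by move=> z1; apply: (act1 SG); exact/unit_diskE. Qed.

Lemma actME a b z : normc z < 1 -> act (a * b)%g z = act a (act b z).
Proof. by move=> z1; apply: (actM SG); exact/unit_diskE. Qed.

Lemma actK c z : normc z < 1 -> act c^-1%g (act c z) = z.
Proof. by move=> z1; rewrite -actME// mulVg act1E. Qed.

Lemma actKV c z : normc z < 1 -> act c (act c^-1%g z) = z.
Proof. by move=> z1; rewrite -actME// mulgV act1E. Qed.

Lemma act_aut c : disk_automorphism (act c) (act c^-1%g).
Proof.
have d c' w : normc w < 1 -> exists A, cdiff (act c') w A.
  by move=> w1; apply/derivable_cdiff; apply: (act_holo SG); exact/unit_diskE.
split => w w1; [exact: d|exact: act_lt1| |exact: act_lt1|exact: actK|exact: actKV].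
by have [A] := d c^-1%g w w1; exact: cdiff_cont.
Qed.

Lemma act_cont c z : normc z < 1 -> act c @ z --> act c z.
Proof. by move=> z1; have [A] := aut_holo (act_aut c) z1; exact: cdiff_cont. Qed.

Lemma act_pdist c z w : normc z < 1 -> normc w < 1 -> pdist (act c z) (act c w) = pdist z w.
Proof. exact: aut_pdist (act_aut c) _ _. Qed.

(** The images in [Sigma] of the disks of radius [1 - 1 / (n + 1)] are open and increase to the
    compact surface, so one of them is everything. *)
Lemma cocompact : exists r : R, 0 <= r < 1 /\
  forall z, normc z < 1 -> exists c, normc (act c z) <= r.
Proof.
have [qT qE qO] := surface_quotient SG.
pose r n : R := 1 - n.+1%:R^-1.
have r1 n : r n < 1 by rewrite /r ltrBlDr ltrDl invr_gt0.
pose V n := [set s | exists2 z, normc z < r n & q z = s].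
have oV n : open (V n).
  apply/qO; apply/openCP => z [/unit_diskE z1 [w wr qw]].
  have w1 : normc w < 1 by exact: lt_trans wr (r1 n).
  have [c zc] : exists c, z = act c w by apply/qE => //; exact/unit_diskE.
  have cz : act c^-1%g z = w by rewrite zc actK.
  have := @act_cont c^-1%g z z1; rewrite cz => /cvgC_at /(_ (r n - normc w)).
  rewrite subr_gt0 => /(_ wr)[k k0 kP].
  have [m [m0 mk m1]] := @exists_le2 _ k (1 - normc z) k0 (ltac:(by rewrite subr_gt0)).
  exists m => // u um; have u1 : normc u < 1 by have := normc_rev u z; lra.
  split; first exact/unit_diskE.
  exists (act c^-1%g u).
    by have := kP u (lt_le_trans um mk); have := normc_rev (act c^-1%g u) w; lra.
  by apply/qE; [apply/unit_diskE; exact: act_lt1|exact/unit_diskE|exists c; rewrite actKV].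
have : \forall n \near \oo, [set: Sigma] `<=` V n.
  apply: (proj1 (compact_near_coveringP _) (surface_compact SG)) => s _.
  have : (q @` @unit_disk R) s by rewrite qT.
  move=> [z /unit_diskE z1 qz].
  have [N _ NP] : \forall n \near \oo, n.+1%:R^-1 < 1 - normc z.
    have z0 : 0 < 1 - normc z by rewrite subr_gt0.
    exact: near_infty_natSinv_lt (PosNum z0).
  exists (V N, [set n | (N <= n)%N]) => /=.
    split; last by exists N.
    apply: open_nbhs_nbhs; split => //; exists z => //.
    by have := NP N (leqnn N); rewrite /= /r ltrBrDr -ltrBrDl.
  move=> [s' n] /= [[w wr qw] Nn]; exists w => //; apply: lt_le_trans wr _.
  by rewrite /r lerB// lef_pV2 ?posrE// ler_nat ltnS.
move=> /filter_ex[n nP]; exists (r n); split.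
  by rewrite r1 andbT /r subr_ge0 invf_le1// ler1n.
move=> z z1; have [w wr qw] := nP (q z) I.
have w1 : normc w < 1 by exact: lt_trans wr (r1 n).
have [c wc] : exists c, w = act c z by apply/qE => //; exact/unit_diskE.
by exists c; rewrite -wc ltW.
Qed.

(** The evenly covered neighbourhoods of [act_cover] give a local bound, and compactness a common
    one for [|z| <= r]. A general [z] is brought there by some [a], at the price of replacing [c] by
    its conjugate [a * c * a^-1]. *)
Lemma uniformly_discrete : exists2 e : R, 0 < e &
  forall c z, c <> 1%g -> normc z < 1 -> e <= pdist z (act c z).
Proof.
have [r [/andP[r0 r1] rP]] := cocompact.
have : \forall e \near (0 : R)^'+, closed_disk r `<=`
    (fun k => forall c, c <> 1%g -> e <= pdist k (act c k)).
  apply: (proj1 (compact_near_coveringP _) (@compact_closed_disk R r)) => k kr.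
  have k1 : normc k < 1 by exact: le_lt_trans kr r1.
  have [V [oV Vk Vd Vc]] := act_cover SG (proj2 (unit_diskE k) k1).
  have [e e0 eV] := proj1 (openCP V) oV k Vk.
  exists (ball (k : C) (e / 2)%:C, [set d : R | d <= e / 4]) => /=.
    split; first by apply: nbhsx_ballx; rewrite ltcR divr_gt0.
    by apply: nbhs_right_le; rewrite divr_gt0.
  move=> [k' d] /= []; rewrite /ball /= normCE ltcR normcBC => kk' de c c1.
  have k'V : V k' by apply: eV; apply: lt_trans kk' _; rewrite ltr_pdivrMr// ltr_pMr// ltr1n.
  have k'1 : normc k' < 1 by apply/unit_diskE; exact: Vd.
  have nV : ~ V (act c k').
    by move=> Vck; have : set0 (act c k') by rewrite -(Vc c c1); split => //; exists k'.
  have far : e / 2 <= normc (k' - act c k').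
    rewrite leNgt; apply/negP => h; apply: nV; apply: eV.
    by have := normc_triangle (act c k') k' k; rewrite (normcBC (act c k') k'); lra.
  have := dist_le_pdist k'1 (act_lt1 c k'1); lra.
move=> /= H; have [e [e0 eP]] : exists e : R, 0 < e /\ closed_disk r `<=`
    (fun k => forall c, c <> 1%g -> e <= pdist k (act c k)).
  near (0 : R)^'+ => e; exists e; split; first by [].
  by near: e.
exists e => // c z c1 z1; have [a ar] := rP z z1.
have az1 := act_lt1 a z1.
rewrite -(act_pdist a z1 (act_lt1 c z1)) -actME//.
have -> : act (a * c)%g z = act (a * c * a^-1)%g (act a z).
  by rewrite -actME// mulgVK.
apply: eP => // E; apply: c1.
move/(congr1 (fun x => x * a)%g) : E; rewrite /= mulgVK mul1g.
by move/(congr1 (fun x => a^-1 * x)%g); rewrite /= mulKg mulVg.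
Unshelve. all: by end_near. Qed.

(* The deck transformations moving the origin by at most about [n]. *)
Definition deck_ball (n : nat) : set Gamma := [set c | expR (- n%:R) <= 1 - normc (act c 0) ^+ 2].

Let n0 : normc (0 : C) < 1. Proof. by rewrite Normc.normc0. Qed.

Lemma deck_ball1 n : deck_ball n 1%g.
Proof. by rewrite /deck_ball /= act1E// Normc.normc0 expr0n subr0 expR_le1 oppr_le0. Qed.

Lemma deck_ball_mono m n : (m <= n)%N -> deck_ball m `<=` deck_ball n.
Proof. by move=> mn c; apply: le_trans; rewrite ler_expR lerN2 ler_nat. Qed.

Lemma deck_defect c z : normc z < 1 ->
  (1 - normc z ^+ 2) * (1 - normc (act c 0) ^+ 2) / 4 <= 1 - normc (act c z) ^+ 2.
Proof. by move=> z1; have := aut_defect (act_aut c) z1 n0; rewrite oppr0 blaschke_0. Qed.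

Lemma deck_ballM a : exists k, forall n c, deck_ball n c -> deck_ball (n + k) (c * a)%g.
Proof.
have a1 := act_lt1 a n0; have d0 := sub_sqr_gt0 a1.
pose d := (1 - normc (act a 0) ^+ 2) / 4.
have dd : 0 < d by rewrite divr_gt0.
have [k _ /(_ k (leqnn k)) kd] : \forall k \near \oo, - ln d <= k%:R :> R by exact: nbhs_infty_ger.
exists k => n c; rewrite /deck_ball /= => h.
rewrite actME//; apply: le_trans (deck_defect c a1).
rewrite natrD opprD expRD mulrAC -/d mulrC ler_pM ?expR_ge0//.
by rewrite -[leRHS]lnK ?posrE// ler_expR lerNl.
Qed.

(** By [uniformly_discrete] the point [act c 0] has Euclidean distance at least [e * m c] to the
    rest of its orbit. Rational coordinates approximating it within a fixed fraction of that gap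
    determine [c]. *)
Lemma countable_deck : countable [set: Gamma].
Proof.
have [e e0 eP] := uniformly_discrete.
pose m c : R := 1 - normc (act c 0).
have m0 c : 0 < m c by rewrite subr_gt0; exact: act_lt1.
pose d c := e * m c / 8.
have d0 c : 0 < d c by rewrite !(divr_gt0, mulr_gt0).
have dense (x t : R) : 0 < t -> {s : rat | `|ratr s - x| < t}.
  move=> t0; apply: cid; have xt : x - t < x + t by lra.
  have [s] := rat_in_itvoo xt; rewrite in_itv /= => /andP[h1 h2].
  by exists s; rewrite ltr_norml; apply/andP; split; lra.
pose f c := (projT1 (dense (Re (act c 0)) _ (d0 c)), projT1 (dense (Im (act c 0)) _ (d0 c))).
have far c c' : c <> c' -> e * m c <= normc (act c 0 - act c' 0).
  move=> cc'; have := eP (c^-1 * c')%g 0 _ n0.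
  rewrite -(act_pdist c n0 (act_lt1 _ n0)) -actME// mulVKg => /(_ _)h.
  rewrite -ler_pdivlMr//; apply: le_trans (pdist_le_dist _ (lexx _) (act_lt1 c' n0)).
    by apply: h => E; apply: cc'; rewrite -(mulg1 c) -E mulVKg.
  by rewrite -subr_gt0; exact: m0.
apply/countable_injP; exists (fun c => pickle (f c)) => c c' _ _ /(pcan_inj pickleK) [E1 E2].
apply: contrapT => cc'; have h1 := far c c' cc'; have h2 := far c' c (fun E => cc' (esym E)).
move: E1 E2; case: (dense (Re (act c 0)) _ _) => s /= s1; case: (dense (Im (act c 0)) _ _) => t /= t1.
case: (dense (Re (act c' 0)) _ _) => s' /= s'1; case: (dense (Im (act c' 0)) _ _) => t' /= t'1 E1 E2.
rewrite -{}E1 in s'1; rewrite -{}E2 in t'1.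
have := normc_le_ReIm (act c 0 - act c' 0); rewrite !raddfB /=.
have := ler_normB (ratr s - Re (act c' 0)) (ratr s - Re (act c 0)).
have := ler_normB (ratr t - Im (act c' 0)) (ratr t - Im (act c 0)).
have E (x y z : R) : z - y - (z - x) = x - y by ring.
rewrite !E.
have := mulr_gt0 e0 (m0 c); have := mulr_gt0 e0 (m0 c').
rewrite (normcBC (act c' 0)) in h2; rewrite /d in s1 t1 s'1 t'1.
lra.
Qed.

End Deck.

(** * Locally constant predicates on convex sets *)

Section LocallyConstant.
Variable R : realType.
Local Notation C := R[i].

(** Otherwise the indicator of [A], extended to the line by clamping the argument to [[0, 1]], would
    be continuous with the only values 0 and 1 and take both, against the intermediate value
    theorem. *)
Lemma interval_locally_constant (A : R -> Prop) :
  (forall t, 0 <= t <= 1 -> exists2 d, 0 < d &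
     forall s, 0 <= s <= 1 -> `|s - t| < d -> (A s <-> A t)) ->
  A 0 -> A 1.
Proof.
move=> loc A0; apply: contrapT => A1.
pose cl (t : R) := Num.max 0 (Num.min 1 t).
have cl01 t : 0 <= cl t <= 1.
  by rewrite /cl le_max lexx /= ge_max ler01 ge_min lexx.
have clL s t : `|cl s - cl t| <= `|s - t|.
  have clE x : [\/ x <= 0 /\ cl x = 0, 0 <= x <= 1 /\ cl x = x | 1 <= x /\ cl x = 1].
    rewrite /cl; case: (leP 1 x) => h1; first by apply: Or33; split => //; apply/max_idPr.
    case: (leP 0 x) => h0; last by apply: Or31; rewrite ltW.
    by apply: Or32; split => //; exact: ltW.
  rewrite ler_norml; have := ler_norm (s - t); have := ler_norm (t - s); rewrite (distrC t s) => h1 h2.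
  have [[? ->]|[/andP[? ?] ->]|[? ->]] := clE s; have [[? ->]|[/andP[? ?] ->]|[? ->]] := clE t;
  by apply/andP; split; lra.
pose f (t : R) : R := if `[< A (cl t) >] then 0 else 1.
have cf : continuous f.
  move=> t; apply/cvgrPdist_lt => e e0.
  have [d d0 dP] := loc _ (cl01 t).
  near=> s; rewrite /f.
  suff -> : `[< A (cl s) >] = `[< A (cl t) >] by rewrite subrr normr0.
  apply/asbool_equiv_eq; apply: dP => //; apply: le_lt_trans (clL _ _) _.
  by rewrite distrC; near: s; exact: cvgr_dist_lt.
have c0 : cl 0 = 0 by rewrite /cl; case: (leP 1 0) => h; rewrite ?maxxx //; lra.
have c1 : cl 1 = 1 by rewrite /cl minxx; apply/max_idPr.
have f0 : f 0 = 0 by rewrite /f c0; case: asboolP.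
have f1 : f 1 = 1 by rewrite /f c1; case: asboolP.
have [] := @IVT _ f 0 1 2^-1 ler01 (continuous_subspaceT cf).
  by rewrite f0 f1 ge_min le_max !invr_ge0 ler0n /= invf_le1// ler1n orbT.
by move=> c _; rewrite /f; case: asboolP => _ E; lra.
Unshelve. all: by end_near. Qed.

Definition convexC (S : set C) := forall a b (t : R),
  S a -> S b -> 0 <= t <= 1 -> S (a + t%:C * (b - a)).

Lemma convex_ball (c : C) (r : R) : convexC [set z | normc (z - c) < r].
Proof.
move=> a b t /= ha hb /andP[t0 t1].
have -> : a + t%:C * (b - a) - c = (1 - t)%:C * (a - c) + t%:C * (b - c).
  by rewrite raddfB /= rmorph1; ring.
apply: le_lt_trans (le_normcD _ _) _; rewrite !Normc.normcM !normc_real.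
rewrite !ger0_norm ?subr_ge0//.
have [->|t0'] := eqVneq t 0; first by rewrite mul0r addr0 subr0 mul1r.
have tp : 0 < t by rewrite lt_def t0'.
have -> : r = (1 - t) * r + t * r by ring.
by apply: ler_ltD; [rewrite ler_wpM2l ?subr_ge0// ltW|rewrite ltr_pM2l].
Qed.

Lemma convexI (S1 S2 : set C) : convexC S1 -> convexC S2 -> convexC (S1 `&` S2).
Proof. by move=> h1 h2 a b t [? ?] [? ?] ?; split; [exact: h1|exact: h2]. Qed.

Lemma convex_locally_constant (S : set C) (A : C -> Prop) : convexC S ->
  (forall z, S z -> exists2 d, 0 < d &
     forall w, S w -> normc (w - z) < d -> (A w <-> A z)) ->
  forall a b, S a -> S b -> A a -> A b.
Proof.
move=> cS loc a b Sa Sb Aa.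
have := @interval_locally_constant (fun t => A (a + t%:C * (b - a))).
rewrite rmorph0 rmorph1 mul0r addr0 mul1r subrKC; apply => // t t01.
have [d d0 dP] := loc _ (cS a b t Sa Sb t01).
have m0 : 0 < normc (b - a) + 1 by rewrite ltr_wpDl// normc_ge0.
exists (d / (normc (b - a) + 1)); first exact: divr_gt0.
move=> s s01; rewrite ltr_pdivlMr// => st; apply: dP; first exact: cS.
have -> : a + s%:C * (b - a) - (a + t%:C * (b - a)) = (s - t)%:C * (b - a).
  by rewrite raddfB /=; ring.
rewrite Normc.normcM normc_real; apply: le_lt_trans st.
by rewrite ler_wpM2l// lerDl.
Qed.

End LocallyConstant.

(** * Lifting maps defined on the disk *)

Section Lifting.
Variables (R : realType) (Y : Type) (E psi : R[i] -> Y).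
Local Notation C := R[i].

(** A lift of [psi] through [E]. What replaces a covering space structure is that [E] is locally
    injective ([E_inj]) and that lifts exist, from any starting point, over disks whose size is
    locally uniform ([local_lift]). *)
Definition lift_on (S : set C) (f : C -> C) := forall z, S z ->
  [/\ normc (f z) < 1, f @ z --> f z & E (f z) = psi z].

Hypothesis E_inj : forall u, normc u < 1 -> exists2 d : R, 0 < d &
  forall v w, normc (v - u) < d -> normc (w - u) < d -> normc v < 1 -> normc w < 1 -> E v = E w -> v = w.

Lemma lift_unique S f g : convexC S -> lift_on S f -> lift_on S g ->
  forall a b, S a -> S b -> f a = g a -> f b = g b.
Proof.
move=> cS lf lg a b Sa Sb; apply: (@convex_locally_constant _ S (fun z => f z = g z)) => // z Sz.
have [f1 /cvgC_at fc fE] := lf _ Sz; have [g1 /cvgC_at gc gE] := lg _ Sz.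
have [fg|/eqP fg] := eqVneq (f z) (g z).
  have [d d0 dP] := E_inj f1.
  have [d1 d10 d1P] := fc _ d0; have [d2 d20 d2P] := gc _ d0.
  have [m [m0 m1 m2]] := exists_le2 d10 d20.
  exists m => // w Sw wz; split => // _; have [? ? e1] := lf _ Sw; have [? ? e2] := lg _ Sw.
  apply: dP; rewrite // ?e1 ?e2//; [by apply: d1P; exact: lt_le_trans wz _|].
  by rewrite fg; apply: d2P; exact: lt_le_trans wz _.
have e0 : 0 < normc (f z - g z) / 2 by rewrite divr_gt0// normc_gt0 subr_eq0; exact/eqP.
have [d1 d10 d1P] := fc _ e0; have [d2 d20 d2P] := gc _ e0.
have [m [m0 m1 m2]] := exists_le2 d10 d20.
exists m => // w Sw wz; split => // h; exfalso.
have := d1P _ (lt_le_trans wz m1); have := d2P _ (lt_le_trans wz m2).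
rewrite h; rewrite (normcBC (g w) (f z)); have := normc_triangle (f z) (g w) (g z); lra.
Qed.

Hypothesis local_lift : forall w, normc w < 1 -> exists2 e : R, 0 < e &
  forall w' u, normc (w' - w) < e -> normc u < 1 -> E u = psi w' ->
  exists2 f, f w' = u & lift_on [set z | normc (z - w') < e] f.

Variable u0 : C.
Hypotheses (u01 : normc u0 < 1) (Eu0 : E u0 = psi 0).

Let uniform_lift (r : R) : r < 1 -> exists2 e : R, 0 < e &
  forall w u, normc w <= r -> normc u < 1 -> E u = psi w ->
  exists2 f, f w = u & lift_on [set z | normc (z - w) < e] f.
Proof.
move=> r1.
have H : \forall e \near (0 : R)^'+, closed_disk r `<=` (fun w => forall u, normc u < 1 -> E u = psi w ->
    exists2 f, f w = u & lift_on [set z | normc (z - w) < e] f).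
  apply: (proj1 (compact_near_coveringP _) (@compact_closed_disk R r)) => k kr.
  have [e e0 eP] := local_lift (le_lt_trans kr r1).
  exists (ball (k : C) e%:C, [set d : R | d <= e]) => /=.
    by split; [apply: nbhsx_ballx; rewrite ltcR|exact: nbhs_right_le].
  move=> [k' d] /= []; rewrite /ball /= normCE ltcR normcBC => kk' de u u1 Eu.
  have [f fk fl] := eP k' u kk' u1 Eu; exists f => // z zk; apply: fl; exact: lt_le_trans zk de.
have [e [e0 eP]] : exists e : R, 0 < e /\ closed_disk r `<=` (fun w => forall u, normc u < 1 -> E u = psi w ->
    exists2 f, f w = u & lift_on [set z | normc (z - w) < e] f).
  near (0 : R)^'+ => e; exists e; split; first by [].
  by near: e.
by exists e => // w u wr; exact: eP.
Unshelve. all: by end_near. Qed.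

(** The radius of the lift grows by [e / 2] at each step, where [e] is the uniform size of local
    lifts over the closed disk of radius [r]. Local lifts are glued by uniqueness on intersections
    of disks, which are convex. *)
Lemma lift_disk (r : R) : 0 < r -> r < 1 ->
  exists2 f, f 0 = u0 & lift_on [set z | normc (z - 0) < r] f.
Proof.
move=> r0 r1; have [e e0 eP] := uniform_lift r1.
suff H n : exists2 f, f 0 = u0 & lift_on [set z | normc (z - 0) < Num.min r (n.+1%:R * (e / 2))] f.
  have [N _ /(_ N (leqnn N)) NP] : \forall k \near \oo, r / (e / 2) <= k%:R by exact: nbhs_infty_ger.
  have [f f0 fl] := H N; exists f => // z zr; apply: fl => /=.
  rewrite lt_min zr /=; apply: lt_le_trans zr _.
  rewrite -ler_pdivrMr ?divr_gt0//; apply: le_trans NP _; rewrite ler_nat//.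
elim: n => [|n [f f0 fl]].
  have [f f0 fl] : exists2 f, f 0 = u0 & lift_on [set z | normc (z - 0) < e] f.
    by apply: eP => //; rewrite Normc.normc0 ltW.
  exists f => // z; rewrite /= mul1r lt_min => /andP[_ ze]; apply: fl.
  by apply: lt_le_trans ze _; rewrite ler_pdivrMr// ler_pMr// ler1n.
(* The factor [s] maps the disk of radius [(n + 2) e / 2] onto the one of radius [(n + 1) e / 2] and
   moves its points by less than [e / 2]; the lift is continued from [s w] to [w]. *)
pose s : R := n.+1%:R / n.+2%:R.
have s0 : 0 < s by rewrite divr_gt0.
have s1 : s < 1 by rewrite ltr_pdivrMr// mul1r ltr_nat.
have s2 : 1 - s = n.+2%:R^-1.
  have p : n.+2%:R != 0 :> R by rewrite pnatr_eq0.
  by apply: (mulIf p); rewrite mulrBl mul1r divfK// mulVf// -natrB// subSnn.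
pose rn := Num.min r (n.+2%:R * (e / 2)).
pose S := [set z : C | normc (z - 0) < Num.min r (n.+1%:R * (e / 2))].
have Ss w : normc w < rn -> S (s%:C * w) /\ normc (w - s%:C * w) < e / 2.
  rewrite lt_min => /andP[wr we]; rewrite /S /= subr0 Normc.normcM normc_real (gtr0_norm s0).
  have w0 := normc_ge0 w; split.
    rewrite lt_min; apply/andP; split.
      by apply: le_lt_trans wr; rewrite ler_piMl// ltW.
    by rewrite /s mulrAC ltr_pdivrMr// -mulrA ltr_pM2l// mulrC.
  have -> : w - s%:C * w = (1 - s)%:C * w by rewrite raddfB /= rmorph1; ring.
  by rewrite Normc.normcM normc_real s2 gtr0_norm ?invr_gt0// mulrC ltr_pdivrMr// mulrC.
have ex w : normc w < rn -> exists f', f' (s%:C * w) = f (s%:C * w) /\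
    lift_on [set z | normc (z - s%:C * w) < e] f'.
  move=> wr; have [Sw _] := Ss w wr; have [h1 _ h2] := fl _ Sw.
  have sr : normc (s%:C * w) <= r by move: Sw; rewrite /S /= subr0 lt_min => /andP[/ltW].
  by have [f' ? ?] := eP _ _ sr h1 h2; exists f'.
have {ex}[G GP] : exists G : C -> C -> C, forall w, normc w < rn -> G w (s%:C * w) = f (s%:C * w) /\
    lift_on [set z | normc (z - s%:C * w) < e] (G w).
  exists (fun w => get (fun f' => f' (s%:C * w) = f (s%:C * w) /\
    lift_on [set z | normc (z - s%:C * w) < e] f')) => w wr.
  by apply: (@getPex _ (fun f' => f' (s%:C * w) = f (s%:C * w) /\
    lift_on [set z | normc (z - s%:C * w) < e] f')); exact: ex.
have cS : convexC S by exact: convex_ball.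
have Gf w z : normc w < rn -> S z -> normc (z - s%:C * w) < e -> G w z = f z.
  move=> wr Sz ze; have [Gw Gl] := GP w wr; have [Sw _] := Ss w wr.
  apply: (@lift_unique (S `&` [set z | normc (z - s%:C * w) < e]) _ _ _ _ _ (s%:C * w)) => //.
  - by apply: convexI => //; exact: convex_ball.
  - by move=> ? [_ ?]; exact: Gl.
  - by move=> ? [? _]; exact: fl.
  - by split => //=; rewrite subrr Normc.normc0.
have GG w w1 : normc w < rn -> normc w1 < rn -> normc (w1 - w) < e / 2 -> G w1 w1 = G w w1.
  move=> wr w1r ww; have [G1 Gl1] := GP w1 w1r; have [Gw Gl] := GP w wr.
  have [Sw1 d1] := Ss w1 w1r; have [Sw d2] := Ss w wr.
  have sd : normc (s%:C * w1 - s%:C * w) < e.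
    rewrite -mulrBr Normc.normcM normc_real (gtr0_norm s0).
    apply: (@le_lt_trans _ _ (normc (w1 - w))); first by rewrite ler_piMl ?normc_ge0// ltW.
    by apply: lt_trans ww _; rewrite ltr_pdivrMr// ltr_pMr// ltr1n.
  apply: (@lift_unique ([set z | normc (z - s%:C * w1) < e] `&` [set z | normc (z - s%:C * w) < e])
     _ _ _ _ _ (s%:C * w1)) => //.
  - by apply: convexI => //; exact: convex_ball.
  - by move=> ? [? _]; exact: Gl1.
  - by move=> ? [_ ?]; exact: Gl.
  - by split => //=; rewrite subrr Normc.normc0.
  - split => /=; first by lra.
    by have := normc_triangle w1 w (s%:C * w); lra.
  - by rewrite G1 (Gf w).
have m0 : normc (0 : C) < rn by rewrite Normc.normc0 lt_min r0 mulr_gt0 ?divr_gt0.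
exists (fun w => G w w); first by have [] := GP 0 m0; rewrite mulr0 f0.
move=> w; rewrite /= subr0 -/rn => wr; have [Gw Gl] := GP w wr; have [Sw d] := Ss w wr.
have [|h1 h2 h3] := Gl w; first by rewrite /=; lra.
split => //; apply/cvgC_at => d' d'0; have [k k0 kP] := proj1 (cvgC_at _ _ _) h2 _ d'0.
have w0 : 0 < rn - normc w by rewrite subr_gt0.
have [m [mp mk m1]] := exists_le2 k0 w0; have [m' [m'p m'k m'1]] := exists_le2 mp (divr_gt0 e0 (ltr0n R 2)).
exists m' => // w1 ww; rewrite (GG w w1) //; first by apply: kP; lra.
- by have := normc_rev w1 w; lra.
- by lra.
Qed.

Lemma lift_exists : exists2 f, f 0 = u0 & lift_on [set z | normc z < 1] f.
Proof.
pose Q r f := f 0 = u0 /\ lift_on [set z | normc (z - 0) < r] f.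
have ex r : 0 < r -> r < 1 -> exists f, Q r f.
  by move=> r0 r1; have [f f0 fl] := lift_disk r0 r1; exists f.
pose F r := get (Q r).
have FP r : 0 < r -> r < 1 -> Q r (F r) by move=> r0 r1; apply: getPex; exact: ex.
(* Each [z] is lifted with the disk half way between [|z|] and 1; uniqueness makes these lifts
   agree. *)
pose m (z : C) : R := (1 + normc z) / 2.
have mP z : normc z < 1 -> [/\ 0 < m z, m z < 1 & normc z < m z].
  by rewrite /m => z1; have := normc_ge0 z; split; lra.
exists (fun z => F (m z) z).
  by have [|h1 h2 _] := mP 0; [rewrite Normc.normc0|case: (FP _ h1 h2)].
have agree z w : normc z < 1 -> normc w < m z -> F (m w) w = F (m z) w.
  move=> z1 wz; have [z0 mz1 _] := mP z z1; have w1 := lt_trans wz mz1; have [w0 mw1 ww] := mP w w1.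
  have [a1 l1] := FP _ z0 mz1; have [a2 l2] := FP _ w0 mw1.
  apply: (@lift_unique ([set z | normc (z - 0) < m w] `&` [set u | normc (u - 0) < m z]) _ _ _ _ _ 0).
  - by apply: convexI; exact: convex_ball.
  - by move=> ? [? _]; exact: l2.
  - by move=> ? [_ ?]; exact: l1.
  - have n0 (a : R) : 0 < a -> normc (0 - 0 : C) < a by rewrite subr0 Normc.normc0.
    by split; exact: n0.
  - by split; rewrite /= subr0.
  - by rewrite a1 a2.
move=> z /= z1; have [z0 mz1 zz] := mP z z1; have [a1 l1] := FP _ z0 mz1.
have [|h1 h2 h3] := l1 z; first by rewrite /= subr0.
split => //; apply/cvgC_at => e e0; have [k k0 kP] := proj1 (cvgC_at _ _ _) h2 _ e0.
have w0 : 0 < m z - normc z by rewrite subr_gt0.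
have [d [d0 dk dm]] := exists_le2 k0 w0.
exists d => // w wz; rewrite (agree z w z1); first by apply: kP; lra.
by have := normc_rev w z; lra.
Qed.

End Lifting.

Section MetricNbhs.
Variables (R : realType) (M : metricType R).
Local Notation C := R[i].

Lemma nbhs_mdistP (x : M) (A : set M) :
  nbhs x A <-> exists2 e : R, 0 < e & forall y, mdist x y < e -> A y.
Proof.
split.
  by move=> /nbhs_ballP[e /= e0 eA]; exists e => // y xy; apply: eA; rewrite ballEmdist.
by move=> [e e0 eA]; apply/nbhs_ballP; exists e => // y; rewrite ballEmdist; exact: eA.
Qed.

Lemma nbhs_disk_timesP (z : C) (t : M) (A : set (C * M)) : nbhs (z, t) A <->
  exists2 e : R, 0 < e & forall w s, normc (w - z) < e -> mdist t s < e -> A (w, s).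
Proof.
split.
  move=> [[U V] /= [/nbhsCP[a a0 aU] /nbhs_mdistP[b b0 bV]] UV].
  have [e [e0 ea eb]] := exists_le2 a0 b0; exists e => // w s wz st.
  by apply: UV; split => /=; [apply: aU; exact: lt_le_trans ea|apply: bV; exact: lt_le_trans eb].
move=> [e e0 eA]; exists ([set w | normc (w - z) < e], [set s | mdist t s < e]) => /=.
  by split; [apply/nbhsCP|apply/nbhs_mdistP]; exists e.
by move=> [w s] [/= wz st]; exact: eA.
Qed.

End MetricNbhs.

(** * Projection to the suspension and coverings of its leaves *)

Section Suspension.
Variables (R : realType) (Gamma : groupType) (act : Gamma -> R[i] -> R[i])
  (Sigma : topologicalType) (q : R[i] -> Sigma) (g : nat)
  (T : metricType R) (rho : Gamma -> T -> T) (X : pmetricType R) (p : R[i] * T -> X).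
Hypotheses (SG : surface_group act q g) (HR : homeo_representation rho)
  (SP : is_suspension p act rho).
Local Notation C := R[i].
Implicit Types (z w : C) (t s : T) (c : Gamma).

Lemma rho1E t : rho 1%g t = t. Proof. by case: HR. Qed.

Lemma rhoME a b t : rho (a * b)%g t = rho a (rho b t). Proof. by case: HR. Qed.

Lemma rhoKV c t : rho c (rho c^-1%g t) = t.
Proof. by rewrite -rhoME mulgV rho1E. Qed.

Lemma rho_cont c t e : 0 < e -> exists2 d : R, 0 < d & forall s, mdist t s < d -> mdist (rho c t) (rho c s) < e.
Proof.
move=> e0; have [h _ _] := HR.
have /(h c t)/nbhs_mdistP[d d0 dP] : nbhs (rho c t) [set y | mdist (rho c t) y < e].
  by apply/nbhs_mdistP; exists e.
by exists d.
Qed.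

Lemma suspE z w t s : normc z < 1 -> normc w < 1 ->
  (p (z, t) = p (w, s) <-> exists c, w = act c z /\ s = rho c t).
Proof.
move=> z1 w1; have [_ /(_ (z, t) (w, s)) h _] := SP.
have {h} := h (proj2 (unit_diskE z) z1) (proj2 (unit_diskE w) w1); move=> ->.
by split => -[c]; [case=> -> ->|case=> -> ->]; exists c.
Qed.

Lemma susp_act c z t : normc z < 1 -> p (act c z, rho c t) = p (z, t).
Proof. by move=> z1; apply/esym/suspE => //; [exact: (act_lt1 SG)|exists c]. Qed.

Lemma susp_onto x : exists z t, normc z < 1 /\ p (z, t) = x.
Proof.
have [h _ _] := SP; have : (p @` (@disk_times R T)) x by rewrite h.
by move=> [[z t] /unit_diskE z1 e]; exists z, t.
Qed.

Lemma disk_timesE z t : @disk_times R T (z, t) <-> normc z < 1.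
Proof. exact: unit_diskE. Qed.

Lemma susp_cont z t (V : set X) : normc z < 1 -> nbhs (p (z, t)) V ->
  exists2 e : R, 0 < e & forall w s, normc (w - z) < e -> mdist t s < e -> normc w < 1 /\ V (p (w, s)).
Proof.
move=> z1; rewrite nbhsE => -[U [oU Ux] UV]; have [_ _ /(_ U)[h _]] := SP.
have := h oU; rewrite openE => /(_ (z, t))[]; first by split => //; exact/unit_diskE.
move=> [A B] /= [/nbhsCP[a a0 aA] /nbhs_mdistP[b b0 bB]] AB.
have [e [e0 ea eb]] := exists_le2 a0 b0; exists e => // w s wz st.
have [] : (@disk_times R T `&` p @^-1` U) (w, s).
  by apply: AB; split => /=; [apply: aA; exact: lt_le_trans ea|apply: bB; exact: lt_le_trans eb].
by move=> /unit_diskE w1 /UV.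
Qed.

Lemma open_susp (W : set (C * T)) : open W -> W `<=` @disk_times R T -> open (p @` W).
Proof.
move=> oW WD; have [_ _ h] := SP; apply/h; rewrite openE => -[z t] [/unit_diskE/= z1 [[w s] Ww e]].
have w1 : normc w < 1 by have /unit_diskE := WD _ Ww.
have [c [wc sc]] := proj1 (suspE t s z1 w1) (esym e).
have : nbhs (w, s) W by move: oW; rewrite openE; exact.
move=> /nbhs_disk_timesP[d d0 dW].
have /cvgC_at/(_ _ d0)[k k0 kP] : act c @ z --> act c z by exact: (act_cont SG).
have [k' k'0 k'P] := rho_cont c t d0.
have z0 : 0 < 1 - normc z by rewrite subr_gt0.
have [m [m0 mk mk']] := exists_le2 k0 k'0; have [m' [m'0 m'm m'z]] := exists_le2 m0 z0.
apply/nbhs_disk_timesP; exists m' => // v u vz tu.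
have v1 : normc v < 1 by have := normc_rev v z; lra.
split; first exact/unit_diskE.
exists (act c v, rho c u); last exact: susp_act.
by apply: dW; rewrite ?wc ?sc; [apply: kP; lra|apply: k'P; lra].
Qed.

Lemma susp_inj_near : exists2 e : R, 0 < e & forall z w t s, normc z < 1 -> normc w < 1 ->
  pdist z w < e -> p (z, t) = p (w, s) -> z = w /\ t = s.
Proof.
have [e e0 eP] := uniformly_discrete SG; exists e => // z w t s z1 w1 zw /suspE[]// c [wc sc].
have [c1|c1] := pselect (c = 1%g).
  by rewrite wc sc c1 rho1E (act1E SG).
by have := eP c z c1 z1; rewrite -wc leNgt zw.
Qed.

Lemma susp_inj_ball z : normc z < 1 -> exists2 d : R, 0 < d & forall v w t s,
  normc (v - z) < d -> normc (w - z) < d -> normc v < 1 -> normc w < 1 -> p (v, t) = p (w, s) -> v = w /\ t = s.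
Proof.
move=> z1; have [e e0 eP] := susp_inj_near; have z0 : 0 < 1 - normc z by rewrite subr_gt0.
exists (e / 2 * (1 - normc z)); first by rewrite mulr_gt0 ?divr_gt0.
move=> v w t s; rewrite -!ltr_pdivrMr// => vz wz v1 w1; apply: eP => //.
have h u : normc u < 1 -> pdist z u <= normc (u - z) / (1 - normc z).
  by move=> u1; rewrite normcBC; exact: pdist_le_dist.
have := pdist_triangle z1 v1 w1; rewrite (pdistC v z); have := h v v1; have := h w w1; lra.
Qed.

Section Covering.
Variables (t : T) (phi : C -> X).
Hypothesis hphi : holomorphic_covering p t phi.

Lemma covering_sheet b : normc b < 1 -> exists B : set C, [/\ open B, B b,
  forall z, B z -> normc z < 1, forall z w, B z -> B w -> p (z, t) = p (w, t) -> z = w &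
  forall u, normc u < 1 -> (exists2 z, B z & p (z, t) = phi u) ->
    exists (W : set C) (f : C -> C), [/\ open W, W u, forall v, W v -> normc v < 1,
      forall v, W v -> (exists A, cdiff f v A) /\ B (f v) &
      [/\ forall v w, W v -> W w -> f v = f w -> v = w, forall z, B z -> exists2 v, W v & f v = z &
       forall v, W v -> phi v = p (f v, t)]]].
Proof.
move=> b1; have [_ /(_ b)] := hphi => -[|B [oB Bb BD Bi [I [W [f [_ UW fP]]]]]].
  exact/unit_diskE.
exists B; split => //.
- by move=> z /BD/unit_diskE.
- by move=> z w Bz Bw; apply: Bi; exact/mem_set.
move=> u u1 [z Bz zu].
have : (\bigcup_i W i) u by rewrite UW; split; [exact/unit_diskE|exists z].
move=> [i _ Wu]; have [oW hf [fB fI fS] Wp] := fP i.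
have WD v : W i v -> normc v < 1.
  by move=> Wv; apply/unit_diskE; have : (\bigcup_i W i) v by [exists i]; rewrite UW => -[].
exists (W i), (f i); split => //.
  by move=> v Wv; split; [apply/derivable_cdiff; exact: hf|exact: fB].
split; last exact: Wp.
  by move=> v w Wv Ww; apply: fI; exact/mem_set.
by move=> y By; have [v Wv fv] := fS _ By; exists v.
Qed.

Let leafE u : normc u < 1 -> exists2 b, normc b < 1 & p (b, t) = phi u.
Proof.
move=> u1; have [h _] := hphi; have : leaf p t (phi u) by rewrite -h; exists u => //; exact/unit_diskE.
by move=> [b /unit_diskE b1 e]; exists b.
Qed.

Let inj_plaque u : normc u < 1 -> exists2 d : R, 0 < d & forall v w, normc (v - u) < d -> normc (w - u) < d ->
  normc v < 1 -> normc w < 1 -> p (v, t) = p (w, t) -> v = w.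
Proof.
by move=> u1; have [d d0 dP] := susp_inj_ball u1; exists d => // v w *; have [] := dP v w t t.
Qed.

Let inj_phi u : normc u < 1 -> exists2 d : R, 0 < d & forall v w, normc (v - u) < d -> normc (w - u) < d ->
  normc v < 1 -> normc w < 1 -> phi v = phi w -> v = w.
Proof.
move=> u1; have [b b1 bu] := leafE u1; have [B [oB Bb BD Bi Bs]] := covering_sheet b1.
have [|W [f [oW Wu WD fB [fI fS fp]]]] := Bs u u1; first by exists b.
have [d d0 dP] := proj1 (openCP _) oW u Wu.
exists d => // v w vu wu v1 w1; rewrite !fp; try exact: dP.
by move=> h; apply: fI; try exact: dP; apply: Bi => //; [have [] := fB v (dP v vu)|have [] := fB w (dP w wu)].
Qed.

(** On one sheet of [phi] the chart [f] is a lift through [p (-, t)]. Any other starting point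
    differs from its value by a deck transformation [c] that fixes [t], so [act c \o f] is the lift
    wanted; it is moreover holomorphic. *)
Let lift_phi w : normc w < 1 -> exists2 e : R, 0 < e & forall w' u, normc (w' - w) < e -> normc u < 1 ->
  p (u, t) = phi w' -> exists2 f, f w' = u &
    lift_on (fun z => p (z, t)) phi [set z | normc (z - w') < e] f /\
    forall z, normc (z - w') < e -> exists A, cdiff f z A.
Proof.
move=> w1; have [b b1 bw] := leafE w1; have [B [oB Bb BD Bi Bs]] := covering_sheet b1.
have [|W [f [oW Ww WD fB [fI fS fp]]]] := Bs w w1; first by exists b.
have [d d0 dP] := proj1 (openCP _) oW w Ww.
exists (d / 2); first by rewrite divr_gt0.
move=> w' u ww u1 pu; have Ww' : W w' by apply: dP; lra.
have [[_ _] fB'] := fB _ Ww'; have f1 := BD _ fB'.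
have [c [uc tc]] := proj1 (suspE t t f1 u1) (esym (etrans pu (fp _ Ww'))).
have Wz z : normc (z - w') < d / 2 -> W z.
  by move=> zw; apply: dP; have := normc_triangle z w' w; lra.
have cd z : normc (z - w') < d / 2 -> exists A, cdiff (act c \o f) z A.
  move=> zw; have [[A hA] fBz] := fB _ (Wz z zw).
  have [A' hA'] := aut_holo (act_aut SG c) (BD _ fBz); exists (A' * A); exact: cdiff_comp.
exists (act c \o f); first by rewrite /= uc.
split => // z /= zw; have [A hA] := cd z zw; have [_ fBz] := fB _ (Wz z zw).
split; [by apply: (act_lt1 SG); exact: BD|exact: cdiff_cont hA|].
by rewrite (fp _ (Wz z zw)) [in LHS]tc susp_act//; exact: BD.
Qed.

(** In the opposite direction the lift through [phi] is the inverse [h] of the chart of a sheet; [h]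
    is continuous by [injective_holomorphic_open]. *)
Let lift_plaque (m : C -> C) w : (forall w, normc w < 1 -> normc (m w) < 1 /\ m @ w --> m w) ->
  normc w < 1 -> exists2 e : R, 0 < e & forall w' u, normc (w' - w) < e -> normc u < 1 ->
  phi u = p (m w', t) -> exists2 f, f w' = u & lift_on phi (fun z => p (m z, t)) [set z | normc (z - w') < e] f.
Proof.
move=> mP w1; have [m1 mc] := mP w w1; have [B [oB Bb BD Bi Bs]] := covering_sheet m1.
have [d d0 dP] := proj1 (openCP _) oB _ Bb.
have [k k0 kP] := proj1 (cvgC_at _ _ _) mc _ d0.
have w0 : 0 < 1 - normc w by rewrite subr_gt0.
have [e [e0 ek ew]] := exists_le2 k0 w0.
exists (e / 2); first by rewrite divr_gt0.
have Bm z : normc (z - w) < e -> normc z < 1 /\ B (m z).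
  by move=> zw; split; [have := normc_rev z w; lra|apply: dP; apply: kP; lra].
move=> w' u ww u1 pu.
have [|W [f [oW Wu WD fB [fI fS fp]]]] := Bs u u1.
  by exists (m w') => //; apply: (proj2 (Bm _ _)); lra.
pose h z := get (fun v => W v /\ f v = z).
have hP z : B z -> W (h z) /\ f (h z) = z.
  move=> Bz; apply: (@getPex _ (fun v => W v /\ f v = z)).
  by have [v Wv fv] := fS z Bz; exists v.
have hf v : W v -> h (f v) = v.
  by move=> Wv; have [_ fBv] := fB v Wv; have [? ?] := hP _ fBv; apply: fI.
have hc z : B z -> h @ z --> h z.
  move=> Bz; have [Wv fv] := hP z Bz.
  have [r r0 rP] := proj1 (openCP _) oW _ Wv.
  apply/cvgC_at => e1 e10; have [s [s0 sr se]] := exists_le2 (divr_gt0 r0 (ltr0n R 2)) e10.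
  have sr' : 0 < s < r by apply/andP; split; lra.
  have [||k1 k10 k1P] := @injective_holomorphic_open _ f (h z) r s sr'.
  - by move=> v vz; have [] := fB v (rP v vz).
  - by move=> v v' vz v'z; apply: fI; exact: rP.
  exists k1 => // y; rewrite -{1}fv => /k1P[v vs <-]; rewrite hf; last by apply: rP; lra.
  exact: lt_le_trans vs se.
have Bw' : B (m w') by apply: (proj2 (Bm _ _)); lra.
exists (h \o m).
  have [? fh] := hP _ Bw'; apply: fI => //; rewrite fh.
  by have [_ fBu] := fB _ Wu; apply: Bi => //; rewrite -pu fp.
move=> z /= zw; have [z1 Bz] : normc z < 1 /\ B (m z) by apply: Bm; have := normc_triangle z w' w; lra.
have [Wh fh] := hP _ Bz; split; first exact: WD.
  apply: (@cvg_comp _ _ _ m h _ (nbhs (m z))); first by have [] := mP z z1.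
  exact: hc.
by rewrite fp// fh.
Qed.

(** Although the leaf need not be simply connected, [phi] and [p (-, t)] both cover it by the disk.
    Each lifts through the other, and uniqueness of lifts makes the two lifts inverse to each
    other. *)
Lemma covering_chart z0 : normc z0 < 1 -> p (z0, t) = phi 0 ->
  exists alpha beta, [/\ disk_automorphism alpha beta, alpha 0 = z0 &
    forall z, normc z < 1 -> phi z = p (alpha z, t)].
Proof.
move=> z01 pz0; have o1 : normc (0 : C) < 1 by rewrite Normc.normc0.
have nz1 : normc (- z0) < 1 by rewrite normcN.
pose D := [set z : C | normc z < 1].
have cD : convexC D.
  by have := @convex_ball R 0 1; congr convexC; apply/funext => z; rewrite /D /mkset subr0.
have idP (E : C -> X) : lift_on E E D id by move=> z z1; split => //; exact: cvg_id.
have [al al0 alP] : exists2 f, f 0 = z0 & lift_on (fun z => p (z, t)) phi D f.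
  apply: lift_exists => // w w1; have [e e0 eP] := lift_phi w1.
  by exists e => // w' u h1 h2 h3; have [f ? []] := eP w' u h1 h2 h3; exists f.
have mP w : normc w < 1 -> normc (blaschke (- z0) w) < 1 /\ blaschke (- z0) @ w --> blaschke (- z0) w.
  by move=> w1; split; [exact: blaschke_lt1|exact: cdiff_cont (cdiff_blaschke _ w1)].
(* Lifts start at 0, so the plaque is first moved by a Blaschke factor that takes 0 to [z0]; [be]
   undoes it. *)
have [ga ga0 gaP] : exists2 f, f 0 = 0 & lift_on phi (fun z => p (blaschke (- z0) z, t)) D f.
  apply: lift_exists => //; first by move=> w w1; exact: lift_plaque.
  by rewrite blaschke0 opprK pz0.
pose be := ga \o blaschke z0.
have beP : lift_on phi (fun z => p (z, t)) D be.
  move=> z z1; have [h1 h2 h3] := gaP _ (blaschke_lt1 z01 z1); split.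
  - exact: h1.
  - apply: (@cvg_comp _ _ _ (blaschke z0) ga _ (nbhs (blaschke z0 z))); last exact: h2.
    exact: cdiff_cont (cdiff_blaschke z01 z1).
  - by rewrite /be /= h3 blaschkeK.
have be0 : be z0 = 0 by rewrite /be /= blaschke_self.
have comp (E F : C -> X) f h : lift_on E F D f -> lift_on F E D h -> lift_on E E D (f \o h).
  move=> fP hP z z1; have [h1 h2 h3] := hP z z1; have [f1 f2 f3] := fP _ h1.
  split; [exact: f1| |by rewrite /= f3].
  by apply: (@cvg_comp _ _ _ h f _ (nbhs (h z))); [exact: h2|exact: f2].
exists al, be; split => //; last by move=> z z1; have [_ _ ->] := alP z z1.
split => w w1.
- have [a1 ac aE] := alP w w1; have [e e0 eP] := lift_phi w1.
  have [|f fw [fl fh]] := eP w (al w) _ a1 aE; first by rewrite subrr Normc.normc0.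
  have [|A hA] := fh w; first by rewrite subrr Normc.normc0.
  exists A; apply: cdiff_ext hA; have w0 : 0 < 1 - normc w by rewrite subr_gt0.
  have [e' [e'0 e'e e'w]] := exists_le2 e0 w0; exists e' => // z zw.
  have fl' : lift_on (fun z => p (z, t)) phi [set z | normc (z - w) < e'] f.
    by move=> v vw; apply: fl; exact: lt_le_trans vw e'e.
  have al' : lift_on (fun z => p (z, t)) phi [set z | normc (z - w) < e'] al.
    by move=> v /= vw; apply: alP; rewrite /D /=; have := normc_rev v w; lra.
  have ww : [set z | normc (z - w) < e'] w by rewrite /= subrr Normc.normc0.
  exact: (lift_unique inj_plaque (@convex_ball R w e') fl' al' ww zw fw).
- by have [] := alP w w1.
- by have [] := beP w w1.
- by have [] := beP w w1.
- have e0 : (be \o al) 0 = id 0 by rewrite /= al0 be0.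
  exact: (lift_unique inj_phi cD (comp _ _ _ _ beP alP) (idP phi) o1 w1 e0).
- have e0 : (al \o be) z0 = id z0 by rewrite /= be0 al0.
  exact: (lift_unique inj_plaque cD (comp _ _ _ _ alP beP) (idP _) z01 w1 e0).
Qed.

End Covering.

(** The form used for the entropy: a deck transformation adapts the chart to whichever
    representative [(z0, t0)] of [x] is given. *)
Lemma covering_lift x (phi : C -> X) z0 t0 : leaf_covering_at p x phi ->
  normc z0 < 1 -> p (z0, t0) = x -> exists alpha beta, [/\ disk_automorphism alpha beta, alpha 0 = z0 &
    forall z, normc z < 1 -> phi z = p (alpha z, t0)].
Proof.
move=> [phi0 [t hphi]] z01 pz0; have [h _] := hphi.
have : leaf p t x by rewrite -h -phi0; exists 0 => //; apply/unit_diskE; rewrite Normc.normc0.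
move=> [z1 /unit_diskE z11 pz1].
have [c [zc tc]] := proj1 (suspE t t0 z11 z01) (etrans pz1 (esym pz0)).
have [al [be [ab a0 aP]]] := covering_chart hphi z11 (etrans pz1 (esym phi0)).
exists (act c \o al), (be \o act c^-1%g); split.
- by apply: comp_aut => //; exact: act_aut SG c.
- by rewrite /= a0 zc.
- by move=> z z2; rewrite aP// tc susp_act//; exact: (aut_lt1 ab).
Qed.

End Suspension.

(** * Entropy and separated sets of the transversal *)

Section Displacement.
Variable R : realType.
Local Notation C := R[i].

(* [(z - m z) * (1 - conjc c * z)] is a quadratic polynomial, so the sum of its values at
   [x], [- x], ['i x], [- 'i x] is four times its constant coefficient. *)
Lemma aut_displacement (m m' : C -> C) (x : R) : disk_automorphism m m' -> 0 <= x < 1 ->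
  (forall z, normc z = x -> pdist z (m z) <= 2^-1) -> normc (m 0) <= 1 - x ^+ 2.
Proof.
move=> hm /andP[x0 x1] small.
have n0 : normc (0 : C) < 1 by rewrite Normc.normc0.
pose c := m' 0; have c1 : normc c < 1 := aut_inv_lt1 hm n0.
have nc1 : normc (- c) < 1 by rewrite normcN.
have hh := comp_aut hm (blaschke_aut nc1).
have [l l1 lP] := aut_fix0 hh (ltac:(by rewrite /= blaschke0 opprK (autKV hm))).
have mE z : normc z < 1 -> m z = l * blaschke c z.
  by move=> z1; rewrite -lP /= ?blaschkeK//; exact: blaschke_lt1.
have m0 : m 0 = - (l * c) by rewrite mE// blaschke0 mulrN.
pose N (z : C) := z - conjc c * z ^+ 2 - l * z + l * c.
have NE z : normc z < 1 -> N z = (z - m z) * (1 - conjc c * z).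
  move=> z1; rewrite mE// /blaschke /N; have := blaschke_den c1 z1.
  by move: (conjc c) => c' ?; field.
(* With [d = pdist z (m z)] one has [|N z| = d D' D], and the two expressions of [1 - |m z|^2] give
   [(1 - d^2) (D' D)^2 = (1 - |c|^2) (1 - x^2)^2]. The bound [d <= 1/2] enters through
   [d^2 <= 1 - d^2]. *)
have Nle z : normc z = x -> normc (N z) <= 1 - x ^+ 2.
  move=> zx; have z1 : normc z < 1 by rewrite zx.
  have mz1 := aut_lt1 hm z1.
  have hd := small z zx; have d0 := pdist_ge0 z (m z).
  rewrite NE// Normc.normcM.
  have := blaschke_ident mz1 z1; have -> : 1 - normc (m z) ^+ 2 = 1 - normc (blaschke c z) ^+ 2.
    by rewrite mE// Normc.normcM l1 mul1r.
  rewrite (blaschke_ident c1 z1) zx -/(pdist z (m z)).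
  have -> : normc (z - m z) = pdist z (m z) * normc (1 - conjc (m z) * z).
    rewrite /pdist /blaschke Normc.normcM Normc.normcV divfK// gt_eqF// normc_gt0.
    exact: blaschke_den.
  have D0 : normc (1 - conjc c * z) != 0 by rewrite normc_eq0 blaschke_den.
  have E0 : normc (1 - conjc (m z) * z) != 0 by rewrite normc_eq0 blaschke_den.
  have := normc_ge0 (1 - conjc c * z); have := normc_ge0 (1 - conjc (m z) * z).
  move: D0 E0; move: (normc (1 - conjc c * z)) (normc (1 - conjc (m z) * z)) (normc_ge0 c).
  move: (normc c) (pdist z (m z)) d0 hd => k d d0 hd D D' k0 DN D'N D'0 D00 E.
  have x2 : 0 <= 1 - x ^+ 2 by rewrite subr_ge0 expr_le1// ltW.
  rewrite -(@ler_pXn2r _ 2)// ?nnegrE ?mulr_ge0//.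
  have E2 : (1 - d ^+ 2) * (D' * D) ^+ 2 = (1 - k ^+ 2) * (1 - x ^+ 2) ^+ 2.
    by rewrite E; field; rewrite DN D'N.
  have d2 : d ^+ 2 <= 1 - d ^+ 2 by nra.
  have -> : (d * D' * D) ^+ 2 = d ^+ 2 * (D' * D) ^+ 2 by ring.
  apply: (le_trans (ler_wpM2r (sqr_ge0 _) d2)); rewrite E2.
  by rewrite ler_piMl ?sqr_ge0// gerBl sqr_ge0.
have four : N x%:C + N (- x%:C) + N ('i * x%:C) + N (- ('i * x%:C)) = 4 * (l * c).
  rewrite /N !sqrrN exprMn sqr_i; ring.
have nx : normc (x%:C) = x by rewrite normc_real ger0_norm.
have ni : normc ('i * x%:C : C) = x.
  by rewrite Normc.normcM nx; have := normc_sqr ('i : C) => /=; rewrite expr0n expr1n add0r => h; rewrite sqrtr1 mul1r.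
have := le_normcD (N x%:C + N (- x%:C) + N ('i * x%:C)) (N (- ('i * x%:C))).
have := le_normcD (N x%:C + N (- x%:C)) (N ('i * x%:C)).
have := le_normcD (N x%:C) (N (- x%:C)).
rewrite four Normc.normcM -normcN -mulrN; rewrite m0 normcN.
have := Nle _ nx; have := Nle _ ni; have := Nle (- x%:C) (ltac:(by rewrite normcN)).
have := Nle (- ('i * x%:C)) (ltac:(by rewrite normcN)).
have -> : normc (4 : C) = 4 by rewrite (_ : 4 = (4 : R)%:C) ?normc_real ?gtr0_norm// rmorph_nat.
rewrite mulrN normcN; lra.
Qed.

End Displacement.

(** * Leaf maps that stay close have lifts that stay close *)

Section Shadowing.
Variables (R : realType) (Gamma : groupType) (act : Gamma -> R[i] -> R[i])
  (Sigma : topologicalType) (q : R[i] -> Sigma) (g : nat)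
  (T : metricType R) (rho : Gamma -> T -> T) (X : pmetricType R) (p : R[i] * T -> X).
Hypotheses (SG : surface_group act q g) (HR : homeo_representation rho)
  (SP : is_suspension p act rho) (cT : compact [set: T]).
Local Notation C := R[i].

(** Since [p] is open, points of [X] near [p (k, t)] have representatives near [(k, t)]; compactness
    of the disk of radius [r] times [T] makes this uniform. *)
Lemma near_orbit (r eta : R) : r < 1 -> 0 < eta -> exists2 e : R, 0 < e &
  forall k w t s, normc k <= r -> normc w < 1 -> mdist (p (k, t)) (p (w, s)) < e ->
  exists c, pdist k (act c w) < eta /\ mdist t (rho c s) < eta.
Proof.
move=> r1 eta0.
have cKT : compact (closed_disk r `*` [set: T]) by apply: compact_setX => //; exact: compact_closed_disk.
pose P (e : R) (u : C * T) := forall w s, normc w < 1 -> mdist (p u) (p (w, s)) < e ->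
  exists c, pdist u.1 (act c w) < eta /\ mdist u.2 (rho c s) < eta.
have : \forall e \near (0 : R)^'+, closed_disk r `*` [set: T] `<=` P e.
  apply: (proj1 (compact_near_coveringP _) cKT) => -[k t] [/= kr _].
  have k1 : normc k < 1 := le_lt_trans kr r1.
  have r0 : 0 < 1 - r by rewrite subr_gt0.
  have k0 : 0 < 1 - normc k by rewrite subr_gt0.
  have er0 : 0 < eta * (1 - r) / 2 by rewrite divr_gt0// mulr_gt0.
  have [d [d0 dr dk]] := exists_le2 er0 k0.
  have [d' [d'0 d'd d'e]] := exists_le2 d0 (divr_gt0 eta0 (ltr0n R 2)).
  pose W := [set u : C * T | normc (u.1 - k) < d' /\ mdist t u.2 < d'].
  have oW : open W.
    rewrite openE => -[w s] [/= wk ts]; apply/nbhs_disk_timesP.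
    have h1 : 0 < d' - normc (w - k) by rewrite subr_gt0.
    have h2 : 0 < d' - mdist t s by rewrite subr_gt0.
    have [b [b0 b1 b2]] := exists_le2 h1 h2; exists b => // v u vw su; split => /=.
      by have := normc_triangle v w k; lra.
    by have := metric_triangle t s u; lra.
  have WD : W `<=` @disk_times R T.
    by move=> [w s] [/= wk _]; apply/unit_diskE => /=; have := normc_rev w k; lra.
  have kk : W (k, t) by split; rewrite /= ?mdistxx// subrr Normc.normc0.
  have : nbhs (p (k, t)) (p @` W).
    by apply: open_nbhs_nbhs; split; [exact: (open_susp SG HR SP)|exists (k, t)].
  move=> /nbhs_mdistP[a a0 aW].
  have a2 : 0 < a / 2 by rewrite divr_gt0.
  have [b b0 bP] : exists2 b : R, 0 < b & forall w s, normc (w - k) < b -> mdist t s < b ->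
      normc w < 1 /\ mdist (p (k, t)) (p (w, s)) < a / 2.
    apply: (susp_cont (V := [set y | mdist (p (k, t)) y < a / 2]) SP k1).
    by apply/nbhs_mdistP; exists (a / 2).
  have [b' [b'0 b'b b'd]] := exists_le2 b0 d'0.
  exists ([set u : C * T | normc (u.1 - k) < b' /\ mdist t u.2 < b'], [set e : R | e <= a / 2]) => /=.
    split; last exact: nbhs_right_le.
    by apply/nbhs_disk_timesP; exists b'.
  move=> [[k' t'] e] [/= [kk' tt'] ea] w s w1 /= /lt_le_trans/(_ ea) d1.
  have [_ d2] := bP k' t' (lt_le_trans kk' b'b) (lt_le_trans tt' b'b).
  have [[w' s'] [/= wk' ts'] e'] : (p @` W) (p (w, s)).
    by apply: aW; have := metric_triangle (p (k, t)) (p (k', t')) (p (w, s)); lra.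
  have w'1 : normc w' < 1 by have := normc_rev w' k; lra.
  have [c [wc sc]] := proj1 (suspE SP s s' w1 w'1) (esym e').
  exists c; rewrite -wc -sc; split; last first.
    by have := metric_triangle t' t s'; rewrite (metric_sym t' t); lra.
  rewrite pdistC; have k'1 : normc k' < 1 by have := normc_rev k' k; lra.
  have h1 := pdist_le_dist r1 kr k'1; have h2 := pdist_le_dist r1 kr w'1.
  have := pdist_triangle k1 w'1 k'1; rewrite (pdistC w' k).
  have close u : normc (u - k) < d -> normc (k - u) / (1 - r) < eta / 2.
    by move=> uk; rewrite ltr_pdivrMr// normcBC; lra.
  have := close k' (ltac:(lra)); have := close w' (ltac:(lra)); lra.
move=> H; have [e [e0 eP]] : exists e : R, 0 < e /\ closed_disk r `*` [set: T] `<=` P e.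
  near (0 : R)^'+ => e; exists e; split; first by [].
  by near: e.
by exists e => // k w t s kr; apply: (eP (k, t)); split.
Unshelve. all: by end_near. Qed.

(** Move [al z] into the disk of radius [r] by some [a]. Closeness in [X] provides a [c] with
    [act c (be z)] near [act a (al z)], and if the lifts are within [e0 / 2], uniform discreteness
    forces [c = a]. So their distance is either below [eta] or at least [e0 / 2]; it cannot jump,
    hence stays below [eta] over the whole disk of radius [x]. The equality [c = a] also compares
    [rho a t] with [rho a s]. *)
Lemma shadowing : exists r e0 : R, [/\ 0 <= r < 1, 0 < e0 <= 1,
  forall z, normc z < 1 -> exists c, normc (act c z) <= r &
  forall eta, 0 < eta -> eta <= e0 / 4 -> exists2 e : R, 0 < e &
  forall (al al' be be' : C -> C) t s (x : R), disk_automorphism al al' -> disk_automorphism be be' -> 0 <= x < 1 ->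
   (forall z, normc z <= x -> mdist (p (al z, t)) (p (be z, s)) < e) ->
   pdist (al 0) (be 0) < e0 / 2 -> forall z, normc z <= x -> pdist (al z) (be z) < eta /\
     forall a, normc (act a (al z)) <= r -> mdist (rho a t) (rho a s) < eta].
Proof.
have [r [/andP[r0 r1] rP]] := cocompact SG; have [e1 e10 e1P] := uniformly_discrete SG.
have [e0 [e00 e0e1 e01]] := exists_le2 e10 ltr01.
exists r, e0; split => //; [exact/andP|exact/andP|] => eta eta0 etae.
have [e ep eP] := near_orbit r1 eta0; exists e => // al al' be be' t s x hal hbe /andP[x0 x1] close start.
have key z a : normc z <= x -> normc (act a (al z)) <= r -> pdist (al z) (be z) < e0 / 2 ->
    pdist (al z) (be z) < eta /\ mdist (rho a t) (rho a s) < eta.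
  move=> zx ar dz; have z1 : normc z < 1 := le_lt_trans zx x1.
  have a1 := aut_lt1 hal z1; have b1 := aut_lt1 hbe z1.
  have [|c [h1 h2]] := eP (act a (al z)) (be z) (rho a t) s ar b1.
    by rewrite (susp_act SG SP); [exact: close|].
  have ca : c = a.
    apply: contrapT => ca; have c1 : (a^-1 * c)%g <> 1%g.
      by move=> h; apply: ca; rewrite -(mulg1 a) -h mulVKg.
    have := e1P _ _ c1 b1; have := pdist_triangle a1 b1 (act_lt1 SG (a^-1 * c)%g b1).
    have -> : pdist (al z) (act (a^-1 * c)%g (be z)) = pdist (act a (al z)) (act c (be z)).
      by rewrite -(act_pdist SG a a1 (act_lt1 SG _ b1)) -(actME SG)// mulVKg.
    by rewrite (pdistC (be z) (al z)); lra.
  by move: h1 h2; rewrite ca (act_pdist SG).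
suff small z : normc z <= x -> pdist (al z) (be z) < eta.
  move=> z zx; split; first exact: small.
  by move=> a /key => /(_ zx)[]//; have := small z zx; lra.
have cS : convexC [set z : C | normc z <= x].
  move=> a b u /= ha hb /andP[u0 u1].
  have -> : a + u%:C * (b - a) = (1 - u)%:C * a + u%:C * b by rewrite raddfB /= rmorph1; ring.
  apply: le_trans (le_normcD _ _) _; rewrite !Normc.normcM !normc_real !ger0_norm ?subr_ge0//.
  have -> : x = (1 - u) * x + u * x by ring.
  by rewrite lerD// ler_wpM2l// subr_ge0.
have contd (f f' : C -> C) v d : disk_automorphism f f' -> normc v < 1 -> 0 < d ->
    exists2 k : R, 0 < k & forall w, normc w < 1 -> normc (w - v) < k -> pdist (f v) (f w) < d.
  move=> hf z1 d0; exists (d * (1 - normc v)); first by rewrite mulr_gt0// subr_gt0.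
  move=> w w1 wz; rewrite (aut_pdist hf)//; apply: le_lt_trans (pdist_le_dist z1 (lexx _) w1) _.
  by rewrite ltr_pdivrMr ?subr_gt0// normcBC.
move=> zx; apply: (@convex_locally_constant R _ (fun z => pdist (al z) (be z) < eta) cS _ 0) => //.
- move=> v /= vx; have v1 := le_lt_trans vx x1.
  have av1 := aut_lt1 hal v1; have bv1 := aut_lt1 hbe v1.
  have q0 : 0 < e0 / 8 by rewrite divr_gt0.
  have [k1 k10 k1P] := contd _ _ v _ hal v1 q0; have [k2 k20 k2P] := contd _ _ v _ hbe v1 q0.
  have [k [k0 kk1 kk2]] := exists_le2 k10 k20.
  exists k => // w wx wv; have w1 := le_lt_trans wx x1.
  have aw1 := aut_lt1 hal w1; have bw1 := aut_lt1 hbe w1.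
  have h1 := k1P w w1 (lt_le_trans wv kk1); have h2 := k2P w w1 (lt_le_trans wv kk2).
  have [a ar] := rP _ aw1; have [a' ar'] := rP _ av1.
  have := key w a wx ar; have := key v a' vx ar'.
  have := pdist_triangle av1 aw1 bw1; have := pdist_triangle bv1 av1 bw1.
  have := pdist_triangle aw1 av1 bv1; have := pdist_triangle bw1 aw1 bv1.
  rewrite (pdistC (al w) (al v)) (pdistC (be w) (be v)) => t1 t2 t3 t4 K1 K2.
  by split=> h; [have [] := K1 (ltac:(lra))|have [] := K2 (ltac:(lra))].
- by rewrite /mkset Normc.normc0.
- have n0 : normc (0 : C) <= x by rewrite Normc.normc0.
  have [|a ar] := rP (al 0); first by apply: (aut_lt1 hal); rewrite Normc.normc0.
  by have [] := key 0 a n0 ar start.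
Qed.

End Shadowing.

(** * The lower bound for covering numbers *)

Section Entropy.
Variables (R : realType) (Gamma : groupType) (act : Gamma -> R[i] -> R[i])
  (Sigma : topologicalType) (q : R[i] -> Sigma) (g : nat)
  (T : pmetricType R) (rho : Gamma -> T -> T) (X : pmetricType R) (p : R[i] * T -> X)
  (phi : X -> R[i] -> X).
Hypotheses (SG : surface_group act q g) (HR : homeo_representation rho)
  (SP : is_suspension p act rho) (cT : compact [set: T])
  (hphi : forall x, leaf_covering_at p x (phi x)).
Local Notation C := R[i].

(** With [c = f' 0] the map [f \o blaschke (- c)] fixes 0, so it is a rotation by [aut_fix0]; this
    gives [f'] explicitly. *)
Lemma inv_aut (f f' : C -> C) : disk_automorphism f f' -> disk_automorphism f' f.
Proof.
move=> hf; have n0 : normc (0 : C) < 1 by rewrite Normc.normc0.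
have c1 := aut_inv_lt1 hf n0; set c := f' 0 in c1.
have nc1 : normc (- c) < 1 by rewrite normcN.
have [l l1 lP] := aut_fix0 (comp_aut hf (blaschke_aut nc1)) (ltac:(by rewrite /= blaschke0 opprK (autKV hf))).
have l0 : l != 0 by rewrite -normc_eq0 l1 oner_eq0.
have inv1 : normc l^-1 = 1 by rewrite Normc.normcV l1 invr1.
have hg := comp_aut (blaschke_aut nc1) (rotation_aut inv1).
have gE z : normc z < 1 -> f' z = blaschke (- c) (l^-1 * z).
  move=> z1; have v1 : normc (l^-1 * z) < 1 by rewrite Normc.normcM inv1 mul1r.
  have := lP _ v1; rewrite /= mulVKf// => E; rewrite -[in LHS]E (autK hf)//; exact: blaschke_lt1.
split => w w1.
- have [A hA] := aut_holo hg w1; exists A; apply: cdiff_ext hA.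
  exists (1 - normc w); first by rewrite subr_gt0.
  by move=> z zw; rewrite gE//; have := normc_rev z w; lra.
- exact: (aut_inv_lt1 hf).
- by have [A] := aut_holo hf w1; exact: cdiff_cont.
- exact: (aut_lt1 hf).
- exact: (autKV hf).
- exact: (autK hf).
Qed.

(** The Euclidean radius [tanh (r / 2)] of the disk of Poincare radius [r]. *)
Let rad (r : R) : R := (expR r - 1) / (expR r + 1).

Let radP (r : R) : 0 <= r -> 0 <= rad r < 1 /\ 1 - rad r ^+ 2 <= 4 * expR (- r).
Proof.
move=> r0; have := expR_ge1Dx r; have e0 := expR_gt0 r.
rewrite expRN /rad; move: (expR r) e0 => y y0 yr; have y1 : 0 < y + 1 by lra.
split.
  by apply/andP; split; [apply: divr_ge0; lra|rewrite ltr_pdivrMr//; lra].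
rewrite (_ : 1 - _ = 4 * y / (y + 1) ^+ 2); last by field; rewrite gt_eqF.
rewrite -mulrA ler_pM2l// ler_pdivrMr ?exprn_gt0//.
by rewrite mulrC ler_pdivlMr// -expr2 ler_pXn2r// ?nnegrE; lra.
Qed.

Let rad_poincare (r : R) (z : C) : 0 <= r -> normc z <= rad r -> poincare_disk r z.
Proof.
move=> r0 zr; have [/andP[_ r1] _] := radP r0; have z1 : normc z < 1 by lra.
split; first exact/unit_diskE.
have d0 : 0 < 1 - normc z by rewrite subr_gt0.
have n0 := normc_ge0 z; rewrite -[leRHS]expRK ler_ln ?posrE ?expR_gt0 ?divr_gt0//; last by lra.
rewrite ler_pdivrMr//; move: zr; rewrite /rad; have := expR_gt0 r; move: (expR r) => y y0.
by rewrite ler_pdivlMr; lra.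
Qed.

(** Two points in one ball for [d_r] have leaf maps that shadow each other, after rotations. The
    automorphism between the lifts then moves the circle of radius [rad r] by less than 1/2, hence
    the centre by at most [4 exp (- r)], which bounds [z - w]. The transverse bound for [c] is
    shadowing at the point that [al] sends to [act c^-1 0]. The shift [ln 32] ensures that this
    point lies in the disk: its defect is at least [3/16 exp (- n)], while [1 - rad r ^+ 2 <= 4 exp
    (- r) = exp (- n) / 8]. *)
Lemma same_ball (eta : R) : 0 < eta -> exists e k : R, [/\ 0 < e, 0 < k &
  forall n x z w t s, let r := n%:R + ln 32 in
   normc z <= k -> normc w <= k ->
   (leafwise_dist phi r x (p (z, t)) < e%:E)%E -> (leafwise_dist phi r x (p (w, s)) < e%:E)%E ->
   normc (z - w) <= 8 * expR (- r) /\ forall c, deck_ball act n c -> mdist (rho c t) (rho c s) < eta].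
Proof.
move=> eta0; have [r0 [e0 [/andP[r00 r01] /andP[e00 e01] cov sh]]] := shadowing SG HR SP cT.
have q0 : 0 < e0 / 4 by rewrite divr_gt0.
have [eta' [eta'0 eta'q eta'e]] := exists_le2 q0 eta0.
have [e ep eP] := sh eta' eta'0 eta'q.
(* Two distances to the common centre [x] add up to [e], and [z], [w] of modulus at most [e0 / 16]
   satisfy [pdist z w < e0 / 2], as shadowing requires at the start. *)
exists (e / 2), (e0 / 16); split; rewrite ?divr_gt0// => n x z w t s r zk wk.
have z1 : normc z < 1 by lra. have w1 : normc w < 1 by lra.
have n0 : normc (0 : C) < 1 by rewrite Normc.normc0.
have r_ge0 : 0 <= r by rewrite addr_ge0// ln_ge0// ler1n.
have [/andP[x0 x1] xe] := radP r_ge0.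
have unfold y : (leafwise_dist phi r x y < (e / 2)%:E)%E -> exists l : C, normc l = 1 /\
    forall v, normc v <= rad r -> mdist (phi x v) (phi y (l * v)) < e / 2.
  move=> /ereal_inf_lt[_ [th _ <-] h]; exists (cexp_i th); split; first exact: normc_cis.
  move=> v vr; rewrite -lte_fin; apply: le_lt_trans h; apply: ereal_sup_ubound.
  by exists v => //; exact: rad_poincare.
move=> /unfold[l [l1 lP]] /unfold[l' [l'1 l'P]].
have [al0 [be0 [h1 h2 h3]]] := covering_lift SG HR SP (hphi (p (z, t))) z1 erefl.
have [al1 [be1 [g1 g2 g3]]] := covering_lift SG HR SP (hphi (p (w, s))) w1 erefl.
have hal := comp_aut h1 (rotation_aut l1); have hbe := comp_aut g1 (rotation_aut l'1).
set al := (X in disk_automorphism X _) in hal; set al' := (X in disk_automorphism _ X) in hal.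
set be := (X in disk_automorphism X _) in hbe; set be' := (X in disk_automorphism _ X) in hbe.
have alz : al 0 = z by rewrite /al /= mulr0.
have bew : be 0 = w by rewrite /be /= mulr0.
have zw0 : pdist z w < e0 / 2.
  have r2 : 2^-1 < 1 :> R by lra.
  apply: le_lt_trans (pdist_le_dist r2 (_ : normc z <= _) w1) _; first by lra.
  rewrite ltr_pdivrMr; last by lra.
  by have := le_normcD z (- w); rewrite normcN; lra.
have := eP al al' be be' t s (rad r) hal hbe (ltac:(by rewrite x0 x1)).
rewrite alz bew => /(_ _ zw0) main.
have {}main v : normc v <= rad r -> pdist (al v) (be v) < eta' /\
    forall a, normc (act a (al v)) <= r0 -> mdist (rho a t) (rho a s) < eta'.
  apply: main => u ur; have u1 : normc u < 1 by lra.
  have E1 : p (al u, t) = phi (p (z, t)) (l * u).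
    by rewrite h3// Normc.normcM l1 mul1r.
  have E2 : p (be u, s) = phi (p (w, s)) (l' * u).
    by rewrite g3// Normc.normcM l'1 mul1r.
  rewrite E1 E2; have := lP u ur; have := l'P u ur.
  have := metric_triangle (phi (p (z, t)) (l * u)) (phi x u) (phi (p (w, s)) (l' * u)).
  by rewrite (metric_sym _ (phi x u)); lra.
split.
  have hm := comp_aut (inv_aut hal) hbe.
  have m0 : normc ((al' \o be) 0) = pdist z w.
    rewrite /= bew -pdist0z -(aut_pdist hal n0 (aut_inv_lt1 hal w1)) alz.
    by rewrite (autKV hal).
  have := aut_displacement hm (ltac:(by rewrite x0 x1) : 0 <= rad r < 1).
  rewrite m0 => /(_ _)h.
  have {}h : pdist z w <= 1 - rad r ^+ 2.
    apply: h => v vr; have v1 : normc v < 1 by lra.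
    have bv1 := aut_lt1 hbe v1.
    rewrite /= -(aut_pdist hal v1 (aut_inv_lt1 hal bv1)) (autKV hal)//.
    by have [] := main v (ltac:(by rewrite vr)); lra.
  by have := dist_le_pdist z1 w1; lra.
move=> c cn; pose v := al' (act c^-1%g 0).
have c01 := act_lt1 SG c^-1%g n0.
have v1 : normc v < 1 := aut_inv_lt1 hal c01.
have alv : al v = act c^-1%g 0 by rewrite /v (autKV hal).
have vE : normc v = normc (act c z).
  rewrite -pdist0z -(aut_pdist hal n0 v1) alz alv -(act_pdist SG c z1 c01) (actKV SG)// pdistz0//.
have [|_ h] := main v; last first.
  by apply: lt_le_trans (h c _) eta'e; rewrite alv (actKV SG)// Normc.normc0.
rewrite vE -(@ler_pXn2r _ 2)// ?nnegrE ?normc_ge0//.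
have := deck_defect SG c z1; move: cn; rewrite /deck_ball /=.
have eE : expR (- r) = expR (- n%:R) / 32.
  by rewrite /r opprD expRD expRN [expR (- ln _)]expRN lnK// posrE.
move: xe; rewrite eE; move: (expR_gt0 (- n%:R : R)); move: (expR _) => E E0 xe cn dd.
have z2 : normc z ^+ 2 <= 4^-1.
  have -> : 4^-1 = 2^-1 ^+ 2 :> R by field.
  by rewrite ler_pXn2r ?nnegrE ?normc_ge0//; lra.
have : (3 / 4) * E <= (1 - normc z ^+ 2) * (1 - normc (act c 0) ^+ 2).
  apply: ler_pM => //; first exact: ltW.
  by rewrite (_ : 3 / 4 = 1 - 4^-1); [exact: lerB|field].
lra.
Qed.

(** The points are the products of an [M] by [M] square grid near 0 with [E]. The mesh
    [16 exp (- r)] exceeds the bound [8 exp (- r)] of [same_ball], and [E] is separated, so no ball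
    contains two of them. *)
Lemma covering_number_lower (eta : R) : 0 < eta -> exists e k : R, [/\ 0 < e, 0 < k &
  forall n E (M : nat), let r := n%:R + ln 32 in separated rho (deck_ball act) n eta E ->
  M%:R * (16 * expR (- r)) <= k -> (((M * M * size E)%:R : R)%:E <= covering_number phi r e)%E].
Proof.
move=> eta0; have [e [k [e0 k0 H]]] := same_ball eta0.
exists e, (k / 2); split; rewrite ?divr_gt0// => n E M r [uE sE] Mk.
apply: le_ereal_inf_tmp => _ [l lP <-]; rewrite lee_fin ler_nat.
have {lP}[f fP] : {f : X -> X & forall y, f y \in l /\ (leafwise_dist phi r (f y) y < e%:E)%E}.
  apply: (@choice _ _ (fun y x => x \in l /\ (leafwise_dist phi r x y < e%:E)%E)) => y.
  by have [x ? ?] := lP y; exists x.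
pose d := 16 * expR (- r); have d0 : 0 < d by rewrite mulr_gt0 ?expR_gt0.
pose pt (u : nat * nat * T) : C := (u.1.1%:R * d) +i* (u.1.2%:R * d).
pose L := [seq (u, t) | u <- [seq (i, j) | i <- iota 0 M, j <- iota 0 M], t <- E].
have <- : size [seq f (p (pt u, u.2)) | u <- L] = (M * M * size E)%N.
  by rewrite size_map !size_allpairs !size_iota.
have ptle u : normc (pt u) <= u.1.1%:R * d + u.1.2%:R * d.
  apply: le_trans (normc_le_ReIm _) _.
  by rewrite [Re _]/= [Im _]/= !ger0_norm ?mulr_ge0// ltW.
have small u : u \in L -> normc (pt u) <= k /\ u.2 \in E.
  move=> /allpairsP[[v t] /= [/allpairsP[[i j] /= [iM jM ->]] tE ->]]; split => //.
  apply: le_trans (ptle _) _; rewrite /=.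
  move: iM jM; rewrite !mem_iota /= !add0n => /ltnW iM /ltnW jM.
  have h i' : (i' <= M)%N -> i'%:R * d <= k / 2.
    by move=> iM'; apply: le_trans Mk; rewrite ler_wpM2r ?ler_nat// ltW.
  by have := h i iM; have := h j jM; lra.
apply: uniq_leq_size; last by move=> _ /mapP[u _ ->]; have [] := fP (p (pt u, u.2)).
rewrite map_inj_in_uniq; last first.
  move=> u v uL vL fuv; have [uk uE'] := small u uL; have [vk vE'] := small v vL.
  have [_ h1] := fP (p (pt u, u.2)); have [_ h2] := fP (p (pt v, v.2)); rewrite fuv in h1.
  have [zw tr] := H n _ _ _ _ _ uk vk h1 h2.
  have near_eq (i j : nat) : `|i%:R * d - j%:R * d| <= 8 * expR (- r) -> i = j.
    wlog ij : i j / (i <= j)%N.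
      by move=> W; case: (leqP i j) => [/W//|/ltnW/W h]; rewrite distrC => /h.
    rewrite distrC -mulrBl -natrB// ger0_norm ?mulr_ge0 ?(ltW d0)// => h.
    apply/eqP; rewrite eqn_leq ij /= -subn_eq0 -leqn0 leqNgt; apply/negP => ji.
    have : 1 <= (j - i)%:R :> R by rewrite ler1n.
    have := expR_gt0 (- r); move: h; rewrite /d; move: (expR _) ((j - i)%:R) => x y; nra.
  have tE : u.2 = v.2.
    apply/eqP; case: eqP => // /eqP /(sE _ _ uE' vE')[c cn]; rewrite leNgt.
    by rewrite tr.
  have := le_trans (normc_Re _) zw; have := le_trans (normc_Im _) zw.
  rewrite !raddfB /= => /near_eq e2 /near_eq e1.
  by move: u v e1 e2 tE {fuv uE' vE' uL vL h1 h2 zw tr uk vk} => [[i j] t] [[i' j'] t'] /= -> -> ->.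
have uij : uniq [seq (i, j) | i <- iota 0 M, j <- iota 0 M].
  by apply: allpairs_uniq; rewrite ?iota_uniq// => -[? ?] [? ?] _ _ [-> ->].
by apply: allpairs_uniq => // -[? ?] [? ?] _ _ [-> ->].
Qed.

(** If it failed, separated sets could be enlarged by the factor [1 + d] at every [k + 1] levels,
    starting from a single point. With the grid this yields entropy at least [2 + l / (2 (k + 1))]
    for [l = ln (1 + d)]. *)
Lemma subexponential_separation : hyperbolic_entropy phi = 2%:E ->
  forall (e d : R) k, 0 < e -> 0 < d -> exists n E, [/\ separated rho (deck_ball act) n e E, E != [::] &
    forall E', separated rho (deck_ball act) (n + k) e E' -> (size E')%:R <= (1 + d) * (size E)%:R].
Proof.
move=> hent e d k e0 d0; apply: contrapT => no.
have d1 : 0 < 1 + d by lra.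
(* The step is [k + 1] rather than [k], so that the level does increase when [k] is 0. *)
have step n E : separated rho (deck_ball act) n e E -> E != [::] -> exists E',
    [/\ separated rho (deck_ball act) (n + k.+1) e E', E' != [::] & (1 + d) * (size E)%:R <= (size E')%:R].
  move=> sE E0; apply: contrapT => no'; apply: no; exists n, E; split => // E' [uE' sE'].
  rewrite leNgt; apply/negP => lt; apply: no'; exists E'; split; last exact: ltW.
    split => // x y xE yE xy; have [h hB he] := sE' x y xE yE xy.
    by exists h => //; apply: deck_ball_mono hB; rewrite leq_add2l.
  rewrite -size_eq0 -lt0n -(ltr_nat R); apply: le_lt_trans lt.
  by rewrite mulr_ge0// ltW.
have seqs j : exists E, [/\ separated rho (deck_ball act) (j * k.+1) e E, E != [::] &
    (1 + d) ^+ j <= (size E)%:R].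
  elim: j => [|j [E [sE E0 Ej]]].
    by exists [:: point]; split => //; split => // x y; rewrite !inE => /eqP -> /eqP ->; rewrite eqxx.
  have [E' [sE' E'0 h]] := step _ _ sE E0; exists E'; rewrite mulSn addnC; split => //.
  by rewrite exprS; apply: le_trans h; rewrite ler_pM2l.
have [eps [kap [eps0 kap0 low]]] := covering_number_lower e0.
pose l := ln (1 + d); have l0 : 0 < l by rewrite ln_gt0// ltrDl.
pose L : R := ln 32; have L0 : 0 <= L by rewrite ln_ge0// ler1n.
(* Only half of the growth rate [l / (k + 1)] is claimed; the other half pays for the additive
   constants. *)
pose b := 2 + l / (2 * k.+1%:R); have k0 : 0 < 2 * k.+1%:R :> R by rewrite mulr_gt0.
suff : (b%:E <= hyperbolic_entropy phi)%E.
  by rewrite hent lee_fin /b gerDl leNgt divr_gt0.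
apply: (@le_trans _ _ (limf_esup (fun r : R => r^-1%:E * lne (covering_number phi r eps))%E (pinfty_nbhs R)));
  last by apply: ereal_sup_ubound; exists eps.
rewrite limf_esupE; apply: le_ereal_inf_tmp => _ [V [A [_ AV]] <-].
(* Beyond [c1] the radius exceeds [A], beyond [c2] the grid size [y] is at least 2, so that rounding
   costs at most a factor 2, and beyond [c3] the constants are at most [j l / 2]. *)
pose c1 := `|A|; pose c2 := 32 / kap; pose c3 := (`|2 * ln (kap / 32)| + l * L / (2 * k.+1%:R)) * 2 / l.
have [j _ /(_ j (leqnn j)) jP] : \forall j \near \oo, c1 + c2 + c3 + 1 <= j%:R :> R by exact: nbhs_infty_ger.
have c10 : 0 <= c1 by exact: normr_ge0.
have c20 : 0 <= c2 by rewrite divr_ge0// ltW.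
have c30 : 0 <= c3.
  by rewrite !(mulr_ge0, addr_ge0)// ?invr_ge0 ?ltW// mulr_gt0// ?invr_gt0.
pose r : R := (j * k.+1)%:R + L.
have jr : j%:R <= r by apply: ler_wpDr => //; rewrite ler_nat leq_pmulr.
have r0 : 0 < r by lra.
have Ar : A < r by have := ler_norm A; rewrite -/c1; lra.
apply: (@le_trans _ _ (r^-1%:E * lne (covering_number phi r eps))%E); last first.
  by apply: ereal_sup_ubound; exists r => //; exact: AV.
pose y := kap * expR r / 16.
have y2 : 2 <= y.
  rewrite /y ler_pdivlMr// -ler_pdivrMl//.
  have -> : kap^-1 * (2 * 16) = c2 by rewrite /c2; field; rewrite gt_eqF.
  by have := expR_ge1Dx r; lra.
have y0 : 0 <= y by lra.
have := truncn_itv y0; set M := Num.truncn y => /andP[My yM].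
have Mhalf : y / 2 <= M%:R by move: yM; rewrite -natr1; lra.
have [E [sE E0 Ej]] := seqs j.
have := low _ _ M sE; rewrite -/L -/r => /(_ _)h.
have {}h : (((M * M * size E)%:R : R)%:E <= covering_number phi r eps)%E.
  apply: h; rewrite mulrA expRN ler_pdivrMr ?expR_gt0//.
  by move: My; rewrite /y ler_pdivlMr.
have Mp : 0 < M%:R :> R by lra.
have Ep : 0 < (size E)%:R :> R by rewrite ltr0n lt0n size_eq0.
have Np : 0 < (M * M * size E)%:R :> R by rewrite !natrM !mulr_gt0.
apply: (@le_trans _ _ (r^-1%:E * lne (((M * M * size E)%:R : R)%:E))%E); last first.
  rewrite lee_wpmul2l ?lee_fin ?invr_ge0 ?(ltW r0)// lee_lne// in_itv /= ?leey ?andbT ?lee_fin ?(ltW Np)//.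
  by apply: le_trans h; rewrite lee_fin ltW.
rewrite lne_EFin// -EFinM lee_fin mulrC ler_pdivlMr//.
rewrite !natrM !lnM ?posrE ?mulr_gt0//.
have lnM' : ln (kap / 32) + r <= ln M%:R :> R.
  rewrite -[X in _ + X]expRK -lnM ?posrE ?expR_gt0 ?divr_gt0// ler_ln ?posrE ?mulr_gt0 ?divr_gt0 ?expR_gt0//.
  by apply: le_trans Mhalf; rewrite /y le_eqVlt; apply/orP; left; apply/eqP; field.
have lnE' : j%:R * l <= ln (size E)%:R :> R.
  by rewrite mulr_natl -lnXn// ler_ln ?posrE ?exprn_gt0.
have hj : (`|2 * ln (kap / 32)| + l * L / (2 * k.+1%:R)) <= j%:R * l / 2.
  have : c3 <= j%:R by lra.
  by rewrite /c3 ler_pdivrMr// ler_pdivlMr.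
have := ler_norm (- (2 * ln (kap / 32))); rewrite normrN.
have -> : b * r = 2 * r + j%:R * l / 2 + l * L / (2 * k.+1%:R).
  rewrite /b /r natrM; have : k.+1%:R != 0 :> R by rewrite pnatr_eq0.
  by move: (k.+1%:R : R) => K K0; field.
have gen (u w v jl m n rr : R) : v + rr <= m -> jl <= n -> w + u <= jl / 2 ->
  - (2 * v) <= w -> 2 * rr + jl / 2 + u <= m + m + n by lra.
exact: gen lnM' lnE' hj.
Qed.

End Entropy.

(** * Change of variables in the plane *)

Section Affine.
Variable R : realType.
Local Notation C := R[i].
Local Notation MR := (measurableTypeR R).
Local Notation mu := (@lebesgue_measure R).
Local Notation mu2 := (mu \x mu)%E.
Local Open Scope ereal_scope.

Lemma measurable_affine (c b : R) : measurable_fun [set: MR] (fun v : MR => c * v + b : MR)%R.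
Proof. by apply: measurable_funD => //; apply: measurable_funM. Qed.

Lemma lebesgue_measure_affine (c b : R) (E : set MR) : c != 0%R -> measurable E ->
  mu [set v : R | E (c * v + b)%R] = (`|c|^-1)%:E * mu E.
Proof.
move=> c0 mE.
have mT : measurable_fun [set: MR] (fun v : MR => c * v + b : MR)%R := measurable_affine c b.
have nc : (0 < `|c|)%R by rewrite normr_gt0.
pose k : {nonneg R} := NngNum (ltW nc).
pose m := mscale k (image_measure mu mT).
have main : mu E = m E.
  apply: lebesgue_measure_unique => // _ [[x y] _ <-].
  change (mu `]x, y] = `|c|%:E * mu ((fun v : R => c * v + b)%R @^-1` `]x, y])).
  rewrite lebesgue_measure_itv /=.
  have [cpos|cneg] := ltP 0%R c.
    have -> : (fun v : R => c * v + b)%R @^-1` `]x, y] = [set` `](x - b) / c, (y - b) / c]%R].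
      apply/seteqP; split => v; rewrite /= !in_itv /= ltr_pdivrMr// ler_pdivlMr// ltrBlDr lerBrDr (mulrC v);
      by [].
    rewrite lebesgue_measure_itv /= !lte_fin ltr_pM2r ?invr_gt0// ltrD2r.
    case: ifPn => _; last by rewrite mule0.
    rewrite -!EFinB -EFinM gtr0_norm//; congr _%:E; field; exact: lt0r_neq0.
  have cn : (c < 0)%R by rewrite lt_neqAle c0.
  have -> : (fun v : R => c * v + b)%R @^-1` `]x, y] = [set` `[(y - b) / c, (x - b) / c[%R].
    apply/seteqP; split => v; rewrite /= !in_itv /= ler_ndivrMr// ltr_ndivlMr// ltrBlDr lerBrDr (mulrC v) andbC;
    by [].
  rewrite lebesgue_measure_itv /= !lte_fin ltr_nM2r ?invr_lt0// ltrD2r.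
  case: ifPn => _; last by rewrite mule0.
  rewrite -!EFinB -EFinM ltr0_norm//; congr _%:E; field; exact: ltr0_neq0.
rewrite main; change (mu ((fun v : R => c * v + b)%R @^-1` E) = `|c|^-1%:E * (`|c|%:E * mu ((fun v : R => c * v + b)%R @^-1` E))).
by rewrite muleA -EFinM mulVf ?gt_eqF// mul1e.
Qed.

Lemma shear2 (c : R) (f : R -> R) (E : set (MR * MR)) : c != 0%R -> measurable_fun [set: MR] (f : MR -> MR) ->
  measurable E -> mu2 [set u : R * R | E (u.1, c * u.2 + f u.1)%R] = (`|c|^-1)%:E * mu2 E.
Proof.
move=> c0 mf mE; rewrite /product_measure1 /=.
rewrite -ge0_integralZl//; last by exact: (@measurable_fun_xsection _ _ _ _ _ mu).
apply: eq_integral => x _; rewrite /= -(@lebesgue_measure_affine c (f x))//; last exact: measurable_xsection.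
Qed.

Lemma measurable_swap_preimage (E : set (MR * MR)) : measurable E -> measurable [set u : MR * MR | E (u.2, u.1)].
Proof.
move=> mE; rewrite -[X in measurable X]setTI.
by apply: (measurable_fun_pair measurable_snd measurable_fst).
Qed.

Lemma swap2 (E : set (MR * MR)) : measurable E -> mu2 [set u : R * R | E (u.2, u.1)] = mu2 E.
Proof.
move=> mE.
have ms : measurable_fun [set: MR * MR] (fun u : MR * MR => (u.2, u.1)).
  by apply: measurable_fun_pair; [exact: measurable_snd|exact: measurable_fst].
have := @product_measure_unique _ _ _ _ R mu mu (image_measure mu2 ms) _ E mE.
rewrite image_measureE => -> // A B mA mB; rewrite image_measureE muleC -product_measure1E//.
by congr (mu2 _); apply/seteqP; split => -[x y] [].
Qed.

Lemma shear1 (c : R) (f : R -> R) (E : set (MR * MR)) : c != 0%R -> measurable_fun [set: MR] (f : MR -> MR) ->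
  measurable E -> mu2 [set u : R * R | E (c * u.1 + f u.2, u.2)%R] = (`|c|^-1)%:E * mu2 E.
Proof.
move=> c0 mf mE; have mE' := measurable_swap_preimage mE.
rewrite -(swap2 mE) -(shear2 c0 mf mE') -[LHS]swap2//.
rewrite -[X in measurable X]setTI.
have mg : measurable_fun [set: MR * MR] (fun u : MR * MR => (c * u.1 + f u.2, u.2) : MR * MR)%R.
  apply: measurable_fun_pair; last exact: measurable_snd.
  apply: measurable_funD; first by apply: measurable_funM => //; exact: measurable_fst.
  exact: measurableT_comp measurable_snd.
exact: mg.
Qed.

Local Notation cx := (fun u : R * R => u.1 +i* u.2).

Lemma measurable_caffine (a b : C) : measurable_fun [set: MR * MR]
  (fun u : MR * MR => (Re (a * cx u + b)%R, Im (a * cx u + b)%R) : MR * MR).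
Proof.
case: a => x y; case: b => b1 b2 /=.
have m1 (k : R) : measurable_fun [set: MR * MR] (fun u : MR * MR => k * u.1)%R.
  by apply: measurable_funM => //; exact: measurable_fst.
have m2 (k : R) : measurable_fun [set: MR * MR] (fun u : MR * MR => k * u.2)%R.
  by apply: measurable_funM => //; exact: measurable_snd.
apply: measurable_fun_pair; apply: measurable_funD => //; [exact: measurable_funB|exact: measurable_funD].
Qed.

(** If [Re a] is not 0, multiplication by [a] is a product of a horizontal and a vertical shear with
    scaling, each handled by Fubini. *)
Lemma lebesgue2_affine (a b : C) (E : set (MR * MR)) : a != 0%R -> measurable E ->
  mu2 [set u : R * R | E (Re (a * cx u + b)%R, Im (a * cx u + b)%R)] = ((normc a ^+ 2)^-1)%:E * mu2 E.
Proof.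
have gen (a' b' : C) (E' : set (MR * MR)) : Re a' != 0%R -> measurable E' ->
    mu2 [set u : R * R | E' (Re (a' * cx u + b')%R, Im (a' * cx u + b')%R)] = ((normc a' ^+ 2)^-1)%:E * mu2 E'.
  move=> x0 mE'; case: a' b' x0 => x y [b1 b2] /= x0.
  have n0 : (0 < x ^+ 2 + y ^+ 2)%R by rewrite ltr_wpDr ?sqr_ge0// exprn_even_gt0.
  pose f1 v : R := (- (y * v) + b1)%R; pose f2 u : R := (y * (u - b1) / x + b2)%R.
  pose c2 : R := ((x ^+ 2 + y ^+ 2) / x)%R.
  have c20 : c2 != 0%R by rewrite mulf_neq0 ?invr_eq0// gt_eqF.
  have mf1 : measurable_fun [set: MR] (f1 : MR -> MR).
    by apply: measurable_funD => //; apply: measurable_funN; apply: measurable_funM.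
  have mf2 : measurable_fun [set: MR] (f2 : MR -> MR).
    by apply: measurable_funD => //; apply: measurable_funM => //; apply: measurable_funM => //; apply: measurable_funB.
  pose E1 := [set u : MR * MR | E' (u.1, c2 * u.2 + f2 u.1)%R].
  have mE1 : measurable E1.
    rewrite -[X in measurable X]setTI.
    have mg : measurable_fun [set: MR * MR] (fun u : MR * MR => (u.1, c2 * u.2 + f2 u.1) : MR * MR)%R.
      apply: measurable_fun_pair; first exact: measurable_fst.
      apply: measurable_funD; first by apply: measurable_funM => //; exact: measurable_snd.
      exact: measurableT_comp measurable_fst.
    exact: mg.
  have := shear1 x0 mf1 mE1; rewrite (shear2 c20 mf2 mE') => E2.
  rewrite (_ : [set _ | _] = [set u : R * R | E1 (x * u.1 + f1 u.2, u.2)%R]).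
    rewrite E2 muleA -EFinM -normfV -normfV -normrM ger0_norm.
      congr (_%:E * _); rewrite sqr_sqrtr ?ltW// /c2; field.
      by rewrite x0 gt_eqF.
    by rewrite /c2 invf_div mulrA mulVf// mul1r invr_ge0 ltW.
  have e1 u v : (x * u + f1 v = x * u - y * v + b1)%R by rewrite /f1 addrA.
  have e2 u v : (c2 * v + f2 (x * u - y * v + b1) = x * v + y * u + b2)%R.
    by rewrite /c2 /f2; field; exact: x0.
  by apply/seteqP; split => -[u v]; rewrite /E1 /= e1 e2.
move=> a0 mE; have [x0|x0] := eqVneq (Re a) 0%R; last exact: gen.
(* A purely imaginary [a] is the product of [1 + i] and [Im a / 2 * (1 + i)], whose real parts are
   not 0. *)
pose e : C := (1 +i* 1)%R; have e0 : Re e != 0%R by rewrite oner_eq0.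
pose a1 : C := (Im a / 2 +i* (Im a / 2))%R.
have aE : (a1 * e = a)%R.
  by case: a x0 @a1 {a0} => x y /= -> ; apply/eqP; rewrite eq_complex /=; apply/andP; split; apply/eqP; field.
have ae : Re a1 != 0%R.
  apply: contra a0 => /eqP h; rewrite -aE; apply/eqP; rewrite /a1; move: h; rewrite /a1 /= => ->.
  exact: mul0r.
pose E1 := [set u : MR * MR | E (Re (a1 * cx u + b)%R, Im (a1 * cx u + b)%R)].
have mE1 : measurable E1.
  by rewrite -[X in measurable X]setTI; exact: (measurable_caffine a1 b).
have := gen e 0%R E1 e0 mE1; rewrite (gen _ b E ae mE).
rewrite (_ : [set _ | _] = [set u : R * R | E (Re (a * cx u + b)%R, Im (a * cx u + b)%R)]).
  move=> ->; rewrite muleA -EFinM; congr (_%:E * _).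
  by rewrite -invfM -exprMn mulrC -Normc.normcM aE.
have e3 (z : C) : (Re z +i* Im z = z)%R by case: z.
by apply/seteqP; split => -[u v]; rewrite /E1 /mkset addr0 e3 mulrA aE.
Qed.

End Affine.

Section MeasureTools.
Local Open Scope ereal_scope.
Variable R : realType.

Section Density.
Context d (T : measurableType d) (m : {measure set T -> \bar R}) (f : T -> R).
Hypotheses (mf : measurable_fun [set: T] f) (f0 : forall x, (0 <= f x)%R).

Definition density (E : set T) : \bar R := \int[m]_(x in E) (f x)%:E.

Let density0 : density set0 = 0. Proof. by rewrite /density integral_set0. Qed.

Let density_ge0 E : 0 <= density E.
Proof. by apply: integral_ge0 => x _; rewrite lee_fin. Qed.

Let density_sigma_additive : semi_sigma_additive density.
Proof.
move=> F mF tF mUF; rewrite /density ge0_integral_bigcup//=.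
- by apply: is_cvg_ereal_nneg_natsum_cond => n _ _; exact: density_ge0.
- by apply: measurable_funTS; exact/measurable_EFinP.
- by move=> x _; rewrite lee_fin.
Qed.

Definition density_measure : {measure set T -> \bar R}.
Proof.
by unshelve refine (HB.pack density (@isMeasure.Build _ T R density density0 density_ge0 density_sigma_additive)).
Defined.

End Density.

Lemma measure_eq_cover d (T : measurableType d) (M1 M2 : {measure set T -> \bar R}) (K : nat -> set T) :
  (forall n, measurable (K n)) ->
  (forall n E, measurable E -> E `<=` K n -> M1 E = M2 E) ->
  forall E, measurable E -> E `<=` \bigcup_n K n -> M1 E = M2 E.
Proof.
move=> mK MK E mE EK.
have -> : E = \bigcup_n (E `&` seqDU K n).
  by rewrite -setI_bigcupr -seqDU_bigcup_eq; apply/esym/setIidPl.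
have mD n : measurable (seqDU K n).
  by apply: measurableD => //; exact: bigsetU_measurable.
have mI n : measurable (E `&` seqDU K n) by exact: measurableI.
have tI : trivIset setT (fun n => E `&` seqDU K n).
  by apply: trivIset_setIl; exact: trivIset_seqDU.
have mU : measurable (\bigcup_n (E `&` seqDU K n)) by exact: bigcup_measurable.
rewrite !measure_semi_bigcup//; apply: eq_eseriesr => n _; apply: (MK n) => //.
by move=> x [_ []].
Qed.

Local Notation MR := (measurableTypeR R).

Lemma ocitv_measure_unique (M1 M2 : {measure set MR -> \bar R}) :
  (forall x y : R, M1 `]x, y]%classic = M2 `]x, y]%classic) -> (forall x y : R, M1 `]x, y]%classic < +oo) ->
  forall A : set MR, measurable A -> M1 A = M2 A.
Proof.
move=> M12 fin A mA; apply: (@measure_unique _ R MR (@ocitv R) (fun n => [set` `]- n%:R, n%:R]%R])) => //.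
- exact: ocitvI.
- by move=> n; apply: is_ocitv.
- apply/seteqP; split => // x _; exists (Num.truncn `|x|).+1 => //=; rewrite in_itv /=.
  have := truncnS_gt `|x|%R; move: (_%:R) => y; rewrite ltr_norml => /andP[-> /ltW ->] //.
- by move=> _ [[x y] _ <-]; exact: M12.
Qed.

Lemma rect_measure_unique (M1 M2 : {measure set (MR * MR) -> \bar R}) :
  M1 setT < +oo ->
  (forall a b c e : R, M1 (`]a, b]%classic `*` `]c, e]%classic) = M2 (`]a, b]%classic `*` `]c, e]%classic)) ->
  forall A : set (MR * MR), measurable A -> M1 A = M2 A.
Proof.
move=> fin M12.
have mitv (x y : R) : measurable (`]x, y]%classic : set MR) by exact: measurable_itv.
have fin1 E : measurable E -> M1 E < +oo.
  by move=> mE; apply: le_lt_trans fin; apply: le_measure; rewrite ?inE.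
have step1 (A : set MR) (c e : R) : measurable A -> M1 (A `*` `]c, e]%classic) = M2 (A `*` `]c, e]%classic).
  pose N (M : {measure set (MR * MR) -> \bar R}) : {measure set MR -> \bar R} :=
    image_measure (mrestr M (measurableX measurableT (mitv c e))) (@measurable_fst _ _ MR MR).
  have NE M B : N M B = M (B `*` `]c, e]%classic).
    by rewrite /N image_measureE /mrestr; congr (M _); apply/seteqP; split => -[x y] /=; tauto.
  move=> mA; rewrite -!NE; apply: ocitv_measure_unique => // x y; rewrite !NE//.
  by apply: fin1; exact: measurableX.
have step2 (A B : set MR) : measurable A -> measurable B -> M1 (A `*` B) = M2 (A `*` B).
  move=> mA mB.
  pose N (M : {measure set (MR * MR) -> \bar R}) : {measure set MR -> \bar R} :=
    image_measure (mrestr M (measurableX mA measurableT)) (@measurable_snd _ _ MR MR).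
  have NE M B' : N M B' = M (A `*` B').
    by rewrite /N image_measureE /mrestr; congr (M _); apply/seteqP; split => -[x y] /=; tauto.
  rewrite -!NE; apply: ocitv_measure_unique => // x y; rewrite !NE//; first exact: step1.
  by apply: fin1; exact: measurableX.
move=> A mA.
apply: (@measure_unique _ R (MR * MR)%type [set A `*` B | A in measurable & B in measurable] (fun=> setT)) => //.
- exact: measurable_prod_measurableType.
- by move=> _ _ [X mX [Y mY <-]] [X' mX' [Y' mY' <-]]; exists (X `&` X'); [exact: measurableI|
    exists (Y `&` Y'); [exact: measurableI|rewrite setXI]].
- by move=> _; exists setT => //; exists setT => //; rewrite setXTT.
- by apply/seteqP; split => // x _; exists 0%N.
- by move=> _ [X mX [Y mY <-]]; exact: step2.
Qed.

End MeasureTools.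

Section SecondCountable.

Lemma second_countable_prod_open (Y Z : topologicalType) (O : set (Y * Z)) :
  @second_countable Y -> @second_countable Z -> open O ->
  exists (A : nat -> set Y) (B : nat -> set Z), [/\ forall n, open (A n), forall n, open (B n) &
    O = \bigcup_n (A n `*` B n)].
Proof.
move=> [bY cY [oY nY]] [bZ cZ [oZ nZ]] oO.
pose P := [set u : set Y * set Z | [/\ bY u.1, bZ u.2 & u.1 `*` u.2 `<=` O]].
have cP : countable P.
  apply: (@sub_countable _ _ _ (bY `*` bZ)); last exact: countableX.
  by apply: subset_card_le => -[a b] [].
have [[u0 Pu0]|Pe] := pselect (P !=set0); last first.
  exists (fun=> set0), (fun=> set0); split; try by move=> _; exact: open0.
  apply/seteqP; split => [[y z] Oyz|? [_ _ []]//]; exfalso; apply: Pe.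
  have [[U V] [/nY[b [bb by'] bU] /nZ[c [bc cz] cV]] UV] : nbhs (y, z) O.
    by move: oO; rewrite openE; exact.
  by exists (b, c); split => // -[y' z'] [/bU ? /cV ?]; exact: UV.
have [f fP] : exists f : nat -> set Y * set Z, range f = P.
  have /pcard_surjP[f sf] : (P #<= [set: nat])%card by exact: cP.
  exists (fun n => if pselect (P (f n)) then f n else u0); apply/seteqP; split.
    by move=> _ [n _ <-]; case: pselect.
  by move=> u Pu; have [n _ fn] := sf u Pu; exists n => //; rewrite fn; case: pselect.
have Pf n : P (f n) by rewrite -fP; exists n.
exists (fun n => (f n).1), (fun n => (f n).2); split.
- by move=> n; apply: oY; have [] := Pf n.
- by move=> n; apply: oZ; have [] := Pf n.
apply/seteqP; split => [[y z] Oyz|u [n _ Pu]]; last by have [_ _] := Pf n; apply.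
have [[U V] [/nY[b [bb by'] bU] /nZ[c [bc cz] cV]] UV] : nbhs (y, z) O.
  by move: oO; rewrite openE; exact.
have : P (b, c) by split => // -[y' z'] [/bU ? /cV ?]; exact: UV.
by rewrite -fP => -[n _ fn]; exists n => //; rewrite fn.
Qed.

Lemma second_countable_real (R : realType) : @second_countable R.
Proof.
exists [set `]ratr q.1, ratr q.2[%classic | q in [set: rat * rat]].
  by apply: (@sub_countable _ _ _ [set: rat * rat]); [exact: card_image_le|exact: countableP].
split; first by move=> _ [[a b] _ <-]; exact: interval_open.
move=> x A /nbhs_ballP[e /= e0 eA].
have [q /= ] := rat_in_itvoo (ltac:(by rewrite ltrBlDr ltrDl) : x - e < x).
have [q' /= ] := rat_in_itvoo (ltac:(by rewrite ltrDl) : x < x + e).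
rewrite !in_itv /= => /andP[q1 q2] /andP[q3 q4].
exists `]ratr q, ratr q'[%classic; first by split; [exists (q, q')|rewrite /= in_itv /= q4 q1].
move=> y; rewrite /= in_itv /= => /andP[y1 y2]; apply: eA.
by rewrite /ball /= ltr_norml; apply/andP; split; lra.
Qed.

Variables (R : realType).
Local Notation MR := (measurableTypeR R).

Lemma measurable_open_R (A : set R) : open A -> measurable (A : set MR).
Proof. by move=> oA; exact: open_measurable. Qed.

Lemma measurable_open_R2 (O : set (R * R)) : open O -> measurable (O : set (MR * MR)).
Proof.
move=> oO; have [A [B [oA oB ->]]] := second_countable_prod_open (second_countable_real R) (second_countable_real R) oO.
by apply: bigcup_measurable => n _; apply: measurableX; exact: measurable_open_R.
Qed.

Lemma open_cx (O : set R[i]) : open O -> open [set u : R * R | O (u.1 +i* u.2)].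
Proof.
move=> /openCP oO; rewrite openE => -[x y] /oO[e e0 eO].
have e2 : 0 < e / 2 by rewrite divr_gt0.
exists (ball x (e / 2), ball y (e / 2)) => /=; first by split; exact: nbhsx_ballx.
move=> [x' y'] /= [xx yy]; apply: eO; apply: le_lt_trans (normc_le_ReIm _) _.
rewrite [Re _]/= [Im _]/=; move: xx yy; rewrite /ball /= (distrC x) (distrC y); lra.
Qed.

Lemma measurable_cx (O : set R[i]) : open O -> measurable [set u : MR * MR | O (u.1 +i* u.2)].
Proof. by move=> oO; exact: measurable_open_R2 (open_cx oO). Qed.

Lemma measurable_patch d (Y : measurableType d) (D : set Y) (f : Y -> R) (k : R) : measurable D ->
  (forall c : R, measurable [set y | D y /\ c < f y]) ->
  measurable_fun [set: Y] (fun y => if pselect (D y) then f y else k : MR).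
Proof.
move=> mD mf _; apply: (measurability _ (RGenOInfty.measurableE R)) => //.
move=> _ [_ [c ->] <-]; rewrite setTI.
have [kc|kc] := ltP c k.
  rewrite (_ : _ @^-1` _ = [set y | D y /\ c < f y] `|` ~` D); last first.
    apply/seteqP; split => y; rewrite /= in_itv /= andbT; case: pselect => Dy //=; tauto.
  by apply: measurableU => //; exact: measurableC.
rewrite (_ : _ @^-1` _ = [set y | D y /\ c < f y])//.
have ck : (c < k) = false by rewrite ltNge kc.
by apply/seteqP; split => y; rewrite /= in_itv /= andbT; case: pselect => Dy /=; rewrite ?ck //; tauto.
Qed.

End SecondCountable.

Lemma cdiff_unique (R : realType) (f : R[i] -> R[i]) z A B : cdiff f z A -> cdiff f z B -> A = B.
Proof. by move=> /cdiffP[_ <-] /cdiffP[_ <-]. Qed.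

Section DensityBounds.
Local Open Scope ereal_scope.
Context d (T : measurableType d) (R : realType) (m : {measure set T -> \bar R}) (f : T -> R).
Hypotheses (mf : measurable_fun [set: T] f) (f0 : forall x, (0 <= f x)%R).

Lemma density_le (E E' : set T) (c : R) : measurable E -> measurable E' -> (0 <= c)%R ->
  (forall x, E x -> (0 < f x)%R -> E' x /\ (f x <= c)%R) -> density m f E <= c%:E * m E'.
Proof.
move=> mE mE' c0 fE.
have mef : measurable_fun [set: T] (EFin \o f) by exact/measurable_EFinP.
have -> : density m f E = density m f (E `&` E').
  rewrite /density [LHS]integral_mkcond [RHS]integral_mkcond; apply: eq_integral => x _.
  rewrite /patch; case: ifPn => [|]; case: ifPn => //; rewrite !in_setE ?notin_setE /=.
    move=> nEE' Ex; have [fx|fx] := ltP 0%R (f x); last by congr _%:E; apply/eqP; rewrite eq_le f0 fx.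
    by exfalso; apply: nEE'; split => //; have [] := fE x Ex fx.
  by move=> [].
apply: (@le_trans _ _ (c%:E * m (E `&` E'))); last first.
  by rewrite lee_wpmul2l ?lee_fin// le_measure ?inE//; exact: measurableI.
rewrite -integral_cst; last exact: measurableI.
apply: ge0_le_integral => //; first exact: measurableI.
- by move=> x _; rewrite lee_fin.
- exact: measurable_funTS.
- move=> x [Ex _]; rewrite lee_fin; have [fx|fx] := ltP 0%R (f x); last exact: le_trans c0.
  by have [] := fE x Ex fx.
Qed.

Lemma density_ge (E E' : set T) (c : R) : measurable E -> measurable E' -> (0 <= c)%R ->
  E' `<=` E -> (forall x, E' x -> (c <= f x)%R) -> c%:E * m E' <= density m f E.
Proof.
move=> mE mE' c0 EE' fE.
have mef : measurable_fun [set: T] (EFin \o f) by exact/measurable_EFinP.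
apply: (@le_trans _ _ (density m f E')); last first.
  by apply: ge0_subset_integral => //; [exact: measurable_funTS|move=> x _; rewrite lee_fin].
rewrite -integral_cst//; apply: ge0_le_integral => //; last exact: measurable_funTS.
Qed.

End DensityBounds.

Section Rectangles.
Variable R : realType.
Local Notation MR := (measurableTypeR R).
Local Notation mu := (@lebesgue_measure R).
Local Notation mu2 := (mu \x mu)%E.

(** Half-open, so that the quarters of a rectangle are disjoint. *)
Definition rect (a b c e : R) : set (R * R) := (`]a, b] `*` `]c, e])%classic.

Lemma measurable_rect a b c e : measurable (rect a b c e : set (MR * MR)).
Proof. by apply: measurableX; exact: measurable_itv. Qed.

Lemma rectP a b c e u : rect a b c e u <-> [/\ a < u.1, u.1 <= b, c < u.2 & u.2 <= e].
Proof. by rewrite /rect /= !in_itv /=; split => [[/andP[? ?] /andP[? ?]]|[? ? ? ?]]; [|split; apply/andP]. Qed.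

Lemma lebesgue2_rect a b c e : a <= b -> c <= e -> mu2 (rect a b c e) = ((b - a) * (e - c))%:E.
Proof.
move=> ab ce; rewrite product_measure1E; try exact: measurable_itv.
change (mu `]a, b]%classic * mu `]c, e]%classic = ((b - a) * (e - c))%:E)%E.
rewrite !lebesgue_measure_itv /= !lte_fin; case: ltP => h1; case: ltP => h2; rewrite -?EFinB -?EFinM ?mule0 ?mul0e//;
  congr _%:E; [have -> : e = c by lra|have -> : b = a by lra|have -> : b = a by lra]; ring.
Qed.

Lemma rect_sub a b c e a' b' c' e' : a' <= a -> b <= b' -> c' <= c -> e <= e' -> rect a b c e `<=` rect a' b' c' e'.
Proof. by move=> ? ? ? ? u /rectP[? ? ? ?]; apply/rectP; split; lra. Qed.

(** Here [W] is the weight at the base point, [e'] its variation, [k] the area of the image and [d]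
    the relative margin by which a rectangle is enlarged or shrunk. The total error must not exceed
    [e]. *)
Lemma pick_params (W k e : R) : 0 <= W -> 0 <= k -> 0 < e -> exists d e', [/\ 0 < d <= 4^-1, 0 < e',
  (W + e') * ((1 + 2 * d) ^+ 2 * k) <= W * k + e &
  W * k - e <= Num.max 0 (W - e') * ((1 - 2 * d) ^+ 2 * k)].
Proof.
move=> W0 k0 e0; pose al := W * k; have al0 : 0 <= al by rewrite mulr_ge0.
pose e' := e / (8 * (k + 1)).
have k8 : 0 < 8 * (k + 1) by lra.
have e'0 : 0 < e' by rewrite divr_gt0.
have e'k : e' * k <= e / 8.
  rewrite /e' mulrAC ler_pdivrMr// (_ : e / 8 * (8 * (k + 1)) = e * k + e); last by field.
  by rewrite lerDl ltW.
have a12 : 0 < 12 * (al + 1) by lra.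
have e12 : 0 < e / (12 * (al + 1)) by rewrite divr_gt0.
have [d [d0 d4 de]] := exists_le2 (ltac:(by rewrite invr_gt0) : 0 < 4^-1 :> R) e12.
have da : d * al <= e / 12.
  move: de; rewrite ler_pdivlMr// => de; have := mulr_ge0 (ltW d0) al0; lra.
exists d, e'; split => //; first by rewrite d0.
- have h : (1 + 2 * d) ^+ 2 <= 1 + 6 * d by nra.
  apply: (@le_trans _ _ ((W + e') * ((1 + 6 * d) * k))).
    by rewrite ler_wpM2l ?ler_wpM2r//; lra.
  rewrite (_ : _ * _ = al + 6 * (d * al) + e' * k + 6 * (d * (e' * k))); last by rewrite /al; ring.
  have : d * (e' * k) <= 4^-1 * (e' * k) by rewrite ler_wpM2r// mulr_ge0// ltW.
  by rewrite -/al; lra.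
- have h : 1 - 4 * d <= (1 - 2 * d) ^+ 2 by have := sqr_ge0 d; lra.
  have [We|We] := leP 0 (W - e'); last first.
    rewrite mul0r -/al subr_le0; apply: (@le_trans _ _ (e' * k)); last by lra.
    by rewrite ler_wpM2r//; lra.
  apply: (@le_trans _ _ ((W - e') * ((1 - 4 * d) * k))); last by rewrite ler_wpM2l ?ler_wpM2r.
  rewrite (_ : (W - e') * _ = al - 4 * (d * al) - e' * k + 4 * (d * (e' * k))); last by rewrite /al; ring.
  have := mulr_ge0 (ltW d0) (mulr_ge0 (ltW e'0) k0).
  by rewrite -/al; lra.
Qed.

Let mrect a b c e : measurable (rect a b c e : set (MR * MR)). Proof. exact: measurable_rect. Qed.

Lemma rect_split1 (M : {measure set (MR * MR) -> \bar R}) a b' b c e : a <= b' -> b' <= b ->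
  (M (rect a b c e) = M (rect a b' c e) + M (rect b' b c e))%E.
Proof.
move=> h1 h2; rewrite -measureU//; last first.
  by apply/seteqP; split => // u [/rectP[? ? ? ?] /rectP[? ? ? ?]]; lra.
congr (M _); apply/seteqP; split => u; last by move=> [|] /rectP[? ? ? ?]; apply/rectP; split; lra.
by move=> /rectP[? ? ? ?]; have [?|?] := leP u.1 b'; [left|right]; apply/rectP.
Qed.

Lemma rect_split2 (M : {measure set (MR * MR) -> \bar R}) a b c e' e : c <= e' -> e' <= e ->
  (M (rect a b c e) = M (rect a b c e') + M (rect a b e' e))%E.
Proof.
move=> h1 h2; rewrite -measureU//; last first.
  by apply/seteqP; split => // u [/rectP[? ? ? ?] /rectP[? ? ? ?]]; lra.
congr (M _); apply/seteqP; split => u; last by move=> [|] /rectP[? ? ? ?]; apply/rectP; split; lra.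
by move=> /rectP[? ? ? ?]; have [?|?] := leP u.2 e'; [left|right]; apply/rectP.
Qed.

Lemma measure_sub_fin_num (M : {measure set (MR * MR) -> \bar R}) E F' : measurable E -> measurable F' -> E `<=` F' ->
  (M F' < +oo)%E -> M E \is a fin_num.
Proof.
by move=> mE mF EF fin; rewrite ge0_fin_numE//; apply: le_lt_trans fin; apply: le_measure; rewrite ?inE.
Qed.

Lemma rect_split4 (M : {measure set (MR * MR) -> \bar R}) a b w h : 0 < w -> 0 < h ->
  (M (rect a (a + w) b (b + h)) < +oo)%E ->
  fine (M (rect a (a + w) b (b + h))) =
  fine (M (rect a (a + w / 2) b (b + h / 2))) + fine (M (rect (a + w / 2) (a + w / 2 + w / 2) b (b + h / 2))) +
  (fine (M (rect a (a + w / 2) (b + h / 2) (b + h / 2 + h / 2))) +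
   fine (M (rect (a + w / 2) (a + w / 2 + w / 2) (b + h / 2) (b + h / 2 + h / 2)))).
Proof.
move=> w0 h0 fin; have e1 x : a + x / 2 + x / 2 = a + x by field.
have e2 x : b + x / 2 + x / 2 = b + x by field.
rewrite e1 e2.
have fi x' b' y' e' : a <= x' -> b' <= a + w -> b <= y' -> e' <= b + h -> M (rect x' b' y' e') \is a fin_num.
  by move=> *; apply: measure_sub_fin_num fin => //; try exact: measurable_rect; exact: rect_sub.
rewrite (@rect_split2 M _ _ _ (b + h / 2)); [|lra|lra].
rewrite (@rect_split1 M _ (a + w / 2)); [|lra|lra].
rewrite (@rect_split1 M _ (a + w / 2) _ (b + _)); [|lra|lra].
by rewrite !fineD//; first [apply: fi; lra|rewrite fin_numD; apply/andP; split; apply: fi; lra].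
Qed.

Lemma rect_shift a b c e d1 d2 D u u' : D <= d1 -> D <= d2 -> - D <= u'.1 - u.1 <= D -> - D <= u'.2 - u.2 <= D ->
  rect a b c e u -> rect (a - d1) (b + d1) (c - d2) (e + d2) u'.
Proof.
by move=> ? ? /andP[? ?] /andP[? ?] /rectP[? ? ? ?]; apply/rectP; split; lra.
Qed.

Lemma rect_margin_area a b w h d : 0 < w -> 0 < h -> - 4^-1 <= d ->
  mu2 (rect (a - d * w) (a + w + d * w) (b - d * h) (b + h + d * h)) = ((1 + 2 * d) ^+ 2 * (w * h))%:E.
Proof.
move=> w0 h0 d4.
have dw : - 4^-1 * w <= d * w by rewrite ler_wpM2r// ltW.
have dh : - 4^-1 * h <= d * h by rewrite ler_wpM2r// ltW.
by rewrite lebesgue2_rect; [congr _%:E; ring|lra|lra].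
Qed.

End Rectangles.

(** * The change of variables formula for holomorphic maps *)

Section ChangeOfVariables.
Variable R : realType.
Local Notation C := R[i].
Local Notation MR := (measurableTypeR R).
Local Notation mu := (@lebesgue_measure R).
Local Notation mu2 := (mu \x mu)%E.
Local Notation cx u := (u.1 +i* u.2).
Implicit Types (z y : C).

Variables (O O' : set C) (F G A : C -> C) (w : C -> R).
Hypotheses (oO : open O) (oO' : open O') (FO : forall z, O z -> O' (F z)) (GO : forall y, O' y -> O (G y))
  (GF : forall z, O z -> G (F z) = z) (FG : forall y, O' y -> F (G y) = y)
  (dF : forall z, O z -> cdiff F z (A z)) (dG : forall y, O' y -> exists B, cdiff G y B).

Definition rcont_at (h : C -> R) z := forall e, 0 < e ->
  exists2 k : R, 0 < k & forall y, normc (y - z) < k -> `|h y - h z| < e.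

Hypotheses (w0 : forall y, 0 <= w y) (cw : forall y, O' y -> rcont_at w y).
(** Continuity of [v] is assumed directly, in place of continuity of [A]: in the applications [v] is
    a density already known to be continuous. *)
Let v z := w (F z) * normc (A z) ^+ 2.
Hypothesis cv : forall z, O z -> rcont_at v z.

Lemma measurable_rcont (D : set C) (h : C -> R) (k : R) : open D -> (forall z, D z -> rcont_at h z) ->
  measurable_fun [set: MR * MR] (fun u : MR * MR => if pselect (D (cx u)) then h (cx u) else k : MR).
Proof.
move=> oD ch; apply: measurable_patch => [|c]; first exact: measurable_cx.
have -> : [set u : MR * MR | D (cx u) /\ c < h (cx u)] = [set u : MR * MR | [set z | D z /\ c < h z] (cx u)] by [].
apply: measurable_cx; apply/openCP => z [Dz hz].
have hz0 : 0 < h z - c by rewrite subr_gt0.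
have [k1 k10 k1P] := ch z Dz _ hz0; have [k2 k20 k2P] := proj1 (openCP _) oD z Dz.
have [k' [k'0 h1 h2]] := exists_le2 k10 k20; exists k' => // y yz; split; first by apply: k2P; lra.
by have := k1P y (lt_le_trans yz h1); rewrite ltr_norml => /andP[]; lra.
Qed.

Let wt (u : MR * MR) : R := if pselect (O' (cx u)) then w (cx u) else 0.
Let vt (u : MR * MR) : R := if pselect (O (cx u)) then v (cx u) else 0.
Let Gt (u : MR * MR) : MR * MR := (if pselect (O' (cx u)) then Re (G (cx u)) else 0,
  if pselect (O' (cx u)) then Im (G (cx u)) else 0).

Let wt0 u : 0 <= wt u.
Proof. by rewrite /wt; case: pselect => /= _; [exact: w0|exact: lexx]. Qed.
Let v0 z : 0 <= v z.
Proof. exact: mulr_ge0 (w0 _) (sqr_ge0 _). Qed.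

Let vt0 u : 0 <= vt u.
Proof. by rewrite /vt; case: pselect => /= _; [exact: v0|exact: lexx]. Qed.
Let mwt : measurable_fun [set: MR * MR] wt.
Proof. exact: (@measurable_rcont O' w 0 oO' cw). Qed.
Let mvt : measurable_fun [set: MR * MR] vt.
Proof. exact: (@measurable_rcont O v 0 oO cv). Qed.

Let mGt : measurable_fun [set: MR * MR] Gt.
Proof.
have cG y : O' y -> forall e, 0 < e -> exists2 k : R, 0 < k & forall y', normc (y' - y) < k -> normc (G y' - G y) < e.
  by move=> Oy; apply/cvgC_at; have [B hB] := dG Oy; exact: cdiff_cont hB.
apply: measurable_fun_pair; [apply: (@measurable_rcont O' (fun y => Re (G y)) 0 oO')|
  apply: (@measurable_rcont O' (fun y => Im (G y)) 0 oO')] => y Oy e e0;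
have [k k0 kP] := cG y Oy e e0; exists k => // y' /kP; apply: le_lt_trans; rewrite -raddfB.
- exact: normc_Re.
- exact: normc_Im.
Qed.

Let m1 : {measure set (MR * MR) -> \bar R} := image_measure (density_measure mu2 mwt wt0) mGt.
Let m2 : {measure set (MR * MR) -> \bar R} := density_measure mu2 mvt vt0.

Let m1E E : m1 E = density mu2 wt (Gt @^-1` E). Proof. by []. Qed.
Let m2E E : m2 E = density mu2 vt E. Proof. by []. Qed.

Let mrect a b c e : measurable (rect a b c e : set (MR * MR)). Proof. exact: measurable_rect. Qed.

Section LocalEstimate.
Variables (l1 l2 : R) (z0 : C).
Hypotheses (l10 : 0 < l1) (l20 : 0 < l2) (Oz0 : O z0).
Let L := l1 + l2.
Let L0 : 0 < L. Proof. by rewrite addr_gt0. Qed.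

Let rect_near a b s u : 0 < s -> a <= Re z0 <= a + s * l1 -> b <= Im z0 <= b + s * l2 ->
  rect a (a + s * l1) b (b + s * l2) u -> normc (cx u - z0) <= s * L.
Proof.
move=> s0 /andP[h1 h2] /andP[h3 h4] /rectP[h5 h6 h7 h8].
apply: le_trans (normc_le_ReIm _) _; rewrite !raddfB /= /L mulrDr.
by apply: lerD; rewrite ler_norml; apply/andP; split; lra.
Qed.

Let area_rect a b s : 0 < s -> mu2 (rect a (a + s * l1) b (b + s * l2)) = (s ^+ 2 * (l1 * l2))%:E.
Proof.
move=> s0; rewrite lebesgue2_rect ?lerDl ?mulr_ge0 ?ltW//; congr _%:E; ring.
Qed.

Let local_estimate2 e : 0 < e -> exists2 k : R, 0 < k & forall a b s, 0 < s -> s < k ->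
  a <= Re z0 <= a + s * l1 -> b <= Im z0 <= b + s * l2 ->
  (((v z0 * (l1 * l2) - e) * s ^+ 2)%:E <= m2 (rect a (a + s * l1) b (b + s * l2)) <=
  ((v z0 * (l1 * l2) + e) * s ^+ 2)%:E)%E.
Proof.
move=> e0; have l12 : 0 < l1 * l2 by rewrite mulr_gt0.
have vz0 := v0 z0.
have e'0 : 0 < e / (l1 * l2) by rewrite divr_gt0.
have [k1 k10 k1P] := cv Oz0 e'0; have [k2 k20 k2P] := proj1 (openCP _) oO z0 Oz0.
have [k [k0 kk1 kk2]] := exists_le2 k10 k20.
exists (k / L); first by rewrite divr_gt0.
move=> a b s s0; rewrite ltr_pdivlMr// => sk h1 h2.
have near u : rect a (a + s * l1) b (b + s * l2) u -> O (cx u) /\ `|v (cx u) - v z0| < e / (l1 * l2).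
  by move=> /(rect_near s0 h1 h2) h; split; [apply: k2P; lra|apply: k1P; lra].
rewrite m2E; apply/andP; split.
  apply: (@le_trans _ _ ((Num.max 0 (v z0 - e / (l1 * l2)))%:E * mu2 (rect a (a + s * l1) b (b + s * l2)))%E).
    rewrite area_rect// -EFinM lee_fin.
    rewrite [leRHS](_ : _ = Num.max 0 (v z0 - e / (l1 * l2)) * (l1 * l2) * s ^+ 2); last by ring.
    apply: ler_wpM2r; first exact: sqr_ge0.
    have -> : v z0 * (l1 * l2) - e = (v z0 - e / (l1 * l2)) * (l1 * l2).
      by rewrite mulrBl divfK// gt_eqF.
    by rewrite ler_wpM2r ?(ltW l12)// le_max lexx orbT.
  have max0 : 0 <= Num.max 0 (v z0 - e / (l1 * l2)) by rewrite le_max lexx.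
  apply: (density_ge _ mvt vt0) => //.
  move=> u /near[Ou]; rewrite ltr_norml /vt => /andP[h3 h4]; case: pselect => //= _.
  by rewrite ge_max; apply/andP; split; [exact: v0|lra].
apply: (@le_trans _ _ ((v z0 + e / (l1 * l2))%:E * mu2 (rect a (a + s * l1) b (b + s * l2)))%E).
  apply: (density_le _ mvt vt0) => //; first by rewrite addr_ge0// ltW.
  move=> u Qu _; split => //; have [Ou] := near u Qu; rewrite ltr_norml /vt => /andP[h3 h4].
  by case: pselect => //= _; lra.
rewrite area_rect// -EFinM lee_fin.
rewrite [leLHS](_ : _ = (v z0 * (l1 * l2) + e) * s ^+ 2)//.
by rewrite -[e in RHS](@divfK _ (l1 * l2)) ?gt_eqF//; ring.
Qed.

(** Let [T] be the tangent map [y |-> z0 + B (y - y0)] of [G]. For a small rectangle [Q] the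
    preimage of [Q] under [G] contains that of the shrunken [Qm] under [T] and is contained in that
    of the enlarged [Qp]. Areas of preimages under [T] are multiplied by [|A z0|^2], and the weight
    is within [e'] of [W]. *)
Let local_estimate1 e : 0 < e -> exists2 k : R, 0 < k & forall a b s, 0 < s -> s < k ->
  a <= Re z0 <= a + s * l1 -> b <= Im z0 <= b + s * l2 ->
  (((v z0 * (l1 * l2) - e) * s ^+ 2)%:E <= m1 (rect a (a + s * l1) b (b + s * l2)) <=
  ((v z0 * (l1 * l2) + e) * s ^+ 2)%:E)%E.
Proof.
move=> e0; have l12 : 0 < l1 * l2 by rewrite mulr_gt0.
pose y0 := F z0; have Oy0 : O' y0 := FO Oz0.
have [B hB] := dG Oy0; have hA := dF Oz0; set A0 := A z0 in hA.
have AB : B * A0 = 1.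
  have h : cdiff id z0 (B * A0).
    apply: (@cdiff_ext R (G \o F) id); last exact: cdiff_comp hA hB.
    by have [k k0 kP] := proj1 (openCP _) oO z0 Oz0; exists k => // u /kP; exact: GF.
  exact: cdiff_unique h (cdiff_id z0).
have B0 : B != 0 by apply: contraTneq (oner_neq0 C) => h; rewrite -AB h mul0r eqxx.
have A00 : A0 != 0 by apply: contraTneq (oner_neq0 C) => h; rewrite -AB h mulr0 eqxx.
have nB0 : 0 < normc B by rewrite normc_gt0.
have nA0 : 0 < normc A0 by rewrite normc_gt0.
have nAB : normc B * normc A0 = 1 by rewrite -Normc.normcM AB Normc.normc1.
have nA2 : (normc B ^+ 2)^-1 = normc A0 ^+ 2.
  by apply: (mulfI (lt0r_neq0 (exprn_gt0 2 nB0))); rewrite divff ?expf_neq0 ?gt_eqF// -exprMn nAB expr1n.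
pose W := w y0; pose k := normc A0 ^+ 2 * (l1 * l2).
have k0 : 0 <= k by rewrite mulr_ge0 ?sqr_ge0// ltW.
have [d [e' [/andP[d0 d4] e'0 up low]]] := pick_params (w0 y0) k0 e0.
have vk : v z0 * (l1 * l2) = W * k by rewrite /v /W /k /y0 -mulrA.
have [l [l0 ll1 ll2]] := exists_le2 l10 l20.
(* Tolerances for the linearisation of [F] and of [G]: on a rectangle of size [s] the errors, read
   in the coordinate of [Q], are at most [d * (s * l)], the margin between [Q] and [Qm] or [Qp]. *)
have eps0 : 0 < d * l / (normc B * L) by rewrite divr_gt0 ?mulr_gt0.
have epsG0 : 0 < d * l / (normc A0 * L) by rewrite divr_gt0 ?mulr_gt0.
have [kF kF0 kFP] := hA _ eps0; have [kG kG0 kGP] := hB _ epsG0.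
have [kw kw0 kwP] := cw Oy0 e'0; have [kO kO0 kOP] := proj1 (openCP _) oO' _ Oy0.
pose M := normc A0 + d * l / (normc B * L).
have M0 : 0 < M by rewrite addr_gt0.
have [t1 [t10 t1w t1O]] := exists_le2 kw0 kO0.
have [t2 [t20 t2t1 t2G]] := exists_le2 t10 kG0.
have [t3 [t30 t3F t3t]] := exists_le2 kF0 (divr_gt0 t20 M0).
exists (t3 / L); first by rewrite divr_gt0.
move=> a b s s0; rewrite ltr_pdivlMr// => st h1 h2.
set Q := rect _ _ _ _.
pose T (u : R * R) : R * R := (Re (B * cx u + (z0 - B * y0)), Im (B * cx u + (z0 - B * y0))).
have area_T E : measurable E -> mu2 (T @^-1` E) = ((normc A0 ^+ 2)%:E * mu2 E)%E.
  by move=> mE; rewrite (lebesgue2_affine _ B0 mE) nA2.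
have mT E : measurable E -> measurable (T @^-1` E : set (MR * MR)).
  by move=> mE; rewrite -[X in measurable X]setTI; exact: (measurable_caffine B (z0 - B * y0)).
pose Qp := rect (a - d * (s * l1)) (a + s * l1 + d * (s * l1)) (b - d * (s * l2)) (b + s * l2 + d * (s * l2)).
pose Qm := rect (a + d * (s * l1)) (a + s * l1 - d * (s * l1)) (b + d * (s * l2)) (b + s * l2 - d * (s * l2)).
have sl1 : 0 < s * l1 by rewrite mulr_gt0. have sl2 : 0 < s * l2 by rewrite mulr_gt0.
have dsl1 : 0 < d * (s * l1) by rewrite mulr_gt0. have dsl2 : 0 < d * (s * l2) by rewrite mulr_gt0.
have dl1 : d * (s * l) <= d * (s * l1) by rewrite ler_pM2l// ler_pM2l.
have dl2 : d * (s * l) <= d * (s * l2) by rewrite ler_pM2l// ler_pM2l.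
have aQp : mu2 Qp = ((1 + 2 * d) ^+ 2 * (l1 * l2) * s ^+ 2)%:E.
  rewrite /Qp rect_margin_area//; last by rewrite (le_trans _ (ltW d0))// oppr_le0 invr_ge0.
  by congr _%:E; ring.
have aQm : mu2 Qm = ((1 - 2 * d) ^+ 2 * (l1 * l2) * s ^+ 2)%:E.
  have := @rect_margin_area R a b _ _ (- d) sl1 sl2; rewrite lerN2 !mulNr !opprK /Qm => -> //.
  by congr _%:E; ring.
have preQ u : Q u -> normc (cx u - z0) <= s * L by exact: rect_near.
have mGQ : measurable (Gt @^-1` Q : set (MR * MR)).
  by have := mGt measurableT (measurable_rect a (a + s * l1) b (b + s * l2)); rewrite setTI.
have xcK (z : C) : (Re z +i* Im z) = z by case: z.
have fin_err (x : R) : x <= s * L -> normc B * (d * l / (normc B * L) * x) <= d * (s * l).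
  move=> xs; have -> : normc B * (d * l / (normc B * L) * x) = d * l / L * x.
    by field; rewrite !gt_eqF.
  apply: (@le_trans _ _ (d * l / L * (s * L))).
    by rewrite ler_wpM2l// divr_ge0 ?mulr_ge0 ?ltW.
  by rewrite le_eqVlt; apply/orP; left; apply/eqP; field; rewrite gt_eqF.
rewrite m1E vk; apply/andP; split.
  apply: (@le_trans _ _ ((Num.max 0 (W - e'))%:E * mu2 (T @^-1` Qm))%E).
    have -> : mu2 (T @^-1` Qm) = (normc A0 ^+ 2 * ((1 - 2 * d) ^+ 2 * (l1 * l2) * s ^+ 2))%:E.
      by rewrite EFinM -aQm; exact: area_T (measurable_rect _ _ _ _).
    rewrite -EFinM lee_fin.
    rewrite [leRHS](_ : _ = Num.max 0 (W - e') * ((1 - 2 * d) ^+ 2 * k) * s ^+ 2); last by rewrite /k; ring.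
    by rewrite ler_wpM2r ?sqr_ge0.
  have inQ u : T u \in Qm -> [/\ O' (cx u), `|w (cx u) - W| < e' & Q (Re (G (cx u)), Im (G (cx u)))].
    rewrite inE => TQ; have [y yE0] : exists y, y = cx u by eexists.
    have [zeta zE] : exists zeta, zeta = B * y + (z0 - B * y0) by eexists.
    have {}TQ : Qm (Re zeta, Im zeta) by rewrite zE yE0.
    rewrite -yE0.
    have Qz : Q (Re zeta, Im zeta).
      apply: rect_sub TQ; rewrite ?lerDl ?gerBl ltW//.
    have := preQ _ Qz; rewrite xcK => zz.
    have yE : y - y0 = A0 * (zeta - z0).
      by rewrite zE (_ : _ - z0 = B * (y - y0)) ?mulrA ?(mulrC A0) ?AB ?mul1r//; ring.
    have yy : normc (y - y0) <= normc A0 * (s * L) by rewrite yE Normc.normcM ler_pM2l.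
    have ysmall : normc (y - y0) < t2.
      apply: le_lt_trans yy _; apply: (@lt_le_trans _ _ (M * t3)); last by move: t3t; rewrite ler_pdivlMr// mulrC.
      apply: (@le_lt_trans _ _ (M * (s * L))); last by rewrite ltr_pM2l.
      by apply: ler_wpM2r; [exact: mulr_ge0 (ltW s0) (ltW L0)|rewrite /M lerDl ltW].
    have yt1 := lt_le_trans ysmall t2t1.
    split; [by apply: kOP; exact: lt_le_trans yt1 t1O|by apply: kwP; exact: lt_le_trans yt1 t1w|].
    have := kGP y (lt_le_trans ysmall t2G); rewrite /y0 (GF Oz0) -/y0.
    have -> : G y - z0 - B * (y - y0) = G y - zeta by rewrite zE; ring.
    move=> Gz; have {}Gz : normc (G y - zeta) <= d * (s * l).
      apply: le_trans Gz _; apply: (le_trans (ler_wpM2l (ltW epsG0) yy)).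
      by rewrite le_eqVlt; apply/orP; left; apply/eqP; field; rewrite !gt_eqF.
    have := le_trans (normc_Re _) Gz; have := le_trans (normc_Im _) Gz.
    rewrite !raddfB !ler_norml.
    move=> h3 h4; have := @rect_shift R _ _ _ _ _ _ _ (Re zeta, Im zeta) (Re (G y), Im (G y)) dl1 dl2 h4 h3 TQ.
    by rewrite !addrK !subrK.
  have max0 : 0 <= Num.max 0 (W - e') by rewrite le_max lexx.
  apply: (density_ge _ mwt wt0) => //; [exact: mT (measurable_rect _ _ _ _)| |].
    by move=> u /mem_set /inQ[Ou _ Qu]; rewrite /Gt /=; case: pselect => //=.
  move=> u /mem_set /inQ[Ou wu _]; rewrite /wt; case: pselect => //= _.
  by rewrite ge_max w0 /=; move: wu; rewrite ltr_distl => /andP[/ltW].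
apply: (@le_trans _ _ ((W + e')%:E * mu2 (T @^-1` Qp))%E); last first.
  have -> : mu2 (T @^-1` Qp) = (normc A0 ^+ 2 * ((1 + 2 * d) ^+ 2 * (l1 * l2) * s ^+ 2))%:E.
    by rewrite EFinM -aQp; exact: area_T (measurable_rect _ _ _ _).
  rewrite -EFinM lee_fin.
  rewrite [leLHS](_ : _ = (W + e') * ((1 + 2 * d) ^+ 2 * k) * s ^+ 2); last by rewrite /k; ring.
  by rewrite ler_wpM2r ?sqr_ge0.
apply: (density_le _ mwt wt0) => //; [exact: mT (measurable_rect _ _ _ _)|by rewrite addr_ge0 ?w0// ltW|].
move=> u; rewrite /wt /Gt /preimage /mkset; case: pselect => /= [Ou|_ _]; last by rewrite ltxx.
have [y yE0] : exists y, y = cx u by eexists.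
rewrite -yE0 in Ou *; have [z zE0] : exists z, z = G y by eexists.
rewrite -zE0 => Qz _.
have Oz : O z by rewrite zE0; exact: GO.
have := preQ _ Qz; rewrite xcK => zz.
have yz : y = F z by rewrite zE0 FG.
have := kFP z (le_lt_trans zz (lt_le_trans st t3F)); rewrite -yz -/y0 => err.
have yy : normc (y - y0) < t2.
  have h : normc (y - y0) <= M * (s * L).
    have -> : y - y0 = (y - y0 - A0 * (z - z0)) + A0 * (z - z0) by ring.
    apply: le_trans (le_normcD _ _) _; rewrite Normc.normcM /M mulrDl addrC.
    apply: lerD; first by rewrite ler_pM2l.
    by apply: le_trans err _; rewrite ler_wpM2l// ltW.
  apply: le_lt_trans h _; apply: (@lt_le_trans _ _ (M * t3)); last by move: t3t; rewrite ler_pdivlMr// mulrC.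
  by rewrite ltr_pM2l.
split; last first.
  by have := kwP y (lt_le_trans (lt_le_trans yy t2t1) t1w); rewrite -/W ltr_distl => /andP[_ /ltW].
have [zeta zE] : exists zeta, zeta = B * y + (z0 - B * y0) by eexists.
have ze : zeta - z = B * (y - y0 - A0 * (z - z0)).
  by rewrite mulrBr mulrA AB zE; ring.
have nze : normc (zeta - z) <= d * (s * l).
  rewrite ze Normc.normcM; apply: le_trans (fin_err _ zz).
  by rewrite ler_pM2l.
have := le_trans (normc_Re _) nze; have := le_trans (normc_Im _) nze.
rewrite !raddfB !ler_norml => h3 h4.
have : Qp (Re zeta, Im zeta).
  exact: (@rect_shift R _ _ _ _ _ _ _ (Re z, Im z) (Re zeta, Im zeta) dl1 dl2 h4 h3 Qz).
by rewrite zE yE0.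
Qed.

Lemma local_estimate e : 0 < e -> exists2 k : R, 0 < k & forall a b s, 0 < s -> s < k ->
  a <= Re z0 <= a + s * l1 -> b <= Im z0 <= b + s * l2 ->
  let Q := rect a (a + s * l1) b (b + s * l2) in
  [/\ (m1 Q < +oo)%E, (m2 Q < +oo)%E & `|fine (m1 Q) - fine (m2 Q)| <= e * s ^+ 2].
Proof.
move=> e0; have e2 : 0 < e / 2 by rewrite divr_gt0.
have [k1 k10 h1] := local_estimate1 e2; have [k2 k20 h2] := local_estimate2 e2.
have [k [k0 kk1 kk2]] := exists_le2 k10 k20; exists k => // a b s s0 sk ha hb Q.
have /andP[] := h1 a b s s0 (lt_le_trans sk kk1) ha hb.
have /andP[] := h2 a b s s0 (lt_le_trans sk kk2) ha hb.
rewrite -/Q => p1 p2 p3 p4.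
have f1 : (m1 Q < +oo)%E by exact: le_lt_trans p4 (ltry _).
have f2 : (m2 Q < +oo)%E by exact: le_lt_trans p2 (ltry _).
split => //; move: p1 p2 p3 p4.
rewrite -(@fineK _ (m1 Q)) ?ge0_fin_numE// -(@fineK _ (m2 Q)) ?ge0_fin_numE// !lee_fin => p1 p2 p3 p4.
by rewrite [fine _]/= [X in _ - X]/= ler_norml; apply/andP; split; lra.
Qed.

End LocalEstimate.

Let rect_eq a b c e : (forall x y : R, a <= x <= b -> c <= y <= e -> O (x +i* y)) ->
  (m1 (rect a b c e) < +oo)%E -> (m2 (rect a b c e) < +oo)%E -> m1 (rect a b c e) = m2 (rect a b c e).
Proof.
move=> inO f1 f2.
have empty : ~~ (a < b) || ~~ (c < e) -> rect a b c e = set0.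
  by move=> h; apply/seteqP; split => // u /rectP[? ? ? ?]; case/orP: h => /negP; apply; lra.
have [ab|ab] := boolP (a < b); last by rewrite empty ?ab// !measure0.
have [ce|ce] := boolP (c < e); last by rewrite empty ?ce ?orbT// !measure0.
pose l1 := b - a; pose l2 := e - c.
have l10 : 0 < l1 by rewrite subr_gt0. have l20 : 0 < l2 by rewrite subr_gt0.
pose Q (x y s : R) := rect x (x + s * l1) y (y + s * l2).
have Q1 : Q a c 1 = rect a b c e by rewrite /Q !mul1r /l1 /l2 !subrKC.
have QM (M : {measure set (MR * MR) -> \bar R}) (x y s : R) : (M (rect a b c e) < +oo)%E -> [/\ 0 < s, a <= x, x + s * l1 <= a + 1 * l1,
    c <= y & y + s * l2 <= c + 1 * l2] -> forall x' b' y' e' : R, x <= x' -> b' <= x + s * l1 -> y <= y' -> e' <= y + s * l2 ->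
    M (rect x' b' y' e') \is a fin_num.
  move=> fin [s0 h1 h2 h3 h4] x' b' y' e' h5 h6 h7 h8; apply: measure_sub_fin_num fin => //.
  by apply: rect_sub; rewrite /l1 /l2 in h2 h4 h6 h8; lra.
have split4 (M : {measure set (MR * MR) -> \bar R}) (x y s : R) : (M (rect a b c e) < +oo)%E -> [/\ 0 < s, a <= x, x + s * l1 <= a + 1 * l1,
    c <= y & y + s * l2 <= c + 1 * l2] -> fine (M (Q x y s)) =
    fine (M (Q x y (s / 2))) + fine (M (Q (x + s / 2 * l1) y (s / 2))) +
    (fine (M (Q x (y + s / 2 * l2) (s / 2))) + fine (M (Q (x + s / 2 * l1) (y + s / 2 * l2) (s / 2)))).
  move=> fin ins; have [s0 h1 h2 h3 h4] := ins.
  have sl1 : 0 < s * l1 by rewrite mulr_gt0. have sl2 : 0 < s * l2 by rewrite mulr_gt0.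
  have g1 : s / 2 * l1 = s * l1 / 2 by field. have g2 : s / 2 * l2 = s * l2 / 2 by field.
  rewrite /Q g1 g2; apply: rect_split4 => //; rewrite -ge0_fin_numE//.
  by apply: (QM M x y s).
apply/eqP; rewrite -(fineK (measure_sub_fin_num _ _ _ f1)) // -(fineK (measure_sub_fin_num _ _ _ f2)) //.
rewrite eqe -subr_eq0; apply/eqP; rewrite -Q1.
have ex (M : {measure set (MR * MR) -> \bar R}) : exists f : R -> R -> R -> R, forall x y s : R, f x y s = fine (M (Q x y s)).
  by exists (fun x y s : R => fine (M (Q x y s))).
have [g1 g1E] := ex m1; have [g2 g2E] := ex m2; rewrite -g1E -g2E.
apply: (@quadrisection R (fun x y s : R => g1 x y s - g2 x y s) l1 l2 l10 l20 a c 1 ltr01).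
  move=> x y s ins; have := split4 m1 x y s f1 ins; rewrite -!g1E => ->.
  by have := split4 m2 x y s f2 ins; rewrite -!g2E => ->; ring.
move=> x y; rewrite !mul1r /l1 /l2 !subrKC => hx hy e1 e10.
have [k k0 kP] := local_estimate l10 l20 (inO x y hx hy) e10.
exists k; first exact: k0.
by move=> x' y' s [s0 _ _ _ _] sk h1 h2; have [_ _] := kP x' y' s s0 sk h1 h2; rewrite g1E g2E.
Qed.

(** Both sides are measures of [E]. On a rectangle shrinking to [z] each of them is [v z] times the
    area up to o(area), so by [quadrisection] they agree on rectangles inside [O], and then on Borel
    sets. *)
Lemma change_of_variables (E : set (MR * MR)) : measurable E ->
  (\int[mu2]_(u in [set u | O' (cx u) /\ E (Re (G (cx u)), Im (G (cx u)))]) (w (cx u))%:E =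
   \int[mu2]_(u in [set u | O (cx u) /\ E u]) (v (cx u))%:E)%E.
Proof.
move=> mE.
have -> : (\int[mu2]_(u in [set u | O' (cx u) /\ E (Re (G (cx u)), Im (G (cx u)))]) (w (cx u))%:E = m1 E)%E.
  rewrite m1E /density [LHS]integral_mkcond [RHS]integral_mkcond.
  apply: eq_integral => u _.
  rewrite /patch /wt /Gt; case: ifPn; case: ifPn; rewrite ?in_setE ?notin_setE /preimage /mkset;
  by case: (pselect (O' (cx u))) => /= Ou h1 h2 //; tauto.
have -> : (\int[mu2]_(u in [set u | O (cx u) /\ E u]) (v (cx u))%:E = m2 E)%E.
  rewrite m2E /density [LHS]integral_mkcond [RHS]integral_mkcond; apply: eq_integral => u _.
  rewrite /patch /vt; case: ifPn; case: ifPn; rewrite ?in_setE ?notin_setE /mkset;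
  by case: (pselect (O (cx u))) => /= Ou h1 h2 //; tauto.
(* Rational rectangles whose closure is in [O] and on which both measures are finite. They cover
   [O], since [local_estimate] makes the measures locally finite. *)
pose P (t : rat * rat * (rat * rat)) := let: (a, b, (c, e)) := t in
  [/\ forall x y : R, ratr a <= x <= ratr b -> ratr c <= y <= ratr e -> O (x +i* y),
    (m1 (rect (ratr a) (ratr b) (ratr c) (ratr e)) < +oo)%E & (m2 (rect (ratr a) (ratr b) (ratr c) (ratr e)) < +oo)%E].
pose K (n : nat) : set (R * R) := if unpickle n is Some t then if pselect (P t) then
  let: (a, b, (c, e)) := t in rect (ratr a) (ratr b) (ratr c) (ratr e) else set0 else set0.
have mK n : measurable (K n : set (MR * MR)).
  by rewrite /K; case: (unpickle n) => // -[[a b] [c e]]; case: pselect => //= _; exact: measurable_rect.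
have cover : \bigcup_n K n = [set u | O (cx u)].
  apply/seteqP; split => u.
    move=> [n _]; rewrite /K; case: (unpickle n) => // -[[a b] [c e]]; case: pselect => //= -[h _ _].
    by move=> /rectP[? ? ? ?]; apply: h; apply/andP; split => //; exact: ltW.
  move=> Ou; have [k k0 kP] := local_estimate (@ltr01 R) (@ltr01 R) Ou (@ltr01 R).
  have [d d0 dP] := proj1 (openCP _) oO _ Ou.
  have [s [s0 sk sd]] := exists_le2 k0 d0.
  have rat_near (x y : R) : x < y -> exists q : rat, x < ratr q < y.
    by move=> xy; have [q] := rat_in_itvoo xy; rewrite in_itv; exists q.
  have s4 : 0 < s / 4 by rewrite divr_gt0.
  have [a /andP[a1 a2]] := rat_near (u.1 - s / 4) u.1 (ltac:(lra)).
  have [b /andP[b1 b2]] := rat_near u.1 (u.1 + s / 4) (ltac:(lra)).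
  have [c /andP[c1 c2]] := rat_near (u.2 - s / 4) u.2 (ltac:(lra)).
  have [e /andP[e1 e2]] := rat_near u.2 (u.2 + s / 4) (ltac:(lra)).
  have Pt : P (a, b, (c, e)).
    have [||||g1 g2 _] := kP (u.1 - s / 4) (u.2 - s / 4) (s / 2); rewrite ?mulr1 /=; try lra; try (apply/andP; split; lra).
    have quarter (x : R) : x - s / 4 + s / 2 = x + s / 4 by field.
    rewrite mulr1 !quarter in g1 g2.
    split.
    - move=> x y /andP[? ?] /andP[? ?]; apply: dP; apply: le_lt_trans (normc_le_ReIm _) _.
      rewrite !raddfB /=; apply: lt_le_trans sd.
      have : `|x - u.1| < s / 2 by rewrite ltr_norml; apply/andP; split; lra.
      have : `|y - u.2| < s / 2 by rewrite ltr_norml; apply/andP; split; lra.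
      lra.
    - by apply: le_lt_trans g1; apply: le_measure; rewrite ?inE//; apply: rect_sub; exact: ltW.
    - by apply: le_lt_trans g2; apply: le_measure; rewrite ?inE//; apply: rect_sub; exact: ltW.
  have [n nE] : exists n, unpickle n = Some (a, b, (c, e)) by eexists; exact: pickleK.
  exists n; [exact: I|]; rewrite /K nE; case: (pselect (P _)) => //= _.
  by apply/rectP; split => //; exact: ltW.
have mO : measurable ([set u | O (cx u)] : set (MR * MR)) by exact: measurable_cx.
have off (M : {measure set (MR * MR) -> \bar R}) : M (~` [set u | O (cx u)]) = 0%E ->
    M E = M (E `&` [set u | O (cx u)]).
  move=> M0; have -> : M E = M ((E `&` [set u | O (cx u)]) `|` (E `\` [set u | O (cx u)])) by rewrite setUIDK.
  rewrite measureU//; [|exact: measurableI|exact: measurableD|]; last by apply/seteqP; split => // x [[_ ?] [_ ?]].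
  rewrite [X in (_ + X)%E](_ : _ = 0%E) ?adde0//; apply/eqP; rewrite eq_le measure_ge0 andbT -M0.
  by apply: le_measure; rewrite ?inE; [exact: measurableD|exact: measurableC|move=> x []].
rewrite (off m1); last first.
  rewrite m1E /density; apply: integral0_eq => u; rewrite /wt /Gt /preimage /mkset /=.
  by case: pselect => //= Ou nO; exfalso; apply: nO; have := GO Ou; case: (G _).
rewrite (off m2); last first.
  by rewrite m2E /density; apply: integral0_eq => u; rewrite /vt /mkset /=; case: pselect.
apply: (@measure_eq_cover R _ _ m1 m2 K mK) => //; last by rewrite cover; exact: subIsetr.
  move=> n E' mE' E'K; move: E'K; rewrite /K; case: (unpickle n) => [[[a b] [c e]]|]; last first.
    by rewrite subset0 => ->; rewrite !measure0.
  case: (pselect (P _)) => [Pt|nPt]; last first.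
    by rewrite /is_left subset0 => E0; rewrite E0 (measure0 m1) (measure0 m2).
  rewrite /is_left.
  move: Pt; rewrite /P => -[inO f1 f2] E'K.
  set Q := rect _ _ _ _ in f1 f2 E'K.
  have mQ : measurable (Q : set (MR * MR)) by exact: measurable_rect.
  have : (mrestr m1 mQ) E' = (mrestr m2 mQ) E'.
    have ft : (mrestr m1 mQ setT < +oo)%E by rewrite /mrestr setTI.
    apply: (@rect_measure_unique R (mrestr m1 mQ) (mrestr m2 mQ) ft) => //.
    move=> a' b' c' e'.
    change (m1 ((`]a', b'] `*` `]c', e'])%classic `&` Q) = m2 ((`]a', b'] `*` `]c', e'])%classic `&` Q)).
    have -> : (`]a', b'] `*` `]c', e'])%classic `&` Q = rect (Num.max a' (ratr a)) (Num.min b' (ratr b))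
        (Num.max c' (ratr c)) (Num.min e' (ratr e)).
      apply/seteqP; split => u.
        by move=> [/rectP[? ? ? ?] /rectP[? ? ? ?]]; apply/rectP; rewrite !gt_max !le_min; split; apply/andP.
      by move=> /rectP; rewrite !gt_max !le_min => -[/andP[? ?] /andP[? ?] /andP[? ?] /andP[? ?]]; split; apply/rectP.
    have sub : rect (Num.max a' (ratr a)) (Num.min b' (ratr b)) (Num.max c' (ratr c)) (Num.min e' (ratr e)) `<=` Q.
      by apply: rect_sub; rewrite ?le_max ?ge_min lexx ?orbT.
    apply: rect_eq.
    - move=> x y; rewrite !ge_max !le_min => /andP[/andP[? ?] /andP[? ?]] /andP[/andP[? ?] /andP[? ?]].
      by apply: inO; apply/andP.
    - by apply: le_lt_trans f1; apply: le_measure; rewrite ?inE.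
    - by apply: le_lt_trans f2; apply: le_measure; rewrite ?inE.
  by rewrite /mrestr (setIidl E'K).
exact: measurableI.
Qed.

End ChangeOfVariables.

(** * The measure on the suspension *)

Section SecondCountableProd.

Lemma second_countable_prod (Y Z : topologicalType) :
  @second_countable Y -> @second_countable Z -> @second_countable (Y * Z)%type.
Proof.
move=> [bY cY [oY nY]] [bZ cZ [oZ nZ]].
exists [set A `*` B | A in bY & B in bZ].
  pose f (u : set Y * set Z) := u.1 `*` u.2.
  apply: (@sub_countable _ _ _ (f @` (bY `*` bZ))).
    by apply: subset_card_le => _ [A bA [B bB <-]]; exists (A, B).
  by apply: (sub_countable (card_image_le _ _)); exact: countableX.
split.
  move=> _ [A bA [B bB <-]]; rewrite openE => -[y z] [/= Ay Bz]; exists (A, B) => //.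
  by split; apply: open_nbhs_nbhs; split => //; [exact: oY|exact: oZ].
move=> [y z] O [[U V] [/nY[b [bb by'] bU] /nZ[c [bc cz] cV]] UV].
exists (b `*` c); first by split => //; exists b => //; exists c.
by move=> [y' z'] [/bU ? /cV ?]; exact: UV.
Qed.

Variables (R : realType) (S : ptopologicalType).
Hypothesis scS : @second_countable S.
Local Notation C := R[i].
Local Notation MR := (measurableTypeR R).

(* Without second countability open sets need not be measurable for the product sigma-algebra. *)
Lemma measurable_open_mix (O : set (C * S)) : open O ->
  measurable ([set y | O (y.2.1 +i* y.2.2, y.1)] : set (borel S * (MR * MR))).
Proof.
move=> oO; pose O' := [set y : S * (R * R) | O (y.2.1 +i* y.2.2, y.1)].
have oO' : open O'.
  rewrite openE => -[s [x y]] Os.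
  have [[U V] [/nbhsCP[e e0 eU] Vs] UV] : nbhs (x +i* y, s) O by move: oO; rewrite openE; exact.
  have e2 : 0 < e / 2 by rewrite divr_gt0.
  exists (V, ball x (e / 2) `*` ball y (e / 2)) => /=.
    by split => //; exists (ball x (e / 2), ball y (e / 2)) => //; split; exact: nbhsx_ballx.
  move=> [s' [x' y']] [/= Vs' [/= xx yy]]; apply: UV; split => //=; apply: eU.
  apply: le_lt_trans (normc_le_ReIm _) _; rewrite !raddfB /=.
  by move: xx yy; rewrite /ball /= (distrC x) (distrC y); lra.
have scR2 := second_countable_prod (second_countable_real R) (second_countable_real R).
have [A [B [oA oB E]]] := second_countable_prod_open scS scR2 oO'.
rewrite -[X in measurable X]/O' E; apply: bigcup_measurable => n _; apply: measurableX.
  by apply: sub_sigma_algebra; exact: oA.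
exact: measurable_open_R2.
Qed.

End SecondCountableProd.

Section Lebesgue2.
Variable R : realType.
Local Notation MR := (measurableTypeR R).
Local Notation mu2 := (@lebesgue_measure R \x @lebesgue_measure R)%E.

Let sigma_finite2 : sigma_finite setT mu2.
Proof.
exists (fun n => rect (- n%:R) n%:R (- n%:R) n%:R).
  apply/seteqP; split => // -[x y] _; pose M := Num.max `|x| `|y|.
  exists (Num.truncn M).+1 => //; have := truncnS_gt M; rewrite {1}/M gt_max !ltr_norml.
  by move=> /andP[/andP[? ?] /andP[? ?]]; apply/rectP; split => //; exact: ltW.
move=> n; split; first exact: measurable_rect.
have n0 : 0 <= n%:R :> R by [].
by rewrite lebesgue2_rect ?ltry//; lra.
Qed.

Definition lebesgue2 : {sigma_finite_measure set (MR * MR)%type -> \bar R} :=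
  HB.pack mu2 (Measure_isSigmaFinite.Build _ _ _ mu2 sigma_finite2).

End Lebesgue2.

Section Area.
Variable R : realType.
Local Notation C := R[i].
Local Notation MR := (measurableTypeR R).
Local Notation mu := (@lebesgue_measure R).
Local Notation mu2 := (mu \x mu)%E.
Local Notation cx u := (u.1 +i* u.2).
Local Notation xc z := (Re z, Im z).

Definition hyp_density (z : C) : R := 4 / (1 - normc z ^+ 2) ^+ 2.

Lemma hyp_density_ge0 z : 0 <= hyp_density z.
Proof. by rewrite /hyp_density divr_ge0// sqr_ge0. Qed.

Lemma hyp_density_gt0 z : normc z < 1 -> 0 < hyp_density z.
Proof. by move=> /sub_sqr_gt0 h; rewrite /hyp_density divr_gt0// exprn_gt0. Qed.

Lemma rcont_cvg (h : C -> R) z : h @ z --> h z -> rcont_at h z.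
Proof.
move=> /cvgrPdist_lt hc e /hc /(proj1 (nbhsCP _ _))[k k0 kP].
by exists k => // y /kP; rewrite distrC.
Qed.

Lemma rcont_hyp_density z : normc z < 1 -> rcont_at hyp_density z.
Proof.
move=> z1; apply: rcont_cvg; have d0 := sub_sqr_gt0 z1.
have nc : (fun y : C => normc y) @ z --> normc z.
  by apply: (@cvg_normc R C (nbhs z) _ id z); exact: cvg_id.
apply: (@cvg_comp _ _ _ (fun y : C => normc y) (fun x : R => 4 / (1 - x ^+ 2) ^+ 2) _ (nbhs (normc z))) => //.
apply: cvgM; first exact: cvg_cst.
apply: cvgV; first by rewrite expf_neq0// gt_eqF.
have c1 : (fun x : R => 1 - x ^+ 2) @ normc z --> 1 - normc z ^+ 2.
  by apply: cvgB; [exact: cvg_cst|exact: exprn_continuous].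
apply: (@cvg_comp _ _ _ (fun x : R => 1 - x ^+ 2) (fun x : R => x ^+ 2) _ (nbhs (1 - normc z ^+ 2))) => //.
exact: exprn_continuous.
Qed.

Definition hyp_weight (u : MR * MR) : R := if pselect (unit_disk (cx u)) then hyp_density (cx u) else 0.

Lemma hyp_weight_ge0 u : 0 <= hyp_weight u.
Proof. by rewrite /hyp_weight; case: (pselect _) => /= _; [exact: hyp_density_ge0|exact: lexx]. Qed.

Lemma measurable_hyp_weight : measurable_fun [set: MR * MR] hyp_weight.
Proof.
apply: (@measurable_rcont R (@unit_disk R) hyp_density 0); first exact: open_unit_disk.
by move=> z /unit_diskE; exact: rcont_hyp_density.
Qed.

(** The hyperbolic area of the disk, as a measure on the whole plane. *)
Definition area := density_measure mu2 measurable_hyp_weight hyp_weight_ge0.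

Lemma areaE E : area E = (\int[mu2]_(u in [set u | unit_disk (cx u) /\ E u]) (hyp_density (cx u))%:E)%E.
Proof.
change (density mu2 hyp_weight E = \int[mu2]_(u in [set u | unit_disk (cx u) /\ E u]) (hyp_density (cx u))%:E)%E.
rewrite /density [LHS]integral_mkcond [RHS]integral_mkcond; apply: eq_integral => u _.
rewrite /patch /hyp_weight; move: (@unit_disk R) => D.
case: (pselect (D (cx u))) => Du; case: (pselect (E u)) => Eu /=.
- by rewrite !mem_set.
- by rewrite !memNset// => -[].
- by rewrite mem_set// memNset// => -[].
- by rewrite !memNset// => -[].
Qed.

Lemma area_ext E E' : (forall u, unit_disk (cx u) -> (E u <-> E' u)) -> area E = area E'.
Proof.
move=> h; rewrite !areaE; congr (integral _ _ _); apply/seteqP; split => u [Du Eu]; split => //; exact/h.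
Qed.

(** By [aut_deriv] the density is its own pullback, which also supplies the continuity that
    [change_of_variables] asks for. *)
Lemma area_aut (f f' : C -> C) (E : set (MR * MR)) : disk_automorphism f f' -> disk_automorphism f' f -> measurable E ->
  area [set u | E (xc (f (cx u)))] = area E.
Proof.
move=> hf hf' mE; rewrite !areaE.
pose A z := 'D_1 f' z.
have dF z : unit_disk z -> cdiff f' z (A z).
  move=> /unit_diskE z1; have [B hB] := aut_holo hf' z1.
  by have /cdiffP[_ h] := hB; rewrite /A h.
have key z : unit_disk z -> hyp_density (f' z) * normc (A z) ^+ 2 = hyp_density z.
  move=> Dz; have z1 := proj1 (unit_diskE z) Dz.
  have := aut_deriv hf' z1 (dF z Dz); rewrite /hyp_density => <-.
  have := sub_sqr_gt0 z1; have : normc (A z) != 0.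
    apply: contraTneq (sub_sqr_gt0 (aut_lt1 hf' z1)) => h.
    by rewrite -(aut_deriv hf' z1 (dF z Dz)) h mul0r ltxx.
  move: (normc (A z)) (1 - normc z ^+ 2) => a b a0 b0; field.
  by rewrite a0 gt_eqF.
rewrite (@change_of_variables R (@unit_disk R) (@unit_disk R) f' f A hyp_density)//.
- by apply: eq_integral => u; rewrite inE => -[Du _]; rewrite key.
- exact: open_unit_disk.
- exact: open_unit_disk.
- by move=> z /unit_diskE z1; apply/unit_diskE; exact: (aut_lt1 hf').
- by move=> z /unit_diskE z1; apply/unit_diskE; exact: (aut_lt1 hf).
- by move=> z /unit_diskE z1; exact: (autK hf').
- by move=> z /unit_diskE z1; exact: (autK hf).
- by move=> z /unit_diskE z1; exact: (aut_holo hf).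
- exact: hyp_density_ge0.
- by move=> z /unit_diskE z1; exact: rcont_hyp_density.
- move=> z Dz e e0; have z1 := proj1 (unit_diskE z) Dz.
  have [k k0 kP] := rcont_hyp_density z1 e0.
  have z0 : 0 < 1 - normc z by rewrite subr_gt0.
  have [d [d0 dk dz]] := exists_le2 k0 z0; exists d => // y yz; rewrite !key//.
    by apply: kP; exact: lt_le_trans yz dk.
  by apply/unit_diskE; have := normc_rev y z; lra.
Qed.

Lemma area_bounded (r : R) (E : set (MR * MR)) : r < 1 -> measurable E ->
  (forall u, E u -> normc (cx u) <= r) -> (area E < +oo)%E.
Proof.
move=> r1 mE Er; have [r0|r0] := ltP r 0.
  rewrite (_ : E = set0) ?measure0//; apply/seteqP; split => // u /Er.
  by rewrite leNgt => /negP[]; apply: lt_le_trans r0 (normc_ge0 _).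
have r2 : 0 < 1 - r ^+ 2 by rewrite subr_gt0 expr_lt1.
apply: (@le_lt_trans _ _ ((4 / (1 - r ^+ 2) ^+ 2)%:E * mu2 (rect (- 2) 2 (- 2) 2))%E).
  apply: (density_le _ measurable_hyp_weight hyp_weight_ge0) => //; first exact: measurable_rect.
    by rewrite divr_ge0// sqr_ge0.
  move=> u Eu _; have ur := Er u Eu; split.
    have := le_trans (normc_Re _) ur; have := le_trans (normc_Im _) ur.
    by rewrite /= !ler_norml => /andP[? ?] /andP[? ?]; apply/rectP; split; lra.
  rewrite /hyp_weight; case: (pselect _) => /= _; last by rewrite divr_ge0// sqr_ge0.
  rewrite /hyp_density ler_pM2l// lef_pV2 ?posrE ?exprn_gt0//; last first.
    by apply: sub_sqr_gt0; exact: le_lt_trans r1.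
  rewrite ler_pXn2r ?nnegrE ?(ltW r2)//; last by apply/ltW/sub_sqr_gt0; exact: le_lt_trans r1.
  by rewrite lerB// ler_pXn2r ?nnegrE// normc_ge0.
by rewrite lebesgue2_rect; [rewrite -EFinM ltry|lra|lra].
Qed.

Lemma area_disk_gt0 : (0 < area setT)%E.
Proof.
apply: (@lt_le_trans _ _ (4%:E * mu2 (rect 0 (1 / 4) 0 (1 / 4)))%E).
  by rewrite lebesgue2_rect; [rewrite -EFinM lte_fin; lra|lra|lra].
apply: (density_ge _ measurable_hyp_weight hyp_weight_ge0) => //; first exact: measurable_rect.
move=> u /rectP[? ? ? ?]; have u1 : normc (cx u) < 1.
  apply: le_lt_trans (normc_le_ReIm _) _; rewrite /= !ger0_norm; lra.
rewrite /hyp_weight; case: (pselect _) => /= [_|[]]; last exact/unit_diskE.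
have h := sub_sqr_gt0 u1; rewrite /hyp_density ler_pdivlMr ?exprn_gt0// ler_piMr//.
by rewrite expr_le1 ?(ltW h)// gerBl sqr_ge0.
Qed.

End Area.

Arguments area {R}.

Lemma small_gap (R : realFieldType) (a x y k : R) : x < a / 4 -> y < a / 4 -> k <= x + y -> 0 < a -> a <= k -> False.
Proof. by lra. Qed.

Lemma rat_near (R : realType) (d : R) : 0 < d -> forall x, exists a : rat, `|x - ratr a| < d / 2.
Proof.
move=> d0 x; have xd : x - d / 2 < x + d / 2 by lra.
have [a] := rat_in_itvoo xd.
by rewrite in_itv /= => /andP[? ?]; exists a; rewrite ltr_norml; apply/andP; split; lra.
Qed.

(** * Descent of the product measure to the suspension *)

Section SuspensionMeasure.
Variables (R : realType) (Gamma : groupType) (act : Gamma -> R[i] -> R[i])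
  (Sigma : topologicalType) (q : R[i] -> Sigma) (g : nat)
  (T : pmetricType R) (rho : Gamma -> T -> T) (X : pmetricType R) (p : R[i] * T -> X).
Hypotheses (SG : surface_group act q g) (HR : homeo_representation rho)
  (SP : is_suspension p act rho) (cT : compact [set: T]).
Variable nu : probability (borel T) R.
Hypothesis nu_inv : forall c (A : set (borel T)), measurable A -> nu (rho c @^-1` A) = nu A.
Local Notation C := R[i].
Local Notation MR := (measurableTypeR R).
Local Notation mu2 := (@lebesgue_measure R \x @lebesgue_measure R)%E.
Local Notation cx u := (u.1 +i* u.2).
Local Notation xc z := (Re z, Im z).
Local Notation Y := (borel T * (MR * MR))%type.
Local Notation D := (@unit_disk R).

Let scT : @second_countable T. Proof. exact: compact_second_countable. Qed.

Let weight (y : Y) : R := hyp_weight y.2.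

Let weight_ge0 y : 0 <= weight y. Proof. exact: hyp_weight_ge0. Qed.

Let mweight : measurable_fun [set: Y] weight.
Proof. exact: (measurableT_comp (@measurable_hyp_weight R) measurable_snd). Qed.

Let m := density_measure (nu \x lebesgue2 R)%E mweight weight_ge0.

Let mE (G : set Y) : measurable G -> (m G = \int[nu]_t area (xsection G t))%E.
Proof.
move=> mG; change (density (nu \x lebesgue2 R)%E weight G = \int[nu]_t area (xsection G t))%E.
rewrite /density integral_mkcond fubini_tonelli1/=; first last.
- by move=> y; rewrite /patch; case: ifPn => // _; rewrite lee_fin.
- apply/(measurable_restrictT _ mG); apply/measurable_EFinP; exact: measurable_funTS.
apply: eq_integral => t _; change (fubini_F (lebesgue2 R) ((fun x : Y => (weight x)%:E) \_ G) t = density mu2 (@hyp_weight R) (xsection G t)).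
rewrite /fubini_F /density [RHS]integral_mkcond; apply: eq_integral => u _.
by rewrite /patch mem_xsection.
Qed.

Let measurable_area_xsection (G : set Y) : measurable G ->
  measurable_fun [set: borel T] (fun t : borel T => area (xsection G t)).
Proof.
move=> mG; apply: (eq_measurable_fun (fubini_F (lebesgue2 R) ((fun x : Y => (weight x)%:E) \_ G))).
  move=> t _; change (fubini_F (lebesgue2 R) ((fun x : Y => (weight x)%:E) \_ G) t = density mu2 (@hyp_weight R) (xsection G t)).
  rewrite /fubini_F /density [RHS]integral_mkcond; apply: eq_integral => u _.
  by rewrite /patch mem_xsection.
apply: measurable_fun_fubini_tonelli_F; last first.
  by move=> y; rewrite /patch; case: ifPn => // _; rewrite lee_fin.
apply/(measurable_restrictT _ mG); apply/measurable_EFinP; exact: measurable_funTS.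
Qed.

Let mD : measurable ([set y | D (cx y.2)] : set Y).
Proof.
have := @measurable_snd _ _ (borel T) (MR * MR)%type measurableT _ (measurable_cx (@open_unit_disk R)).
by rewrite setTI.
Qed.

Let proj (y : Y) : borel X := if pselect (D (cx y.2)) then p (cx y.2, y.1) else point.

Let measurable_chart (W : set (C * T)) (V : set X) : open W -> W `<=` @disk_times R T -> open V ->
  measurable ([set y | W (cx y.2, y.1) /\ V (p (cx y.2, y.1))] : set Y).
Proof.
move=> oW WD oV.
have := @measurable_open_mix R T scT [set u | W u /\ V (p u)]; apply.
rewrite openE => -[z t] [Wz Vz]; have z1 : normc z < 1 by apply/(disk_timesE z t); exact: (WD (z, t)).
have [e e0 eP] := susp_cont SP z1 (open_nbhs_nbhs (conj oV Vz)).
have /nbhs_disk_timesP[d d0 dP] : nbhs (z, t) W by move: oW; rewrite openE; exact.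
have [k [k0 ke kd]] := exists_le2 e0 d0; apply/nbhs_disk_timesP; exists k => // w s wz st; split.
  by apply: dP; [exact: lt_le_trans wz kd|exact: lt_le_trans st kd].
by have [] := eP w s (lt_le_trans wz ke) (lt_le_trans st ke).
Qed.

Let open_disk_times : open (@disk_times R T).
Proof.
rewrite openE => -[z t] /disk_timesE z1; apply/nbhs_disk_timesP; exists (1 - normc z).
  by rewrite subr_gt0.
by move=> w s wz _; apply/disk_timesE; have := normc_rev w z; lra.
Qed.

Let mproj : measurable_fun [set: Y] proj.
Proof.
apply: (@measurability _ _ _ _ _ proj (@open X)) => // _ [V oV <-]; rewrite setTI.
have mV := measurable_chart open_disk_times (@subset_refl _ _) oV.
have [pV|pV] := pselect (V point).
  rewrite (_ : _ @^-1` _ = [set y | disk_times (cx y.2, y.1) /\ V (p (cx y.2, y.1))] `|` ~` [set y | D (cx y.2)]).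
    by apply: measurableU; [exact: mV|apply: measurableC; exact: mD].
  apply/seteqP; split => y; rewrite /preimage /mkset /proj; case: (pselect (D (cx y.2))) => /= Dy.
  - by left; split.
  - by right.
  - by move=> [[]|].
  - by [].
rewrite (_ : _ @^-1` _ = [set y | disk_times (cx y.2, y.1) /\ V (p (cx y.2, y.1))])//.
apply/seteqP; split => y; rewrite /preimage /mkset /proj; case: (pselect (D (cx y.2))) => /= Dy.
- by split.
- by [].
- by move=> [].
- by move=> [/Dy].
Qed.

Let actY c (y : Y) : Y := (rho c y.1, (if pselect (D (cx y.2)) then Re (act c (cx y.2)) else 0,
  if pselect (D (cx y.2)) then Im (act c (cx y.2)) else 0)).

Let mrho c : measurable_fun [set: borel T] (rho c : borel T -> borel T).
Proof.
apply: (@measurability _ _ _ _ _ (rho c : borel T -> borel T) (@open T)) => // _ [V oV <-]; rewrite setTI.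
by apply: sub_sigma_algebra; have [hc _ _] := HR; apply: open_comp => // t _; exact: hc.
Qed.

Let mactY c : measurable_fun [set: Y] (actY c).
Proof.
have cont z : D z -> forall e, 0 < e -> exists2 k : R, 0 < k & forall y, normc (y - z) < k -> normc (act c y - act c z) < e.
  by move=> /unit_diskE z1; apply/cvgC_at; exact: (act_cont SG).
have mact : measurable_fun [set: MR * MR] (fun u : MR * MR => (if pselect (D (cx u)) then Re (act c (cx u)) else 0,
    if pselect (D (cx u)) then Im (act c (cx u)) else 0) : MR * MR).
  apply: measurable_fun_pair; [apply: (@measurable_rcont R D (fun y => Re (act c y)) 0 (@open_unit_disk R))|
    apply: (@measurable_rcont R D (fun y => Im (act c y)) 0 (@open_unit_disk R))] => z Dz e e0;
  have [k k0 kP] := cont z Dz e e0; exists k => // y /kP; apply: le_lt_trans; rewrite -raddfB.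
  - exact: normc_Re.
  - exact: normc_Im.
apply: measurable_fun_pair; first exact: (measurableT_comp (mrho c) measurable_fst).
exact: (measurableT_comp mact measurable_snd).
Qed.

Let pull c (G : set Y) : set Y := [set y | D (cx y.2) /\ G (rho c y.1, xc (act c (cx y.2)))].

Let pullE c G : pull c G = [set y | D (cx y.2)] `&` actY c @^-1` G.
Proof.
rewrite /pull /actY; move: (@unit_disk R) => D0.
apply/seteqP; split => y; rewrite /setI /preimage /mkset; case: (pselect (D0 (cx y.2))) => /= Dy => -[h1 h2].
- by split.
- by [].
- by split.
- by [].
Qed.

Let mpull c G : measurable G -> measurable (pull c G).
Proof.
move=> mG; rewrite pullE; apply: measurableI; first exact: mD.
by have := @mactY c measurableT _ mG; rewrite setTI.
Qed.

Let m_pull c G : measurable G -> m (pull c G) = m G.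
Proof.
move=> mG; rewrite (mE (mpull c mG)) (mE mG).
pose k t : \bar R := area (xsection G t).
have mk : measurable_fun [set: borel T] k by exact: measurable_area_xsection.
transitivity (\int[nu]_t k (rho c t))%E.
  apply: eq_integral => t _; rewrite /k.
  rewrite -(area_aut (act_aut SG c) _ (measurable_xsection _ mG)); last first.
    by have := act_aut SG c^-1%g; rewrite invgK.
  apply: area_ext => u Du; rewrite /xsection /mkset !inE /pull /mkset; tauto.
rewrite -[LHS](@ge0_integral_pushforward _ _ _ _ _ _ (mrho c) nu setT k)//.
- by apply: eq_measure_integral => A mA _; exact: nu_inv.
Qed.

Let eG : {e : Gamma -> nat | injective e}.
Proof.
apply: cid; have /countable_injP[e einj] := countable_deck SG; exists e => a b.
by apply: einj; rewrite inE.
Qed.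

Let orbit_sum (H : Gamma -> set Y) : (forall c, measurable (H c)) ->
  (forall c c' y, H c y -> H c' y -> c = c') ->
  (m [set y | exists c, H c y] = \sum_(n <oo) m [set y | exists c, projT1 eG c = n /\ H c y])%E.
Proof.
move=> mH dH; have einj := projT2 eG; set e := projT1 eG in einj *.
have mHn n : measurable [set y | exists c, e c = n /\ H c y].
  have [[c ec]|nc] := pselect (exists c, e c = n).
    rewrite (_ : [set _ | _] = H c)//; apply/seteqP; split => y; last by exists c.
    by move=> [c' [ec']]; have -> : c' = c by apply: einj; rewrite ec.
  by rewrite (_ : [set _ | _] = set0)//; apply/seteqP; split => // y [c [ec _]]; apply: nc; exists c.
have -> : [set y | exists c, H c y] = \bigcup_n [set y | exists c, e c = n /\ H c y].
  by apply/seteqP; split => [y [c Hc]|y [n _ [c [_ Hc]]]]; [exists (e c) => //; exists c|exists c].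
apply: (measure_semi_bigcup m) => //; last exact: bigcup_measurable.
move=> i j _ _ [y [[c [ci Hc]] [c' [c'j Hc']]]].
by rewrite -ci -c'j (dH _ _ _ Hc Hc').
Qed.

(** The group is countable, so both disjoint unions are sums over an enumeration of it and can be
    compared term by term. *)
Let orbit_eq (H H' : Gamma -> set Y) : (forall c, measurable (H c)) -> (forall c, measurable (H' c)) ->
  (forall c c' y, H c y -> H c' y -> c = c') -> (forall c c' y, H' c y -> H' c' y -> c = c') ->
  (forall c, m (H c) = m (H' c)) -> m [set y | exists c, H c y] = m [set y | exists c, H' c y].
Proof.
move=> mH mH' dH dH' HH'; rewrite !orbit_sum//; apply: eq_eseriesr => n _.
have einj := projT2 eG; set e := projT1 eG in einj *.
have [[c ec]|nc] := pselect (exists c, e c = n).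
  have E (K : Gamma -> set Y) : [set y | exists c, e c = n /\ K c y] = K c.
    apply/seteqP; split => y; last by exists c.
    by move=> [c' [ec']]; have -> : c' = c by apply: einj; rewrite ec.
  by rewrite !E.
have E (K : Gamma -> set Y) : [set y | exists c, e c = n /\ K c y] = set0.
  by apply/seteqP; split => // y [c [ec _]]; apply: nc; exists c.
by rewrite !E.
Qed.

(* The orbit of a point is represented in the first small set of a countable cover that
   it meets. *)
Lemma fundamental_domain : exists (Fd : set (MR * MR)) (r : R), [/\ measurable Fd, r < 1,
  forall u, Fd u -> normc (cx u) <= r,
  forall z, normc z < 1 -> exists c, Fd (xc (act c z)) &
  forall z c c', normc z < 1 -> Fd (xc (act c z)) -> Fd (xc (act c' z)) -> c = c'].
Proof.
have [r [/andP[r0 r1] rP]] := cocompact SG; have [e e0 eP] := uniformly_discrete SG.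
have xcK z : (Re z +i* Im z) = z by case: z.
(* Distinct points of an orbit with modulus at most [r] are at Euclidean distance at least
   [e * (1 - r) = 4 d], so a set [V n], of diameter at most [2 d], contains at most one of them. *)
pose d := e * (1 - r) / 4; have d0 : 0 < d by rewrite divr_gt0// mulr_gt0// subr_gt0.
pose qq (n : nat) : R * R := if @unpickle (rat * rat)%type n is Some ab then (ratr ab.1, ratr ab.2) else (0, 0).
pose V n : set (MR * MR) := [set u | normc (cx u) <= r /\ normc (cx u - cx (qq n)) < d].
have Vin n z : V n (xc z) <-> normc z <= r /\ normc (z - cx (qq n)) < d.
  by change (normc (Re z +i* Im z) <= r /\ normc ((Re z +i* Im z) - cx (qq n)) < d <-> normc z <= r /\ normc (z - cx (qq n)) < d); rewrite xcK.
have Vdisj n z c c' : normc z < 1 -> V n (xc (act c z)) -> V n (xc (act c' z)) -> c = c'.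
  move=> z1 /Vin[h1 h2] /Vin[h3 h4]; apply: contrapT => cc'.
  have cz1 := act_lt1 SG c z1; have c'z1 := act_lt1 SG c' z1.
  have := eP (c' * c^-1)%g (act c z) _ cz1; rewrite -(actME SG)// mulgVK => /(_ _)h.
  have {}h : e <= pdist (act c z) (act c' z).
    by apply: h => E; apply: cc'; rewrite -[RHS](mulgVK c) E mul1g.
  have := pdist_le_dist r1 h1 c'z1; rewrite ler_pdivlMr ?subr_gt0// => h5.
  have := normc_triangle (act c z) (cx (qq n)) (act c' z); rewrite [normc (cx (qq n) - _)]normcBC => h6.
  have : e * (1 - r) <= pdist (act c z) (act c' z) * (1 - r) by rewrite ler_pM2r ?subr_gt0.
  have : 0 < e * (1 - r) by rewrite mulr_gt0// subr_gt0.
  by apply: (small_gap h2 h4); apply: le_trans h5 h6.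
have mV n : measurable (V n).
  rewrite (_ : V n = ~` [set u | [set z : C | r < normc z] (cx u)] `&` [set u | [set z : C | normc (z - cx (qq n)) < d] (cx u)]).
    apply: measurableI; first apply: measurableC; apply: measurable_cx; apply/openCP => z /= hz.
      exists (normc z - r); first by rewrite subr_gt0.
      by move=> w wz /=; have := normc_rev z w; rewrite (normcBC z w); lra.
    exists (d - normc (z - cx (qq n))); first by rewrite subr_gt0.
    by move=> w wz /=; have := normc_triangle w z (cx (qq n)); lra.
  apply/seteqP; split => u; rewrite /V /setI /setC /mkset => -[h1 h2]; split => //.
    by apply/negP; rewrite -leNgt.
  by rewrite leNgt; apply/negP.
pose GV n : set (MR * MR) := [set u | D (cx u) /\ exists c, V n (xc (act c (cx u)))].
have mGV n : measurable (GV n).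
  have mc c : measurable ([set u | D (cx u) /\ V n (xc (act c (cx u)))] : set (MR * MR)).
    have := @mpull c (setT `*` V n) (measurableX measurableT (mV n)).
    move=> /(measurable_xsection point); congr (measurable _).
    by apply/seteqP; split => u; rewrite /xsection /pull /mkset inE /=; tauto.
  
  rewrite (_ : GV n = \bigcup_(c in [set: Gamma]) [set u | D (cx u) /\ V n (xc (act c (cx u)))]).
    by apply: countable_bigcupT_measurable => //; exact: countable_deck SG.
  apply/seteqP; split => u.
    by move=> [Du [c Vc]]; exists c.
  by move=> [c _ [Du Vc]]; split => //; exists c.
pose Fd : set (MR * MR) := [set u | exists n, V n u /\ forall k, (k < n)%N -> ~ GV k u].
have GVin n z : GV n (xc z) <-> normc z < 1 /\ exists c, V n (xc (act c z)).
  change (unit_disk (Re z +i* Im z) /\ (exists c, V n (xc (act c (Re z +i* Im z)))) <-> normc z < 1 /\ exists c, V n (xc (act c z))).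
  by rewrite xcK; split => -[/unit_diskE].
have GV_act k z c : normc z < 1 -> GV k (xc z) -> GV k (xc (act c z)).
  move=> z1 /GVin[_ [b Vb]]; apply/GVin; split; first exact: (act_lt1 SG c z1).
  by exists (b * c^-1)%g; rewrite -(actME SG)// mulgVK.
have GVD k z c : normc z < 1 -> V k (xc (act c z)) -> GV k (xc z).
  by move=> z1 h; apply/GVin; split => //; exists c.
exists Fd, r; split => //.
- have -> : Fd = \bigcup_n (V n `\` \bigcup_(k < n) GV k).
    apply/seteqP; split => u.
      by move=> [n [Vn h]]; exists n => //; split => // -[k /= kn]; exact: h.
    by move=> [n _ [Vn h]]; exists n; split => // k kn Gk; apply: h; exists k.
  apply: bigcup_measurable => n _; apply: measurableD => //.
  by apply: bigcup_measurable => k _.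
- by move=> u [n [[]]].
- move=> z z1; have [c0 c0r] := rP z z1.
  have ex : exists n, `[< GV n (xc z) >].
    have [a aP] := rat_near d0 (Re (act c0 z)); have [b bP] := rat_near d0 (Im (act c0 z)).
    exists (pickle (a, b)); apply/asboolP; apply: (GVD _ _ c0) => //; apply/Vin; rewrite /qq pickleK; split => //.
    by apply: le_lt_trans (normc_le_ReIm _) _; rewrite !raddfB /= [ltRHS](splitr d); exact: ltrD.
  have := ex_minnP ex => -[n /asboolP GVn nmin].
  have [_ [c Vc]] := proj1 (GVin n z) GVn; exists c; exists n; split => // k kn Gk.
  have : GV k (xc z).
    have := @GV_act k (act c z) c^-1%g (act_lt1 SG c z1) Gk; by rewrite (actK SG).
  by move=> /asboolP/nmin; rewrite leqNgt kn.
- move=> z c c' z1 [n [Vn h]] [n' [Vn' h']].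
  have nn' : n = n'.
    apply/eqP; rewrite eqn_leq; apply/andP; split; rewrite leqNgt; apply/negP => lt.
      by apply: (h _ lt); apply: GV_act => //; exact: GVD Vn'.
    by apply: (h' _ lt); apply: GV_act => //; exact: GVD Vn.
  by rewrite -nn' in Vn'; exact: Vdisj Vn Vn'.
Qed.

Let nu_cst (a : \bar R) : (\int[nu]__ a = a)%E.
Proof.
by rewrite (integral_cst nu measurableT) -[RHS](mule1 a); congr (_ * _)%E; exact: probability_setT.
Qed.

(** The measure is the image of [m] restricted to [T] times the domain [Fd], normalised. The formula
    for [A] in the injective image of [W] holds because the parts of [T x Fd] and of [W] over [A]
    are both cut by the group into pieces that deck transformations exchange, and [m] is
    invariant. *)
Lemma suspension_measure_exists : exists (mu : probability (borel X) R) (k : R), 0 < k /\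
  forall (W : set (C * T)) (A : set (borel X)), open W -> W `<=` @disk_times R T ->
  (forall u v, W u -> W v -> p u = p v -> u = v) -> measurable A -> A `<=` p @` W ->
  (mu A = k%:E * \int[nu]_t area [set u | W (cx u, t) /\ A (p (cx u, t))])%E.
Proof.
have [Fd [r [mFd r1 Fdr Fdex Fduniq]]] := fundamental_domain.
have xcK z : (Re z +i* Im z) = z by case: z.
pose FT : set Y := [set y | Fd y.2].
have mFT : measurable FT by have := @measurable_snd _ _ (borel T) (MR * MR)%type measurableT _ mFd; rewrite setTI.
have FdD u : Fd u -> normc (cx u) < 1 by move=> /Fdr h; exact: le_lt_trans r1.
pose mu0 := image_measure (mrestr m mFT) mproj.
have mu0E A : mu0 A = m (proj @^-1` A `&` FT) by [].
have key (W : set (C * T)) (A : set (borel X)) : open W -> W `<=` @disk_times R T ->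
    (forall u v, W u -> W v -> p u = p v -> u = v) -> measurable A -> A `<=` p @` W ->
    mu0 A = m [set y | W (cx y.2, y.1) /\ A (p (cx y.2, y.1))].
  move=> oW WD Winj mA AW; rewrite mu0E.
  pose G : set Y := [set y | W (cx y.2, y.1) /\ A (p (cx y.2, y.1))].
  have mG : measurable G.
    have -> : G = [set y | W (cx y.2, y.1)] `&` proj @^-1` A.
      apply/seteqP; split => y [Wy Ay]; split => //; move: Ay; rewrite /proj /preimage /mkset;
      by case: (pselect (D (cx y.2))) => //= nD; exfalso; apply: nD; exact: (WD _ Wy).
    apply: measurableI; first exact: (@measurable_open_mix R T scT W oW).
    by have := mproj measurableT mA; rewrite setTI.
  have -> : proj @^-1` A `&` FT = [set y | exists c, (FT `&` pull c G) y].
    apply/seteqP; split => y.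
      move=> [Ay Fy]; have y1 := FdD _ Fy; have Dy := proj2 (unit_diskE _) y1.
      have {}Ay : A (p (cx y.2, y.1)) by move: Ay; rewrite /proj /preimage /mkset; case: (pselect _).
      have [[w s] Ws ws] := AW _ Ay; have w1 : normc w < 1 by apply/disk_timesE; exact: WD Ws.
      have [c [wc sc]] := proj1 (suspE SP _ _ y1 w1) (esym ws).
      exists c; split => //; split => //; rewrite /G /mkset /= xcK -wc -sc ws; split => //.
    move=> [c [Fy [Dy [Wy Ay]]]]; split => //; rewrite /proj /preimage /mkset.
    case: (pselect _) => //= _; move: Ay; rewrite /= xcK.
    by rewrite (susp_act SG SP)//; exact/unit_diskE.
  have -> : [set y | W (cx y.2, y.1) /\ A (p (cx y.2, y.1))] = [set y | exists c, (pull c^-1%g FT `&` G) y].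
    apply/seteqP; split => y; last by move=> [c []].
    move=> Gy; have [Wy _] := Gy; have Dy : D (cx y.2) := WD _ Wy.
    have [c Fc] := Fdex _ (proj1 (unit_diskE _) Dy).
    by exists c^-1%g; split => //; rewrite invgK; split.
  have uniqH c c' y : D (cx y.2) -> W (act c (cx y.2), rho c y.1) -> W (act c' (cx y.2), rho c' y.1) -> c = c'.
    move=> /unit_diskE y1 W1 W2; have := Winj _ _ W1 W2; rewrite !(susp_act SG SP)// => /(_ erefl)[E _].
    have : act (c'^-1 * c)%g (cx y.2) = cx y.2 by rewrite (actME SG)// E (actK SG).
    move=> /(act_free SG (proj2 (unit_diskE _) y1)) h.
    by rewrite -[LHS](mulVKg c') h mulg1.
  apply: orbit_eq.
  - by move=> c; apply: measurableI => //; exact: mpull.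
  - by move=> c; apply: measurableI => //; exact: mpull.
  - move=> c c' y [_ [Dy [W1 _]]] [_ [_ [W2 _]]]; apply: (uniqH c c' y Dy).
      by move: W1; rewrite /= xcK.
    by move: W2; rewrite /= xcK.
  - move=> c c' y [[Dy F1] _] [[_ F2] _].
    by apply: invg_inj; apply: (Fduniq (cx y.2)) => //; exact/unit_diskE.
  - move=> c; rewrite -[LHS](@m_pull c^-1%g); last by apply: measurableI => //; exact: mpull.
    congr (m _); apply/seteqP; split => y.
      move=> [Dy [Fy [_ Gy]]]; split; first by split.
      have y1 := proj1 (unit_diskE _) Dy.
      by move: Gy; rewrite /= xcK (actKV SG)// (rhoKV HR); case: y {Dy Fy y1} => ? [].
    move=> [[Dy Fy] Gy]; have y1 := proj1 (unit_diskE _) Dy.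
    split => //; split => //; split; first by change (D (Re (act c^-1%g (cx y.2)) +i* Im (act c^-1%g (cx y.2)))); rewrite xcK; apply/unit_diskE; exact: (act_lt1 SG).
    by rewrite /= xcK (actKV SG)// (rhoKV HR); case: y {Dy Fy y1} Gy => ? [].
have areaFT : m FT = area Fd.
  rewrite (mE mFT); transitivity (\int[nu]_t area Fd)%E.
    by apply: eq_integral => t _; congr (area _); apply/seteqP; split => u; rewrite /xsection /mkset inE.
  by rewrite nu_cst.
have fin : (mu0 setT < +oo)%E.
  by rewrite mu0E preimage_setT setTI areaFT; exact: area_bounded r1 mFd Fdr.
(* The translates of [T x Fd] fill [D x T] and have equal mass, so a null [Fd] would make the disk
   null. *)
have pos : (0 < mu0 setT)%E.
  rewrite mu0E preimage_setT setTI lt0e measure_ge0 andbT; apply/eqP => FT0.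
  have := area_disk_gt0 R; have -> : area (setT : set (MR * MR)) = m [set y | D (cx y.2)].
    rewrite (mE mD); transitivity (\int[nu]_t area (setT : set (MR * MR)))%E.
      by rewrite nu_cst.
    by apply: eq_integral => t _; apply: area_ext => u Du; rewrite /xsection /mkset inE.
  rewrite (_ : [set y | D (cx y.2)] = [set y | exists c, pull c FT y]).
    rewrite orbit_sum; first last.
    - move=> c c' y [Dy F1] [_ F2]; apply: (Fduniq (cx y.2)) => //; exact/unit_diskE.
    - by move=> c; exact: mpull.
    rewrite eseries0 ?ltxx// => n _ _; have einj := projT2 eG; set e := projT1 eG in einj *.
    have [[c ec]|nc] := pselect (exists c, e c = n).
      rewrite (_ : [set _ | _] = pull c FT) ?m_pull//; apply/seteqP; split => y; last by exists c.
      by move=> [c' [ec']]; have -> : c' = c by apply: einj; rewrite ec.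
    by rewrite (_ : [set _ | _] = set0) ?measure0//; apply/seteqP; split => // y [c [ec _]]; apply: nc; exists c.
  apply/seteqP; split => y; last by move=> [c []].
  by move=> Dy; have [c Fc] := Fdex _ (proj1 (unit_diskE _) Dy); exists c; split.
have fn : mu0 setT \is a fin_num by rewrite ge0_fin_numE.
pose k := (fine (mu0 setT))^-1; have k0 : 0 < k by rewrite invr_gt0 fine_gt0// pos.
pose mu := mscale (NngNum (ltW k0)) mu0.
have mu1 : mu setT = 1%E.
  change (k%:E * mu0 setT = 1)%E; rewrite -(fineK fn) -EFinM mulVf// gt_eqF// fine_gt0//.
  by rewrite pos.
pose P : probability (borel X) R := HB.pack mu (Measure_isProbability.Build _ _ _ mu mu1).
exists P, k; split => // W A oW WD Winj mA AW.
change (k%:E * mu0 A = k%:E * \int[nu]_t area [set u | W (cx u, t) /\ A (p (cx u, t))])%E.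
rewrite (key W A)//; congr (_ * _)%E; rewrite mE.
  by apply: eq_integral => t _; congr (area _); apply/seteqP; split => u; rewrite /xsection /mkset inE.
have -> : [set y | W (cx y.2, y.1) /\ A (p (cx y.2, y.1))] = [set y : Y | W (cx y.2, y.1)] `&` proj @^-1` A.
  apply/seteqP; split => y [Wy Ay]; split => //; move: Ay; rewrite /proj /preimage /mkset;
  by case: (pselect (D (cx y.2))) => //= nD; exfalso; apply: nD; exact: (WD _ Wy).
apply: measurableI; first exact: (@measurable_open_mix R T scT W oW).
by have := mproj measurableT mA; rewrite setTI.
Qed.

End SuspensionMeasure.

(** * Disintegration in flow boxes *)

Section IntegralDensity.
Local Open Scope ereal_scope.
Context d (T : measurableType d) (R : realType).

Section OneMeasure.
Variables (m : {measure set T -> \bar R}) (f : T -> R).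
Hypotheses (mf : measurable_fun [set: T] f) (f0 : forall x, (0 <= f x)%R).
Let dm := density_measure m mf f0.

Import HBNNSimple.

Let mfE : measurable_fun [set: T] (EFin \o f). Proof. exact/measurable_EFinP. Qed.

Let integral_density_nnsfun (h : {nnsfun T >-> R}) :
  \int[dm]_x (h x)%:E = \int[m]_x ((h x)%:E * (f x)%:E).
Proof.
have mh r : measurable (h @^-1` [set r]) by exact: measurable_sfunP.
under [in LHS]eq_integral do rewrite fimfunE -fsumEFin//.
rewrite ge0_integral_fsum//; last 2 first.
  - by move=> r; apply/measurable_EFinP; apply: measurable_funM => //; exact: measurable_indic.
  - by move=> r z _; rewrite EFinM nnfun_muleindic_ge0.
transitivity (\int[m]_x \sum_(r \in range h) (r%:E * ((\1_(h @^-1` [set r]) x)%:E * (f x)%:E))); last first.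
  apply: eq_integral => x _; rewrite [in RHS]fimfunE -fsumEFin// !fsbig_finite//=.
  rewrite ge0_sume_distrl.
    by apply: eq_bigr => r _; rewrite EFinM muleA.
  by move=> r _; rewrite EFinM nnfun_muleindic_ge0.
have ge0 r x : 0 <= r%:E * ((\1_(h @^-1` [set r]) x)%:E * (f x)%:E).
  by rewrite muleA; apply: mule_ge0; [exact: nnfun_muleindic_ge0|rewrite lee_fin].
have mif r : measurable_fun [set: T] (fun x => (\1_(h @^-1` [set r]) x)%:E * (f x)%:E).
  by apply: emeasurable_funM => //; apply/measurable_EFinP; exact: measurable_indic.
rewrite ge0_integral_fsum//; last by move=> r; exact: measurable_funeM.
apply: eq_fsbigr => r _.
have [r0|r0] := leP 0%R r; last first.
  rewrite !integral0_eq// => x _; rewrite preimage_nnfun0// indic0 ?mul0e ?mule0//.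
  by rewrite mulr0.
under eq_integral do rewrite EFinM.
rewrite !ge0_integralZl//.
- congr (_ * _); rewrite integral_indic// setIT.
  change (\int[m]_(x in h @^-1` [set r]) (f x)%:E = \int[m]_x ((\1_(h @^-1` [set r]) x)%:E * (f x)%:E)).
  rewrite integral_mkcond; apply: eq_integral => x _.
  by rewrite /patch indicE; case: ifPn => _; rewrite ?mul1e ?mul0e.
- by move=> x _; rewrite mule_ge0// lee_fin.
- by apply/measurable_EFinP; exact: measurable_indic.
Qed.

Lemma ge0_integral_density (h : T -> \bar R) : measurable_fun [set: T] h -> (forall x, 0 <= h x) ->
  \int[dm]_x h x = \int[m]_x (h x * (f x)%:E).
Proof.
move=> mh h0; pose h_ := nnsfun_approx measurableT mh.
transitivity (\int[dm]_x (lim ((h_ n x)%:E @[n --> \oo]))).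
  by apply/eq_integral => x _; apply/esym/cvg_lim => //=; exact: cvg_nnsfun_approx.
rewrite monotone_convergence//; last 3 first.
  by move=> n; exact/measurable_EFinP.
  by move=> n x _; rewrite lee_fin.
  by move=> x _ a b ab; rewrite lee_fin; exact/lefP/nd_nnsfun_approx.
rewrite (_ : (fun _ => _) = (fun n => \int[m]_x ((h_ n x)%:E * (f x)%:E))); last first.
  by apply/funext => n; exact: integral_density_nnsfun.
rewrite -monotone_convergence//; last 3 first.
  by move=> n; apply: emeasurable_funM => //; exact/measurable_EFinP.
  by move=> n x _; rewrite mule_ge0// lee_fin.
  by move=> x _ a b ab; apply: lee_wpmul2r; rewrite ?lee_fin//; exact/lefP/nd_nnsfun_approx.
apply: eq_integral => x _; apply/cvg_lim => //.
apply: cvgeMr => //; exact: cvg_nnsfun_approx.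
Qed.

Lemma integrable_density (h : T -> R) : dm.-integrable [set: T] (EFin \o h) ->
  m.-integrable [set: T] (EFin \o (fun x => h x * f x)%R) /\
  \int[dm]_x (h x)%:E = \int[m]_x (h x * f x)%:E.
Proof.
move=> /integrableP[mh hfin].
have mh' : measurable_fun [set: T] h by exact/measurable_EFinP.
split.
  apply/integrableP; split; first by apply/measurable_EFinP; exact: measurable_funM.
  apply: le_lt_trans hfin; rewrite ge0_integral_density//; last exact: measurableT_comp.
  apply: ge0_le_integral => //.
  - by apply: measurableT_comp => //; apply/measurable_EFinP; exact: measurable_funM.
  - by apply: emeasurable_funM => //; exact: measurableT_comp.
  - by move=> x _; rewrite /= normrM EFinM (ger0_norm (f0 x)).
rewrite integralE [RHS]integralE !ge0_integral_density//; first last.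
- exact: measurable_funepos.
- exact: measurable_funeneg.
congr (_ - _); apply: eq_integral => x _.
  by rewrite !funeposE -!EFin_max -EFinM maxr_pMl// mul0r.
by rewrite !funenegE -!EFinN -!EFin_max -EFinM maxr_pMl// mul0r mulNr.
Qed.

End OneMeasure.

(** If [r] has density [H] with respect to [s] on [V], then [s] is recovered from [r] with the
    density [H^-1]. In this way an unknown local transverse measure is expressed by a measure
    defined on the whole transversal. *)
Lemma integral_density_inv (s r : {measure set T -> \bar R}) (H h : T -> R) (V : set T) (k : T -> \bar R) :
  measurable V -> measurable_fun [set: T] H -> (forall t, (0 <= H t)%R) ->
  measurable_fun [set: T] h -> (forall t, (0 <= h t)%R) -> (forall t, V t -> (h t * H t = 1)%R) ->
  (forall A, measurable A -> A `<=` V -> r A = \int[s]_(t in A) (H t)%:E) ->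
  measurable_fun [set: T] k -> (forall t, 0 <= k t) -> (forall t, ~ V t -> k t = 0) ->
  \int[r]_t ((h t)%:E * k t) = \int[s]_t k t.
Proof.
move=> mV mH H0 mh h0 hH rV mk k0 kV.
have mhk : measurable_fun [set: T] (fun t => (h t)%:E * k t).
  by apply: emeasurable_funM => //; exact/measurable_EFinP.
have hk0 t : 0 <= (h t)%:E * k t by rewrite mule_ge0// lee_fin.
have toV (M : {measure set T -> \bar R}) : \int[M]_t ((h t)%:E * k t) = \int[M]_(t in V) ((h t)%:E * k t).
  rewrite [RHS]integral_mkcond; apply: eq_integral => t _; rewrite /patch.
  by case: ifPn => // /negP Vt; rewrite kV ?mule0// => Vt'; apply: Vt; rewrite inE.
rewrite toV (eq_measure_integral (density_measure s mH H0)).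
  rewrite -toV ge0_integral_density//; apply: eq_integral => t _.
  have [Vt|Vt] := pselect (V t); last by rewrite kV// mule0 mul0e.
  by rewrite muleAC -EFinM hH// mul1e.
by move=> A mA AV; rewrite rV.
Qed.

End IntegralDensity.

Section Regularity.
Context (R : realType) (X : pmetricType R).
Variable m : {finite_measure set (borel X) -> \bar R}.
Local Open Scope ereal_scope.

Let mopen (O : set X) : open O -> measurable (O : set (borel X)).
Proof. by move=> oO; exact: sub_sigma_algebra. Qed.

Let mclosed (O : set X) : closed O -> measurable (O : set (borel X)).
Proof. by move=> /closed_openC/mopen/measurableC; rewrite setCK. Qed.

Let mfin (E : set (borel X)) : measurable E -> m E < +oo.
Proof. by move=> mE; rewrite -ge0_fin_numE//; exact: fin_num_measure. Qed.

Let small_tail (D_ : (set (borel X))^nat) (a : \bar R) : (forall n, measurable (D_ n)) -> nonincreasing_seq D_ ->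
  m (\bigcap_n D_ n) < a -> exists n, m (D_ n) < a.
Proof.
move=> mD nD lta; have mI : measurable (\bigcap_n D_ n) by exact: bigcap_measurableType.
have cv := nonincreasing_cvg_mu (mfin (mD 0%N)) mD mI nD.
have : \forall n \near \oo, (m \o D_) n < a.
  exact: (cv _ (open_ereal_lt' lta)).
by move=> [N _ /(_ N (leqnn N))]; exists N.
Qed.

Let good (A : set X) := forall e : R, (0 < e)%R -> exists F O : set X,
  [/\ closed F, open O, F `<=` A, A `<=` O & m (O `\` F) < e%:E].

Let good_open (A : set X) : open A -> good A.
Proof.
move=> oA e e0.
pose B n := \bigcup_(y in ~` A) (ball y n.+1%:R^-1 : set X)°.
have oB n : open (B n) by apply: bigcup_open => y _; exact: open_interior.
have [|||n nP] := @small_tail (fun n => A `&` B n) e%:E.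
- by move=> n; apply: mopen; exact: openI.
- move=> i j ij; apply/subsetPset => x [Ax [y Ay xy]]; split => //; exists y => //.
  move: xy; apply: interiorS; apply: le_ball; rewrite lef_pV2 ?posrE//.
  by rewrite ler_nat.
- suff -> : \bigcap_n (A `&` B n) = set0 by rewrite measure0 lte_fin.
  apply/seteqP; split => // x Bx; have [Ax _] := Bx 0%N I.
  have : nbhs x A by move: oA; rewrite openE; exact.
  move=> /nbhs_ballP[r /= r0 rA].
  have [k kr] : exists k : nat, (k.+1%:R^-1 < r)%R.
    exists (Num.truncn r^-1); rewrite invf_plt ?posrE//; exact: truncnS_gt.
  have [_ [y Ay /interior_subset xy]] := Bx k I; apply: Ay; apply: rA.
  by apply: ball_sym; apply: le_ball xy; exact: ltW.
exists (~` B n), A; split => //; last by rewrite setDE setCK.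
  by rewrite closedC.
move=> x nB; apply: contrapT => nA; apply: nB; exists x => //.
by apply: nbhsx_ballx; rewrite invr_gt0.
Qed.

Let good_bigcup (A : (set X)^nat) : (forall n, good (A n)) -> good (\bigcup_n A n).
Proof.
move=> gA e e0.
have /choice[FO FOP] : forall n, exists FO : set X * set X, [/\ closed FO.1, open FO.2, FO.1 `<=` A n,
    A n `<=` FO.2 & m (FO.2 `\` FO.1) < ((e / 2) / 2 ^+ n.+1)%:E].
  move=> n; have [|F [U h]] := gA n ((e / 2) / 2 ^+ n.+1)%R; last by exists (F, U).
  by rewrite !divr_gt0// exprn_gt0.
pose O := \bigcup_n (FO n).2.
have oO : open O by apply: bigcup_open => n _; have [] := FOP n.
have cF n : closed (FO n).1 by have [] := FOP n.
have oOn n : open (FO n).2 by have [] := FOP n.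
pose F n := \bigcup_(i < n) (FO i).1.
have clF n : closed (F n) by apply: closed_bigcup; [exact: finite_II|move=> i _; exact: cF].
have [|||n nP] := @small_tail (fun n => O `\` F n) e%:E.
- by move=> n; apply: measurableD; [exact: mopen|exact: mclosed].
- move=> i j ij; apply/subsetPset => x [Ox Fx]; split => // -[k /= ki Fk]; apply: Fx; exists k => //=.
  exact: leq_trans ij.
- apply: (@le_lt_trans _ _ (m (\bigcup_n ((FO n).2 `\` (FO n).1)))).
    apply: le_measure; rewrite ?inE.
    - by apply: bigcap_measurableType => n _; apply: measurableD; [exact: mopen|exact: mclosed].
    - by apply: bigcup_measurable => n _; apply: measurableD; [exact: mopen|exact: mclosed].
    move=> x h; have [[k _ Ok] _] := h 0%N I; exists k => //; split => // Fk.
    by have [_] := h k.+1 I; apply; exists k => //=.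
  apply: (@le_lt_trans _ _ (\sum_(n <oo) m ((FO n).2 `\` (FO n).1))).
    apply: measure_sigma_subadditive => //.
    - by move=> n; apply: measurableD; [exact: mopen|exact: mclosed].
    - by apply: bigcup_measurable => n _; apply: measurableD; [exact: mopen|exact: mclosed].
  apply: (@le_lt_trans _ _ (e / 2)%:E); last by rewrite lte_fin; lra.
  apply: le_trans (@epsilon_trick0 R (e / 2) xpredT _); last by rewrite divr_ge0// ltW.
  by apply: lee_nneseries => n _ //; have [_ _ _ _ /ltW] := FOP n; rewrite natrX.
exists (F n), O; split => //.
- by move=> x [i _ Fi]; exists i => //; have [_ _ h _ _] := FOP i; exact: h.
- by move=> x [i _ Ai]; exists i => //; have [_ _ _ h _] := FOP i; exact: h.
Qed.

(** The sets that can be squeezed between a closed and an open set up to small mass form a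
    sigma-algebra containing the open sets. *)
Lemma closed_inner_regular (A : set (borel X)) (e : R) : measurable A -> (0 < e)%R ->
  exists F : set X, [/\ closed F, F `<=` A & m A < m F + e%:E].
Proof.
move=> mA e0.
have : good A.
  move: A mA; apply: smallest_sub; last by move=> A oA; exact: good_open.
  split.
  - by apply: good_open; exact: open0.
  - move=> A gA e' e'0; have [F [U [cF oU FA AU FU]]] := gA e' e'0; exists (~` U), (~` F); split.
    + by rewrite closedC.
    + by rewrite openC.
    + by rewrite setTD; exact: subsetC.
    + by rewrite setTD; exact: subsetC.
    + by rewrite setDE setCK setIC -setDE.
  - by move=> A gA; exact: good_bigcup.
move=> /(_ e e0)[F [U [cF oU FA AU FU]]]; exists F; split => //.
have -> : A = F `|` (A `\` F) by rewrite setDUK.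
have mAF : measurable (A `\` F) by apply: measurableD => //; exact: mclosed.
rewrite measureU//; last 2 first.
- exact: mclosed.
- by rewrite setIDA setIC -setIDA setDv setI0.
rewrite lteD2lE; last by rewrite fin_num_measure//; exact: mclosed.
apply: le_lt_trans FU; apply: le_measure; rewrite ?inE//.
  by apply: measurableD; [exact: mopen|exact: mclosed].
by apply: setSD.
Qed.

End Regularity.

Section ProductNbhs.
Context (R : realType) (S : topologicalType).
Local Notation C := R[i].

Lemma nbhs_prodCP (z : C) (t : S) (A : set (C * S)) : nbhs (z, t) A <->
  exists2 e : R, 0 < e & exists2 V, nbhs t V & forall w s, normc (w - z) < e -> V s -> A (w, s).
Proof.
split.
  move=> [[U V] /= [/nbhsCP[e e0 eU] tV] UV]; exists e => //; exists V => // w s wz Vs.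
  by apply: UV; split => //=; exact: eU.
move=> [e e0 [V tV eV]]; exists ([set w | normc (w - z) < e], V) => /=.
  by split => //; apply/nbhsCP; exists e.
by move=> [w s] [/= wz Vs]; exact: eV.
Qed.

(* Cauchy's estimate on the circle of radius [r / 4] about the base point. *)
Lemma deriv_family_cont (F : C * S -> C) z0 t0 (r : R) (V : set S) : 0 < r -> nbhs t0 V ->
  (forall z t, normc (z - z0) < r -> V t -> exists B, cdiff (fun w => F (w, t)) z B) ->
  (forall z, normc (z - z0) < r -> {for (z, t0), continuous F}) ->
  forall e, 0 < e -> exists2 k : R, 0 < k & exists2 V', nbhs t0 V' &
  forall z t, normc (z - z0) < k -> V' t ->
    normc ('D_1 (fun w => F (w, t)) z - 'D_1 (fun w => F (w, t0)) z0) < e.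
Proof.
move=> r0 V0 dF cF e e0; pose rho := r / 4; have rho0 : 0 < rho by rewrite divr_gt0.
pose e1 := e * rho / 4; have e10 : 0 < e1 by rewrite !(mulr_gt0, divr_gt0).
have e12 : 0 < e1 / 2 by rewrite divr_gt0.
have e14 : 0 < e1 / 2 / 2 by rewrite divr_gt0.
have rho4 : rho * 4 = r by rewrite /rho divfK.
have contF z (d : R) : normc (z - z0) < r -> 0 < d -> \forall v \near (z, t0), normc (F v - F (z, t0)) < d.
  move=> zr d0; have := cF z zr [set y | normc (y - F (z, t0)) < d]; apply.
  by apply/nbhsCP; exists d.
(* Joint continuity of [F] at the points [(z0 + u, t0)] becomes uniform in [u] over the closed disk
   of radius [rho]. *)
have := compact_near_coveringP (closed_disk rho); have cc := @compact_closed_disk R rho.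
move=> [/(_ cc) nc _]; have {}nc := nc (C * S)%type (nbhs (z0, t0))
  (fun v u => normc (F (v.1 + u, v.2) - F (z0 + u, t0)) < e1 / 2) _.
have : \forall v \near (z0, t0), closed_disk rho `<=`
    (fun u => normc (F (v.1 + u, v.2) - F (z0 + u, t0)) < e1 / 2).
  apply: nc => u ur; have ur' : normc u <= rho := ur.
  have u1 : normc (z0 + u - z0) < r by rewrite addrC addKr; lra.
  have /nbhs_prodCP[k k0 [W Wt kW]] := contF _ _ u1 e14.
  have k2 : 0 < k / 2 by rewrite divr_gt0.
  exists ([set u' | normc (u' - u) < k / 2], [set v | normc (v.1 - z0) < k / 2 /\ W v.2]) => /=.
    split; first by apply/nbhsCP; exists (k / 2).
    by apply/nbhs_prodCP; exists (k / 2) => //; exists W.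
  move=> [u' [z t]] /= [uu [zz Wt']].
  have h1 : normc (F (z + u', t) - F (z0 + u, t0)) < e1 / 2 / 2.
    apply: kW => //; rewrite (_ : _ - _ = (z - z0) + (u' - u)); last by ring.
    by apply: le_lt_trans (le_normcD _ _) _; rewrite [ltRHS](splitr k) ltrD.
  have h2 : normc (F (z0 + u', t0) - F (z0 + u, t0)) < e1 / 2 / 2.
    apply: kW; last exact: nbhs_singleton.
    rewrite (_ : _ - _ = u' - u); last by ring.
    by apply: lt_trans uu _; rewrite ltr_pdivrMr// ltr_pMr// ltr1n.
  rewrite (_ : _ - _ = (F (z + u', t) - F (z0 + u, t0)) - (F (z0 + u', t0) - F (z0 + u, t0))); last by ring.
  apply: le_lt_trans (le_normcD _ _) _; rewrite normcN [ltRHS](splitr (e1 / 2)).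
  exact: ltrD.
move=> /nbhs_prodCP[k k0 [W Wt kW]].
have [k' [k'0 k'k k'r]] := exists_le2 k0 rho0; exists k' => //; exists (V `&` W); first exact: filterI.
move=> z t zz [Vt Wt'].
have zk := lt_le_trans zz k'k; have zrho := lt_le_trans zz k'r.
have nz0 : normc (z0 - z0) < r by rewrite subrr Normc.normc0.
have [B hB] : exists B, cdiff (fun w => F (w, t)) z B by apply: dF => //; lra.
have [B0 hB0] : exists B, cdiff (fun w => F (w, t0)) z0 B by apply: dF => //; exact: nbhs_singleton.
have [_ ->] := proj1 (cdiffP _ _ _) hB; have [_ ->] := proj1 (cdiffP _ _ _) hB0.
have := @deriv_close R (fun w => F (w, t)) (fun w => F (w, t0)) z z0 B B0 (rho * 2) rho e1.
move=> h; apply: (@le_lt_trans _ _ (2 * (e1 / rho))); last first.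
  rewrite /e1 (_ : 2 * _ = e / 2); last by field; rewrite gt_eqF.
  by rewrite ltr_pdivrMr// ltr_pMr// ltr1n.
apply: h => //.
- by rewrite rho0 ltr_pMr// ltr1n.
- move=> w wz; apply: dF => //; have := normc_triangle w z z0; lra.
- move=> w wz; apply: dF; last exact: nbhs_singleton.
  by lra.
move=> u ur; have h1 := kW z t zk Wt' u; have h2 := kW z t zk Wt' 0.
have {}h1 : normc (F (z + u, t) - F (z0 + u, t0)) < e1 / 2 by apply: h1; change (normc u <= rho); rewrite ur.
have {}h2 : normc (F (z, t) - F (z0, t0)) < e1 / 2.
  have := h2; rewrite /= !addr0; apply; change (normc (0 : C) <= rho); rewrite Normc.normc0; exact: ltW.
rewrite (_ : _ - _ - _ = (F (z + u, t) - F (z0 + u, t0)) - (F (z, t) - F (z0, t0))); last by ring.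
apply: le_trans (le_normcD _ _) _; rewrite normcN [leRHS](splitr e1).
by apply: lerD; exact: ltW.
Qed.

End ProductNbhs.

(** * Leafwise area and local structure of flow boxes *)

Section FlowBoxGeometry.
Variables (R : realType) (Gamma : groupType) (act : Gamma -> R[i] -> R[i])
  (Sigma : topologicalType) (q : R[i] -> Sigma) (g : nat)
  (T : pmetricType R) (rho : Gamma -> T -> T) (X : pmetricType R) (p : R[i] * T -> X).
Hypotheses (SG : surface_group act q g) (HR : homeo_representation rho)
  (SP : is_suspension p act rho).
Variables (S : ptopologicalType) (U : set X) (Phi : X -> R[i] * S) (Psi : R[i] * S -> X).
Hypothesis FB : flow_box p U Phi Psi.
Local Notation C := R[i].
Local Notation D := (@unit_disk R).

Lemma chart_exists x : exists W s, suspension_chart p W s /\ (p @` W) x.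
Proof.
have [z [t [z1 <-]]] := susp_onto SP x; have [d d0 dP] := susp_inj_ball SG HR SP z1.
pose W : set (C * T) := [set v | normc v.1 < 1 /\ normc (v.1 - z) < d].
pose s y := get [set v | W v /\ p v = y].
exists W, s; split; last by exists (z, t) => //; split => //=; rewrite subrr Normc.normc0.
split.
- rewrite openE => -[w t'] [/= w1 wz]; apply/nbhs_disk_timesP.
  have [k [k0 k1 kd]] := @exists_le2 _ (1 - normc w) (d - normc (w - z)) (ltac:(by rewrite subr_gt0)) (ltac:(by rewrite subr_gt0)).
  exists k => // v s' vw _; split => /=.
    by have := normc_rev v w; lra.
  by have := normc_triangle v w z; lra.
- by move=> [w t'] [/= w1 _]; apply/(disk_timesE w t').
- move=> v Wv; rewrite /s; have : [set v' | W v' /\ p v' = p v] v by [].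
  move=> /getI; set v' := get _ => -[[h1 h2] h3].
  case: v v' Wv h1 h2 h3 => v1 v2 [v1' v2'] [/= w1 w2] h1 h2 h3.
  by have [-> ->] := dP _ _ _ _ h2 w2 h1 w1 h3.
Qed.

Section Chart.
Variables (W : set (C * T)) (s : X -> C * T).
Hypothesis WS : suspension_chart p W s.
Let F (v : C * S) := (s (Psi v)).1.

Lemma chart_section x : (p @` W) x -> W (s x) /\ p (s x) = x.
Proof. by have [_ _ h] := WS; move=> [v Wv <-]; rewrite h. Qed.

Lemma chart_lt1 x : (p @` W) x -> normc (s x).1 < 1.
Proof. by move=> /chart_section[Wx _]; have [_ h _] := WS; exact/unit_diskE/h. Qed.

Lemma chart_near u : D u.1 -> (p @` W) (Psi u) -> \forall v \near u, D v.1 /\ (p @` W) (Psi v).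
Proof.
move=> Du Wu; have [oW WD _] := WS; apply: filterI.
  apply: (@cvg_fst _ _ (nbhs u.1) (nbhs u.2)); apply: open_nbhs_nbhs; split => //; exact: open_unit_disk.
have := flow_box_contV FB Du; apply; apply: open_nbhs_nbhs; split => //; exact: (open_susp SG HR SP).
Qed.

Lemma chart_foliated u : D u.1 -> (p @` W) (Psi u) -> [/\ {for u, continuous (s \o Psi)},
  \forall v \near u, (s (Psi v)).2 = (s (Psi (u.1, v.2))).2 & exists A, cdiff (fun z => F (z, u.2)) u.1 A].
Proof.
move=> Du Wu; have [_ h] := flow_box_compat FB WS; have [h1 h2 h3] := h u (conj Du Wu); split => //.
exact/derivable_cdiff.
Qed.

Lemma chart_cont u : D u.1 -> (p @` W) (Psi u) -> {for u, continuous F}.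
Proof.
move=> Du Wu; have [h _ _] := chart_foliated Du Wu.
move=> A nA; have : nbhs (s (Psi u)) [set y | A y.1].
  by exists (A, setT); [split => //; exact: filterT|move=> y []].
exact: h.
Qed.

End Chart.

Let area_at (W : set (C * T)) (s : X -> C * T) (u : C * S) : R :=
  let F := fun z => (s (Psi (z, u.2))).1 in
  4 * normc ('D_1 F u.1) ^+ 2 / (1 - normc (F u.1) ^+ 2) ^+ 2.

(** The lifts given by two charts differ at [u] by some deck transformation [c], and by the same [c]
    at nearby points of the plaque, since [V] is open. By [aut_deriv] composing with [act c] does
    not change the pullback of the hyperbolic area. *)
Let area_at_indep W s V r u : suspension_chart p W s -> suspension_chart p V r -> D u.1 ->
  (p @` W) (Psi u) -> (p @` V) (Psi u) -> area_at V r u = area_at W s u.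
Proof.
move=> WS VS Du Wu Vu; case: u => z0 t in Du Wu Vu *.
have [c1 _ [A hA]] := chart_foliated WS Du Wu; have [_ _ [B hB]] := chart_foliated VS Du Vu.
have [Ws ps] := chart_section WS Wu; have [Vs pr] := chart_section VS Vu.
have w1 := chart_lt1 WS Wu; have w'1 := chart_lt1 VS Vu.
rewrite /= in hA hB; rewrite /area_at /=.
have [_ ->] := proj1 (cdiffP _ _ _) hA; have [_ ->] := proj1 (cdiffP _ _ _) hB.
set v := s (Psi (z0, t)) in Ws ps w1 *; set v' := r (Psi (z0, t)) in Vs pr w'1 *.
have [c [wc tc]] : exists c, v'.1 = act c v.1 /\ v'.2 = rho c v.2.
  by apply/(suspE SP) => //; rewrite -!surjective_pairing ps pr.
have [Ac hAc] := aut_holo (act_aut SG c) w1.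
have nV : nbhs v [set y | normc y.1 < 1 /\ V (act c y.1, rho c y.2)].
  rewrite [v]surjective_pairing; have [oV _ _] := VS.
  have : nbhs (v'.1, v'.2) V by rewrite -surjective_pairing; move: oV; rewrite openE; exact.
  move=> /nbhs_disk_timesP[e e0 eV].
  have /cvgC_at/(_ e e0)[k k0 kP] : act c @ v.1 --> act c v.1 by exact: (act_cont SG).
  have [l l0 lP] := rho_cont HR c v.2 e0.
  have v0 : 0 < 1 - normc v.1 by rewrite subr_gt0.
  have [m [m0 mk ml]] := exists_le2 k0 l0; have [n [n0 nm n1]] := exists_le2 m0 v0.
  apply/nbhs_disk_timesP; exists n => // a b av bv; split => /=.
    by have := normc_rev a v.1; lra.
  apply: eV; first by rewrite wc; apply: kP; exact: lt_le_trans (lt_le_trans av nm) mk.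
  by rewrite tc; apply: lP; exact: lt_le_trans (lt_le_trans bv nm) ml.
have near_z : exists2 e : R, 0 < e & forall z, normc (z - z0) < e -> act c (s (Psi (z, t))).1 = (r (Psi (z, t))).1.
  have cz : (fun z : C => (z, t)) @ z0 --> (z0, t).
    move=> O /nbhs_prodCP[e e0 [V' tV' h]]; apply/nbhsCP; exists e => // w wz; apply: h => //.
    exact: nbhs_singleton.
  have /nbhsCP[e1 e10 h1] := cz _ (@chart_near W s WS (z0, t) Du Wu).
  have /nbhsCP[e2 e20 h2] := cz _ (c1 _ nV).
  have [e [e0 ee1 ee2]] := exists_le2 e10 e20; exists e => // z ze.
  have [_ /(chart_section WS)[_ psz]] := h1 z (lt_le_trans ze ee1).
  have [s1 Vsz] := h2 z (lt_le_trans ze ee2).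
  have [_ _ rV] := VS; have := rV _ Vsz.
  by rewrite (susp_act SG SP c _ s1) /= -surjective_pairing psz => ->.
have hB' : cdiff (fun z => (r (Psi (z, t))).1) z0 (Ac * A).
  exact: cdiff_ext near_z (cdiff_comp hA hAc).
rewrite (cdiff_unique hB hB') Normc.normcM.
have := aut_deriv (act_aut SG c) w1 hAc; have d1 := sub_sqr_gt0 w1.
rewrite wc => E; have d2 := sub_sqr_gt0 w'1; rewrite wc -E in d2.
have nA0 : normc Ac != 0 by apply: contraTneq d2 => ->; rewrite mul0r ltxx.
rewrite -E; move: nA0 (lt0r_neq0 d1); move: (normc Ac) (normc A) (1 - _) => a b d a0 d0.
by field; rewrite a0 d0.
Qed.

Lemma poincare_areaE W s u : suspension_chart p W s -> D u.1 -> (p @` W) (Psi u) ->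
  poincare_area p Psi u = hyp_density (s (Psi u)).1 * normc ('D_1 (fun z => (s (Psi (z, u.2))).1) u.1) ^+ 2.
Proof.
move=> WS Du Wu; transitivity (area_at W s u); last first.
  by rewrite /area_at /hyp_density /= -surjective_pairing mulrAC.
rewrite /poincare_area; set P := [set r | _].
have : P (get P) by apply: (@getI _ _ (area_at W s u)); exists W, s.
by move=> [V [r [VS Vu E]]]; rewrite E; exact: (area_at_indep WS VS Du Wu Vu).
Qed.

Lemma poincare_area_ge0 u : D u.1 -> 0 <= poincare_area p Psi u.
Proof.
move=> Du; have [W [s [WS Wu]]] := chart_exists (Psi u).
by rewrite (poincare_areaE WS Du Wu) mulr_ge0 ?hyp_density_ge0// sqr_ge0.
Qed.

(** Across plaques the lift [F] is only continuous; that its leafwise derivative is continuous as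
    well is [deriv_family_cont]. *)
Lemma poincare_area_cont z0 t0 : normc z0 < 1 -> forall e, 0 < e -> \forall v \near (z0, t0),
  `|poincare_area p Psi v - poincare_area p Psi (z0, t0)| < e.
Proof.
move=> z01; have Dz0 : D z0 by exact/unit_diskE.
have [W [s [WS Wu]]] := chart_exists (Psi (z0, t0)).
have nr := chart_near WS (Dz0 : D (z0, t0).1) Wu; have /nbhs_prodCP[r r0 [V tV rV]] := nr.
pose F (v : C * S) := (s (Psi v)).1.
pose dF (v : C * S) := normc ('D_1 (fun z => F (z, v.2)) v.1).
have cF : {for (z0, t0), continuous F} := chart_cont WS (Dz0 : D (z0, t0).1) Wu.
have cdF : dF @ (z0, t0) --> dF (z0, t0).
  apply/cvgrPdist_lt => e e0.
  have [||k k0 [V' tV' kV]] := @deriv_family_cont R S F z0 t0 r V r0 tV _ _ e e0.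
  - move=> z t zr Vt; have [Dz Wz] := rV z t zr Vt; by have [_ _] := chart_foliated WS (Dz : D (z, t).1) Wz.
  - move=> z zr; have [Dz Wz] := rV z t0 zr (nbhs_singleton tV); exact: (chart_cont WS (Dz : D (z, t0).1) Wz).
  apply/nbhs_prodCP; exists k => //; exists V' => // z t zk Vt.
  rewrite /dF; have := kV z t zk Vt; rewrite distrC; apply: le_lt_trans.
  rewrite ler_norml lerNl opprB; apply/andP; split; last exact: normc_rev.
  by rewrite normcBC; exact: normc_rev.
have ch : (fun v => hyp_density (F v)) @ (z0, t0) --> hyp_density (F (z0, t0)).
  apply: (@cvg_comp _ _ _ F (@hyp_density R) _ (nbhs (F (z0, t0)))) => //.
  have := rcont_hyp_density (chart_lt1 WS Wu); rewrite -/(F (z0, t0)) => hc.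
  apply/cvgrPdist_lt => e /hc[k k0 kP]; apply/nbhsCP; exists k => // w /kP; by rewrite distrC.
have ca : (fun v => hyp_density (F v) * dF v ^+ 2) @ (z0, t0) --> hyp_density (F (z0, t0)) * dF (z0, t0) ^+ 2.
  by apply: cvgM => //; apply: cvgM.
move=> e e0; have /cvgrPdist_lt/(_ e e0) h := ca.
near=> v.
have [Dv Wv] : D v.1 /\ (p @` W) (Psi v) by near: v.
rewrite (poincare_areaE WS Dv Wv) (poincare_areaE WS (Dz0 : D (z0, t0).1) Wu) distrC.
by near: v.
Unshelve. all: by end_near. Qed.

End FlowBoxGeometry.

Section FlowBoxLocal.
Variables (R : realType) (Gamma : groupType) (act : Gamma -> R[i] -> R[i])
  (Sigma : topologicalType) (q : R[i] -> Sigma) (g : nat)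
  (T : pmetricType R) (rho : Gamma -> T -> T) (X : pmetricType R) (p : R[i] * T -> X).
Hypotheses (SG : surface_group act q g) (HR : homeo_representation rho)
  (SP : is_suspension p act rho).
Variables (S : ptopologicalType) (U : set X) (Phi : X -> R[i] * S) (Psi : R[i] * S -> X).
Hypothesis FB : flow_box p U Phi Psi.
Local Notation C := R[i].
Local Notation D := (@unit_disk R).

(* [F(-, t)] lifts the plaques of a small box about [(u0, t0)] to the universal covers of
   the leaves and [tau] is the induced map of transversals; [G] and [beta] are inverse. *)
Lemma flow_box_local u0 t0 : normc u0 < 1 ->
  exists (r : R) (V : set S) (W : set (C * T)) (F : C * S -> C) (tau : S -> T) (G : C * T -> C) (beta : T -> S),
  [/\ [/\ 0 < r, open V, V t0 & forall z, normc (z - u0) < r -> normc z < 1],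
    [/\ W `<=` @disk_times R T, forall u v, W u -> W v -> p u = p v -> u = v &
        forall O, open O -> open [set v | W v /\ O (beta v.2)]],
    forall z t, normc (z - u0) < r -> V t -> [/\ W (F (z, t), tau t), p (F (z, t), tau t) = Psi (z, t),
      exists A, cdiff (fun w => F (w, t)) z A &
      poincare_area p Psi (z, t) = hyp_density (F (z, t)) * normc ('D_1 (fun w => F (w, t)) z) ^+ 2] &
    forall w s, W (w, s) -> [/\ Phi (p (w, s)) = (G (w, s), beta s) /\ U (p (w, s)), normc (G (w, s) - u0) < r, V (beta s),
      exists A, cdiff (fun v => G (v, s)) w A & F (G (w, s), beta s) = w /\ tau (beta s) = s]].
Proof.
move=> u01; have Du0 : D (u0, t0).1 by exact/unit_diskE.
have [W0 [s0 [WS Wu]]] := chart_exists SG HR SP (Psi (u0, t0)).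
have [oW0 W0D s0p] := WS.
have [c0 b0 _] := chart_foliated FB WS Du0 Wu.
have [W0v pv] := chart_section WS Wu; set v0 := s0 (Psi (u0, t0)) in W0v pv.
have U0 : U (p v0) by rewrite pv; exact: (flow_box_from FB).
have [hc1 _] := flow_box_compat FB WS.
have [_ b1 _] := hc1 v0 (conj W0v U0).
have v01 : normc v0.1 < 1 by exact/unit_diskE/W0D.
have : nbhs v0 [set v | W0 v /\ (p @^-1` U) v].
  apply: filterI; first by move: oW0; rewrite openE; exact.
  have := @susp_cont _ _ _ _ _ _ _ SP v0.1 v0.2 U v01; rewrite -surjective_pairing.
  move=> h; have [|e e0 eP] := h; first by apply: open_nbhs_nbhs; split => //; exact: flow_box_open FB.
  by rewrite [v0]surjective_pairing; apply/nbhs_disk_timesP; exists e => // w s h1 h2; have [] := eP w s h1 h2.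
move=> n0; have := @filterI _ _ (@nbhs_filter (C * T)%type v0) _ _ n0 b1; rewrite [v0]surjective_pairing => /nbhs_disk_timesP[r' r'0 r'P].
(* On [N0] the transverse coordinate of [Phi \o p] depends on the [T]-coordinate alone. The box
   given by [r] and [V1] is chosen small enough to be mapped into [N0], so that both transition maps
   preserve plaques. *)
pose N0 := [set v : C * T | normc (v.1 - v0.1) < r' /\ mdist v0.2 v.2 < r'].
have N0P v : N0 v -> [/\ W0 v, U (p v) & (Phi (p v)).2 = (Phi (p (v0.1, v.2))).2].
  by case: v => w s [h1 h2]; have [[]] := r'P w s h1 h2.
have nN0 : nbhs v0 N0.
  by rewrite [v0]surjective_pairing; apply/nbhs_disk_timesP; exists r'.
have ff := @nbhs_filter (C * S)%type (u0, t0).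
have := @filterI _ _ ff _ _ (@filterI _ _ ff _ _ (chart_near SG HR SP FB WS Du0 Wu) b0) (c0 _ nN0).
move=> /nbhs_prodCP[r r0 [V1 tV1 box1]].
pose V := V1°; have oV : open V by exact: open_interior.
have box z t : normc (z - u0) < r -> V t -> [/\ D z, (p @` W0) (Psi (z, t)),
    (s0 (Psi (z, t))).2 = (s0 (Psi (u0, t))).2 & N0 (s0 (Psi (z, t)))].
  by move=> h1 /interior_subset h2; have [[[]]] := box1 z t h1 h2.
pose beta s := (Phi (p (v0.1, s))).2.
pose G v := (Phi (p v)).1.
pose W := [set v | N0 v /\ (normc (G v - u0) < r /\ V (Phi (p v)).2)].
pose F v := (s0 (Psi v)).1.
pose tau t := (s0 (Psi (u0, t))).2.
have WE w s : W (w, s) -> Phi (p (w, s)) = (G (w, s), beta s).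
  by move=> [/N0P[_ _ h] _]; rewrite [LHS]surjective_pairing h.
have sE z t : normc (z - u0) < r -> V t -> s0 (Psi (z, t)) = (F (z, t), tau t).
  by move=> h1 h2; have [_ _ h _] := box z t h1 h2; rewrite [LHS]surjective_pairing h.
have boxD z : normc (z - u0) < r -> D z.
  by move=> zr; have [] := box z t0 zr (tV1 : V t0).
exists r, V, W, F, tau, G, beta; split.
- by split => // z /boxD/unit_diskE.
- split.
  + by move=> v [/N0P[W0v' _ _] _]; exact: W0D.
  + by move=> u v [/N0P[/s0p Eu _ _] _] [/N0P[/s0p Ev _ _] _] puv; rewrite -Eu -Ev puv.
  + move=> O oO; rewrite openE => -[w s] [Wv /= Os].
    have [[/= h1 h2] [h3 h4]] := Wv.
    have [W0ws Uws _] := N0P _ (Wv.1).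
    have [cPhi _ _] := hc1 (w, s) (conj W0ws Uws).
    have nP : nbhs (Phi (p (w, s))) [set y | normc (y.1 - u0) < r /\ (V `&` O) y.2].
      rewrite (WE _ _ Wv); apply/nbhs_prodCP; exists (r - normc (G (w, s) - u0)).
        by rewrite subr_gt0.
      exists (V `&` O) => [|a b aw bV /=].
        by apply: open_nbhs_nbhs; split; [exact: openI|split => //; move: h4; rewrite (WE _ _ Wv)].
      by split => //; have := normc_triangle a (G (w, s)) u0; lra.
    have nN : nbhs (w, s) N0.
      have k0 : 0 < r' - mdist v0.2 s by rewrite subr_gt0.
      have k1 : 0 < r' - normc (w - v0.1) by rewrite subr_gt0.
      have [k [k'0 kk0 kk1]] := exists_le2 k0 k1; apply/nbhs_disk_timesP; exists k => // a b aw bs; split => /=.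
        by have := normc_triangle a w v0.1; lra.
      have := metric_triangle v0.2 s b; lra.
    have := @filterI _ _ (@nbhs_filter (C * T)%type (w, s)) _ _ nN (cPhi _ nP); apply: filterS => -[a b] [Na [Ga [Vb Ob]]].
    have Wab : W (a, b) by split.
    by split => //; move: Ob; rewrite /comp (WE _ _ Wab).
- move=> z t zr Vt; have [Dz Wz _ Nz] := box z t zr Vt; have sz := sE z t zr Vt.
  have [_ pz] := chart_section WS Wz; rewrite sz in pz; split => //.
  + rewrite sz in Nz; split => //; rewrite /G pz (flow_boxVK FB)//=.
  + by have [_ _] := chart_foliated FB WS (Dz : D (z, t).1) Wz.
  + exact: (poincare_areaE SG HR SP FB WS (Dz : D (z, t).1) Wz).
- move=> w s Wv; have [Nws [Gr Vb]] := Wv; have [W0ws Uws _] := N0P _ Nws; have E := WE _ _ Wv.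
  have Vb' : V (beta s) by move: Vb; rewrite E.
  split => //.
  + have [_ _] := hc1 (w, s) (conj W0ws Uws); exact: (proj1 (derivable_cdiff _ _)).
  + have := sE _ _ Gr Vb'; rewrite -E (flow_boxK FB)// s0p//.
    by move=> [h1 h2].
Qed.

End FlowBoxLocal.

Lemma measurable_patch_open d (Y : measurableType d) (Z : ptopologicalType) (D : set Y) (f : Y -> Z) (k : Z) :
  measurable D -> (forall O, open O -> measurable [set y | D y /\ O (f y)]) ->
  measurable_fun [set: Y] ((fun y => if pselect (D y) then f y else k) : Y -> borel Z).
Proof.
move=> mD mf; pose h : Y -> borel Z := fun y => if pselect (D y) then f y else k.
apply: (@measurability _ _ _ _ _ h (@open Z)) => // _ [V oV <-]; rewrite setTI.
have mV := mf V oV.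
have [kV|kV] := pselect (V k).
  rewrite (_ : _ @^-1` _ = [set y | D y /\ V (f y)] `|` ~` D); last first.
    by apply/seteqP; split => y; rewrite /preimage /setU /setC /h /mkset; case: (pselect (D y)) => /= Dy; tauto.
  by apply: measurableU => //; exact: measurableC.
rewrite (_ : _ @^-1` _ = [set y | D y /\ V (f y)])//.
by apply/seteqP; split => y; rewrite /preimage /h /mkset; case: (pselect (D y)) => /= Dy; tauto.
Qed.

Section FlowBoxMeasurable.
Variables (R : realType) (Gamma : groupType) (act : Gamma -> R[i] -> R[i])
  (Sigma : topologicalType) (q : R[i] -> Sigma) (g : nat)
  (T : pmetricType R) (rho : Gamma -> T -> T) (X : pmetricType R) (p : R[i] * T -> X).
Hypotheses (SG : surface_group act q g) (HR : homeo_representation rho)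
  (SP : is_suspension p act rho) (cT : compact [set: T]).
Variables (S : ptopologicalType) (U : set X) (Phi : X -> R[i] * S) (Psi : R[i] * S -> X).
Hypothesis FB : flow_box p U Phi Psi.
Local Notation C := R[i].
Local Notation MR := (measurableTypeR R).
Local Notation mu2 := (@lebesgue_measure R \x @lebesgue_measure R)%E.
Local Notation cx u := (u.1 +i* u.2).
Local Notation xc z := (Re z, Im z).
Local Notation Y := (borel S * (MR * MR))%type.
Local Notation D := (@unit_disk R).

Lemma suspension_compact : compact [set: X].
Proof.
have [r [/andP[r0 r1] rP]] := cocompact SG.
rewrite (_ : [set: X] = p @` (closed_disk r `*` [set: T])); last first.
  apply/seteqP; split => // x _; have [z [t [z1 <-]]] := susp_onto SP x.
  have [c cr] := rP z z1; exists (act c z, rho c t); first by split.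
  exact: (susp_act SG SP).
apply: continuous_compact; last by apply: compact_setX => //; exact: compact_closed_disk.
apply: continuous_in_subspaceT => -[z t]; rewrite inE => -[/= zr _] V nV.
have z1 : normc z < 1 by exact: le_lt_trans r1.
have [e e0 eP] := susp_cont SP z1 nV; apply/nbhs_disk_timesP; exists e => // w s wz st.
by have [] := eP w s wz st.
Qed.

Let D0 : D (0 : C). Proof. by apply/unit_diskE; rewrite Normc.normc0. Qed.

Let section_cont (t : S) : {for t, continuous (fun t => Psi (0, t))}.
Proof.
move=> V nV; have := flow_box_contV FB (D0 : D ((0 : C), t).1) nV.
move=> /nbhs_prodCP[e e0 [W tW eW]]; apply: filterS tW => s Ws; apply: eW => //.
by rewrite subrr Normc.normc0.
Qed.

Let PhiPsi t : Phi (Psi (0, t)) = (0, t).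
Proof. exact: (flow_boxVK FB). Qed.

(** The map [t |-> Psi (0, t)] embeds the transversal in the compact metric space [X], the second
    component of [Phi] being a continuous inverse; so the topological properties of [X] pass to
    [S]. *)
Lemma transversal_second_countable : @second_countable S.
Proof.
have [B cB [oB nB]] : @second_countable X by apply: compact_second_countable; exact: suspension_compact.
exists [set [set t | b (Psi (0, t))] | b in B]; first exact: (sub_countable (card_image_le _ _)).
split.
  move=> _ [b Bb <-]; rewrite openE => t bt; apply: section_cont.
  by apply: open_nbhs_nbhs; split => //; exact: oB.
move=> t O tO; have := flow_box_cont FB (flow_box_from FB (D0 : D ((0 : C), t).1)).
move=> /(_ [set y | O y.2]); rewrite PhiPsi => h.
have /nB[b [Bb bP] bO] : nbhs (Psi (0, t)) (Phi @^-1` [set y | O y.2]).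
  by apply: h; exists (setT, O) => /=; [split => //; exact: filterT|move=> y []].
exists [set t | b (Psi (0, t))]; first by split => //; exists b.
by move=> s /bO; rewrite /preimage /mkset PhiPsi.
Qed.

Lemma transversal_hausdorff : hausdorff_space S.
Proof.
move=> t s clts; have E : Psi (0, t) = Psi (0, s).
  apply: metric_hausdorff => A B /section_cont nA /section_cont nB.
  by have [u [Au Bu]] := clts _ _ nA nB; exists (Psi (0, u)).
by have := PhiPsi t; rewrite E PhiPsi => -[].
Qed.

Let scS := transversal_second_countable.

(** [Psi], and below [Phi], in real coordinates with the transversal first, completed by constants
    so as to be measurable on the whole space. *)
Definition box_point (y : Y) : borel X := if pselect (D (cx y.2)) then Psi (cx y.2, y.1) else point.

Definition box_coord (x : borel X) : Y := (if pselect (U x) then (Phi x).2 else point,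
  (if pselect (U x) then Re (Phi x).1 else 0, if pselect (U x) then Im (Phi x).1 else 0)).

Definition area_weight (y : Y) : R := if pselect (D (cx y.2)) then poincare_area p Psi (cx y.2, y.1) else 0.

Lemma measurable_disk_box : measurable ([set y | D (cx y.2)] : set Y).
Proof.
have := @measurable_snd _ _ (borel S) (MR * MR)%type measurableT _ (measurable_cx (@open_unit_disk R)).
by rewrite setTI.
Qed.

Let open_box (P : C * S -> Prop) : (forall z t, normc z < 1 -> P (z, t) -> \forall v \near (z, t), P v) ->
  measurable ([set y | D (cx y.2) /\ P (cx y.2, y.1)] : set Y).
Proof.
move=> hP; apply: (@measurable_open_mix R S scS [set v | D v.1 /\ P v]).
rewrite openE => -[z t] [/= Dz Pz]; have z1 := proj1 (unit_diskE _) Dz.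
have /nbhs_prodCP[e e0 [V tV eV]] := hP z t z1 Pz.
have [k k0 kD] := proj1 (openCP _) (@open_unit_disk R) z Dz.
have [l [l0 le lk]] := exists_le2 e0 k0; apply/nbhs_prodCP; exists l => //; exists V => // w s wz Vs.
by split => /=; [apply: kD; exact: lt_le_trans lk|apply: eV => //; exact: lt_le_trans le].
Qed.

Lemma measurable_box_point : measurable_fun [set: Y] box_point.
Proof.
apply: measurable_patch_open; first exact: measurable_disk_box.
move=> V oV; apply: (open_box (P := fun v => V (Psi v))) => z t /unit_diskE Dz Vz.
by apply: (flow_box_contV FB (Dz : D (z, t).1)); apply: open_nbhs_nbhs.
Qed.

Let mU : measurable (U : set (borel X)).
Proof. by apply: sub_sigma_algebra; exact: flow_box_open FB. Qed.

Let open_coord (O : set (C * S)) : open O -> measurable ([set x | U x /\ O (Phi x)] : set (borel X)).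
Proof.
move=> oO; apply: sub_sigma_algebra; rewrite openE => x [Ux Ox]; apply: filterI.
  by apply: open_nbhs_nbhs; split => //; exact: flow_box_open FB.
by apply: (flow_box_cont FB Ux); apply: open_nbhs_nbhs.
Qed.

Lemma measurable_box_coord : measurable_fun [set: borel X] box_coord.
Proof.
apply: measurable_fun_pair.
  apply: measurable_patch_open => // V oV; apply: (open_coord (O := [set v | V v.2])).
  by apply: open_comp => // v _; exact: cvg_snd.
have key (h : C -> R) : (forall z w, `|h z - h w| <= normc (z - w)) ->
    measurable_fun [set: borel X] (fun x => if pselect (U x) then h (Phi x).1 else 0 : MR).
  move=> hh; apply: measurable_patch => // c; apply: (open_coord (O := [set v | c < h v.1])).
  rewrite openE => -[z t] /= hz; apply/nbhs_prodCP; exists (h z - c); first by rewrite subr_gt0.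
  exists setT; first exact: filterT.
  move=> w s wz _ /=; have := hh w z; rewrite ler_norml => /andP[]; lra.
apply: measurable_fun_pair; apply: key => z w; rewrite -raddfB; [exact: normc_Re|exact: normc_Im].
Qed.

Lemma area_weight_ge0 y : 0 <= area_weight y.
Proof.
rewrite /area_weight; case: (pselect (D (cx y.2))) => /= Dy; last exact: lexx.
by apply: (poincare_area_ge0 SG HR SP FB).
Qed.

Lemma measurable_area_weight : measurable_fun [set: Y] area_weight.
Proof.
apply: measurable_patch; first exact: measurable_disk_box.
move=> c; apply: (open_box (P := fun v => c < poincare_area p Psi v)) => z t z1 cz.
have d0 : 0 < poincare_area p Psi (z, t) - c by rewrite subr_gt0.
have := poincare_area_cont SG HR SP FB t z1 d0; apply: filterS => v.
by rewrite ltr_norml => /andP[]; lra.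
Qed.

Lemma box_pointK x : U x -> box_point (box_coord x) = x.
Proof.
move=> Ux; rewrite /box_coord; case: (pselect (U x)) => // Ux' /=; rewrite /box_point /fst /snd.
have E : Re (Phi x).1 +i* Im (Phi x).1 = (Phi x).1 by case: (Phi x).1.
rewrite E; case: (pselect (D (Phi x).1)) => /= h; first by rewrite -surjective_pairing (flow_boxK FB).
by exfalso; apply: h; exact: (flow_box_to FB).
Qed.

Lemma box_coordE x : U x -> box_coord x = ((Phi x).2, xc (Phi x).1).
Proof. by move=> Ux; rewrite /box_coord; case: (pselect (U x)). Qed.

End FlowBoxMeasurable.

Section FiniteMeasureOf.
Context d (T : measurableType d) (R : realType) (m : {measure set T -> \bar R}).

(** Indexed by the proof of finiteness, so that the structure of a finite measure can be declared on
    it. *)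
Definition finite_copy (_ : fin_num_fun m) : set T -> \bar R := m.

HB.instance Definition _ fm := Measure.copy (finite_copy fm) m.
HB.instance Definition _ fm := Measure_isFinite.Build d T R (finite_copy fm) fm.

Definition finite_measure_of fm : {finite_measure set T -> \bar R} := finite_copy fm.

End FiniteMeasureOf.

(** * Local transverse measures *)

Section PlaqueArea.
Variables (R : realType) (Gamma : groupType) (act : Gamma -> R[i] -> R[i])
  (Sigma : topologicalType) (q : R[i] -> Sigma) (g : nat)
  (T : pmetricType R) (rho : Gamma -> T -> T) (X : pmetricType R) (p : R[i] * T -> X).
Hypotheses (SG : surface_group act q g) (HR : homeo_representation rho)
  (SP : is_suspension p act rho) (cT : compact [set: T]).
Variables (S : ptopologicalType) (U : set X) (Phi : X -> R[i] * S) (Psi : R[i] * S -> X).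
Hypothesis FB : flow_box p U Phi Psi.
Local Notation C := R[i].
Local Notation MR := (measurableTypeR R).
Local Notation mu2 := (@lebesgue_measure R \x @lebesgue_measure R)%E.
Local Notation cx u := (u.1 +i* u.2).
Local Notation xc z := (Re z, Im z).
Local Notation Y := (borel S * (MR * MR))%type.
Local Notation D := (@unit_disk R).
Local Notation aw := (area_weight p Psi).

Let maw := measurable_area_weight SG HR SP cT FB.
Let aw0 := area_weight_ge0 SG HR SP FB.

Definition plaque_area (G : set Y) (t : S) : \bar R := (\int[mu2]_(u in xsection G t) (aw (t, u))%:E)%E.

Lemma plaque_area_ge0 G t : (0 <= plaque_area G t)%E.
Proof. by apply: integral_ge0 => u _; rewrite lee_fin; exact: aw0. Qed.

Let plaque_areaE G t : plaque_area G t = fubini_F (lebesgue2 R) ((fun x : Y => (aw x)%:E) \_ G) t.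
Proof.
rewrite /fubini_F /plaque_area [LHS]integral_mkcond; apply: eq_integral => u _.
by rewrite /patch mem_xsection.
Qed.

Let patch_meas (G : set Y) : measurable G -> measurable_fun [set: Y] ((fun x : Y => (aw x)%:E) \_ G).
Proof.
by move=> mG; apply/(measurable_restrictT _ mG); apply/measurable_EFinP; exact: measurable_funTS maw.
Qed.

Let patch_ge0 (G : set Y) y : (0 <= ((fun x : Y => (aw x)%:E) \_ G) y)%E.
Proof. by rewrite /patch; case: ifPn => // _; rewrite lee_fin; exact: aw0. Qed.

Lemma measurable_plaque_area (G : set Y) : measurable G -> measurable_fun [set: borel S] (plaque_area G : borel S -> \bar R).
Proof.
move=> mG; apply: (eq_measurable_fun (fubini_F (lebesgue2 R) ((fun x : Y => (aw x)%:E) \_ G))).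
  by move=> t _; rewrite plaque_areaE.
by apply: measurable_fun_fubini_tonelli_F; [exact: patch_meas|exact: patch_ge0].
Qed.

Lemma integral_plaque_area (s : {finite_measure set (borel S) -> \bar R}) (G : set Y) : measurable G ->
  (\int[(s \x lebesgue2 R)%E]_(y in G) (aw y)%:E = \int[s]_t plaque_area G t)%E.
Proof.
move=> mG; rewrite [LHS]integral_mkcond fubini_tonelli1; [|exact: patch_meas|exact: patch_ge0].
by apply: eq_integral => t _; rewrite -plaque_areaE.
Qed.

Variables (nu : probability (borel T) R) (mu : probability (borel X) R) (k : R).
Hypothesis k0 : 0 < k.
Hypothesis muE : forall (W : set (C * T)) (A : set (borel X)), open W -> W `<=` @disk_times R T ->
  (forall u v, W u -> W v -> p u = p v -> u = v) -> measurable A -> A `<=` p @` W ->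
  (mu A = k%:E * \int[nu]_t area [set u | W (cx u, t) /\ A (p (cx u, t))])%E.

Definition box_set (G : set Y) : set (borel X) := [set x | U x /\ G (box_coord U Phi x)].

Lemma measurable_box_set (G : set Y) : measurable G -> measurable (box_set G).
Proof.
move=> mG; have mU : measurable (U : set (borel X)) by apply: sub_sigma_algebra; exact: flow_box_open FB.
by have := measurable_box_coord FB measurableT mG; rewrite setTI; exact: measurableI.
Qed.

(** The measure [s] is the image under [beta] of [k nu] on the projection [J] of [W] to [T]. A slice
    of [G] over [s'] in [J], read in the universal cover, has hyperbolic area
    [plaque_area G (beta s')], by [change_of_variables] along [F (-, beta s')]. *)
Lemma box_measure_local u0 t0 : normc u0 < 1 ->
  exists (s : {finite_measure set (borel S) -> \bar R}) (r : R) (V : set S),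
  [/\ 0 < r, open V, V t0, forall z, normc (z - u0) < r -> normc z < 1 &
    forall G : set Y, measurable G -> (forall t u, G (t, u) -> normc (cx u - u0) < r /\ V t) ->
    (mu (box_set G) = \int[s]_t plaque_area G t)%E].
Proof.
move=> u01; have [r [V [W [F [tau [H [beta [[r0 oV Vt0 boxD] [WD Winj Wopen] boxP WP]]]]]]]] :=
  flow_box_local SG HR SP FB t0 u01.
have oW : open W.
  rewrite (_ : W = [set v | W v /\ [set: S] (beta v.2)]); first exact: (Wopen _ openT).
  by apply/seteqP; split => [v|v []].
pose J := [set s | exists w, W (w, s)].
have JO O : open O -> measurable ([set s | J s /\ O (beta s)] : set (borel T)).
  move=> oO; apply: sub_sigma_algebra; rewrite openE => s [[w Ww] Os].
  have := Wopen O oO; rewrite openE => /(_ (w, s) (conj Ww Os))/nbhs_prodCP[e e0 [N sN eN]].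
  apply: filterS sN => s' Ns'.
  have [Ws' Os'] := eN w s' (ltac:(by rewrite subrr Normc.normc0)) Ns'.
  by split => //; exists w.
have mJ : measurable (J : set (borel T)).
  rewrite (_ : J = [set s | J s /\ [set: S] (beta s)]); first exact: (JO _ openT).
  by apply/seteqP; split => [v|v []].
pose beta' : borel T -> borel S := fun s => if pselect (J s) then beta s else point.
have mbeta : measurable_fun [set: borel T] beta' by apply: measurable_patch_open => //; exact: JO.
pose f : borel T -> R := fun s => k * \1_J s.
have mf : measurable_fun [set: borel T] f by apply: measurable_funM => //; exact: measurable_indic.
have f0 s : 0 <= f s by rewrite mulr_ge0// ?(ltW k0)// indicE.
pose dm := density_measure nu mf f0.
pose s0 := image_measure dm mbeta.
have fin : fin_num_fun s0.
  move=> A mA; rewrite ge0_fin_numE; last exact: measure_ge0.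
  apply: (@le_lt_trans _ _ (k%:E * nu setT)%E); last by rewrite (probability_setT nu) mule1 ltry.
  change (density nu f (beta' @^-1` A) <= k%:E * nu setT)%E.
  apply: (density_le nu mf f0) => //; [|exact: ltW|].
    by have := mbeta measurableT _ mA; rewrite setTI.
  by move=> s _ _; split => //; rewrite /f ler_piMr ?(ltW k0)// indicE; case: (_ \in _).
exists (finite_measure_of fin), r, V; split => // G mG Gbox.
have mA := measurable_box_set mG; set A := box_set G in mA *.
have mK := measurable_plaque_area mG.
have AW : A `<=` p @` W.
  move=> x [Ux]; rewrite (box_coordE _ Ux) => /Gbox.
  rewrite (_ : cx (xc (Phi x).1) = (Phi x).1); last by case: (Phi x).1.
  move=> [h1 h2]; have [Wx px _ _] := boxP _ _ h1 h2.
  exists (F ((Phi x).1, (Phi x).2), tau (Phi x).2) => //.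
  by rewrite px -surjective_pairing (flow_boxK FB).
have slice s : (area [set u | W (cx u, s) /\ A (p (cx u, s))] = plaque_area G (beta' s) * (\1_J s)%:E)%E.
  have [Js|nJ] := pselect (J s); last first.
    rewrite indicE memNset// mule0 (_ : [set u | _] = set0) ?measure0//.
    by apply/seteqP; split => // u [Wu _]; apply: nJ; exists (cx u).
  rewrite indicE mem_set// mule1; have -> : beta' s = beta s by rewrite /beta'; case: pselect.
  have [w0 Ww0] := Js; have [_ _ Vb _ [_ tb]] := WP _ _ Ww0.
  set t := beta s in Vb tb *.
  pose Oz := [set z : C | normc (z - u0) < r]; pose Ow := [set w | W (w, s)].
  have oOz : open Oz.
    apply/openCP => z zr; exists (r - normc (z - u0)); first by rewrite subr_gt0.
    by move=> w wz; change (normc (w - u0) < r); have := normc_triangle w z u0; lra.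
  have oOw : open Ow.
    apply/openCP => w Ww; have := oW; rewrite openE => /(_ (w, s) Ww)/nbhs_prodCP[e e0 [N sN eN]].
    by exists e => // v vw; apply: eN => //; exact: nbhs_singleton.
  have FO z : Oz z -> Ow (F (z, t)).
    by move=> zr; have [Wz _ _ _] := boxP _ _ zr Vb; rewrite /Ow /mkset -tb.
  have GO w : Ow w -> Oz (H (w, s)) by move=> Ww; have [] := WP _ _ Ww.
  have HF z : Oz z -> H (F (z, t), s) = z.
    move=> zr; have [Wz pz _ _] := boxP _ _ zr Vb; have := FO z zr.
    move=> /WP[[E _] _ _ _ _]; move: pz; rewrite tb => pz; move: E; rewrite pz (flow_boxVK FB) => [[<-]//|].
    by apply/unit_diskE; exact: boxD.
  have FH w : Ow w -> F (H (w, s), t) = w by move=> Ww; have [_ _ _ _ []] := WP _ _ Ww.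
  have dF z : Oz z -> cdiff (fun w => F (w, t)) z ('D_1 (fun w => F (w, t)) z).
    by move=> zr; have [_ _ [B hB] _] := boxP _ _ zr Vb; have [_ ->] := proj1 (cdiffP _ _ _) hB.
  have dH w : Ow w -> exists B, cdiff (fun v => H (v, s)) w B.
    by move=> Ww; have [_ _ _ h _] := WP _ _ Ww.
  have cw w : Ow w -> rcont_at (@hyp_density R) w.
    by move=> Ww; apply: rcont_hyp_density; apply/(disk_timesE w s); exact: WD.
  have vE z : Oz z -> hyp_density (F (z, t)) * normc ('D_1 (fun w => F (w, t)) z) ^+ 2 = poincare_area p Psi (z, t).
    by move=> zr; have [_ _ _ ->] := boxP _ _ zr Vb.
  have cv z : Oz z -> rcont_at (fun z => hyp_density (F (z, t)) * normc ('D_1 (fun w => F (w, t)) z) ^+ 2) z.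
    move=> zr e e0; have := poincare_area_cont SG HR SP FB t (boxD z zr) e0.
    move=> /nbhs_prodCP[d d0 [N tN dN]]; have [l l0 lO] := proj1 (openCP _) oOz z zr.
    have [m [m0 md ml]] := exists_le2 d0 l0; exists m => // y yz.
    rewrite !vE//; last by apply: lO; exact: lt_le_trans ml.
    by apply: dN; [exact: lt_le_trans md|exact: nbhs_singleton].
  have := @change_of_variables R Oz Ow (fun z => F (z, t)) (fun w => H (w, s))
    (fun z => 'D_1 (fun w => F (w, t)) z) (@hyp_density R) oOz oOw FO GO HF FH dF dH (@hyp_density_ge0 R) cw cv _
    (@measurable_xsection _ _ (borel S) (MR * MR)%type G t mG).
  rewrite areaE => cov; transitivity
    (\int[mu2]_(u in [set u | Ow (cx u) /\ xsection G t (xc (H (cx u, s)))]) (hyp_density (cx u))%:E)%E.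
    congr (integral _ _ _); apply/seteqP; split => u.
      move=> [_ [Ww [Ux]]]; rewrite (box_coordE _ Ux); have [[E _] _ _ _ _] := WP _ _ Ww.
      by rewrite E => Gu; split => //; rewrite /xsection /mkset inE.
    move=> [Ww]; rewrite /xsection /mkset inE => Gu; have [[E Ux] _ _ _ _] := WP _ _ Ww.
    split; first exact: (WD _ Ww).
    by split => //; split => //; rewrite (box_coordE _ Ux) E.
  rewrite cov /plaque_area [LHS]integral_mkcond [RHS]integral_mkcond; apply: eq_integral => u _.
  rewrite /patch; have [Gu|nGu] := pselect (G (t, u)); last first.
    by rewrite !memNset// /xsection /mkset inE// => -[].
  have [ur _] := Gbox _ _ Gu.
  rewrite !mem_set; [|by rewrite /xsection /mkset inE|by split => //; rewrite /xsection /mkset inE].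
  congr (_%:E); rewrite vE//.
  rewrite /area_weight; case: (pselect _) => //= nD; exfalso; apply: nD.
  by apply/unit_diskE/boxD.
rewrite (muE oW WD Winj mA AW) -ge0_integralZl//; last 2 first.
- apply: (eq_measurable_fun (fun s : borel T => plaque_area G (beta' s) * (\1_J s)%:E)%E).
    by move=> s _; rewrite slice.
  apply: emeasurable_funM; first exact: (measurableT_comp mK mbeta).
  by apply/measurable_EFinP; exact: measurable_indic.
- by rewrite lee_fin ltW.
transitivity (\int[s0]_t plaque_area G t)%E; last by [].
rewrite ge0_integral_pushforward//; last by move=> t _; exact: plaque_area_ge0.
rewrite preimage_setT ge0_integral_density; first last.
- by move=> s; exact: plaque_area_ge0.
- exact: (measurableT_comp mK mbeta).
by apply: eq_integral => s _; rewrite slice /f EFinM muleCA.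
Qed.

End PlaqueArea.

Lemma lt_double (R : realFieldType) (x y z d r : R) : x <= y + z -> y < d -> z < d -> d < r / 2 -> x < r.
Proof. by lra. Qed.

(** * Disintegration over the whole transversal *)

Section BoxDisintegration.
Variables (R : realType) (Gamma : groupType) (act : Gamma -> R[i] -> R[i])
  (Sigma : topologicalType) (q : R[i] -> Sigma) (g : nat)
  (T : pmetricType R) (rho : Gamma -> T -> T) (X : pmetricType R) (p : R[i] * T -> X).
Hypotheses (SG : surface_group act q g) (HR : homeo_representation rho)
  (SP : is_suspension p act rho) (cT : compact [set: T]).
Variables (S : ptopologicalType) (U : set X) (Phi : X -> R[i] * S) (Psi : R[i] * S -> X).
Hypothesis FB : flow_box p U Phi Psi.
Local Notation C := R[i].
Local Notation MR := (measurableTypeR R).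
Local Notation mu2 := (@lebesgue_measure R \x @lebesgue_measure R)%E.
Local Notation cx u := (u.1 +i* u.2).
Local Notation xc z := (Re z, Im z).
Local Notation Y := (borel S * (MR * MR))%type.
Local Notation D := (@unit_disk R).
Local Notation aw := (area_weight p Psi).
Local Notation parea := (plaque_area p Psi).

Let maw := measurable_area_weight SG HR SP cT FB.
Let aw0 := area_weight_ge0 SG HR SP FB.
Let mparea := measurable_plaque_area SG HR SP cT FB.
Let parea0 := plaque_area_ge0 SG HR SP FB.
Let scS := transversal_second_countable SG SP cT FB.

Lemma poincare_area_gt0 z t : normc z < 1 -> 0 < poincare_area p Psi (z, t).
Proof.
move=> z1; have [r [V [W [F [tau [H [beta [[r0 _ Vt boxD] [WD _ _] boxP WP]]]]]]]] := flow_box_local SG HR SP FB t z1.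
have zr : normc (z - z) < r by rewrite subrr Normc.normc0.
have [Wz pz [A hA] ->] := boxP _ _ zr Vt; have [_ ->] := proj1 (cdiffP _ _ _) hA.
have [_ _ _ [B hB] _] := WP _ _ Wz.
have F1 : normc (F (z, t)) < 1 by apply/(disk_timesE (F (z, t)) (tau t)); exact: WD.
have id1 : cdiff ((fun v => H (v, tau t)) \o (fun w => F (w, t))) z 1.
  apply: cdiff_ext (cdiff_id z); exists r => // w wr; have [Ww pw _ _] := boxP _ _ wr Vt.
  have [[E _] _ _ _ _] := WP _ _ Ww; move: E; rewrite pw (flow_boxVK FB) => [[E _]|]; first by rewrite /= -E.
  by apply/unit_diskE; exact: boxD.
have BA := cdiff_unique (cdiff_comp hA hB) id1.
have A0 : 0 < normc A.
  rewrite normc_gt0; apply: contra_eqN BA => /eqP ->; rewrite mulr0 eq_sym; exact: oner_neq0.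
by rewrite mulr_gt0 ?exprn_gt0// hyp_density_gt0.
Qed.

Let ball_set (c : C) (d : R) : set Y := [set y | normc (cx y.2 - c) < d].

Let mball c d : measurable (ball_set c d).
Proof.
have oB : open [set z : C | normc (z - c) < d].
  apply/openCP => z zr; exists (d - normc (z - c)); first by rewrite subr_gt0.
  by move=> w wz; change (normc (w - c) < d); have := normc_triangle w z c; lra.
by have := @measurable_snd _ _ (borel S) (MR * MR)%type measurableT _ (measurable_cx oB); rewrite setTI.
Qed.

Let mtrans (A : set (borel S)) : measurable A -> measurable ([set y | A y.1] : set Y).
Proof. by move=> mA; have := @measurable_fst _ _ (borel S) (MR * MR)%type measurableT _ mA; rewrite setTI. Qed.

Let area_bound (r : R) t : r < 1 -> exists2 M : R, 0 <= M & forall z, normc z <= r -> poincare_area p Psi (z, t) <= M.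
Proof.
move=> r1; have := proj1 (compact_near_coveringP (closed_disk r)) (@compact_closed_disk R r).
move=> nc; have {}nc := nc R (pinfty_nbhs R) (fun M z => poincare_area p Psi (z, t) <= M) _.
have : \forall M \near +oo, closed_disk r `<=` (fun z => poincare_area p Psi (z, t) <= M).
  apply: nc => z zr.
  have z1 : normc z < 1 by exact: le_lt_trans zr r1.
  have /nbhs_prodCP[e e0 [V tV eV]] := poincare_area_cont SG HR SP FB t z1 ltr01.
  exists ([set w | normc (w - z) < e], [set M | poincare_area p Psi (z, t) + 1 <= M]) => /=.
    by split; [apply/nbhsCP; exists e|exact: (nbhs_pinfty_ge (num_real _))].
  move=> [w M] /= [wz hM]; have := eV w t wz (nbhs_singleton tV).
  by rewrite ltr_norml => /andP[]; lra.
move=> [N [_ hN]]; exists (Num.max 0 (N + 1)); first by rewrite le_max lexx.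
move=> z zr; apply: (@le_trans _ _ (N + 1)); last by rewrite le_max lexx orbT.
by apply: (hN (N + 1)) => //; rewrite ltrDl.
Qed.

Let ball_area (c : C) (d r : R) t : 0 < d -> r < 1 -> (forall z, normc (z - c) < d -> normc z <= r) ->
  (0 < parea (ball_set c d) t < +oo)%E.
Proof.
move=> d0 r1 dr; have c1 : normc c < 1 by apply: le_lt_trans r1; apply: dr; rewrite subrr Normc.normc0.
have msec : measurable (xsection (ball_set c d) t) by apply: measurable_xsection; exact: mball.
have mat : measurable_fun [set: MR * MR] (fun u : MR * MR => aw (t, u)) by exact: measurableT_comp maw (pair1_measurable _).
have at0 u : 0 <= aw (t, u) by exact: aw0.
have inb u : xsection (ball_set c d) t u -> normc (cx u - c) < d by rewrite /xsection /mkset inE.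
apply/andP; split.
  have a0 := poincare_area_gt0 t c1; set a := poincare_area _ _ _ in a0; have a2 : 0 < a / 2 by rewrite divr_gt0.
  have /nbhs_prodCP[e e0 [V tV eV]] := poincare_area_cont SG HR SP FB t c1 a2.
  have [k [k0 ke kd]] := exists_le2 e0 d0; have k4 : 0 < k / 4 by rewrite divr_gt0.
  have rk u : rect (Re c) (Re c + k / 4) (Im c) (Im c + k / 4) u -> normc (cx u - c) < k.
    case: u => x y /rectP[/= h1 h2 h3 h4]; apply: le_lt_trans (normc_le_ReIm _) _; rewrite !raddfB /=.
    by rewrite !ger0_norm; lra.
  apply: (@lt_le_trans _ _ ((a / 2)%:E * mu2 (rect (Re c) (Re c + k / 4) (Im c) (Im c + k / 4)))%E).
    rewrite lebesgue2_rect; [|lra|lra].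
    by rewrite -EFinM lte_fin !mulr_gt0//; lra.
  apply: (density_ge mu2 mat at0) => //; [exact: measurable_rect|exact: ltW| |].
    by move=> u /rk uk; rewrite /xsection /mkset inE; exact: lt_le_trans kd.
  move=> u /rk uk; have := eV _ t (lt_le_trans uk ke) (nbhs_singleton tV).
  rewrite /area_weight; case: (pselect _) => /= [_|[]]; first by rewrite -/a ltr_norml => /andP[]; lra.
  by apply/unit_diskE; apply: le_lt_trans r1; apply: dr; exact: lt_le_trans kd.
have [M M0 MP] := area_bound t r1.
apply: (@le_lt_trans _ _ (M%:E * mu2 (rect (- 2) 2 (- 2) 2))%E).
  apply: (density_le mu2 mat at0) => //; first exact: measurable_rect.
  move=> u /inb/dr ur _; split.
    have ur1 := le_lt_trans ur r1.
    have := le_lt_trans (normc_Re _) ur1; have := le_lt_trans (normc_Im _) ur1.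
    by rewrite /= !ltr_norml => /andP[? ?] /andP[? ?]; apply/rectP; split; lra.
  by rewrite /area_weight; case: (pselect _) => //= _; exact: MP.
by rewrite lebesgue2_rect; [rewrite -EFinM ltry|lra|lra].
Qed.

Let parea_transversal (G : set Y) (A : set S) t : (parea ([set y | A y.1] `&` G) t = (\1_A t)%:E * parea G t)%E.
Proof.
rewrite /plaque_area; have [At|nA] := pselect (A t).
  rewrite indicE mem_set// mul1e; congr (integral _ _ _); apply/seteqP; split => u; rewrite /xsection /mkset !inE.
    by case.
  by split.
rewrite indicE memNset// mul0e (_ : xsection _ _ = set0) ?integral_set0//.
by apply/seteqP; split => u; rewrite /xsection /mkset !inE => // -[].
Qed.

Let parea_out (G : set Y) (V : set S) t : (forall u, G (t, u) -> V t) -> ~ V t -> parea G t = 0%E.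
Proof.
move=> GV nV; rewrite /plaque_area (_ : xsection _ _ = set0) ?integral_set0//.
by apply/seteqP; split => u //; rewrite /xsection /mkset inE => /GV.
Qed.

Section Hfun.
Variables (c : C) (d r : R).
Hypotheses (d0 : 0 < d) (r1 : r < 1) (dr : forall z, normc (z - c) < d -> normc z <= r).

Definition ball_mass (t : borel S) : R := fine (parea (ball_set c d) t).

Lemma ball_massE t : (ball_mass t)%:E = parea (ball_set c d) t.
Proof.
have /andP[h1 h2] := ball_area t d0 r1 dr; rewrite /ball_mass fineK// ge0_fin_numE//.
Qed.

Lemma ball_mass_gt0 t : 0 < ball_mass t.
Proof. by have /andP[h1 _] := ball_area t d0 r1 dr; rewrite -lte_fin ball_massE. Qed.

Lemma measurable_ball_mass : measurable_fun [set: borel S] ball_mass.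
Proof.
have mf : measurable_fun [set: \bar R] (@fine R) by exact: fine_measurable.
exact: (measurableT_comp mf (mparea (mball c d))).
Qed.

Lemma measurable_ball_massV : measurable_fun [set: borel S] (fun t => (ball_mass t)^-1).
Proof.
apply: (eq_measurable_fun (fun t : borel S => if pselect ([set: borel S] t) then (ball_mass t)^-1 else 0 : MR)).
  by move=> t _; case: (pselect _) => //= -[].
apply: measurable_patch => // a; have [a0|a0] := leP a 0.
  rewrite (_ : [set y | _] = setT)//; apply/seteqP; split => // t _; split => //.
  by apply: le_lt_trans a0 _; rewrite invr_gt0 ball_mass_gt0.
have := measurable_ball_mass measurableT (measurable_itv `]-oo, a^-1[ : measurable (_ : set MR)).
rewrite setTI; congr (measurable _); apply/seteqP; split => t; rewrite /preimage /mkset /= in_itv /=.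
  by move=> h; split => //; rewrite -[a]invrK ltf_pV2// posrE ?invr_gt0 ?ball_mass_gt0.
by move=> [_ h]; rewrite -[ball_mass t]invrK ltf_pV2// posrE ?invr_gt0 ?ball_mass_gt0.
Qed.

Lemma integral_ball_mass (s : {measure set (borel S) -> \bar R}) A : measurable A ->
  (\int[s]_t parea ([set y | A y.1] `&` ball_set c d) t = \int[s]_(t in A) (ball_mass t)%:E)%E.
Proof.
move=> mA; rewrite [RHS]integral_mkcond; apply: eq_integral => t _.
rewrite parea_transversal -ball_massE /patch indicE; case: (t \in A); first by rewrite mul1e.
by rewrite mul0e.
Qed.

End Hfun.

Variable (mu : probability (borel X) R).
Local Notation bs := (box_set U Phi).

Let mU : measurable (U : set (borel X)).
Proof. by apply: sub_sigma_algebra; exact: flow_box_open FB. Qed.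

Let M : {measure set Y -> \bar R} := image_measure (mrestr mu mU) (measurable_box_coord FB).

Let ME G : M G = mu (bs G).
Proof. by change (mu (box_coord U Phi @^-1` G `&` U) = mu (bs G)); rewrite setIC. Qed.

(** Near [(u, t)] the measure [mu] is [s] times the leafwise area. *)
Let agree (s : {finite_measure set (borel S) -> \bar R}) (u : C) (t : S) := exists (r : R) (V : set S),
  [/\ 0 < r, open V, V t & forall G : set Y, measurable G -> (forall t w, G (t, w) -> normc (cx w - u) < r /\ V t) ->
    (mu (bs G) = \int[s]_t parea G t)%E].

Hypothesis local : forall u t, normc u < 1 -> exists s, agree s u t.

(** By second countability of [S], countably many boxes over rational disks on which the two
    measures agree cover the points satisfying [Q]. *)
Lemma measure_eq_boxes (M1 M2 : {measure set Y -> \bar R}) (Q : C -> S -> Prop) :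
  (forall z t, Q z t -> exists (r : R) (V : set S), [/\ 0 < r, open V, V t &
    forall G : set Y, measurable G -> (forall t w, G (t, w) -> normc (cx w - z) < r /\ V t) -> M1 G = M2 G]) ->
  forall G : set Y, measurable G -> (forall t w, G (t, w) -> Q (cx w) t) -> M1 G = M2 G.
Proof.
move=> loc; have [B cB [oB nB]] := scS.
have [b0 Bb0] : exists b0, B b0 by have [b [Bb _] _] := nB point setT filterT; exists b.
have [f fP] : exists f : nat -> set S, range f = B.
  have /pcard_surjP[f sf] : (B #<= [set: nat])%card by exact: cB.
  exists (fun n => if pselect (B (f n)) then f n else b0); apply/seteqP; split.
    by move=> _ [n _ <-]; case: pselect.
  by move=> u Pu; have [n _ fn] := sf u Pu; exists n => //; rewrite fn; case: pselect.
have Bf n : B (f n) by rewrite -fP; exists n.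
pose box (i : nat * (rat * rat) * nat) : set Y :=
  [set y | f i.1.1 y.1] `&` ball_set (ratr i.1.2.1 +i* ratr i.1.2.2) i.2.+1%:R^-1.
have mbox i : measurable (box i).
  by apply: measurableI; [apply: mtrans; apply: sub_sigma_algebra; exact: oB|exact: mball].
pose good i := forall G : set Y, measurable G -> G `<=` box i -> M1 G = M2 G.
pose K n : set Y := if @unpickle (nat * (rat * rat) * nat)%type n is Some i then
  (if pselect (good i) then box i else set0) else set0.
move=> G mG GQ; apply: (@measure_eq_cover _ _ _ M1 M2 K) => //.
- move=> n; rewrite /K; case: unpickle => [i|]; last exact: measurable0.
  by case: (pselect (good i)) => /= _; [exact: mbox|exact: measurable0].
- move=> n E mE; rewrite /K; case: unpickle => [i|]; last by rewrite subset0 => ->; rewrite !measure0.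
  by case: (pselect (good i)) => /= [gi|_]; [exact: gi|rewrite subset0 => ->; rewrite !measure0].
move=> [t w] Gtw; have [r [V [r0 oV Vt rV]]] := loc _ _ (GQ _ _ Gtw).
have [n nr] : exists n : nat, n.+1%:R^-1 < r / 2.
  exists (Num.truncn (r / 2)^-1); rewrite invf_plt ?posrE ?divr_gt0//; exact: truncnS_gt.
have n0 : 0 < n.+1%:R^-1 :> R by rewrite invr_gt0.
have [a aP] := rat_near n0 w.1; have [b bP] := rat_near n0 w.2.
have wab : normc (cx w - (ratr a +i* ratr b)) < n.+1%:R^-1.
  by apply: le_lt_trans (normc_le_ReIm _) _; rewrite !raddfB /= [ltRHS](splitr _); exact: ltrD.
have [v [Bv vt] vV] := nB t V (open_nbhs_nbhs (conj oV Vt)).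
have [l _ fl] : range f v by rewrite fP.
have gi : good (l, (a, b), n).
  move=> G' mG' G'b; apply: rV => // t' w' /G'b[/= h1 h2]; split; last by apply: vV; rewrite -fl.
  apply: (lt_double _ h2 wab nr); rewrite [X in _ <= _ + X]normcBC.
  exact: (normc_triangle (cx w') (ratr a +i* ratr b) (cx w)).
exists (pickle (l, (a, b), n)) => //; rewrite /K pickleK; case: (pselect _) => //= _.
by split => //=; rewrite fl.
Qed.

(** The mass of the sets over one disk determines a transverse measure, because the leafwise area of
    the disk is positive and finite and can be divided out. *)
Let agree_unique (s1 s2 : {measure set (borel S) -> \bar R}) c d r (V : set S) : 0 < d -> r < 1 ->
  (forall z, normc (z - c) < d -> normc z <= r) -> open V ->
  (forall G : set Y, measurable G -> (forall t w, G (t, w) -> normc (cx w - c) < d /\ V t) ->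
    (\int[s1]_t parea G t = \int[s2]_t parea G t)%E) ->
  forall G : set Y, measurable G -> (forall t w, G (t, w) -> V t) ->
    (\int[s1]_t parea G t = \int[s2]_t parea G t)%E.
Proof.
move=> d0 r1 dr oV s12 G mG GV; have mV : measurable (V : set (borel S)) by exact: sub_sigma_algebra.
pose H := ball_mass c d; have mH := measurable_ball_mass c d; have mHV := measurable_ball_massV d0 r1 dr.
have H0 t : 0 <= H t by apply/ltW; exact: (ball_mass_gt0 d0 r1 dr).
have HV0 t : 0 <= (H t)^-1 by rewrite invr_ge0.
have HH t : V t -> (H t)^-1 * H t = 1 by move=> _; rewrite mulVf// gt_eqF//; exact: (ball_mass_gt0 d0 r1 dr).
pose dm := density_measure s2 mH H0.
have kV t : ~ V t -> parea G t = 0%E by apply: parea_out => u; exact: GV.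
transitivity (\int[dm]_t (((H t)^-1)%:E * parea G t))%E.
  apply/esym; apply: (integral_density_inv mV mH H0 mHV HV0 HH _ (mparea mG) (parea0 _) kV) => A mA AV.
  change (\int[s2]_(t in A) (H t)%:E = \int[s1]_(t in A) (H t)%:E)%E.
  rewrite -!(integral_ball_mass d0 r1 dr)//; apply/esym/s12.
    by apply: measurableI; [exact: mtrans|exact: mball].
  by move=> t w [At Bt]; split => //; exact: AV.
by apply: (integral_density_inv mV mH H0 mHV HV0 HH _ (mparea mG) (parea0 _) kV).
Qed.

(** Within one local box, agreement of [s] at one point makes [s] equal to the measure of that box
    near [t], by [agree_unique], hence gives agreement at every other point. So the property is
    locally constant in [u], and the disk is convex. *)
Let agree_all s t : agree s 0 t -> forall u, normc u < 1 -> agree s u t.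
Proof.
move=> a0 u u1.
have step z r V (s' : {finite_measure set (borel S) -> \bar R}) : 0 < r -> open V -> V t -> (forall z', normc (z' - z) < r -> normc z' < 1) ->
    (forall G : set Y, measurable G -> (forall t w, G (t, w) -> normc (cx w - z) < r /\ V t) ->
      (mu (bs G) = \int[s']_t parea G t)%E) ->
    forall w w', normc (w - z) < r -> normc (w' - z) < r -> agree s w t -> agree s w' t.
  move=> r0 oV Vt rD rP w w' wr w'r [r' [V' [r'0 oV' Vt' rP']]].
  have w1 := rD _ wr; have e1 : 0 < r - normc (w - z) by rewrite subr_gt0.
  have e2 : 0 < (1 - normc w) / 2 by rewrite divr_gt0// subr_gt0.
  have [d1 [d10 d1a d1b]] := exists_le2 e1 e2; have [d [d0 dd1 dr']] := exists_le2 d10 r'0.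
  have key := @agree_unique s s' w d ((1 + normc w) / 2) (V `&` V') d0 (ltac:(by lra)) _ (openI oV oV') _.
  have w'0 : 0 < r - normc (w' - z) by rewrite subr_gt0.
  exists (r - normc (w' - z)), (V `&` V'); split => //; first exact: openI.
  move=> G mG GP; rewrite (rP G mG); last first.
    move=> t' v /GP[h1 [h2 _]]; split => //; have := normc_triangle (cx v) w' z; move: h1.
    by move: (normc _) (normc _) (normc _) => x1 x2 x3; lra.
  apply/esym/key => //.
  - move=> v vw; have := normc_rev v w; move: vw d1b dd1; move: (normc _) (normc _) (normc _) => x1 x2 x3; lra.
  - move=> G' mG' G'P; rewrite -rP//; last first.
      move=> t' v /G'P[h1 [h2 _]]; split => //; have := normc_triangle (cx v) w z; move: h1 d1a dd1.
      by move: (normc _) (normc _) (normc _) => x1 x2 x3; lra.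
    by rewrite -rP'// => t' v /G'P[h1 [_ h2]]; split => //; exact: lt_le_trans dr'.
  - by move=> t' v /GP[].
have := @convex_locally_constant R [set z | normc (z - 0) < 1] (fun w => agree s w t) (@convex_ball R 0 1) _ 0 u.
have S0 : [set z : C | normc (z - 0) < 1] 0 by rewrite /mkset subrr Normc.normc0.
have Su : [set z : C | normc (z - 0) < 1] u by rewrite /mkset subr0.
move=> h; apply: h S0 Su a0 => z; rewrite /mkset subr0 => z1; have [s' [r [V [r0 oV Vt rP]]]] := local t z1.
have z0 : 0 < 1 - normc z by rewrite subr_gt0.
have [d [d0 dr dz]] := exists_le2 r0 z0; exists d => // w _ wd.
have sP := step z d V s' d0 oV Vt.
have zd : normc (z - z) < d by rewrite subrr Normc.normc0.
have dD z' : normc (z' - z) < d -> normc z' < 1 by have := normc_rev z' z; lra.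
have dP (G : set Y) : measurable G -> (forall t w, G (t, w) -> normc (cx w - z) < d /\ V t) ->
    (mu (bs G) = \int[s']_t parea G t)%E.
  by move=> mG GP; apply: rP => // t' v /GP[h1 h2]; split => //; exact: lt_le_trans dr.
by split; [exact: (sP dD dP w z)|exact: (sP dD dP z w)].
Qed.

Let half : (1 / 2 : R) < 1. Proof. by lra. Qed.
Let half0 : 0 < (1 / 2 : R). Proof. by lra. Qed.
Let half_sub (z : C) : normc (z - 0) < 1 / 2 -> normc z <= 1 / 2. Proof. by rewrite subr0 => /ltW. Qed.
Local Notation B0 := (ball_set 0 (1 / 2)).

(** The normalisation that works for the whole transversal at once: with respect to any local
    transverse measure it has density [ball_mass 0 (1 / 2)], the area of the half disk in the
    plaque. Hence [leaf_density] is the inverse of that area. *)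
Definition transversal_mass := image_measure (mrestr M (mball 0 (1 / 2))) (@measurable_fst _ _ (borel S) (MR * MR)%type).

Lemma transversal_massE A : transversal_mass A = mu (bs ([set y | A y.1] `&` B0)).
Proof. exact: ME. Qed.

Lemma transversal_mass_fin : fin_num_fun transversal_mass.
Proof.
move=> A mA; rewrite transversal_massE; apply: fin_num_measure.
by apply: (measurable_box_set FB); apply: measurableI; [exact: mtrans|exact: mball].
Qed.

Definition transversal_measure := finite_measure_of transversal_mass_fin.

Definition leaf_density (t : borel S) : R := (ball_mass 0 (1 / 2) t)^-1.

Lemma leaf_density_ge0 t : 0 <= leaf_density t.
Proof. by rewrite invr_ge0; apply/ltW; exact: (ball_mass_gt0 half0 half half_sub). Qed.

Lemma measurable_leaf_density : measurable_fun [set: borel S] leaf_density.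
Proof. exact: (measurable_ball_massV half0 half half_sub). Qed.

Lemma box_weight_ge0 (y : Y) : 0 <= leaf_density y.1 * aw y.
Proof. by rewrite mulr_ge0// leaf_density_ge0. Qed.

Lemma measurable_box_weight : measurable_fun [set: Y] (fun y : Y => leaf_density y.1 * aw y).
Proof.
apply: measurable_funM => //.
exact: (measurableT_comp measurable_leaf_density measurable_fst).
Qed.

Definition box_measure := density_measure (transversal_measure \x lebesgue2 R)%E measurable_box_weight box_weight_ge0.

Let box_measureE (G : set Y) : measurable G -> (box_measure G = \int[transversal_measure]_t ((leaf_density t)%:E * parea G t))%E.
Proof.
move=> mG; change (density (transversal_measure \x lebesgue2 R)%E (fun y : Y => leaf_density y.1 * aw y)%R G =
  \int[transversal_measure]_t ((leaf_density t)%:E * parea G t))%E.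
rewrite /density [LHS]integral_mkcond fubini_tonelli1; first last.
- by move=> y; rewrite /patch; case: ifPn => // _; rewrite lee_fin; exact: box_weight_ge0.
- by apply/(measurable_restrictT _ mG); apply/measurable_EFinP; exact: measurable_funTS measurable_box_weight.
apply: eq_integral => t _; rewrite /fubini_F /plaque_area -ge0_integralZl//.
- rewrite [RHS]integral_mkcond; apply: eq_integral => u _.
  by rewrite /patch mem_xsection; case: ifPn => // _; rewrite EFinM.
- exact: measurable_xsection.
- apply/measurable_EFinP; apply: measurable_funTS; exact: measurableT_comp maw (pair1_measurable _).
- by move=> u _; rewrite lee_fin; exact: aw0.
- by rewrite lee_fin leaf_density_ge0.
Qed.

(** It suffices to argue near each [(z, t)]. There [mu] is given by a local measure [s], which by
    [agree_all] also gives [mu] near [(u, t)] for every [u] in the half disk; so [transversal_mass]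
    is [ball_mass] times [s], and [leaf_density] cancels this factor. *)
Lemma box_disintegration (G : set Y) : measurable G -> (forall t w, G (t, w) -> normc (cx w) < 1) ->
  mu (bs G) = box_measure G.
Proof.
move=> mG GD; rewrite -ME; apply: (@measure_eq_boxes M box_measure (fun z _ => normc z < 1)) => // z t z1.
have n0 : normc (0 : C) < 1 by rewrite Normc.normc0.
have [s s0] := local t n0; have sall := agree_all s0.
pose nus := density_measure (s \x lebesgue2 R)%E maw aw0.
have nusE G' : measurable G' -> (nus G' = \int[s]_t parea G' t)%E.
  by move=> mG'; exact: (integral_plaque_area SG HR SP cT FB s mG').
have nc := proj1 (compact_near_coveringP (closed_disk (1 / 2 : R))) (@compact_closed_disk R (1 / 2)).
(* The neighbourhood of [t] in which [s] is valid depends on [u]; compactness of the closed half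
   disk provides a common one. *)
have {}nc := nc S (nbhs t) (fun t u => agree s u t) _.
have : \forall t' \near t, closed_disk (1 / 2) `<=` (fun u => agree s u t').
  apply: nc.
  move=> u uh; have u1 : normc u < 1 := le_lt_trans uh half.
  have [r [V [r0 oV Vt rP]]] := sall u u1.
  exists ([set w | normc (w - u) < r], V) => /=.
    by split; [apply/nbhsCP; exists r|exact: open_nbhs_nbhs].
  move=> [w t'] /= [wu Vt']; exists (r - normc (w - u)), V; split => //; first by rewrite subr_gt0.
  move=> G' mG' G'P; apply: rP => // t'' v /G'P[h1 h2]; split => //.
  by have := normc_triangle (cx v) w u; move: h1; move: (normc _) (normc _) (normc _) => x1 x2 x3; lra.
move=> tV0; pose V0 := [set t' | closed_disk (1 / 2) `<=` (fun u => agree s u t')].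
have [r [V [r0 oV Vt rP]]] := sall z z1.
pose V1 := V0° `&` V; have oV1 : open V1 by apply: openI => //; exact: open_interior.
exists r, V1; split => // G' mG' G'P; rewrite ME box_measureE//.
rewrite (rP G' mG'); last by move=> t' w /G'P[h1 [_ h2]].
have mV1 : measurable (V1 : set (borel S)) by exact: sub_sigma_algebra.
apply/esym; apply: (integral_density_inv mV1 (measurable_ball_mass 0 (1 / 2)) _ measurable_leaf_density leaf_density_ge0 _ _ (mparea mG') (parea0 _)).
- by move=> t'; apply/ltW; exact: (ball_mass_gt0 half0 half half_sub).
- by move=> t' _; rewrite /leaf_density mulVf// gt_eqF//; exact: (ball_mass_gt0 half0 half half_sub).
- move=> A mA AV; rewrite -(integral_ball_mass half0 half half_sub)//.
  have mAB : measurable ([set y | A y.1] `&` B0) by apply: measurableI; [exact: mtrans|exact: mball].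
  change (transversal_mass A = \int[s]_t parea ([set y | A y.1] `&` B0) t)%E.
  rewrite transversal_massE -nusE// -ME.
  apply: (@measure_eq_boxes M nus (fun z t => normc z <= 1 / 2 /\ V0 t)) => // [w t' [wh V0t']|t' w [At' Bw]].
    have [r' [V' [r'0 oV' Vt'' rP']]] := V0t' w wh; exists r', V'; split => // G'' mG'' G''P.
    by rewrite ME nusE//; exact: rP'.
  split; first by apply: half_sub.
  by have [/interior_subset] := AV _ At'.
- by move=> t' nV; apply: (parea_out _ nV) => u /G'P[].
Qed.

End BoxDisintegration.

Lemma density_integrable d (T : measurableType d) (R : realType) (m : {measure set T -> \bar R}) (f : T -> R)
  (mf : measurable_fun [set: T] f) (f0 : forall x, 0 <= f x) (h : T -> R) : measurable_fun [set: T] h ->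
  m.-integrable [set: T] (EFin \o (fun x => h x * f x)) -> (density_measure m mf f0).-integrable [set: T] (EFin \o h).
Proof.
move=> mh /integrableP[_ hfin]; have mhE : measurable_fun [set: T] (EFin \o h) by exact/measurable_EFinP.
apply/integrableP; split=> //; rewrite ge0_integral_density//; last exact: measurableT_comp.
apply: le_lt_trans hfin; apply: ge0_le_integral => //.
- by move=> x _; rewrite mule_ge0// lee_fin.
- by apply: emeasurable_funM; [exact: measurableT_comp|exact/measurable_EFinP].
- by apply: measurableT_comp => //; apply/measurable_EFinP; exact: measurable_funM.
- by move=> x _; rewrite /= normrM EFinM (ger0_norm (f0 x)).
Qed.

Lemma harmonic_cst (R : realType) (a : R) : harmonic_on_disk (fun _ : R[i] => a).
Proof.
have dcst (v : R * R) : 'D_v (fun _ : R * R => a) = (fun _ => 0) by apply/funext => u; exact: derive_cst.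
have dcst0 (v : R * R) : 'D_v (fun _ : R * R => 0 : R) = (fun _ => 0) by apply/funext => u; exact: derive_cst.
split => [u v _ _|u v w _ _ _|u _]; first exact: derivable_cst.
  rewrite dcst dcst0; split; first exact: derivable_cst.
  exact: cst_continuous.
have e v w : 'D_w ('D_v (fun _ : R * R => a)) u = 0 by rewrite dcst; exact: derive_cst.
by rewrite /= !e addr0.
Qed.

(** * The disintegration formula for functions *)

Section FlowBoxDisintegration.
Variables (R : realType) (Gamma : groupType) (act : Gamma -> R[i] -> R[i])
  (Sigma : topologicalType) (q : R[i] -> Sigma) (g : nat)
  (T : pmetricType R) (rho : Gamma -> T -> T) (X : pmetricType R) (p : R[i] * T -> X).
Hypotheses (SG : surface_group act q g) (HR : homeo_representation rho)
  (SP : is_suspension p act rho) (cT : compact [set: T]).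
Variables (S : ptopologicalType) (U : set X) (Phi : X -> R[i] * S) (Psi : R[i] * S -> X).
Hypothesis FB : flow_box p U Phi Psi.
Local Notation C := R[i].
Local Notation MR := (measurableTypeR R).
Local Notation mu2 := (@lebesgue_measure R \x @lebesgue_measure R)%E.
Local Notation cx u := (u.1 +i* u.2).
Local Notation xc z := (Re z, Im z).
Local Notation Y := (borel S * (MR * MR))%type.
Local Notation D := (@unit_disk R).
Local Notation aw := (area_weight p Psi).

Let D0 : D (0 : C). Proof. by apply/unit_diskE; rewrite Normc.normc0. Qed.

(** Regularity is taken from [X]: the set [A] is moved to its copy in the plaque centres,
    approximated there by a closed set, which is compact because [X] is, and projected back to [S]
    by [Phi]. *)
Lemma radon_finite_measure (s : {finite_measure set (borel S) -> \bar R}) : radon s.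
Proof.
have hS := transversal_hausdorff FB.
have mK (K : set S) : compact K -> measurable (K : set (borel S)).
  move=> /(compact_closed hS)/closed_openC oK; rewrite -[K]setCK; apply: measurableC; exact: sub_sigma_algebra.
split; first by move=> K cK; rewrite -ge0_fin_numE//; apply: fin_num_measure; exact: mK.
move=> A mA; apply/eqP; rewrite eq_le; apply/andP; split; last first.
  apply: ge_ereal_sup => _ [K [cK KA] <-]; apply: le_measure; rewrite ?inE//; exact: mK.
pose iota : borel S -> borel X := fun t => Psi (0, t).
have miota : measurable_fun [set: borel S] iota.
  apply: (@measurability _ _ _ _ _ iota (@open X)) => // _ [V oV <-]; rewrite setTI.
  apply: sub_sigma_algebra; rewrite openE => t Vt.
  have := flow_box_contV FB (D0 : D ((0 : C), t).1) (open_nbhs_nbhs (conj oV Vt)).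
  move=> /nbhs_prodCP[e e0 [W tW eW]]; apply: filterS tW => u Wu; apply: eW => //.
  by rewrite subrr Normc.normc0.
have Ui t : U (iota t) by exact: (flow_box_from FB (D0 : D ((0 : C), t).1)).
have Pi t : Phi (iota t) = (0, t) by exact: (flow_boxVK FB).
pose m0 := image_measure s miota.
have fm : fin_num_fun m0.
  move=> E mE; change (s (iota @^-1` E) \is a fin_num); apply: fin_num_measure.
  by have := miota measurableT _ mE; rewrite setTI.
pose A' : set (borel X) := box_set U Phi (A `*` [set (0, 0)]).
have m00 : measurable ([set (0, 0)] : set (MR * MR)).
  rewrite (_ : [set (0, 0)] = [set 0] `*` [set 0]); first by apply: measurableX; exact: measurable_set1.
  by apply/seteqP; split => -[x y] /=; [case=> -> ->|case=> -> ->].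
have mA' : measurable A' by apply: (measurable_box_set FB); exact: measurableX.
have A'i t : A' (iota t) <-> A t.
  rewrite /A' /box_set /mkset; split => [[Ut]|At].
    by rewrite (box_coordE _ Ut) Pi => -[].
  by split => //; rewrite (box_coordE _ (Ui t)) Pi; split.
have A'onto x : A' x -> iota (Phi x).2 = x.
  move=> [Ux]; rewrite (box_coordE _ Ux) => -[_ [r0 i0]]; rewrite -[RHS](flow_boxK FB Ux) /iota.
  by congr (Psi _); move: r0 i0; case: (Phi x) => -[a b] t /= -> ->.
have A'E : iota @^-1` A' = A by apply/seteqP; split => t /A'i.
have sE : (s A <= m0 A')%E by change (s A <= s (iota @^-1` A'))%E; rewrite A'E.
apply/lee_addgt0Pr => e e0.
have [F [cF FA' /ltW Fe]] := closed_inner_regular (finite_measure_of fm) mA' e0.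
have FU x : F x -> U x by move=> /FA'[].
apply: le_trans sE _; apply: le_trans Fe _; apply: leeD => //.
apply: ereal_sup_ubound; exists (iota @^-1` F) => //; split; last by move=> t /FA'/A'i.
rewrite (_ : iota @^-1` F = (fun x => (Phi x).2) @` F); last first.
  apply/seteqP; split => [t Ft|_ [x Fx <-]]; first by exists (iota t) => //; rewrite Pi.
  by rewrite /preimage /mkset A'onto//; exact: FA'.
apply: continuous_compact.
  apply: continuous_in_subspaceT => x; rewrite inE => /FU Ux V nV.
  have nV' : nbhs (Phi x) [set y | V y.2].
    by exists (setT, V); [split => //; exact: filterT|move=> y []].
  exact: (flow_box_cont FB Ux nV').
apply: (subclosed_compact cF (suspension_compact SG SP cT)); exact: subsetT.
Qed.

Variables (nu : probability (borel T) R) (mu : probability (borel X) R) (k : R).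
Hypothesis k0 : 0 < k.
Hypothesis muE : forall (W : set (C * T)) (A : set (borel X)), open W -> W `<=` @disk_times R T ->
  (forall u v, W u -> W v -> p u = p v -> u = v) -> measurable A -> A `<=` p @` W ->
  (mu A = k%:E * \int[nu]_t area [set u | W (cx u, t) /\ A (p (cx u, t))])%E.

Let nuS := transversal_measure FB mu.
Let h := leaf_density p Psi.
Let bm := box_measure SG HR SP cT FB mu.

Let mU : measurable (U : set (borel X)).
Proof. by apply: sub_sigma_algebra; exact: flow_box_open FB. Qed.

Let m1U : measurable_fun [set: borel X] (\1_U : borel X -> R). Proof. exact: measurable_indic. Qed.
Let m1U0 x : 0 <= (\1_U x : R). Proof. by rewrite indicE. Qed.
Let mcoord := measurable_box_coord FB.
Let muU := density_measure mu m1U m1U0.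
Let M := image_measure muU mcoord.

Let M_bm (G : set Y) : measurable G -> M G = bm G.
Proof.
move=> mG; pose GD := G `&` [set y | D (cx y.2)].
have mGD : measurable GD by apply: measurableI => //; exact: measurable_disk_box.
transitivity (mu (box_set U Phi G)).
  change (density mu (\1_U) (box_coord U Phi @^-1` G) = mu (box_set U Phi G)).
  have mpre : measurable (box_coord U Phi @^-1` G) by have := mcoord measurableT mG; rewrite setTI.
  by rewrite /density integral_indic.
transitivity (mu (box_set U Phi GD)).
  congr (mu _); apply/seteqP; split => x [Ux]; last by move=> [Gx _]; split.
  move=> Gx; split => //; split => //; rewrite /mkset (box_coordE _ Ux) (_ : cx (xc (Phi x).1) = (Phi x).1); last by case: (Phi x).1.
  exact: (flow_box_to FB).
rewrite (box_disintegration SG HR SP cT FB _ mGD); last first.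
- by move=> t w [_ Dw]; exact/unit_diskE.
- move=> u t u1; have [s [r [V [r0 oV Vt _ rP]]]] := box_measure_local SG HR SP cT FB k0 muE t u1.
  by exists s, r, V.
change (\int[(nuS \x lebesgue2 R)%E]_(y in GD) (h y.1 * aw y)%:E = \int[(nuS \x lebesgue2 R)%E]_(y in G) (h y.1 * aw y)%:E)%E.
rewrite [LHS]integral_mkcond [RHS]integral_mkcond; apply: eq_integral => y _; rewrite /patch.
have [Gy|nG] := pselect (G y); last by rewrite !memNset// => -[].
have [Dy|nD] := pselect (D (cx y.2)); first by rewrite !mem_set.
rewrite memNset; last by move=> [].
by rewrite mem_set// /area_weight; case: (pselect _) => //= _; rewrite mulr0.
Qed.

Lemma flow_box_disintegration : disintegration p mu U Psi nuS (fun t _ => h t).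
Proof.
have h0 := leaf_density_ge0 SG HR SP cT FB; have mh := measurable_leaf_density SG HR SP cT FB.
have mw := measurable_box_weight SG HR SP cT FB; have w0 := box_weight_ge0 SG HR SP cT FB.
split.
- exact: radon_finite_measure.
- by move=> t; exact: harmonic_cst.
- by move=> t z _; exact: h0.
- by move=> z _; exact: mh.
move=> f intf.
(* Integrability of [f] is only given on [U]. Extended by 0 it becomes a function [F] of the box
   coordinates, so that equality of measures can be applied to integrals. *)
pose f1 : borel X -> R := fun x => if pselect (U x) then f x else 0.
have f1E x : U x -> f1 x = f x by move=> Ux; rewrite /f1; case: (pselect (U x)).
have mf1 : measurable_fun [set: borel X] f1.
  apply/measurable_EFinP; have /integrableP[mf _] := intf.
  rewrite (_ : EFin \o f1 = (EFin \o f) \_ U); first exact/(measurable_restrictT _ mU).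
  apply/funext => x; rewrite /patch /f1 /=; case: (pselect (U x)) => /= Ux; first by rewrite mem_set.
  by rewrite memNset.
pose F : Y -> R := f1 \o box_point Psi.
have mF : measurable_fun [set: Y] F by exact: measurableT_comp mf1 (measurable_box_point SG SP cT FB).
have Fc x : U x -> F (box_coord U Phi x) = f x by move=> Ux; rewrite /F /= (box_pointK FB Ux) f1E.
have Fcoord_int : muU.-integrable [set: borel X] ((EFin \o F) \o box_coord U Phi).
  apply: (@density_integrable _ _ _ _ _ m1U m1U0 (F \o box_coord U Phi)).
    exact: measurableT_comp mF mcoord.
  have : mu.-integrable [set: borel X] ((EFin \o f) \_ U) by apply/(integrable_mkcond _ mU).
  apply: eq_integrable => // x _; rewrite /patch /= indicE; case: ifPn => Ux.
    by rewrite Fc ?mulr1//; rewrite inE in Ux.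
  by rewrite mulr0.
have mFE : measurable_fun [set: Y] (EFin \o F) by exact/measurable_EFinP.
have intM : M.-integrable [set: Y] (EFin \o F).
  by apply: integrable_pushforward => //; rewrite preimage_setT.
have step1 : (\int[mu]_(x in U) (f x)%:E = \int[M]_y (F y)%:E)%E.
  rewrite (integral_pushforward mcoord mFE) ?preimage_setT//.
  have [_ ->] := integrable_density Fcoord_int.
  rewrite [LHS]integral_mkcond; apply: eq_integral => x _; rewrite /patch indicE; case: ifPn => Ux.
    by rewrite /= Fc ?mulr1//; rewrite inE in Ux.
  by rewrite mulr0.
have intbm : bm.-integrable [set: Y] (EFin \o F).
  have /integrableP[_ Mfin] := intM; apply/integrableP; split => //.
  rewrite (eq_measure_integral M)// => A mA _; exact/esym/M_bm.
have step2 : (\int[M]_y (F y)%:E = \int[bm]_y (F y)%:E)%E.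
  by apply: eq_measure_integral => A mA _; exact: M_bm.
have [intw step3] := integrable_density intbm.
rewrite step1 step2 step3 -(integral12_prod_meas1 intw).
apply: eq_integral => t _; rewrite /fubini_F [RHS]integral_mkcond; apply: eq_integral => u _.
rewrite /patch /= /F /area_weight /=; have [Du|nD] := pselect (D (cx u)); last first.
  rewrite memNset//; case: (pselect (D (cx u))) => //= _; by rewrite !mulr0.
rewrite mem_set//; case: (pselect (D (cx u))) => //= _.
have -> : f1 (box_point Psi (t, u)) = f (Psi (cx u, t)).
  rewrite /box_point /=; case: (pselect _) => //= _; apply: f1E.
  exact: (flow_box_from FB (Du : D (cx u, t).1)).
by rewrite -/(h t) mulrA (mulrC (h t)).
Qed.

End FlowBoxDisintegration.

Lemma suspension_invariant_measure (R : realType) (Gamma : groupType) (act : Gamma -> R[i] -> R[i])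
  (Sigma : topologicalType) (q : R[i] -> Sigma) (g : nat)
  (T : pmetricType R) (rho : Gamma -> T -> T) (X : pmetricType R) (p : R[i] * T -> X)
  (nu : probability (borel T) R) :
  surface_group act q g -> homeo_representation rho -> is_suspension p act rho -> compact [set: T] ->
  (forall c (A : set (borel T)), measurable A -> nu (rho c @^-1` A) = nu A) ->
  exists mu : probability (borel X) R, invariant_measure p mu.
Proof.
move=> SG HR SP cT nu_inv.
have [mu [k [k0 muE]]] := suspension_measure_exists SG HR SP cT nu_inv.
exists mu; split => S U Phi Psi FB; have dis := flow_box_disintegration SG HR SP cT FB k0 muE.
  by exists (transversal_measure FB mu), (fun t _ => leaf_density p Psi t).
by exists (transversal_measure FB mu), (fun t _ => leaf_density p Psi t).
Qed.

Theorem corollary1p3 (R : realType) (Gamma : groupType)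
    (act : Gamma -> R[i] -> R[i])
    (Sigma : topologicalType) (q : R[i] -> Sigma) (g : nat)
    (T : metricType R) (rho : Gamma -> T -> T)
    (X : pmetricType R) (p : R[i] * T -> X) (phi : X -> R[i] -> X) :
  (2 <= g)%N ->
  surface_group act q g ->
  compact [set: T] ->
  homeo_representation rho ->
  is_suspension p act rho ->
  (forall x, leaf_covering_at p x (phi x)) ->
  hyperbolic_entropy phi = 2%:E ->
  exists mu : probability (borel X) R, invariant_measure p mu.
Proof.
(* So that repacking [T] with a point does not change its metric structure up to conversion. *)
case: T rho p => T [m1 m2 m3 m4 m5 m6 m7 m8] rho p _ SG cT HR SP hphi h2.
set T0 : metricType R := Metric.Pack _ in rho p SG cT HR SP hphi *.
(* [T0] is inhabited because [p] maps onto the pointed space [X]; measures on [T0] need a base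
   point. *)
have [[z0 t0] _] : exists u : R[i] * T0, True.
  have [onto _ _] := SP; have : (p @` @disk_times R T0) point by rewrite onto.
  by move=> [u _ _]; exists u.
pose T' : pmetricType R := HB.pack (Metric.sort T0) (isPointed.Build T0 t0).
have sep := @subexponential_separation R Gamma act Sigma q g T' rho X p phi SG HR SP cT hphi h2.
have [nu nu_inv] := @invariant_measure_exists R Gamma T' rho cT HR (deck_ball act)
  (deck_ball1 SG) (deck_ballM SG) (@deck_ball_mono R Gamma act) sep.
exact: (@suspension_invariant_measure R Gamma act Sigma q g T' rho X p nu SG HR SP cT nu_inv).
Qed.
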